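(* Let $(q,u,B,S)$ be the solution of (MHD$_\varepsilon$) on $[0,T]$. The entropy $S$ satisfies $$\frac{\mathrm d}{\mathrm dt}\sum_{l=0}^4\sum_{k=0}^{4-l}\left\|(\varepsilon D_t)^{k+2l}\left(S,\rho^{-1}B\cdot\nabla S\right)\right\|_{4-k-l}^2\le P(E(t)).$$
   Context: Domain: $\Omega=\mathbb{R}^3_+=\{x\in\mathbb{R}^3:x_3>0\}$, $\Sigma=\{x_3=0\}$. $\varepsilon>0$ is the Mach number; $u$ is the velocity, $B$ the magnetic field, $S$ the entropy, $p=1+\varepsilon q$ the fluid pressure, $D_t:=\partial_t+u\cdot\nabla$. Equation of state: the density $\rho=\rho(p,S)$ is a given smooth function with $\rho\ge\bar\rho_0>0$ and $\partial\rho/\partial p>0$; $a:=\frac1\rho\frac{\partial\rho}{\partial p}>0$. Since $p=1+\varepsilon q$, one regards $\rho$ and $a$ as functions of $(\varepsilon q,S)$. System (MHD$_\varepsilon$) on $[0,T]\times\Omega$: $aD_tq+\varepsilon^{-1}\nabla\cdot u=0$; $\rho D_tu+\varepsilon^{-1}\nabla q+\frac12\nabla|B|^2-B\cdot\nabla B=0$; $D_tB=B\cdot\nabla u-B(\nabla\cdot u)$; $\nabla\cdot B=0$; $D_tS=0$; with $u_3=B_3=0$ on $[0,T]\times\Sigma$ and $(q,u,B,S)|_{t=0}=(q_0,u_0,B_0,S_0)$. Standing assumptions: $(q_0,u_0,B_0,S_0)\in H^8(\Omega)\times H^8(\Omega)\times H^8(\Omega)\times H^9(\Omega)$ satisfies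 the compatibility conditions $B_3|_{t=0}=0$, $\partial_t^ju_3|_{t=0}=0$ on $\Sigma$ for $0\le j\le7$, and $E(0)\le M$ with $M>0$ independent of $\varepsilon$, where $E(t)=\sum_{l=0}^4E_{4+l}(t)$, $E_{4+l}(t)=\sum_{k=0}^{4-l}\|(\varepsilon D_t)^{k+2l}(q,u,B,S,\rho^{-1}B\cdot\nabla S)\|_{4-k-l}^2$, $\|f\|_s=\|f(t,\cdot)\|_{H^s(\Omega)}$, and the norm squared of a tuple is the sum of squared norms of components. $P(\cdots)$ denotes a generic polynomial in its arguments with non-negative coefficients, independent of $\varepsilon$. *)

(* Defs.v *)
From HB Require Import structures.
From mathcomp Require Import all_boot all_order all_algebra.
From mathcomp Require Import all_classical all_reals all_analysis.

Set Implicit Arguments.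
Unset Strict Implicit.
Unset Printing Implicit Defensive.

Import Order.TTheory GRing.Theory Num.Theory.
Import numFieldNormedType.Exports.

Local Open Scope classical_set_scope.
Local Open Scope ring_scope.

(* The point ((x1, x2), x3) of R^3. *)
Notation R3 R := (R * R * R)%type.

Section smooth_functions.
Context {R : realType} {V : normedModType R}.

Definition iterD (f : V -> R) (vs : seq V) : V -> R :=
  foldr (fun v g x => 'D_v g x) f vs.

(* On a finite-dimensional V this is C^oo: all iterated directional
   derivatives exist everywhere and are continuous. *)
Definition smooth (f : V -> R) : Prop :=
  forall vs : seq V,
    continuous (iterD f vs) /\
    forall x v, derivable (iterD f vs) x v.

Definition test_function (U : set V) (phi : V -> R) : Prop :=
  smooth phi /\
  exists K : set V, [/\ compact K, K `<=` U & forall x, ~ K x -> phi x = 0].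

End smooth_functions.

Section half_space.
Context {R : realType}.
Implicit Types (f g : R3 R -> R) (alpha : 'I_3 -> nat).

Definition half_space : set (R3 R) := [set x | 0 < x.2].
Definition half_space_bd : set (R3 R) := [set x | x.2 = 0].

Definition leb3 :=
  ((@lebesgue_measure R \x @lebesgue_measure R) \x @lebesgue_measure R)%E.

Definition evec (i : 'I_3) : R3 R :=
  ((i == 0 :> nat)%:R, (i == 1 :> nat)%:R, (i == 2 :> nat)%:R).

Definition sqnorm f : \bar R :=
  (\int[leb3]_(x in half_space) ((f x) ^+ 2)%:E)%E.

Definition is_L2 f : Prop :=
  measurable_fun half_space f /\ (sqnorm f < +oo)%E.

Definition intO f : R := (\int[leb3]_(x in half_space) f x)%R.

Definition pderiv alpha f : R3 R -> R :=
  iterD f (flatten [seq nseq (alpha i) (evec i) | i <- enum 'I_3]).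

Definition mlen alpha : nat := (\sum_(i < 3) alpha i)%N.

Definition is_wderiv alpha f g : Prop :=
  is_L2 g /\
  forall phi, test_function half_space phi ->
    intO (fun x => f x * pderiv alpha phi x) =
    (-1) ^+ mlen alpha * intO (fun x => g x * phi x).

(* A representative of the weak derivative, which is unique up to null sets. *)
Definition wderiv alpha f : R3 R -> R :=
  xget (fun=> 0) [set g | is_wderiv alpha f g].

Definition wpartial (i : 'I_3) f : R3 R -> R :=
  wderiv (fun j => (j == i)%N : nat) f.

Definition in_H (n : nat) f : Prop :=
  is_L2 f /\
  forall alpha, (mlen alpha <= n)%N -> exists g, is_wderiv alpha f g.

Definition Hnorm2 (n : nat) f : \bar R :=
  if `[< in_H n f >] then
    (\sum_(alpha : {ffun 'I_3 -> 'I_n.+1} | (\sum_(i < 3) alpha i <= n)%N)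
       sqnorm (wderiv (fun i => alpha i) f))%E
  else +oo%E.

(* For f in H^1, vanishing of the trace on {x3 = 0}, expressed by Green's
   formula against test functions that need not vanish on the boundary. *)
Definition zero_trace f : Prop :=
  forall phi, test_function [set: R3 R] phi ->
    intO (fun x => f x * 'D_(evec ord_max) phi x) =
    - intO (fun x => wpartial ord_max f x * phi x).

End half_space.

Section time_dependent.
Context {R : realType}.
Variable T : R.
Implicit Types f g : R -> R3 R -> R.

(* Derivative relative to [0, T]: one-sided at the two end points. *)
Definition time_deriv (h : R -> R) (t : R) : R :=
  lim ((fun s => (h s - h t) / (s - t)) @ within `[0, T] t^').

Definition time_derivable (h : R -> R) (t : R) : Prop :=
  cvg ((fun s => (h s - h t) / (s - t)) @ within `[0, T] t^').

Definition cont_H (n : nat) f : Prop :=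
  forall t, t \in `[0, T] ->
    in_H n (f t) /\
    (fun s => Hnorm2 n (f s \- f t)) @ within `[0, T] (nbhs t) --> 0%E.

Definition C1_field f : Prop :=
  [/\ {within `[0, T] `*` closure half_space,
         continuous (fun z : R * R3 R => f z.1 z.2)},
      forall t x, t \in `[0, T] -> half_space x ->
         time_derivable (f^~ x) t /\
         forall i, derivable (f t) x (evec i),
      {within `[0, T] `*` half_space,
         continuous (fun z : R * R3 R => time_deriv (f^~ z.2) z.1)} &
      forall i, {within `[0, T] `*` half_space,
         continuous (fun z : R * R3 R => 'D_(evec i) (f z.1) z.2)}].

Variable u : 'I_3 -> R -> R3 R -> R.

(* g is the distributional material derivative (d/dt + u . grad) f on
   ]0, T[ x half_space, and lies in C([0, T]; L^2). *)
Definition is_Dt f g : Prop :=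
  cont_H 0 g /\
  forall phi : R * R3 R -> R,
    test_function (`]0, T[ `*` half_space) phi ->
    (\int[lebesgue_measure]_(t in `]0, T[)
       intO (fun x => f t x *
         ('D_1 (fun s => phi (s, x)) t +
          \sum_(i < 3) 'D_(evec i) (fun y => u i t y * phi (t, y)) x)))%R =
    - (\int[lebesgue_measure]_(t in `]0, T[)
         intO (fun x => g t x * phi (t, x)))%R.

(* Unique for every t in [0, T] up to null sets of half_space. *)
Definition Dt f : R -> R3 R -> R :=
  xget (fun _ _ => 0) [set g | is_Dt f g].

Definition eDt (eps : R) (m : nat) f : R -> R3 R -> R :=
  iter m (fun g t x => eps * Dt g t x) f.

End time_dependent.

Inductive unknown : Type :=
  | Prs | Vel of 'I_3 | Mag of 'I_3 | Ent.

Section mhd.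
Context {R : realType}.
Variables (rho : R * R -> R) (eps : R).

(* The density as a function of (p, S). *)
Definition equation_of_state (rho0 : R) : Prop :=
  [/\ smooth rho, 0 < rho0, forall z, rho0 <= rho z
    & forall z, 0 < 'D_((1, 0) : R * R) rho z].

(* Left-hand sides of the evolution equations at a point, from the values v,
   the time derivatives d and the spatial derivatives gr i = d/dx_i of the
   unknowns there; the i-th component of grad |B|^2 / 2 is
   sum_j B_j (d/dx_i) B_j. *)
Definition mhd_lhs (v d : unknown -> R) (gr : 'I_3 -> unknown -> R) (c : unknown) : R :=
  let z := (1 + eps * v Prs, v Ent) in
  let r := rho z in
  let a := r^-1 * 'D_((1, 0) : R * R) rho z in
  let D c := d c + \sum_(j < 3) v (Vel j) * gr j c in
  let divu := \sum_(j < 3) gr j (Vel j) in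
  match c with
  | Prs => a * D Prs + eps^-1 * divu
  | Vel i => r * D (Vel i) + eps^-1 * gr i Prs
             + \sum_(j < 3) v (Mag j) * gr i (Mag j)
             - \sum_(j < 3) v (Mag j) * gr j (Mag i)
  | Mag i => D (Mag i)
             - (\sum_(j < 3) v (Mag j) * gr j (Vel i) - v (Mag i) * divu)
  | Ent => D Ent
  end.

(* c k j is the j-th time derivative at t = 0 of the unknown k, computed
   from the data w0 by formally differentiating the equations in time: the
   Taylor polynomial with these coefficients satisfies the equations at t = 0
   together with their first six time derivatives. *)
Definition initial_jet (w0 : unknown -> R3 R -> R)
    (c : unknown -> nat -> R3 R -> R) : Prop :=
  let taylor (s : nat -> R) (t : R) := \sum_(j < 8) t ^+ j / j`!%:R * s j in
  [/\ forall k, c k 0%N = w0 k,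
      forall k j, (j < 8)%N -> in_H (8 - j) (c k j) &
      {ae leb3, forall x, half_space x -> forall k j, (j < 7)%N ->
         derive1n j (fun t => mhd_lhs
            (fun k' => taylor (fun j' => c k' j' x) t)
            (fun k' => 'D_1 (taylor (fun j' => c k' j' x)) t)
            (fun i k' => taylor (fun j' => wpartial i (c k' j') x) t)
            k) 0 = 0}].

Definition admissible_data (w0 : unknown -> R3 R -> R) : Prop :=
  [/\ forall k, in_H 8 (w0 k),
      in_H 9 (w0 Ent),
      zero_trace (w0 (Mag ord_max)) &
      exists c, initial_jet w0 c /\
        forall j, (j < 8)%N -> zero_trace (c (Vel ord_max) j)].

Section flow.
Variables (T : R) (w : unknown -> R -> R3 R -> R).

(* rho^-1 B . grad S *)
Definition magS (t : R) (x : R3 R) : R :=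
  (rho (1 + eps * w Prs t x, w Ent t x))^-1 *
  \sum_(j < 3) w (Mag j) t x * 'D_(evec j) (w Ent t) x.

Definition u_of : 'I_3 -> R -> R3 R -> R := fun i => w (Vel i).

Definition energy_term (k l : nat) (f : R -> R3 R -> R) (t : R) : \bar R :=
  Hnorm2 (4 - k - l) (eDt T u_of eps (k + l.*2) f t).

Definition entropy_energy (t : R) : \bar R :=
  (\sum_(l < 5) \sum_(k < 5 - l)
     (energy_term k l (w Ent) t + energy_term k l magS t))%E.

Definition energy (t : R) : \bar R :=
  (\sum_(l < 5) \sum_(k < 5 - l)
     (energy_term k l (w Prs) t
      + \sum_(i < 3) energy_term k l (w (Vel i)) t
      + \sum_(i < 3) energy_term k l (w (Mag i)) t
      + energy_term k l (w Ent) t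
      + energy_term k l magS t))%E.

(* All the iterated material derivatives entering the energy exist, and are
   continuous in time with values in the corresponding Sobolev space. *)
Definition energy_regular (f : R -> R3 R -> R) : Prop :=
  (forall m, (m < 8)%N ->
     exists g, is_Dt T u_of (eDt T u_of eps m f) g) /\
  forall k l, (k + l <= 4)%N ->
    cont_H T (4 - k - l) (eDt T u_of eps (k + l.*2) f).

Definition mhd_solution (w0 : unknown -> R3 R -> R) : Prop :=
  [/\ (forall k, C1_field T (w k)) /\
      (forall k, energy_regular (w k)) /\ energy_regular magS,
      forall t x, t \in `[0, T] -> half_space x ->
        forall k, mhd_lhs (fun k' => w k' t x)
                          (fun k' => time_deriv T ((w k')^~ x) t)
                          (fun i k' => 'D_(evec i) (w k' t) x) k = 0,
      forall t x, t \in `[0, T] -> half_space x ->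
        \sum_(j < 3) 'D_(evec j) (w (Mag j) t) x = 0,
      forall t x, t \in `[0, T] -> half_space_bd x ->
        w (Vel ord_max) t x = 0 /\ w (Mag ord_max) t x = 0 &
      {ae leb3, forall x, half_space x -> forall k, w k 0 x = w0 k x}].

End flow.
End mhd.

(* Main.v *)
Require Import Defs.
From HB Require Import structures.
From mathcomp Require Import all_boot all_order all_algebra.
From mathcomp Require Import all_classical all_reals all_analysis.
From mathcomp Require Import measurable_realfun ring lra zify.

(** The entropy is carried by the flow, D_t S = 0, and so is m = rho^-1 B . grad S: by the induction
    equation and the conservation of mass the field b = B / rho is frozen into the flow,
    D_t b = b . grad u, which makes b . grad S constant along trajectories.  Every term of the entropy
    energy that contains a material derivative therefore vanishes, and the energy is the sum of the
    squared norms of S and m in H^4 (entropy_energyE).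

    Let f be transported by u.  A derivative of order at most four of f is transported up to the
    commutator of the derivative with u . grad, which contains at most four derivatives of f and of u;
    it is bounded in L^2 by C |u|_4 |f|_4, because a product of two functions is square integrable as
    soon as three derivatives are available between them (sob_prod).  The term of highest order is the
    transport of a square; its integral is, up to a constant factor, that of the square times the
    divergence of u, because u is tangent to the boundary (transport_zero).  Hence the derivative of
    |f|_4^2 is at most C |u|_4 |f|_4^2, and the polynomial C (X + X^2) does.  Since f has no fifth
    derivative, the argument runs on iterated difference quotients of f, with bounds that are uniform
    in the step (tri_bound, tri_energy); the step then tends to zero under the time derivative
    (rate_intro, energy_rate).

    Weak derivatives and material derivatives are defined by duality.  They are tested with tensor
    products of functions of one variable, whose span is dense in L^2 (L2_density), so that an
    inner product with a test function is a function of one real variable and elementary calculus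
    applies to it.  In this way a weak derivative in time that is continuous with values in L^2 is a
    strong one (weak_strong), and a weak derivative in space is a limit of difference quotients
    (dq_cvg).

    The transport of S follows from the equations by integration by parts in space-time (J_transport).
    The field m contains a derivative of S and has no classical derivatives itself.  Its equation is
    obtained in weak form (J_frozen) from the exchange of two derivatives in the integral of
    d_a S d_i A, for A of class C^1 with compact support (J_swap), applied to the products of b_i,
    the velocity of space-time (1, u) and a test function. *)

Set Implicit Arguments.
Unset Strict Implicit.
Unset Printing Implicit Defensive.

Import Order.TTheory GRing.Theory Num.Theory.
Import numFieldNormedType.Exports.

Local Open Scope classical_set_scope.
Local Open Scope ring_scope.

(** * Smooth functions of one variable and tensor products *)

Section smooth1.
Context {R : realType}.
Implicit Types a f g : R -> R.

(** Smoothness in terms of derivatives of one real variable, for which exp (-1 / x) and its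
    relatives can be handled by induction. *)
Definition sm1 (f : R -> R) : Prop := forall n x, derivable ((derive1n n f)) x 1.

Definition dclosed (C : set (R -> R)) : Prop :=
  forall f, C f -> exists2 g, C g & forall x : R, is_derive x (1:R) f (g x).

(** Only membership of a derivative in the class is required, so no formula for the derivatives
    of order n is ever written down. *)
Lemma dclosed_sm1 (C : set (R -> R)) f : dclosed C -> C f -> sm1 f.
Proof.
move=> dC Cf.
have H n : C (derive1n n f).
  elim: n => [|n IH]; first by rewrite derive1n0.
  have [g Cg dg] := dC _ IH.
  rewrite derive1nS (_ : derive1 (derive1n n f) = g)//.
  by apply/funext => x; rewrite derive1E; have := dg x => dgx; rewrite derive_val.
move=> n x; have [g Cg dg] := dC _ (H n).
by have := dg x => dgx; exact: ex_derive.
Qed.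

Lemma sm1_is_derive f : sm1 f -> forall x : R, is_derive x (1:R) f ((derive1 f) x).
Proof.
move=> sf x; rewrite derive1E; apply: derivableP.
by have := sf 0%N x; rewrite derive1n0.
Qed.

Lemma sm1_derive f : sm1 f -> sm1 (derive1 f).
Proof. by move=> sf n x; rewrite -derive1Sn; exact: sf. Qed.

Lemma sm1_continuous f : sm1 f -> continuous f.
Proof.
move=> sf x; apply: differentiable_continuous; apply/derivable1_diffP.
by have := sf 0%N x; rewrite derive1n0.
Qed.

Lemma sm1_comp_affine f c d : sm1 f -> sm1 (fun x => f (c * x + d)).
Proof.
move=> sf.
apply: (@dclosed_sm1
  [set h | exists k g, sm1 g /\ h = fun x => k * g (c * x + d)]); last first.
  by exists 1, f; split => //; apply/funext => x; rewrite mul1r.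
move=> h [k [g [sg ->]]].
exists (fun x => (k * c) * (derive1 g) (c * x + d)).
  by exists (k * c), (derive1 g); split; [exact: sm1_derive|].
move=> x.
have h1 : is_derive x (1:R) (fun x => c * x + d) c.
  by apply: is_derive_eq; rewrite addr0 /GRing.scale/= mulr1.
have h2 := @is_derive1_comp _ g (fun x => c * x + d) x _ _
  (sm1_is_derive sg _) h1.
apply: is_derive_eq; rewrite /GRing.scale/=; ring.
Qed.

Inductive sum_prod1 : set (R -> R) :=
| Sp1 f g : sm1 f -> sm1 g -> sum_prod1 (f \* g)
| Sp2 F G : sum_prod1 F -> sum_prod1 G -> sum_prod1 (F \+ G).

Lemma sm1M f g : sm1 f -> sm1 g -> sm1 (f \* g).
Proof.
move=> sf sg; apply: (@dclosed_sm1 sum_prod1); last exact: Sp1.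
move=> h; elim=> {}h.
  move=> k sh sk; exists (((derive1 h) \* k) \+ (h \* (derive1 k))).
    exact: (Sp2 (Sp1 (sm1_derive sh) sk) (Sp1 sh (sm1_derive sk))).
  move=> x; have hx := sm1_is_derive sh x; have kx := sm1_is_derive sk x.
  by apply: is_derive_eq; rewrite /GRing.scale/=; ring.
move=> k _ [h' Ch' dh] _ [k' Ck' dk]; exists (h' \+ k'); first exact: (Sp2 Ch' Ck').
by move=> x; have := dh x; have := dk x => ? ?; exact: is_deriveD.
Qed.

(** ** The standard flat function *)

(** exp (-1 / x) / x^k for positive x: the derivative of each of these functions is a linear
    combination of two others. *)
Definition flat k : R -> R :=
  fun x => if 0 < x then x ^- k * expR (- x^-1) else 0.

Lemma flat_ge0 k x : 0 <= flat k x.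
Proof.
rewrite /flat; case: ifPn => // x0.
by rewrite mulr_ge0 ?expR_ge0// invr_ge0 exprn_ge0// ltW.
Qed.

(** The exponential series dominates each of its terms, so exp (1 / x) beats all powers of 1 / x. *)
Lemma flat_le k x : 0 <= x -> flat k x <= (k.+1)`!%:R * x.
Proof.
rewrite le_eqVlt => /predU1P[<-|x0]; first by rewrite /flat ltxx mulr0.
rewrite /flat x0 expRN.
have h : (x^-1) ^+ k.+1 / (k.+1)`!%:R <= expR x^-1.
  apply: le_trans (@expR_ge1Dxn _ x^-1 k _); last by rewrite invr_ge0 ltW.
  by rewrite lerDr.
have f0 : 0 < (k.+1)`!%:R :> R by rewrite ltr0n fact_gt0.
rewrite ler_pdivrMr ?expR_gt0// -ler_pdivrMl ?mulr_gt0//.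
apply: le_trans h; rewrite le_eqVlt; apply/orP; left; apply/eqP.
rewrite exprS exprVn; field.
by rewrite !gt_eqF// exprn_gt0.
Qed.

Lemma flat0_le1 x : flat 0 x <= 1.
Proof.
rewrite /flat; case: ifPn => // x0.
by rewrite expr0 invr1 mul1r expR_le1 oppr_le0 invr_ge0 ltW.
Qed.

Lemma is_derive_flat k (x:R) :
  is_derive x (1:R) (flat k) (- k%:R * flat k.+1 x + flat k.+2 x).
Proof.
have [x0|x0|->] := ltgtP x 0.
- rewrite /flat ltNge (ltW x0)/= mulr0 addr0.
  apply: (@near_eq_is_derive _ _ _ (cst 0)).
  near=> y; rewrite /cst ltNge; suff -> : y <= 0 by [].
  by apply: ltW; near: y; exact: lt_nbhsl.
- rewrite {2 3}/flat x0.
  apply: (@near_eq_is_derive R R R (fun y : R => y^-1 ^+ k * expR (- y^-1))).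
    near=> y; rewrite /flat exprVn; suff -> : 0 < y by [].
    by near: y; exact: lt_nbhsr.
  have xn0 : x != 0 by rewrite gt_eqF.
  have h1 : is_derive x (1:R) (fun y : R => y^-1) (- x ^- 2).
    by apply: is_derive_eq (@is_deriveV _ id x 1 1 xn0 _) _; rewrite /GRing.scale/= mulr1.
  have h2 : is_derive x (1:R) (fun y : R => y^-1 ^+ k) (k%:R * x^-1 ^+ k.-1 * - x ^- 2).
    rewrite (_ : (fun y : R => _) = (fun y : R => y^-1) ^+ k); last first.
      by apply/funext => y; rewrite exprfctE.
    by apply: is_derive_eq; rewrite /GRing.scale/=.
  have h3 : is_derive x (1:R) (fun y : R => expR (- y^-1)) (expR (- x^-1) * x ^- 2).
    apply: (@is_derive1_comp _ expR (fun y => - y^-1)).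
    by apply: is_derive_eq; rewrite opprK.
  apply: is_derive_eq; rewrite /GRing.scale/=.
  rewrite -[x ^- _.+1]exprVn -[x ^- _.+2]exprVn.
  case: k h2 => [|k] h2; first by rewrite -exprVn; ring.
  rewrite /= -[x ^- _.+2]exprVn !exprS; ring.
- rewrite {2 3}/flat ltxx mulr0 addr0.
  have H : h^-1 *: (flat k (h *: 1 + 0) - flat k 0) @[h --> (0:R)^'] --> (0 : R).
    apply/cvgr0Pnorm_le => e e0.
    have d0 : 0 < e / (k.+2)`!%:R by rewrite divr_gt0// ltr0n fact_gt0.
    near=> h.
    have h0 : h != 0 by near: h; exact: nbhs_dnbhs_neq.
    rewrite addr0 /flat ltxx subr0 /GRing.scale/= mulr1.
    case: ifPn => h1; last by rewrite mulr0 normr0 ltW.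
    have -> : h^-1 * (h ^- k * expR (- h^-1)) = flat k.+1 h.
      by rewrite /flat h1 mulrA exprS invfM.
    rewrite ger0_norm ?flat_ge0// (le_trans (flat_le _ (ltW h1)))//.
    rewrite -ler_pdivlMl ?ltr0n ?fact_gt0// mulrC.
    near: h; apply: nbhs_dnbhs; exact: lt_le_nbhsl.
  by apply: DeriveDef; [apply/cvg_ex; exists 0|exact/cvg_lim].
Unshelve. all: end_near. Qed.

Inductive flat_span : set (R -> R) :=
| Fs1 k : flat_span (flat k)
| Fs2 c f : flat_span f -> flat_span (fun x => c * f x)
| Fs3 f g : flat_span f -> flat_span g -> flat_span (f \+ g).

Lemma flat_sm1 k : sm1 (flat k).
Proof.
apply: (@dclosed_sm1 flat_span); last first.
  exact: Fs1.
move=> f; elim=> {f}.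
  move=> j; exists (fun x => - j%:R * flat j.+1 x + flat j.+2 x).
    exact: (Fs3 (Fs2 _ (Fs1 _)) (Fs1 _)).
  by move=> x; exact: is_derive_flat.
- move=> c f _ [f' Cf' df]; exists (fun x => c * f' x); first exact: (Fs2 _ Cf').
  by move=> x; have := df x => ?; apply: is_derive_eq; rewrite /GRing.scale/=; ring.
- move=> f g _ [f' Cf' df] _ [g' Cg' dg]; exists (f' \+ g'); first exact: (Fs3 Cf' Cg').
  by move=> x; have := df x; have := dg x => ? ?; exact: is_deriveD.
Qed.

(** Normalised so that it tends to the indicator of the interval as n grows. *)
Definition cutoff n (p q : R) : R -> R :=
  fun x => flat 0 (n%:R * (x - p)) * flat 0 (n%:R * (q - x)).

Lemma cutoff_sm1 n p q : sm1 (cutoff n p q).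
Proof.
have -> : cutoff n p q = (fun x => flat 0 (n%:R * x + (- (n%:R * p)))) \*
                       (fun x => flat 0 (- n%:R * x + n%:R * q)).
  by apply/funext => x; rewrite /cutoff/=; congr (flat 0 _ * flat 0 _); ring.
by apply: sm1M; apply: sm1_comp_affine; exact: flat_sm1.
Qed.

Lemma cutoff_ge0 n p q x : 0 <= cutoff n p q x.
Proof. by rewrite mulr_ge0// flat_ge0. Qed.

Lemma cutoff_le1 n p q x : cutoff n p q x <= 1.
Proof. by rewrite mulr_ile1 ?flat_ge0 ?flat0_le1. Qed.

Lemma cutoff_out n p q x : ~~ (p < x < q) -> cutoff n p q x = 0.
Proof.
rewrite negb_and -!leNgt => /orP[h|h]; rewrite /cutoff /flat.
  by rewrite ltNge mulr_ge0_le0 ?subr_le0//= mul0r.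
by rewrite [X in _ * X](_ : _ = 0) ?mulr0// ltNge mulr_ge0_le0 ?subr_le0.
Qed.

Lemma flat_cvg (y : R) : 0 < y -> flat 0 (n%:R * y) @[n --> \oo] --> (1 : R).
Proof.
move=> y0; have E : expR (- 0) = 1 :> R by rewrite oppr0 expR0.
suff : flat 0 (n%:R * y) @[n --> \oo] --> expR (- 0) by rewrite E.
have h : (- (n.+1%:R * y)^-1) @[n --> \oo] --> (- 0 : R).
  apply: cvgN; under eq_fun do rewrite invfM.
  rewrite -(mul0r y^-1); apply: cvgMl; exact: cvg_harmonic.
rewrite -(cvg_shiftS (fun n => flat 0 (n%:R * y))) /=.
rewrite (_ : (fun n => _) = (fun n => expR (- (n.+1%:R * y)^-1))).
  by apply: (cvg_comp _ _ h); exact: continuous_expR.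
by apply/funext => n; rewrite /flat pmulr_rgt0 ?ltr0n// y0 expr0 invr1 mul1r.
Qed.

Lemma cutoff_cvg p q x :
  cutoff n p q x @[n --> \oo] --> ((p < x < q)%R%:R : R).
Proof.
have [/andP[h1 h2]|h] := boolP (p < x < q).
  rewrite -[X in _ --> X]mulr1; apply: cvgM; apply: flat_cvg; by rewrite subr_gt0.
rewrite (_ : (fun n => _) = cst 0); first exact: cvg_cst.
by apply/funext => n; rewrite cutoff_out.
Qed.

End smooth1.

(** ** Products of smooth functions *)

Section smooth_products.
Context {R : realType}.

Definition Dclosed {V : normedModType R} (C : set (V -> R)) : Prop :=
  forall f, C f -> [/\ continuous f, forall x v, derivable f x v &
    forall v, C (fun x => 'D_v f x)].

Lemma Dclosed_smooth {V : normedModType R} (C : set (V -> R)) f :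
  Dclosed C -> C f -> smooth f.
Proof.
move=> dC Cf vs.
have : C (Defs.iterD f vs) by elim: vs => //= v vs IH; have [_ _] := dC _ IH; apply.
by move/dC => [].
Qed.

Lemma smooth_Dclosed {V : normedModType R} : Dclosed (@smooth R V).
Proof.
move=> f sf; split.
- by have [] := sf [::].
- by have [] := sf [::].
move=> v vs; have := sf (rcons vs v).
by rewrite /Defs.iterD foldr_rcons.
Qed.

Inductive tensor_span {V1 V2 : normedModType R} : set (V1 * V2 -> R) :=
| Ts1 f g : smooth f -> smooth g -> tensor_span (fun z => f z.1 * g z.2)
| Ts2 F G : tensor_span F -> tensor_span G -> tensor_span (F \+ G).

Lemma is_derive_tensor {V1 V2 : normedModType R} (f : V1 -> R) (g : V2 -> R)
    (z v : V1 * V2) : derivable f z.1 v.1 -> derivable g z.2 v.2 ->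
  is_derive z v (fun z => f z.1 * g z.2)
    ('D_(v.1) f z.1 * g z.2 + f z.1 * 'D_(v.2) g z.2).
Proof.
move=> df dg.
have h1 : is_derive z v (fun z => f z.1) ('D_(v.1) f z.1).
  exact: (DeriveDef (f := fun z => f z.1) df).
have h2 : is_derive z v (fun z => g z.2) ('D_(v.2) g z.2).
  exact: (DeriveDef (f := fun z => g z.2) dg).
apply: is_derive_eq; rewrite /GRing.scale/=; ring.
Qed.

(** The class of sums of tensor products is stable under partial derivatives. *)
Lemma smooth_tensor {V1 V2 : normedModType R} (f : V1 -> R) (g : V2 -> R) :
  smooth f -> smooth g -> smooth (fun z : V1 * V2 => f z.1 * g z.2).
Proof.
move=> sf sg; apply: (@Dclosed_smooth _ tensor_span); last exact: Ts1.
move=> F; elim=> {F}.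
  move=> {sf sg f g} f g sf sg.
  have [cf df Df] := smooth_Dclosed sf; have [cg dg Dg] := smooth_Dclosed sg.
  split.
  - move=> z; apply: cvgM.
      by apply: (continuous_comp (g := f)); [exact: cvg_fst|exact: cf].
    by apply: (continuous_comp (g := g)); [exact: cvg_snd|exact: cg].
  - by move=> x v; apply: ex_derive; exact: is_derive_tensor.
  - move=> v; rewrite (_ : (fun x => _) =
      ((fun z => 'D_(v.1) f z.1 * g z.2) \+ (fun z => f z.1 * 'D_(v.2) g z.2))).
      exact: (Ts2 (Ts1 (Df _) sg) (Ts1 sf (Dg _))).
    apply/funext => z; have := is_derive_tensor (df z.1 v.1) (dg z.2 v.2) => ?.
    by rewrite derive_val.
move=> F G _ [cF dF DF] _ [cG dG DG]; split.
- by move=> z; apply: cvgD; [exact: cF|exact: cG].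
- by move=> x v; apply: derivableD; [exact: dF|exact: dG].
- move=> v; rewrite (_ : (fun x => _) = ((fun x => 'D_v F x) \+ (fun x => 'D_v G x))).
    exact: (Ts2 (DF v) (DG v)).
  by apply/funext => z; rewrite deriveD.
Qed.

Lemma derive_line (f : R -> R) x (v : R) : derivable f x 1 ->
  derivable f x v /\ 'D_v f x = v * derive1 f x.
Proof.
move=> /derivable1_diffP df; split; first exact: diff_derivable.
by rewrite deriveE// diff1E.
Qed.

Lemma sm1_smooth (f : R -> R) : sm1 f -> smooth f.
Proof.
move=> sf; apply: (@Dclosed_smooth _ [set h | exists c g, sm1 g /\ h = fun x => c * g x]).
  move=> h [c [g [sg ->]]].
  have H x v := @derive_line g x v (sg 0%N x).
  have dg x v : derivable (fun x => c * g x) x v.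
    by apply: derivableM; [exact: derivable_cst|have [] := H x v].
  split=> //.
  - move=> x; apply: cvgM; [exact: cvg_cst|exact: sm1_continuous].
  - move=> v; exists (c * v), (derive1 g); split; first exact: sm1_derive.
    apply/funext => x; have [h1 h2] := H x v.
    by rewrite -mulrA -h2 (deriveM (derivable_cst _ _ _) h1) derive_cst /GRing.scale/= mulr0 addr0.
by exists 1, f; split => //; apply/funext => x; rewrite mul1r.
Qed.

End smooth_products.

(** * Tensor test functions on the half-space *)

Section tests.
Context {R : realType}.
Implicit Types (a b c : R -> R) (psi : R3 R -> R).

Definition test1 (P : pred R) a : Prop :=
  sm1 a /\ exists p q, [/\ P p, P q & forall x, ~~ (p <= x <= q) -> a x = 0].

Definition tens a b c : R3 R -> R := fun x => a x.1.1 * b x.1.2 * c x.2.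

(** Tests of this form are stable under derivation and translation, reduce integrals to one
    variable at a time, and still determine square integrable functions. *)
Definition tst psi : Prop := exists a b c,
  [/\ test1 predT a, test1 predT b, test1 (> 0) c & psi = tens a b c].

Lemma test1_derive P a : test1 P a -> test1 P (derive1 a).
Proof.
move=> [sa [p [q [Pp Pq a0]]]]; split; first exact: sm1_derive.
exists p, q; split => // x xpq.
rewrite -(@derive1_cst R R 0 x) !derive1E.
apply: near_eq_derive; move: xpq; rewrite negb_and -!ltNge => /orP[xp|qx].
  near=> y; rewrite a0 ?cstE// negb_and -!ltNge; apply/orP; left.
  by near: y; exact: lt_nbhsl.
near=> y; rewrite a0 ?cstE// negb_and -!ltNge; apply/orP; right.
by near: y; exact: lt_nbhsr.
Unshelve. all: end_near. Qed.

Lemma smooth_tens a b c : sm1 a -> sm1 b -> sm1 c -> smooth (tens a b c).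
Proof.
move=> sa sb sc; exact: (smooth_tensor (f := fun z : R * R => a z.1 * b z.2)
  (smooth_tensor (sm1_smooth sa) (sm1_smooth sb)) (sm1_smooth sc)).
Qed.

Lemma tst_supp psi : tst psi -> exists p1 q1 p2 q2 p3 q3 : R, 
  [/\ 0 < p3, 0 < q3 & forall x, ~ (`[p1, q1] `*` `[p2, q2] `*` `[p3, q3]) x -> psi x = 0].
Proof.
move=> [a [b [c [[_ [p1 [q1 [_ _ a0]]]] [_ [p2 [q2 [_ _ b0]]]] [_ [p3 [q3 [P3 Q3 c0]]]] ->]]]].
exists p1, q1, p2, q2, p3, q3; split => // -[[x y] z] /=; rewrite !in_itv/= => h.
rewrite /tens/=.
have [h1|/a0 ->] := boolP (p1 <= x <= q1); last by rewrite !mul0r.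
have [h2|/b0 ->] := boolP (p2 <= y <= q2); last by rewrite mulr0 mul0r.
have [h3|/c0 ->] := boolP (p3 <= z <= q3); last by rewrite mulr0.
by exfalso; apply: h.
Qed.

Lemma tst_test_function psi : tst psi -> test_function half_space psi.
Proof.
move=> tp; split.
  by case: tp => a [b [c [[sa _] [sb _] [sc _] ->]]]; exact: smooth_tens.
have [p1 [q1 [p2 [q2 [p3 [q3 [P3 Q3 h]]]]]]] := tst_supp tp.
exists (`[p1, q1] `*` `[p2, q2] `*` `[p3, q3]).
split; [by do ![apply: compact_setX]; exact: segment_compact| |exact: h].
by move=> [[x y] z] [_ /=]; rewrite in_itv/= => /andP[/(lt_le_trans P3)].
Qed.

Lemma test_function_time (T : R) (eta : R -> R) psi :
  test1 [pred t | 0 < t < T] eta -> tst psi ->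
  test_function (`]0, T[ `*` half_space) (fun z => eta z.1 * psi z.2).
Proof.
move=> [se [p [q [/andP[p0 pT] /andP[q0 qT] e0]]]] tp; split.
  apply: smooth_tensor; first exact: sm1_smooth.
  by case: tp => a [b [c [[sa _] [sb _] [sc _] ->]]]; exact: smooth_tens.
have [p1 [q1 [p2 [q2 [p3 [q3 [P3 Q3 h]]]]]]] := tst_supp tp.
exists (`[p, q] `*` (`[p1, q1] `*` `[p2, q2] `*` `[p3, q3])); split.
- by do ![apply: compact_setX]; exact: segment_compact.
- move=> [t [[x y] z]] [/= + [_ /=]]; rewrite !in_itv/= => /andP[pt tq] /andP[/(lt_le_trans P3) z0 _].
  by split => //; rewrite (lt_le_trans p0)//= (le_lt_trans tq).
- move=> [t x] /= tx; have [tpq|/e0 ->] := boolP (p <= t <= q); last by rewrite mul0r.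
  by rewrite h ?mulr0// => hx; apply: tx; split => //=; rewrite in_itv.
Qed.

Lemma derive_tens a b c x (v : R3 R) : sm1 a -> sm1 b -> sm1 c ->
  is_derive x v (tens a b c)
   (v.1.1 * tens (derive1 a) b c x + v.1.2 * tens a (derive1 b) c x
    + v.2 * tens a b (derive1 c) x).
Proof.
move=> sa sb sc.
have [da Da] := derive_line v.1.1 (sa 0%N x.1.1).
have [db Db] := derive_line v.1.2 (sb 0%N x.1.2).
have [dc Dc] := derive_line v.2 (sc 0%N x.2).
have h := @is_derive_tensor _ _ _ a b x.1 v.1 da db.
have h2 : derivable (fun z : R * R => a z.1 * b z.2) x.1 v.1 by have [] := h.
have := @is_derive_tensor _ _ _ (fun z : R * R => a z.1 * b z.2) c x v h2 dc.
move=> h3; apply: is_derive_eq; rewrite derive_val Da Db Dc /tens; ring.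
Qed.

Definition tens_d (i : 'I_3) a b c : R3 R -> R :=
  if i == 0 :> nat then tens (derive1 a) b c
  else if i == 1%N :> nat then tens a (derive1 b) c else tens a b (derive1 c).

Lemma derive_tensE i a b c x : sm1 a -> sm1 b -> sm1 c ->
  'D_(evec i) (tens a b c) x = tens_d i a b c x.
Proof.
move=> sa sb sc; have h := derive_tens x (evec i) sa sb sc.
rewrite derive_val /tens_d /evec/=.
by case: i {h} => -[|[|[|//]]] /= _; rewrite !mul0r mul1r ?addr0 ?add0r.
Qed.

Lemma tst_derive i psi : tst psi -> tst (fun x => 'D_(evec i) psi x).
Proof.
move=> [a [b [c [ta tb tc ->]]]].
have [sa _] := ta; have [sb _] := tb; have [sc _] := tc.
rewrite (_ : (fun x => _) = tens_d i a b c); last first.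
  by apply/funext => x; rewrite derive_tensE.
rewrite /tens_d; case: ifPn => _; last case: ifPn => _.
- by exists (derive1 a), b, c; split; [exact: test1_derive ta|exact: tb|exact: tc|reflexivity].
- by exists a, (derive1 b), c; split; [exact: ta|exact: test1_derive tb|exact: tc|reflexivity].
- by exists a, b, (derive1 c); split; [exact: ta|exact: tb|exact: test1_derive tc|reflexivity].
Qed.

Definition alpha3 (i j k : nat) : 'I_3 -> nat :=
  fun m => if m == 0 :> nat then i else if m == 1%N :> nat then j else k.

Lemma alpha3E (al : 'I_3 -> nat) : exists i j k, al = alpha3 i j k.
Proof.
exists (al ord0), (al (inord 1)), (al ord_max); apply/funext => m; rewrite /alpha3.
case: eqVneq => m0; first by congr al; apply/val_inj.
case: eqVneq => m1; first by congr al; apply/val_inj; rewrite /= inordK.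
by congr al; apply/val_inj; case: m m0 m1 => -[|[|[|]]].
Qed.

Lemma iterD_nseq (f : R3 R -> R) n v vs :
  Defs.iterD f (nseq n v ++ vs) = iter n (fun g x => 'D_v g x) (Defs.iterD f vs).
Proof. by elim: n => //= n ->. Qed.

Lemma pderiv_alpha3 i j k (f : R3 R -> R) : pderiv (alpha3 i j k) f =
  iter i (fun g x => 'D_(evec ord0) g x) (iter j (fun g x => 'D_(evec (inord 1)) g x)
   (iter k (fun g x => 'D_(evec ord_max) g x) f)).
Proof.
rewrite /pderiv enum_ordSl enum_ordSl enum_ordSl (_ : enum 'I_0 = [::]); last first.
  by apply/size0nil; rewrite size_enum_ord.
rewrite /= /alpha3/= cats0 !iterD_nseq -[nseq k _]cats0 iterD_nseq/=.
have -> : lift ord0 ord0 = inord 1 :> 'I_3 by apply/val_inj; rewrite /= inordK.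
by have -> : lift ord0 (lift ord0 ord0) = ord_max :> 'I_3 by apply/val_inj.
Qed.

Lemma tens_iter i j k a b c : sm1 a -> sm1 b -> sm1 c ->
  pderiv (alpha3 i j k) (tens a b c) = tens (derive1n i a) (derive1n j b) (derive1n k c).
Proof.
move=> sa sb sc; rewrite pderiv_alpha3.
have H n (f : R -> R) : sm1 f -> sm1 (derive1n n f).
  by move=> sf; elim: n => [|n IH]; [exact: sf|rewrite derive1nS; exact: sm1_derive].
have -> : iter k (fun g x => 'D_(evec ord_max) g x) (tens a b c) = tens a b (derive1n k c).
  elim: k => [//|k IH]; rewrite iterS IH; apply/funext => x.
  by rewrite (derive_tensE _ _ sa sb (H k _ sc)).
have -> : iter j (fun g x => 'D_(evec (inord 1)) g x) (tens a b (derive1n k c)) = tens a (derive1n j b) (derive1n k c).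
  elim: j => [//|j IH]; rewrite iterS IH; apply/funext => x.
  by rewrite (derive_tensE _ _ sa (H j _ sb) (H k _ sc)) /tens_d inordK.
elim: i => [//|i IH]; rewrite iterS IH; apply/funext => x.
by rewrite (derive_tensE _ _ (H i _ sa) (H j _ sb) (H k _ sc)).
Qed.

Definition add1 (al : 'I_3 -> nat) (i : 'I_3) : 'I_3 -> nat := fun j => (al j + (j == i))%N.

Lemma mlen_add1 al i : mlen (add1 al i) = (mlen al).+1.
Proof.
rewrite /mlen /add1 big_split/=.
have -> : (\sum_(j < 3) (j == i) = 1)%N; last by rewrite addn1.
by rewrite (bigD1 i)//= eqxx big1 // => j /negPf ->.
Qed.

(** Each factor of a tensor product is differentiated separately, so that the order of the
    derivatives is immaterial. *)
Lemma pderiv_add1 al i psi : tst psi ->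
  pderiv (add1 al i) psi = pderiv al (fun x => 'D_(evec i) psi x).
Proof.
move=> [a [b [c [[sa _] [sb _] [sc _] ->]]]].
have [i1 [j1 [k1 ->]]] := alpha3E al.
rewrite (_ : (fun x => 'D_(evec i) _ x) = tens_d i a b c); last first.
  by apply/funext => x; rewrite derive_tensE.
rewrite /tens_d; case: ifPn => [/eqP i0|i0]; last case: ifPn => [/eqP i2|i2].
- rewrite (_ : add1 _ _ = alpha3 i1.+1 j1 k1).
    by rewrite (tens_iter _ _ _ sa sb sc) derive1Sn (tens_iter _ _ _ (sm1_derive sa) sb sc).
  by apply/funext => m; rewrite /add1 /alpha3; case: m i i0 => -[|[|[|//]]] ? [[|[|[|//]]] ?] //= _; rewrite ?addn0 ?addn1.
- rewrite (_ : add1 _ _ = alpha3 i1 j1.+1 k1).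
    by rewrite (tens_iter _ _ _ sa sb sc) derive1Sn (tens_iter _ _ _ sa (sm1_derive sb) sc).
  by apply/funext => m; rewrite /add1 /alpha3; case: m i i0 i2 => -[|[|[|//]]] ? [[|[|[|//]]] ?] //= _; rewrite ?addn0 ?addn1.
- rewrite (_ : add1 _ _ = alpha3 i1 j1 k1.+1).
    by rewrite (tens_iter _ _ _ sa sb sc) derive1Sn (tens_iter _ _ _ sa sb (sm1_derive sc)).
  by apply/funext => m; rewrite /add1 /alpha3; case: m i i0 i2 => -[|[|[|//]]] ? [[|[|[|//]]] ?] //= _; rewrite ?addn0 ?addn1.
Qed.

End tests.

(** * The space of square integrable functions on the half-space *)

Section L2.
Context {R : realType}.
Implicit Types f g h : R3 R -> R.
Local Notation D := (@half_space R).
Local Notation mu := (@leb3 R).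

Lemma measurable_half_space : measurable D.
Proof.
rewrite (_ : D = setT `&` snd @^-1` `]0, +oo[); last first.
  by rewrite setTI; apply/seteqP; split => x /=; rewrite in_itv/= andbT.
exact: measurable_snd.
Qed.
Local Hint Resolve measurable_half_space : core.

Lemma is_L2_integrable f : is_L2 f -> mu.-integrable D (EFin \o (f \* f)).
Proof.
move=> [mf nf]; apply/integrableP; split.
  by apply/measurable_EFinP; exact: measurable_funM.
apply: le_lt_trans nf; rewrite le_eqVlt; apply/orP; left; apply/eqP.
apply: eq_integral => x _ /=.
by rewrite ger0_norm -expr2 // sqr_ge0.
Qed.

Lemma is_L2P f : measurable_fun D f -> mu.-integrable D (EFin \o (f \* f)) -> is_L2 f.
Proof.
move=> mf /integrableP[_ h]; split => //; apply: le_lt_trans h.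
rewrite le_eqVlt; apply/orP; left; apply/eqP; apply: eq_integral => x _ /=.
by rewrite ger0_norm -expr2 // sqr_ge0.
Qed.

Lemma L2_mul f g : is_L2 f -> is_L2 g -> mu.-integrable D (EFin \o (f \* g)).
Proof.
move=> Lf Lg; have [mf _] := Lf; have [mg _] := Lg.
have : mu.-integrable D ((EFin \o (f \* f)%R) \+ (EFin \o (g \* g)%R))%E.
  by apply: integrableD => //; exact: is_L2_integrable.
apply: le_integrable => //.
  by apply/measurable_EFinP; exact: measurable_funM.
move=> x _ /=; rewrite lee_fin (ger0_norm (addr_ge0 _ _)) -?expr2 ?sqr_ge0//.
rewrite normrM -(real_normK (num_real (f x))) -(real_normK (num_real (g x))).
have := sqr_ge0 (`|f x| - `|g x|); have := mulr_ge0 (normr_ge0 (f x)) (normr_ge0 (g x)); nra.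
Qed.

Lemma L2_le f g : measurable_fun D f -> is_L2 g ->
  (forall x, D x -> `|f x| <= `|g x|) -> is_L2 f.
Proof.
move=> mf Lg fg; apply: is_L2P => //.
apply: le_integrable (is_L2_integrable Lg) => //.
  by apply/measurable_EFinP; exact: measurable_funM.
by move=> x Dx /=; rewrite lee_fin !normrM ler_pM// fg.
Qed.

Lemma L2D f g : is_L2 f -> is_L2 g -> is_L2 (f \+ g).
Proof.
move=> Lf Lg; have [mf _] := Lf; have [mg _] := Lg.
have fg := L2_mul Lf Lg.
apply: is_L2P; first exact: measurable_funD.
rewrite (_ : _ \o _ = (EFin \o (f \* f)%R) \+ (((EFin \o (f \* g)%R) \+ (EFin \o (f \* g)%R))
    \+ (EFin \o (g \* g)%R)))%E; last first.
  by apply/funext => x /=; rewrite -!EFinD; congr EFin; ring.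
apply: integrableD => //; first exact: is_L2_integrable.
apply: integrableD => //; last exact: is_L2_integrable.
exact: integrableD.
Qed.

Lemma L2Z c f : is_L2 f -> is_L2 (c \*o f).
Proof.
move=> Lf; have [mf _] := Lf; apply: is_L2P; first exact: measurable_funM.
rewrite (_ : _ \o _ = (fun x => (c ^+ 2)%:E * (EFin \o (f \* f)%R) x))%E; last first.
  by apply/funext => x /=; rewrite -!EFinM; congr EFin; ring.
by apply: integrableZl => //; exact: is_L2_integrable.
Qed.

Lemma L2_eq f g : (forall x, D x -> f x = g x) -> is_L2 f -> is_L2 g.
Proof.
move=> fg Lf; apply: (@L2_le _ f) => //; last by move=> x /fg ->.
case: Lf => mf _; apply: eq_measurable_fun mf => x; rewrite inE; exact: fg.
Qed.

Lemma L2B f g : is_L2 f -> is_L2 g -> is_L2 (f \- g).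
Proof.
move=> Lf Lg; apply: (@L2_eq (f \+ (-1 \*o g))); last by apply: L2D => //; exact: L2Z.
by move=> x _ /=; rewrite mulN1r.
Qed.

Lemma L20 : is_L2 (fun _ => 0 : R).
Proof.
split; first exact: measurable_cst.
by rewrite /sqnorm; under eq_integral do rewrite expr0n/=; rewrite integral0.
Qed.

Definition ip f g : R := intO (fun x => f x * g x).

Lemma ipC f g : ip f g = ip g f.
Proof. by apply: eq_Rintegral => x _; rewrite mulrC. Qed.

Lemma eq_ip f f' g g' : (forall x, D x -> f x = f' x) -> (forall x, D x -> g x = g' x) ->
  ip f g = ip f' g'.
Proof. by move=> ff gg; apply: eq_Rintegral => x /[!inE] Dx; rewrite ff// gg. Qed.

Lemma ipDl f g h : is_L2 f -> is_L2 g -> is_L2 h -> ip (f \+ g) h = ip f h + ip g h.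
Proof.
move=> Lf Lg Lh; rewrite /ip /intO -RintegralD//; [|exact: L2_mul..].
by apply: eq_Rintegral => x _ /=; rewrite mulrDl.
Qed.

Lemma ipZl c f h : is_L2 f -> is_L2 h -> ip (c \*o f) h = c * ip f h.
Proof.
move=> Lf Lh; rewrite /ip /intO -RintegralZl//; last exact: L2_mul.
by apply: eq_Rintegral => x _ /=; rewrite mulrA.
Qed.

Lemma ipBl f g h : is_L2 f -> is_L2 g -> is_L2 h -> ip (f \- g) h = ip f h - ip g h.
Proof.
move=> Lf Lg Lh; rewrite /ip /intO -RintegralB//; [|exact: L2_mul..].
by apply: eq_Rintegral => x _ /=; rewrite mulrBl.
Qed.

Lemma ipDr f g h : is_L2 f -> is_L2 g -> is_L2 h -> ip h (f \+ g) = ip h f + ip h g.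
Proof. by move=> Lf Lg Lh; rewrite ipC ipDl// !(ipC h). Qed.

Lemma ipBr f g h : is_L2 f -> is_L2 g -> is_L2 h -> ip h (f \- g) = ip h f - ip h g.
Proof. by move=> Lf Lg Lh; rewrite ipC ipBl// !(ipC h). Qed.

Lemma ipZr c f h : is_L2 f -> is_L2 h -> ip h (c \*o f) = c * ip h f.
Proof. by move=> Lf Lh; rewrite ipC ipZl// ipC. Qed.

Lemma ip_ge0 f : 0 <= ip f f.
Proof. by apply: Rintegral_ge0 => x _; rewrite -expr2 sqr_ge0. Qed.

Lemma sqnormE f : is_L2 f -> sqnorm f = (ip f f)%:E.
Proof.
move=> [mf nf]; rewrite /ip /intO /Rintegral fineK.
  by apply: eq_integral => x _; rewrite expr2.
rewrite ge0_fin_numE; last by apply: integral_ge0 => x _; rewrite lee_fin -expr2 sqr_ge0.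
apply: le_lt_trans nf; rewrite le_eqVlt; apply/orP; left; apply/eqP.
by apply: eq_integral => x _; rewrite expr2.
Qed.

Definition nrm f : R := Num.sqrt (ip f f).

Lemma nrm_ge0 f : 0 <= nrm f. Proof. exact: sqrtr_ge0. Qed.

Lemma nrm2 f : nrm f ^+ 2 = ip f f.
Proof. by rewrite sqr_sqrtr// ip_ge0. Qed.

Lemma eq_nrm f g : (forall x, D x -> f x = g x) -> nrm f = nrm g.
Proof. by move=> fg; rewrite /nrm (eq_ip fg fg). Qed.

Lemma ip_cs f g : is_L2 f -> is_L2 g -> `|ip f g| <= nrm f * nrm g.
Proof.
move=> Lf Lg.
rewrite -(@ler_pXn2r _ 2)// ?nnegrE ?mulr_ge0 ?nrm_ge0//.
rewrite real_normK ?num_real// exprMn !nrm2.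
have H t : 0 <= ip f f + t * (2 * ip f g) + t ^+ 2 * ip g g.
  have := ip_ge0 (f \+ (t \*o g)).
  rewrite ipDl ?ipDr ?ipZl ?ipZr ?(ipC g f)//; do ?[exact: L2D|exact: L2Z|exact: L2D (L2Z _ _)].
  by move=> h; apply: le_trans h _; rewrite le_eqVlt; apply/orP; left; apply/eqP; ring.
have := ip_ge0 g; rewrite le_eqVlt => /predU1P[g0|g0].
  rewrite -g0 mulr0; suff -> : ip f g = 0 by rewrite expr0n.
  apply/eqP/contraT => fg0.
  have := H (- (ip f f + 1) / (2 * ip f g)).
  rewrite -g0 mulr0 addr0 mulfVK; last by rewrite mulf_neq0// pnatr_eq0.
  by rewrite opprD addrA subrr add0r oppr_ge0 ler10.
have := H (- ip f g / ip g g).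
have -> : ip f f + - ip f g / ip g g * (2 * ip f g) + (- ip f g / ip g g) ^+ 2 * ip g g =
   ip f f - ip f g ^+ 2 / ip g g.
  by field; rewrite gt_eqF.
by rewrite subr_ge0 ler_pdivrMr.
Qed.

Lemma nrmD f g : is_L2 f -> is_L2 g -> nrm (f \+ g) <= nrm f + nrm g.
Proof.
move=> Lf Lg; rewrite -(@ler_pXn2r _ 2)// ?nnegrE ?addr_ge0 ?nrm_ge0//.
rewrite nrm2 ipDl ?ipDr ?(ipC g f)//; try exact: L2D.
have := ler_normlW (ip_cs Lf Lg).
rewrite -!nrm2; nra.
Qed.

Lemma nrmZ c f : is_L2 f -> nrm (c \*o f) = `|c| * nrm f.
Proof.
move=> Lf; rewrite /nrm ipZl ?ipZr//; last exact: L2Z.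
by rewrite mulrA -expr2 sqrtrM ?sqr_ge0// sqrtr_sqr.
Qed.

Lemma nrmBC f g : nrm (f \- g) = nrm (g \- f).
Proof. by rewrite /nrm /ip; congr Num.sqrt; apply: eq_Rintegral => x _ /=; ring. Qed.

Lemma nrmB f g : is_L2 f -> is_L2 g -> nrm (f \- g) <= nrm f + nrm g.
Proof.
move=> Lf Lg; have -> : f \- g = f \+ (-1 \*o g).
  by apply/funext => x /=; rewrite mulN1r.
apply: le_trans (nrmD Lf _) _; first exact: L2Z.
by rewrite nrmZ// normrN1 mul1r.
Qed.

Lemma nrm_dist f g h : is_L2 f -> is_L2 g -> is_L2 h ->
  nrm (f \- h) <= nrm (f \- g) + nrm (g \- h).
Proof.
move=> Lf Lg Lh; have -> : f \- h = (f \- g) \+ (g \- h).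
  by apply/funext => x /=; rewrite addrA subrK.
by apply: nrmD; exact: L2B.
Qed.

Lemma nrm_sub f g : is_L2 f -> is_L2 g -> nrm f <= nrm g + nrm (f \- g).
Proof.
move=> Lf Lg; have {1}-> : f = g \+ (f \- g).
  by apply/funext => x /=; rewrite addrC subrK.
by apply: nrmD => //; exact: L2B.
Qed.

Lemma nrm0 : nrm (fun=> 0) = 0.
Proof.
rewrite /nrm /ip /intO /Rintegral; under eq_integral do rewrite mul0r.
by rewrite integral0 sqrtr0.
Qed.

Lemma ip_nrm0l f g : is_L2 f -> is_L2 g -> nrm f = 0 -> ip f g = 0.
Proof.
by move=> Lf Lg f0; have := ip_cs Lf Lg; rewrite f0 mul0r normr_le0 => /eqP.
Qed.

Lemma ip_ext f f' g : is_L2 f -> is_L2 f' -> is_L2 g -> nrm (f \- f') = 0 ->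
  ip f g = ip f' g.
Proof.
move=> Lf Lf' Lg ff; apply/eqP; rewrite -subr_eq0 -ipBl// ip_nrm0l//.
exact: L2B.
Qed.

Lemma nrm_ext f f' : is_L2 f -> is_L2 f' -> nrm (f \- f') = 0 -> nrm f = nrm f'.
Proof.
move=> Lf Lf' ff; apply/eqP; rewrite eq_le.
have := nrm_sub Lf Lf'; have := nrm_sub Lf' Lf; rewrite (nrmBC f') ff !addr0.
by move=> -> ->.
Qed.

Lemma le_nrm f g : is_L2 f -> is_L2 g -> (forall x, D x -> `|f x| <= `|g x|) ->
  nrm f <= nrm g.
Proof.
move=> Lf Lg fg; rewrite /nrm ler_sqrt ?ip_ge0//.
apply: le_Rintegral => //; [exact: is_L2_integrable..|].
move=> x Dx; rewrite -!expr2 -(real_normK (num_real (f x))) -(real_normK (num_real (g x))).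
by rewrite lerXn2r ?nnegrE// fg.
Qed.

Lemma nrm_eq0 f : is_L2 f -> nrm f = 0 -> {ae mu, forall x, D x -> f x = 0}.
Proof.
move=> Lf f0; have [mf _] := Lf.
have := sqnormE Lf; rewrite -nrm2 f0 expr0n/= => h.
have m2 : measurable_fun D (EFin \o (fun x => (f x) ^+ 2)).
  by apply/measurable_EFinP; exact: measurable_funX.
have /(ae_eq_integral_abs mu measurable_half_space m2) : (\int[mu]_(x in D) `|((f x) ^+ 2)%:E| = 0)%E.
  transitivity (sqnorm f); last by rewrite h.
  apply: eq_integral => x _ /=.
  by rewrite ger0_norm ?sqr_ge0.
apply: filterS => x /[apply] -[]/eqP.
by rewrite sqrf_eq0 => /eqP.
Qed.

End L2.
#[global] Hint Resolve measurable_half_space : core.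

(** * Translations and Tonelli on the half-space *)

(** ** Invariance of product measures *)

Definition int_invariant {R : realType} d (T : measurableType d)
    (m : {measure set T -> \bar R}) (s : T -> T) : Prop :=
  measurable_fun setT s /\
  forall F : T -> \bar R, measurable_fun setT F -> (forall x, 0 <= F x)%E ->
    (\int[m]_x F (s x) = \int[m]_x F x)%E.

(** Tonelli's theorem, one factor at a time. *)
Lemma int_invariant_prod {R : realType} d1 d2 (T1 : measurableType d1)
    (T2 : measurableType d2) (m1 : {sigma_finite_measure set T1 -> \bar R})
    (m2 : {sigma_finite_measure set T2 -> \bar R}) (s1 : T1 -> T1) (s2 : T2 -> T2) :
  int_invariant m1 s1 -> int_invariant m2 s2 ->
  int_invariant (m1 \x m2)%E (fun x => (s1 x.1, s2 x.2)).
Proof.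
move=> [ms1 H1] [ms2 H2].
have ms : measurable_fun setT (fun x : T1 * T2 => (s1 x.1, s2 x.2)).
  apply: measurable_fun_pair.
    by apply: measurableT_comp ms1 _; exact: measurable_fst.
  by apply: measurableT_comp ms2 _; exact: measurable_snd.
split=> // F mF F0.
rewrite fubini_tonelli1//; last by apply: measurableT_comp mF _.
rewrite fubini_tonelli1// -(H1 (fubini_F m2 F)); last 2 first.
- exact: measurable_fun_fubini_tonelli_F.
- by move=> x; exact: integral_ge0.
apply: eq_integral => x _; rewrite /fubini_F/= -(H2 (fun y => F (s1 x, y)))//.
exact: measurable_fun_pair2.
Qed.

Section sf.
Context {R : realType}.
Local Notation RR := (measurableTypeR R).
Local Notation lam := (@lebesgue_measure R).

(** An intermediate measure that carries the sigma-finiteness required by Tonelli's theorem. *)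
Definition leb2 : set (RR * RR) -> \bar R := (lam \x lam)%E.
HB.instance Definition _ := Measure.on leb2.

Definition cube2 (n : nat) : set (RR * RR) := `[- n%:R, n%:R] `*` `[- n%:R, n%:R].

Lemma leb2_sigma_finite : sigma_finite setT leb2.
Proof.
have m n : measurable (`[- n%:R, n%:R] : set RR) by exact: measurable_itv.
exists cube2.
  apply/seteqP; split => // -[x y] _.
  have [k [hx hy]] : exists k : nat, `|x| <= k%:R /\ `|y| <= k%:R.
    exists (maxn (Num.truncn `|x|).+1 (Num.truncn `|y|).+1).
    split; apply: ltW; apply: lt_le_trans (truncnS_gt _) _; rewrite ler_nat ?leq_maxl ?leq_maxr//.
  by exists k => //; split; rewrite /= in_itv/= -ler_norml.
move=> n; split; first exact: measurableX.
rewrite /leb2/= product_measure1E//= !lebesgue_measure_itv/= !lte_fin.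
by case: ifPn => _; rewrite ?mule0 ?ltry // -!EFinB -EFinM ltry.
Qed.

HB.instance Definition _ := Measure_isSigmaFinite.Build _ _ _ leb2 leb2_sigma_finite.

Definition leb3m : set (RR * RR * RR) -> \bar R := (leb2 \x lam)%E.
HB.instance Definition _ := Measure.on leb3m.

Lemma leb3m_sigma_finite : sigma_finite setT leb3m.
Proof.
have m n : measurable (`[- n%:R, n%:R] : set RR) by exact: measurable_itv.
have m2 n : measurable (cube2 n) by exact: measurableX.
exists (fun n => cube2 n `*` `[- n%:R, n%:R]).
  apply/seteqP; split => // -[[x y] z] _.
  have [k [hx [hy hz]]] : exists k : nat, `|x| <= k%:R /\ `|y| <= k%:R /\ `|z| <= k%:R.
    exists (maxn (maxn (Num.truncn `|x|).+1 (Num.truncn `|y|).+1) (Num.truncn `|z|).+1).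
    split; last split; apply: ltW; apply: lt_le_trans (truncnS_gt _) _; rewrite ler_nat !leq_max leqnn ?orbT//.
  by exists k => //; split; [split|]; rewrite /= in_itv/= -ler_norml.
move=> n; split; first exact: measurableX.
rewrite /leb3m/= product_measure1E//= /leb2 product_measure1E//= !lebesgue_measure_itv/= !lte_fin.
by case: ifPn => _; rewrite ?mule0 ?ltry // -!EFinB -!EFinM ltry.
Qed.

HB.instance Definition _ := Measure_isSigmaFinite.Build _ _ _ leb3m leb3m_sigma_finite.

End sf.

Section translation.
Context {R : realType}.
Local Notation D := (@half_space R).
Local Notation mu := (@leb3 R).
Local Notation lam := (@lebesgue_measure R).
Local Notation RR := (measurableTypeR R).

Section lebesgue_shift.
Variable v : R.

Lemma measurable_addv : measurable_fun [set: RR] ((fun x => x + v) : RR -> RR).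
Proof. by apply: measurable_funD => //; exact: measurable_cst. Qed.

Lemma measurable_preimage_addv (A : set RR) : measurable A ->
  measurable ((fun x : RR => (x + v : RR)) @^-1` A).
Proof. by move=> mA; rewrite -[X in measurable X]setTI; exact: measurable_addv. Qed.

(** The image of Lebesgue measure under the translation by v. *)
Definition lebesgue_shift (A : set RR) : \bar R :=
  lam ((fun x : RR => (x + v : RR)) @^-1` A).

Let shift0 : lebesgue_shift set0 = 0%E.
Proof. by rewrite /lebesgue_shift preimage_set0 measure0. Qed.

Let shift_ge0 A : (0 <= lebesgue_shift A)%E.
Proof. exact: measure_ge0. Qed.

Let shift_sigma_additive : semi_sigma_additive lebesgue_shift.
Proof.
move=> F mF tF mUF; rewrite /lebesgue_shift preimage_bigcup.
apply: measure_semi_sigma_additive.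
- by move=> n; exact: measurable_preimage_addv.
- apply/trivIsetP => /= i j _ _ ij; rewrite -preimage_setI.
  by move/trivIsetP : tF => /(_ _ _ _ _ ij) ->//; rewrite preimage_set0.
- by rewrite -preimage_bigcup; exact: measurable_preimage_addv.
Qed.

HB.instance Definition _ := isMeasure.Build _ _ _ lebesgue_shift
  shift0 shift_ge0 shift_sigma_additive.

(** The two measures agree on intervals, which determine them. *)
Lemma lebesgue_shiftE (A : set RR) : measurable A -> lebesgue_shift A = lam A.
Proof.
move=> mA; apply/esym/lebesgue_measure_unique => //= _ [[a b]] _ <-.
rewrite /lebesgue_shift /= (_ : _ @^-1` _ = [set` `]a - v, b - v]]); last first.
  by apply/seteqP; split => x /=; rewrite !in_itv/= ltrBlDr lerBrDr.
rewrite !lebesgue_measure_itv/= !lte_fin ltrD2r; case: ifPn => // _.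
by rewrite -!EFinB; congr EFin; ring.
Qed.

Lemma integral_shift1 (F : RR -> \bar R) : measurable_fun setT F ->
  (forall x, 0 <= F x)%E -> (\int[lam]_x F (x + v)%R = \int[lam]_x F x)%E.
Proof.
move=> mF F0.
have -> : (\int[lam]_x F x = \int[lebesgue_shift]_x F x)%E.
  by apply: eq_measure_integral => A mA _; apply/esym/lebesgue_shiftE.
have := @ge0_integral_pushforward _ _ RR RR R _ measurable_addv lam setT F
  measurableT mF (fun x _ => F0 x).
by move=> h; apply: esym; exact: h.
Qed.

End lebesgue_shift.

Lemma int_invariant1 (v : R) : int_invariant lam (fun x : RR => (x + v : RR)).
Proof.
by split; [exact: measurable_addv|move=> F mF F0; exact: integral_shift1].
Qed.

Lemma int_invariant3 (v : R3 R) :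
  int_invariant (@leb3m R) (fun x : RR * RR * RR => (x + v : RR * RR * RR)).
Proof.
have h2 := int_invariant_prod (int_invariant1 v.1.1) (int_invariant1 v.1.2).
have h3 := @int_invariant_prod R _ _ _ _ (@leb2 R) lam _ _ h2 (int_invariant1 v.2).
move: h3.
rewrite (_ : (fun x => _) = (fun x : RR * RR * RR => (x + v : RR * RR * RR)))//.
Qed.

Lemma measurable_half_spaceE : measurable (D : set (RR * RR * RR)).
Proof. exact: (@measurable_half_space R). Qed.

Lemma integral_shiftD (v : R3 R) (F : RR * RR * RR -> \bar R) : 0 <= v.2 ->
  measurable_fun (D : set (RR * RR * RR)) F -> (forall x, D x -> 0 <= F x)%E ->
  (\int[leb3m]_(x in D) F (x + v)%R = \int[leb3m]_(x in [set x | (v.2 < x.2)%R]) F x)%E.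
Proof.
move=> v0 mF F0.
pose G x := if (v.2 < x.2)%R then F x else 0%E.
have mS : measurable ([set x | (v.2 < x.2)%R] : set (RR * RR * RR)).
  rewrite (_ : [set _ | _] = setT `&` snd @^-1` `]v.2, +oo[); last first.
    by rewrite setTI; apply/seteqP; split => x /=; rewrite in_itv/= andbT.
  exact: measurable_snd.
have SD : [set x : R3 R | (v.2 < x.2)%R] `<=` D by move=> x /=; exact: le_lt_trans.
have GE : G = F \_ [set x | (v.2 < x.2)%R].
  by apply/funext => x; rewrite /G patchE; case: ifPn => h; [rewrite mem_set|rewrite memNset//; exact/negP].
rewrite [RHS]integral_mkcond -GE; have [_ <-] := int_invariant3 v.
- rewrite [LHS]integral_mkcond; congr integral; apply/funext => x.
  rewrite patchE /G /=; case: ifPn => [/set_mem /= h|h].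
    by rewrite ltrDr h.
  case: ifPn => // h'; case/negP: h; apply/mem_set; by rewrite /half_space/= -(ltrDr v.2).
- rewrite GE; apply/(measurable_restrictT _ mS); exact: (measurable_funS (E := D) (@measurable_half_space R) SD mF).
- move=> x; rewrite /G; case: ifPn => // h; apply: F0; exact: SD.
Qed.

End translation.
#[global] Hint Resolve measurable_half_spaceE : core.

(** * Shifts of square integrable functions *)

Section shifts.
Context {R : realType}.
Implicit Types f g h psi : R3 R -> R.
Local Notation D := (@half_space R).
Local Notation mu := (@leb3 R).
Local Notation RR := (measurableTypeR R).

Definition sh (v : R3 R) f : R3 R -> R := fun x => f (x + v).

Lemma half_spaceD (v x : R3 R) : 0 <= v.2 -> D x -> D (x + v).
Proof. by rewrite /half_space/= => v0 x0; rewrite ltr_pwDl. Qed.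

Lemma measurable_sh v f : 0 <= v.2 -> measurable_fun D f -> measurable_fun D (sh v f).
Proof.
move=> v0 mf; have [ms _] := int_invariant3 v.
apply: (@measurable_comp _ _ _ (RR * RR * RR)%type (RR * RR * RR)%type RR D f D (fun x : RR * RR * RR => (x + v : RR * RR * RR))) => //.
- by move=> _ [x Dx <-]; exact: half_spaceD.
- exact: measurable_funTS.
Qed.

Lemma sqnorm_sh v f : 0 <= v.2 -> measurable_fun D f -> (sqnorm (sh v f) <= sqnorm f)%E.
Proof.
move=> v0 mf; rewrite /sqnorm /sh.
have mf2 : measurable_fun (D : set (RR * RR * RR)) (fun x => ((f x) ^+ 2)%:E : \bar R).
  by apply/measurable_EFinP; exact: measurable_funX.
have f0 x : D x -> (0 <= ((f x) ^+ 2)%:E)%E by rewrite lee_fin sqr_ge0.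
have := integral_shiftD v0 mf2 f0; rewrite /leb3m => ->.
apply: ge0_subset_integral => //.
- rewrite (_ : [set _ | _] = setT `&` snd @^-1` `]v.2, +oo[); last first.
    by rewrite setTI; apply/seteqP; split => x /=; rewrite in_itv/= andbT.
  exact: measurable_snd.
- by move=> x /=; exact: le_lt_trans.
Qed.

Lemma L2_sh v f : 0 <= v.2 -> is_L2 f -> is_L2 (sh v f).
Proof.
move=> v0 [mf nf]; split; first exact: measurable_sh.
exact: le_lt_trans (sqnorm_sh v0 mf) nf.
Qed.

Lemma nrm_sh v f : 0 <= v.2 -> is_L2 f -> nrm (sh v f) <= nrm f.
Proof.
move=> v0 Lf; rewrite /nrm ler_sqrt ?ip_ge0// -lee_fin -!sqnormE//; last exact: L2_sh.
by apply: sqnorm_sh => //; case: Lf.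
Qed.

(** The translation maps the half-space into itself and misses only a layer at the boundary,
    where F vanishes. *)
Lemma intO_shift v (F : R3 R -> R) : 0 <= v.2 -> mu.-integrable D (EFin \o F) ->
  (forall x, D x -> x.2 <= v.2 -> F x = 0) -> intO (fun x => F (x + v)) = intO F.
Proof.
move=> v0 /integrableP[mF _] F0.
have mS : measurable ([set x | (v.2 < x.2)%R] : set (RR * RR * RR)).
  rewrite (_ : [set _ | _] = setT `&` snd @^-1` `]v.2, +oo[); last first.
    by rewrite setTI; apply/seteqP; split => x /=; rewrite in_itv/= andbT.
  exact: measurable_snd.
have SD : [set x : R3 R | (v.2 < x.2)%R] `<=` D by move=> x /=; exact: le_lt_trans.
have key (G : RR * RR * RR -> \bar R) : measurable_fun (D : set (RR * RR * RR)) G ->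
    (forall x, 0 <= G x)%E -> (forall x, D x -> x.2 <= v.2 -> G x = 0%E) ->
    (\int[mu]_(x in D) G (x + v)%R = \int[mu]_(x in D) G x)%E.
  move=> mG G0 Gv; have := integral_shiftD v0 mG (fun x _ => G0 x); rewrite /leb3m => ->.
  rewrite integral_mkcond [RHS]integral_mkcond; congr integral; apply/funext => x.
  rewrite !patchE; case: ifPn => [/set_mem xS|xS]; first by rewrite mem_set//; exact: SD.
  case: ifPn => // /set_mem Dx; rewrite Gv// leNgt; apply: contra xS => ?; exact: mem_set.
rewrite /intO /Rintegral; congr fine; rewrite integralE [RHS]integralE; congr (_ - _)%E.
- transitivity (\int[mu]_(x in D) ((EFin \o F)^\+) (x + v)%R)%E.
    by apply: eq_integral => x _; rewrite !funeposE.
  apply: (key ((EFin \o F)^\+)%E) => //.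
  + by apply: measurable_funepos; exact: mF.
  + by move=> x Dx xv; rewrite funeposE /= F0// maxxx.
- transitivity (\int[mu]_(x in D) ((EFin \o F)^\-) (x + v)%R)%E.
    by apply: eq_integral => x _; rewrite !funenegE.
  apply: (key ((EFin \o F)^\-)%E) => //.
  + by apply: measurable_funeneg; exact: mF.
  + by move=> x Dx xv; rewrite funenegE /comp F0// oppe0 maxxx.
Qed.

(** ** Test functions are square integrable *)

Definition cube3 (n : nat) : set (RR * RR * RR) := cube2 n `*` `[- n%:R, n%:R].

Lemma measurable_cube3 n : measurable (cube3 n).
Proof. by do 2 ?apply: measurableX; exact: measurable_itv. Qed.

Lemma leb3_cube3 n : mu (cube3 n) = ((2 * n%:R) ^+ 3)%:E.
Proof.
pose I : set RR := [set` `[- n%:R, n%:R]].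
have m1 : measurable I by exact: measurable_itv.
have m2 : measurable (cube2 n : set (RR * RR)) by exact: measurableX.
have -> : mu (cube3 n) = (leb2 (cube2 n) * lebesgue_measure I)%E.
  exact: (@product_measure1E _ _ _ _ R (@leb2 R) (@lebesgue_measure R) _ _ m2 m1).
have -> : leb2 (cube2 n) = (lebesgue_measure I * lebesgue_measure I)%E.
  exact: product_measure1E.
rewrite /I !lebesgue_measure_itv/= !lte_fin.
case: ifPn => h.
  by rewrite -!EFinB -!EFinM; congr EFin; ring.
suff -> : n%:R = 0 :> R by rewrite !mule0 mulr0 expr0n.
apply/eqP; rewrite eq_le ler0n andbT; move: h; rewrite -leNgt; have := ler0n R n; lra.
Qed.

Lemma L2_box (f : R3 R -> R) (C : R) (n : nat) : measurable_fun D f ->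
  (forall x, D x -> `|f x| <= C) ->
  (forall x, ~ cube3 n x -> f x = 0) ->
  is_L2 f /\ nrm f ^+ 2 <= C ^+ 2 * (2 * n%:R) ^+ 3.
Proof.
move=> mf fC f0.
have h : (sqnorm f <= (C ^+ 2 * (2 * n%:R) ^+ 3)%:E)%E.
  apply: (@le_trans _ _ (\int[mu]_(x in D) (C ^+ 2 * \1_(cube3 n) x)%:E)%E).
    apply: ge0_le_integral; first exact: measurable_half_spaceE.
    - by move=> x _; rewrite lee_fin sqr_ge0.
    - by apply/measurable_EFinP; exact: measurable_funX.
    - apply/measurable_EFinP; apply: measurable_funM; first exact: measurable_cst.
      by apply: measurable_indic; exact: measurable_cube3.
    - move=> x Dx; rewrite lee_fin indicE; have [hx|hx] := boolP (x \in cube3 n).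
      + rewrite mulr1 -(real_normK (num_real (f x))); have := fC _ Dx; have := normr_ge0 (f x); nra.
      + by rewrite mulr0 f0 ?expr0n//= => h; case/negP: hx; exact: mem_set.
  under eq_integral do rewrite EFinM.
  rewrite ge0_integralZl//; [|by apply/measurable_EFinP; apply: measurable_indic; exact: measurable_cube3|by rewrite lee_fin sqr_ge0].
  rewrite integral_indic//; last exact: measurable_cube3.
  rewrite [leRHS]EFinM; apply: lee_pmul; [by rewrite lee_fin sqr_ge0|exact: measure_ge0|exact: lexx|].
  rewrite -leb3_cube3.
  apply: le_measure; rewrite ?inE; [|exact: measurable_cube3|exact: subIsetl].
  by apply: measurableI; [exact: measurable_cube3|].
have Lf : is_L2 f by split => //; apply: le_lt_trans h _; exact: ltry.
by split => //; rewrite nrm2 -lee_fin -sqnormE.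
Qed.

Lemma test1_bounded (P : pred R) (a : R -> R) : test1 P a -> exists2 C, 0 <= C & forall x, `|a x| <= C.
Proof.
move=> [sa [p [q [_ _ a0]]]].
have ca : {within `[p, q], continuous (fun x => `|a x|)}.
  apply: continuous_subspaceT => x; apply: cvg_norm; exact: sm1_continuous.
have [pq|qp] := leP p q; last first.
  exists 0 => // x; rewrite a0 ?normr0//; apply/negP => /andP[h1 h2].
  by have := le_trans h1 h2; rewrite leNgt qp.
have [c _ h] := EVT_max pq ca; exists `|a c| => // x.
have [xpq|/a0 ->] := boolP (p <= x <= q); last by rewrite normr0.
by apply: h; rewrite in_itv.
Qed.

Lemma test1_lip (P : pred R) (a : R -> R) : test1 P a -> exists2 C, 0 <= C & forall x y, `|a x - a y| <= C * `|x - y|.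
Proof.
move=> ta; have [C C0 HC] := test1_bounded (test1_derive ta); exists C => //.
have [sa _] := ta.
have key x y : x < y -> `|a x - a y| <= C * `|x - y|.
  move=> xy; have [||c _ h] := @MVT R a (derive1 a) x y xy.
  - by move=> z _; exact: sm1_is_derive.
  - by apply: continuous_subspaceT => z; exact: sm1_continuous.
  by rewrite distrC h normrM (distrC x) ler_wpM2r.
move=> x y; have [/key//|yx|->] := ltgtP x y; last by rewrite !subrr normr0 mulr0.
by rewrite distrC (distrC x); exact: key.
Qed.

Lemma measurable_tens a b c : sm1 a -> sm1 b -> sm1 c -> measurable_fun D (tens a b c).
Proof.
have H (s : R -> R) : sm1 s -> measurable_fun [set: RR] s.
  by move=> ss; apply: continuous_measurable_fun; exact: sm1_continuous.
move=> /H ma /H mb /H mc; apply: (@measurable_funTS _ _ (RR * RR * RR)%type RR).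
apply: measurable_funM; first apply: measurable_funM.
- apply: (measurableT_comp ma); apply: measurableT_comp; [exact: measurable_fst|exact: measurable_fst].
- apply: (measurableT_comp mb); apply: measurableT_comp; [exact: measurable_snd|exact: measurable_fst].
- apply: (measurableT_comp mc); exact: measurable_snd.
Qed.

Lemma test1_cube (P : pred R) (a : R -> R) : test1 P a -> exists n : nat, forall x, ~~ (- n%:R <= x <= n%:R) -> a x = 0.
Proof.
move=> [_ [p [q [_ _ a0]]]].
exists (maxn (Num.truncn `|p|).+1 (Num.truncn `|q|).+1) => x; apply: contraNeq => ax.
have /andP[px xq] : p <= x <= q by apply: contraNT ax => /a0 ->.
have : `|p| <= (maxn (Num.truncn `|p|).+1 (Num.truncn `|q|).+1)%:R.
  by apply: ltW; apply: lt_le_trans (truncnS_gt _) _; rewrite ler_nat leq_maxl.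
have : `|q| <= (maxn (Num.truncn `|p|).+1 (Num.truncn `|q|).+1)%:R.
  by apply: ltW; apply: lt_le_trans (truncnS_gt _) _; rewrite ler_nat leq_maxr.
by rewrite !ler_norml => /andP[_ ?] /andP[? _]; apply/andP; split; lra.
Qed.

Lemma tst_cube psi : tst psi -> exists n, forall x, ~ cube3 n x -> psi x = 0.
Proof.
move=> [a [b [c [ta tb tc ->]]]].
have [n1 a0] := test1_cube ta; have [n2 b0] := test1_cube tb; have [n3 c0] := test1_cube tc.
pose n := maxn (maxn n1 n2) n3.
have H m (y : R) : (m <= n)%N -> - m%:R <= y <= m%:R -> - n%:R <= y <= n%:R.
  rewrite -(ler_nat R) => mn /andP[? ?]; apply/andP; split; lra.
exists n => -[[x y] z] h; rewrite /tens/=.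
have [h1|/a0 ->] := boolP (- n1%:R <= x <= n1%:R); last by rewrite !mul0r.
have [h2|/b0 ->] := boolP (- n2%:R <= y <= n2%:R); last by rewrite mulr0 mul0r.
have [h3|/c0 ->] := boolP (- n3%:R <= z <= n3%:R); last by rewrite mulr0.
case: h; split; [split|]; rewrite /= in_itv/=; apply: H; try eassumption; rewrite /n !leq_max leqnn ?orbT//.
Qed.

Lemma tst_bounded psi : tst psi -> exists2 C, 0 <= C & forall x, `|psi x| <= C.
Proof.
move=> [a [b [c [/test1_bounded[Ca Ca0 ha] /test1_bounded[Cb Cb0 hb] /test1_bounded[Cc Cc0 hc] ->]]]].
exists (Ca * Cb * Cc) => [|x]; first by rewrite !mulr_ge0.
by rewrite /tens !normrM !ler_pM// mulr_ge0.
Qed.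

Lemma tst_measurable psi : tst psi -> measurable_fun D psi.
Proof. by move=> [a [b [c [[sa _] [sb _] [sc _] ->]]]]; exact: measurable_tens. Qed.

Lemma tst_L2 psi : tst psi -> is_L2 psi.
Proof.
move=> tp; have [n pn] := tst_cube tp; have [C _ pC] := tst_bounded tp.
by have [] := @L2_box psi C n (tst_measurable tp) (fun x _ => pC x) pn.
Qed.

Lemma test1_shift (P : pred R) (a : R -> R) (v : R) : test1 P a -> 
  (forall x, P x -> P (x + v)) -> test1 P (fun x => a (x - v)).
Proof.
move=> [sa [p [q [Pp Pq a0]]]] PD; split.
  rewrite (_ : (fun x => _) = (fun x => a (1 * x + - v))); first exact: sm1_comp_affine.
  by apply/funext => x; rewrite mul1r.
exists (p + v), (q + v); split; [exact: PD|exact: PD|].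
by move=> x h; apply: a0; rewrite lerBrDr lerBlDr.
Qed.

Lemma tst_shift psi v : 0 <= v.2 -> tst psi -> tst (sh (- v) psi).
Proof.
move=> v0 [a [b [c [ta tb tc ->]]]].
exists (fun x => a (x - v.1.1)), (fun x => b (x - v.1.2)), (fun x => c (x - v.2)).
split=> //; [exact: test1_shift|exact: test1_shift|].
by apply: test1_shift => // x /= x0; rewrite ltr_pwDl.
Qed.

Lemma tst_out psi x : tst psi -> x.2 <= 0 -> psi x = 0.
Proof.
move=> [a [b [c [_ _ [_ [p [q [p0 _ c0]]]] ->]]]] x0; rewrite /tens c0 ?mulr0//.
by rewrite negb_and -ltNge (le_lt_trans x0).
Qed.

Lemma ip_sh_test v f psi : 0 <= v.2 -> is_L2 f -> tst psi ->
  ip (sh v f) psi = ip f (sh (- v) psi).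
Proof.
move=> v0 Lf tp; rewrite /ip -[RHS](intO_shift v0).
- by apply: eq_Rintegral => x _; rewrite /sh addrK.
- by apply: L2_mul => //; apply: tst_L2; exact: tst_shift.
- by move=> x _ xv; rewrite /sh (tst_out tp) ?mulr0//= subr_le0.
Qed.

End shifts.

(** * Density of the span of tensor test functions *)

Section density.
Context {R : realType}.
Implicit Types f g h psi : R3 R -> R.
Local Notation D := (@half_space R).
Local Notation mu := (@leb3 R).
Local Notation RR := (measurableTypeR R).
Local Notation E3 := (RR * RR * RR)%type.

Lemma nrm_dct (F : nat -> R3 R -> R) f g : (forall n, measurable_fun D (F n)) ->
  measurable_fun D f -> is_L2 g ->
  (forall n x, D x -> `|f x - F n x| <= `|g x|) ->
  (forall x, D x -> F n x @[n --> \oo] --> f x) ->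
  forall e, 0 < e -> exists n, nrm (f \- F n) <= e.
Proof.
move=> mF mf Lg Fg cF e e0.
have LF n : is_L2 (f \- F n).
  by apply: (@L2_le _ _ g); [exact: measurable_funB mf (mF n)|exact: Lg|exact: Fg].
pose G n x := (((f x - F n x) ^+ 2)%:E : \bar R).
have mG n : measurable_fun (D : set E3) (G n).
  by apply/measurable_EFinP; apply: measurable_funX; exact: measurable_funB mf (mF n).
have ig : mu.-integrable D (fun x => ((g x) ^+ 2)%:E).
  apply: eq_integrable (is_L2_integrable Lg); first exact: measurable_half_spaceE.
  by move=> x _ /=; rewrite expr2.
have cG x : D x -> G n x @[n --> \oo] --> 0%E.
  move=> Dx; apply: cvg_EFin; first exact: nearW.
  rewrite (_ : 0 = (f x - f x) ^+ 2); last by rewrite subrr expr0n.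
  rewrite /comp/=; under eq_fun do rewrite expr2.
  rewrite expr2; apply: cvgM; apply: cvgB; [exact: cvg_cst|exact: cF|exact: cvg_cst|exact: cF].
have h := @dominated_cvg _ E3 R mu D measurable_half_spaceE G (fun=> 0%E)
   (fun x => ((g x) ^+ 2)%:E) mG cG (fun _ _ => isT) ig _.
have {}h : (fun n => ip (f \- F n) (f \- F n)) @ \oo --> (0 : R).
  have : (\int[mu]_(x in D) G n x)%E @[n --> \oo] --> 0%E.
    rewrite -(integral0 mu D); apply: h => n x Dx.
    by rewrite /G /= lee_fin normrX -(real_normK (num_real (g x))) lerXn2r ?nnegrE// Fg.
  move=> /fine_cvg; apply: cvg_trans; apply: near_eq_cvg; apply: nearW => n.
  by rewrite /ip /intO /Rintegral; congr fine; apply: eq_integral => x _; rewrite /G expr2.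
have : 0 < e ^+ 2 by rewrite exprn_gt0.
move/cvgr0Pnorm_le : h => /[apply] -[n _ /(_ n (leqnn n))]/=.
rewrite ger0_norm ?ip_ge0// -nrm2 ler_pXn2r ?nnegrE ?nrm_ge0 ?(ltW e0)// => h.
by exists n.
Qed.

Lemma indic_setCI (T : Type) (A W : set T) x :
  \1_W x + -1 * \1_(A `&` W) x = \1_(~` A `&` W) x :> R.
Proof.
rewrite !indicE !in_setI in_setC.
by case: (x \in W); case: (x \in A); rewrite /= ?mulr0 ?mulr1 ?addr0 ?subrr.
Qed.

Lemma indic_setUI (T : Type) (A B W : set T) x : A `&` B = set0 ->
  \1_(A `&` W) x + 1 * \1_(B `&` W) x = \1_((A `|` B) `&` W) x :> R.
Proof.
move=> AB; rewrite !indicE !in_setI in_setU.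
have [xA|xA] := boolP (x \in A); have [xB|xB] := boolP (x \in B);
  case: (x \in W); rewrite /= ?mulr0 ?mulr1 ?addr0 ?add0r//.
by have : set0 x; [rewrite -AB; split; exact: set_mem|].
Qed.

Section closed_class.
Variable P : (R3 R -> R) -> Prop.
Hypothesis P_tst : forall psi, tst psi -> P psi.
Hypothesis P_lin : forall c f g, is_L2 f -> is_L2 g -> P f -> P g -> P (f \+ (c \*o g)).
Hypothesis P_lim : forall f, is_L2 f ->
  (forall e, 0 < e -> exists g, [/\ is_L2 g, P g & nrm (f \- g) <= e]) -> P f.

Definition win (W : set E3) : Prop :=
  [/\ measurable W, W `<=` D & exists n, W `<=` cube3 n].

Lemma L2_indic W : win W -> is_L2 (\1_W : E3 -> R).
Proof.
move=> [mW WD [n Wn]]; have [] := @L2_box R (\1_W) 1 n; last by [].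
- by apply: measurable_funTS; exact: measurable_indic.
- by move=> x _; rewrite indicE; case: (x \in W); rewrite ?normr1 ?normr0.
- move=> x xn; rewrite indicE memNset// => Wx; apply: xn; exact: Wn.
Qed.

Lemma win_sub V W : win W -> measurable V -> V `<=` W -> win V.
Proof.
move=> [mW WD [n Wn]] mV VW; split => //; first exact: subset_trans WD.
by exists n; exact: subset_trans Wn.
Qed.

Lemma P_eq f g : is_L2 f -> is_L2 g -> (forall x, D x -> f x = g x) -> P f -> P g.
Proof.
move=> Lf Lg fg Pf; apply: P_lim => // e e0; exists f; split => //.
rewrite (@eq_nrm _ _ (fun=> 0)) ?nrm0 ?ltW// => x Dx /=.
by rewrite fg ?subrr.
Qed.

(** The sets whose indicator has the property form a Dynkin system. *)
Lemma dynkin_indic d (T : measurableType d) (G : set (set T)) (phi : E3 -> T) W :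
  measurable_fun setT phi -> win W -> @measurable _ T = <<s G >> -> setI_closed G ->
  P (\1_W : E3 -> R) -> (forall A, G A -> P (\1_(phi @^-1` A `&` W) : E3 -> R)) ->
  forall A, measurable A -> P (\1_(phi @^-1` A `&` W) : E3 -> R).
Proof.
move=> mphi wW GE GI PW PG A; rewrite GE; move: A.
have mpre A : measurable A -> measurable (phi @^-1` A).
  by move=> mA; rewrite -[X in measurable X]setTI; exact: mphi.
have [mW WD Wn] := wW.
have wA A : measurable A -> win (phi @^-1` A `&` W).
  by move=> mA; apply: (win_sub wW) => //; apply: measurableI => //; exact: mpre.
apply: dynkin_induction => //.
- by rewrite preimage_setT setTI.
- move=> S mS PS.
  apply: (@P_eq (\1_W \+ (-1 \*o \1_(phi @^-1` S `&` W)))).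
  + by apply: L2D; [exact: L2_indic|apply: L2Z; apply: L2_indic; exact: wA].
  + by apply: L2_indic; apply: wA; exact: measurableC.
  + by move=> x _; rewrite preimage_setC -indic_setCI.
  + by apply: P_lin => //; apply: L2_indic => //; exact: wA.
- move=> F mF tF PF.
  pose B n := phi @^-1` (\big[setU/set0]_(k < n) F k) `&` W.
  have mU n : measurable (\big[setU/set0]_(k < n) F k) by apply: bigsetU_measurable => k _.
  have PB n : P (\1_(B n) : E3 -> R).
    elim: n => [|n IH].
      apply: (@P_eq (\1_W \+ (-1 \*o \1_W))).
      + by apply: L2D; [|apply: L2Z]; exact: L2_indic.
      + by apply: L2_indic; exact: wA.
      + by move=> x _; rewrite /B big_ord0 preimage_set0 set0I indic0 /= mulN1r subrr.
      + by apply: P_lin => //; exact: L2_indic.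
    apply: (@P_eq (\1_(B n) \+ (1 \*o \1_(phi @^-1` F n `&` W)))).
    + by apply: L2D; [|apply: L2Z]; apply: L2_indic; exact: wA.
    + by apply: L2_indic; exact: wA.
    + move=> x _; rewrite /B big_ord_recr/= preimage_setU -indic_setUI//.
      rewrite -preimage_setI; apply/seteqP; split => // y [/=].
      rewrite -bigcup_mkord => -[k /= kn Fk] Fn.
      by move/trivIsetP : tF => /(_ k n I I); rewrite neq_ltn kn => /(_ isT)/seteqP[+ _]; apply; split; eassumption.
    + by apply: P_lin => //; apply: L2_indic; exact: wA.
  have mUF : measurable (\bigcup_k F k) by apply: bigcup_measurable => k _; exact: mF.
  apply: P_lim; first by apply: L2_indic; exact: wA.
  move=> e e0.
  have [] := @nrm_dct (fun n => \1_(B n)) (\1_(phi @^-1` (\bigcup_k F k) `&` W)) (\1_W) _ _ _ _ _ e e0.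
  + by move=> n; apply: measurable_funTS; apply: measurable_indic; have [] := wA _ (mU n).
  + by apply: measurable_funTS; apply: measurable_indic; have [] := wA _ mUF.
  + exact: L2_indic.
  + move=> n x _; rewrite !indicE /B !in_setI.
    case: (x \in W); rewrite ?andbF ?andbT ?subrr ?normr0// normr1.
    by do 2 case: (_ \in _); rewrite /= ?subrr ?subr0 ?sub0r ?normrN ?normr1 ?normr0.
  + move=> x _; apply: cvg_near_cst.
    have [xW|xW] := boolP (x \in W); last first.
      by apply: nearW => n; rewrite !indicE /B !in_setI (negbTE xW) !andbF.
    have [[k _ Fk]|h] := pselect ((\bigcup_k F k) (phi x)).
      exists k.+1 => // n /= kn; rewrite !indicE /B !in_setI xW !andbT.
      rewrite !mem_set//; first by exists k.
      by rewrite -bigcup_mkord; exists k.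
    apply: nearW => n; rewrite !indicE /B !in_setI xW !andbT !memNset// => h2; apply: h.
    by move: h2; rewrite /preimage/= -bigcup_mkord => -[k _ Fk]; exists k.
  move=> n hn; exists (\1_(B n)); split => //.
  by apply: L2_indic; exact: wA.
Qed.

Let X1 (A : set RR) : set E3 := (fun x : E3 => x.1.1 : RR) @^-1` A.
Let X2 (A : set RR) : set E3 := (fun x : E3 => x.1.2 : RR) @^-1` A.
Let X3 (A : set RR) : set E3 := (fun x : E3 => x.2 : RR) @^-1` A.

Let mX1 : measurable_fun setT (fun x : E3 => x.1.1 : RR).
Proof. by apply: measurableT_comp; [exact: measurable_fst|exact: measurable_fst]. Qed.
Let mX2 : measurable_fun setT (fun x : E3 => x.1.2 : RR).
Proof. by apply: measurableT_comp; [exact: measurable_snd|exact: measurable_fst]. Qed.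
Let mX3 : measurable_fun setT (fun x : E3 => x.2 : RR).
Proof. exact: measurable_snd. Qed.

Let box (a1 b1 a2 b2 a3 b3 : R) : set E3 :=
  X1 [set` `]a1, b1[] `&` (X2 [set` `]a2, b2[] `&` X3 [set` `]a3, b3[]).

Let measurable_preT d (T : measurableType d) (phi : E3 -> T) (A : set T) :
  measurable_fun setT phi -> measurable A -> measurable (phi @^-1` A).
Proof. by move=> mp mA; rewrite -[X in measurable X]setTI; exact: mp. Qed.

Let win_box a1 b1 a2 b2 a3 b3 : 0 < a3 -> win (box a1 b1 a2 b2 a3 b3).
Proof.
move=> a30; split.
- by do 2 ?apply: measurableI; apply: measurable_preT => //; exact: measurable_itv.
- by move=> x [_ [_]]; rewrite /X3/= in_itv/= => /andP[/(lt_trans a30)].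
pose N (a : R) := (Num.truncn `|a|).+1.
pose n := (N a1 + N b1 + N a2 + N b2 + N a3 + N b3)%N.
have H a b y : (N a <= n)%N -> (N b <= n)%N -> a < y < b -> - n%:R <= y <= n%:R.
  move=> an bn /andP[ay yb].
  have h1 : `|a| <= n%:R.
    by apply: ltW; apply: lt_le_trans (truncnS_gt _) _; rewrite ler_nat.
  have h2 : `|b| <= n%:R.
    by apply: ltW; apply: lt_le_trans (truncnS_gt _) _; rewrite ler_nat.
  by move: h1 h2; rewrite !ler_norml => /andP[? ?] /andP[? ?]; apply/andP; split; lra.
exists n => -[[x y] z] [/= h1 [/= h2 h3]].
move: h1 h2 h3; rewrite /X1 /X2 /X3 /= !in_itv/= => h1 h2 h3.
split; [split|]; rewrite /= in_itv/=.
- by apply: (H a1 b1) => //; rewrite /n; lia.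
- by apply: (H a2 b2) => //; rewrite /n; lia.
- by apply: (H a3 b3) => //; rewrite /n; lia.
Qed.

Let P_box a1 b1 a2 b2 a3 b3 : 0 < a3 -> P (\1_(box a1 b1 a2 b2 a3 b3) : E3 -> R).
Proof.
move=> a30; have wb := win_box a1 b1 a2 b2 b3 a30.
have tc n : tst (tens (cutoff n a1 b1) (cutoff n a2 b2) (cutoff n a3 b3)).
  exists (cutoff n a1 b1), (cutoff n a2 b2), (cutoff n a3 b3); split=> //.
  - split; first exact: cutoff_sm1.
    exists a1, b1; split => // x h; rewrite cutoff_out//.
    by apply: contra h => /andP[? ?]; rewrite !ltW.
  - split; first exact: cutoff_sm1.
    exists a2, b2; split => // x h; rewrite cutoff_out//.
    by apply: contra h => /andP[? ?]; rewrite !ltW.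
  - split; first exact: cutoff_sm1.
    exists a3, (Num.max a3 b3); split => //; first by rewrite /= lt_max a30.
    move=> x h; rewrite cutoff_out//.
    by apply: contra h => /andP[h1 h2]; rewrite (ltW h1) le_max (ltW h2) orbT.
have E x : \1_(box a1 b1 a2 b2 a3 b3) x = (a1 < x.1.1 < b1)%R%:R * (a2 < x.1.2 < b2)%R%:R * (a3 < x.2 < b3)%R%:R :> R.
  rewrite indicE /box !in_setI -!natrM !mulnb -andbA; congr ((nat_of_bool _)%:R).
  by congr [&& _, _ & _]; rewrite /X1 /X2 /X3; apply/idP/idP => [/set_mem|h]; rewrite ?inE /= in_itv.
apply: P_lim; first exact: L2_indic.
move=> e e0.
have [] := @nrm_dct (fun n => tens (cutoff n a1 b1) (cutoff n a2 b2) (cutoff n a3 b3))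
  (\1_(box a1 b1 a2 b2 a3 b3)) (\1_(box a1 b1 a2 b2 a3 b3)) _ _ _ _ _ e e0.
- by move=> n; exact: tst_measurable.
- by have [] := L2_indic wb.
- exact: L2_indic.
- move=> n x _; rewrite E /tens.
  have := cutoff_ge0 n a1 b1 x.1.1; have := cutoff_le1 n a1 b1 x.1.1.
  have := cutoff_ge0 n a2 b2 x.1.2; have := cutoff_le1 n a2 b2 x.1.2.
  have := cutoff_ge0 n a3 b3 x.2; have := cutoff_le1 n a3 b3 x.2.
  have [h1|h1] := boolP (a1 < x.1.1 < b1); last by rewrite (cutoff_out n h1) !mul0r subrr.
  have [h2|h2] := boolP (a2 < x.1.2 < b2); last by rewrite (cutoff_out n h2) !(mulr0, mul0r) subrr.
  have [h3|h3] := boolP (a3 < x.2 < b3); last by rewrite (cutoff_out n h3) !(mulr0, mul0r) subrr.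
  rewrite !mulr1 normr1 => c1 c0 b1' b0 a1' a0.
  set p := _ * _ * _.
  have p1 : p <= 1 by apply: mulr_ile1 => //; [exact: mulr_ge0|exact: mulr_ile1].
  have p0 : 0 <= p by do 2 apply: mulr_ge0 => //.
  by rewrite ger0_norm ?subr_ge0// gerBl.
- by move=> x _; rewrite E; apply: cvgM; [apply: cvgM|]; exact: cutoff_cvg.
move=> n h; eexists; split; [exact: tst_L2 (tc n)|exact: P_tst (tc n)|exact: h].
Qed.

Let rayP (x a b : R) : [set` `]x, +oo[] `&` [set` `]a, b[] = [set` `](Num.max x a), b[].
Proof.
apply/seteqP; split => y /=; rewrite !in_itv/= ?andbT gt_max.
  by move=> [-> /andP[-> ->]].
by move=> /andP[/andP[-> ->] ->].
Qed.

Let rayI : setI_closed (@RGenOInfty.G R).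
Proof.
move=> _ _ [x ->] [y ->]; exists (Num.max x y).
apply/seteqP; split => z /=; rewrite !in_itv/= !andbT gt_max.
  by move=> [-> ->].
by move=> /andP[].
Qed.

Let P1 A1 a1 b1 a2 b2 a3 b3 : 0 < a3 -> measurable A1 ->
  P (\1_(X1 A1 `&` box a1 b1 a2 b2 a3 b3) : E3 -> R).
Proof.
move=> a30; apply: (dynkin_indic mX1 (win_box a1 b1 a2 b2 b3 a30) (RGenOInfty.measurableE R) rayI).
  exact: P_box.
move=> _ [x ->]; rewrite /box setIA -preimage_setI rayP; exact: P_box.
Qed.

Let wbI W a1 b1 a2 b2 a3 b3 : 0 < a3 -> measurable W -> win (W `&` box a1 b1 a2 b2 a3 b3).
Proof.
move=> a30 mW; apply: (win_sub (win_box a1 b1 a2 b2 b3 a30)).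
  by apply: measurableI => //; have [] := win_box a1 b1 a2 b2 b3 a30.
exact: subIsetr.
Qed.

Let P2 A1 A2 a1 b1 a2 b2 a3 b3 : 0 < a3 -> measurable A1 -> measurable A2 ->
  P (\1_(X2 A2 `&` (X1 A1 `&` box a1 b1 a2 b2 a3 b3)) : E3 -> R).
Proof.
move=> a30 mA1; apply: (dynkin_indic mX2 (wbI a1 b1 a2 b2 b3 a30 (measurable_preT mX1 mA1)) (RGenOInfty.measurableE R) rayI).
  exact: P1.
move=> _ [x ->].
rewrite (_ : _ `&` _ = X1 A1 `&` box a1 b1 (Num.max x a2) b2 a3 b3); first exact: P1.
by rewrite /box -rayP /X2 preimage_setI; apply/seteqP; split => y /=; tauto.
Qed.

Let P3 A1 A2 A3 a1 b1 a2 b2 a3 b3 : 0 < a3 -> measurable A1 -> measurable A2 -> measurable A3 ->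
  P (\1_(X3 A3 `&` (X2 A2 `&` (X1 A1 `&` box a1 b1 a2 b2 a3 b3))) : E3 -> R).
Proof.
move=> a30 mA1 mA2; rewrite setIA.
have w : win (X2 A2 `&` (X1 A1 `&` box a1 b1 a2 b2 a3 b3)).
  by rewrite setIA; apply: wbI => //; apply: measurableI; exact: measurable_preT.
move=> mA3; rewrite -setIA; move: A3 mA3.
apply: (dynkin_indic mX3 w (RGenOInfty.measurableE R) rayI).
  exact: P2.
move=> _ [x ->].
rewrite (_ : _ `&` _ = X2 A2 `&` (X1 A1 `&` box a1 b1 a2 b2 (Num.max x a3) b3)).
  by apply: P2 => //; rewrite lt_max a30 orbT.
by rewrite /box -rayP /X3 preimage_setI; apply/seteqP; split => y /=; tauto.
Qed.

Let rectI d1 d2 (T1 : measurableType d1) (T2 : measurableType d2) :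
  setI_closed [set A `*` B | A in @measurable _ T1 & B in @measurable _ T2].
Proof.
move=> _ _ [A mA [B mB <-]] [A' mA' [B' mB' <-]]; rewrite -setXI.
by exists (A `&` A'); [exact: measurableI|exists (B `&` B') => //; exact: measurableI].
Qed.

Let P12 (A12 : set (RR * RR)) A3 a1 b1 a2 b2 a3 b3 : 0 < a3 -> measurable A12 -> measurable A3 ->
  P (\1_(fst @^-1` A12 `&` (X3 A3 `&` box a1 b1 a2 b2 a3 b3)) : E3 -> R).
Proof.
move=> a30 mA12 mA3; move: A12 mA12.
apply: (dynkin_indic (phi := (fst : E3 -> RR * RR)) measurable_fst (wbI a1 b1 a2 b2 b3 a30 (measurable_preT mX3 mA3)) _ (@rectI _ _ RR RR)).
- exact: measurable_prod_measurableType.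
- have := @P3 setT setT A3 a1 b1 a2 b2 a3 b3 a30 measurableT measurableT mA3.
  by rewrite /X2 /X1 !preimage_setT !setTI.
- move=> _ [A1 mA1 [A2 mA2 <-]].
  rewrite (_ : _ `&` _ = X3 A3 `&` (X2 A2 `&` (X1 A1 `&` box a1 b1 a2 b2 a3 b3))); first exact: P3.
  by apply/seteqP; split => y /=; rewrite /X1 /X2 /X3 /=; tauto.
Qed.

Let P123 (A : set E3) a1 b1 a2 b2 a3 b3 : 0 < a3 -> measurable A ->
  P (\1_(A `&` box a1 b1 a2 b2 a3 b3) : E3 -> R).
Proof.
move=> a30 mA; move: A mA.
apply: (dynkin_indic (phi := (id : E3 -> E3)) (@measurable_id _ _ _) (win_box a1 b1 a2 b2 b3 a30) _ (@rectI _ _ (RR * RR)%type RR)).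
- exact: measurable_prod_measurableType.
- exact: P_box.
- move=> _ [A1 mA1 [A2 mA2 <-]].
  rewrite (_ : _ `&` _ = fst @^-1` A1 `&` (X3 A2 `&` box a1 b1 a2 b2 a3 b3)); first exact: P12.
  by apply/seteqP; split => y /=; rewrite /X3 /=; tauto.
Qed.

Import HBNNSimple.

Let W n := box (- n.+1%:R) n.+1%:R (- n.+1%:R) n.+1%:R n.+1%:R^-1 n.+1%:R.
Let wW n : win (W n). Proof. by apply: win_box; rewrite invr_gt0. Qed.

Let P_nnsfun (g : {nnsfun E3 >-> R}) n : P (fun x => g x * \1_(W n) x).
Proof.
have [r [A gE]] : exists (r : seq R) (A : R -> set E3), (forall y, measurable (A y)) /\
    forall x, g x = \sum_(y <- r) y * \1_(A y) x.
  exists (finmap.enum_fset (fset_set (range g))), (fun y => g @^-1` [set y]); split.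
    by move=> y; exact: measurable_funPTI.
  by move=> x; rewrite fimfunE fsbig_finite.
move: gE => [mA gE].
have L y : is_L2 (\1_(A y `&` W n) : E3 -> R).
  by apply: L2_indic; apply: (win_sub (wW n)) => //; apply: measurableI => //; have [] := wW n.
suff [L' H] : is_L2 (fun x => (\sum_(y <- r) y * \1_(A y) x) * \1_(W n) x) /\
    P (fun x => (\sum_(y <- r) y * \1_(A y) x) * \1_(W n) x).
  by rewrite (_ : (fun x => _) = (fun x => (\sum_(y <- r) y * \1_(A y) x) * \1_(W n) x))//; apply/funext => x; rewrite gE.
elim: r {gE} => [|y r [L' IH]].
  have -> : (fun x : E3 => (\sum_(y <- [::]) y * \1_(A y) x) * \1_(W n) x) = (\1_(W n) \+ (-1 \*o \1_(W n))).
    by apply/funext => x; rewrite big_nil mul0r /= mulN1r subrr.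
  split; first by apply: L2D; [|apply: L2Z]; exact: L2_indic.
  by apply: P_lin; [exact: L2_indic|exact: L2_indic|exact: P_box|exact: P_box].
have -> : (fun x : E3 => (\sum_(y <- y :: r) y * \1_(A y) x) * \1_(W n) x) =
   ((fun x : E3 => (\sum_(y <- r) y * \1_(A y) x) * \1_(W n) x) \+ (y \*o \1_(A y `&` W n))).
  apply/funext => x; rewrite big_cons /= mulrDl addrC; congr (_ + _).
  by rewrite indicI /= mulrA.
split; first by apply: L2D => //; exact: L2Z.
by apply: P_lin => //; apply: P123 => //; rewrite invr_gt0.
Qed.

Let P_ge0 f : is_L2 f -> (forall x, D x -> 0 <= f x) -> P f.
Proof.
move=> Lf f0; have [mf _] := Lf.
have mfE : measurable_fun (D : set E3) (EFin \o f) by exact/measurable_EFinP.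
pose g := nnsfun_approx measurable_half_spaceE mfE.
have f0E x : D x -> (0 <= (EFin \o f) x)%E by move=> Dx; rewrite lee_fin f0.
have cg x : D x -> g n x @[n --> \oo] --> f x.
  by move=> Dx; have := cvg_nnsfun_approx measurable_half_spaceE mfE f0E Dx => /fine_cvg.
have gf n x : D x -> g n x <= f x.
  move=> Dx; rewrite -(cvg_lim _ (cg x Dx))//.
  apply: (@nondecreasing_cvgn_le R (fun n => g n x)).
    by move=> a b ab; have /lefP := nd_nnsfun_approx measurable_half_spaceE mfE ab; exact.
  by apply/cvg_ex; exists (f x); exact: cg.
have mF n : measurable_fun (D : set E3) (fun x => g n x * \1_(W n) x).
  apply: measurable_funM; apply: measurable_funTS => //.
  by apply: measurable_indic; have [] := wW n.
have LF n : is_L2 (fun x => g n x * \1_(W n) x).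
  apply: (@L2_le _ _ f); [exact: mF|exact: Lf|move=> x Dx; rewrite indicE normrM].
  rewrite (ger0_norm (f0 _ Dx)) ger0_norm//.
  by case: (x \in W n); rewrite ?normr1 ?normr0 ?mulr1 ?mulr0 ?f0// gf.
apply: P_lim => // e e0.
have [] := @nrm_dct (fun n x => g n x * \1_(W n) x) f f mF mf Lf _ _ e e0.
- move=> n x Dx; rewrite indicE; have := gf n x Dx; have : 0 <= g n x by [].
  have := f0 _ Dx; case: (x \in W n) => a0 a1 a2; rewrite ?mulr1 ?mulr0 ?subr0//.
  by rewrite !ger0_norm ?subr_ge0// gerBl.
- move=> x Dx; rewrite -[X in _ --> X]mulr1; apply: cvgM; first exact: cg.
  apply: cvg_near_cst.
  pose N := ((Num.truncn `|x.1.1|).+1 + (Num.truncn `|x.1.2|).+1 + (Num.truncn `|x.2|).+1 + (Num.truncn `|x.2^-1|).+1)%N.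
  exists N => // n /= Nn.
  have H (y : R) : ((Num.truncn `|y|).+1 <= n)%N -> - n.+1%:R < y < n.+1%:R.
    move=> yn; rewrite -ltr_norml; apply: lt_le_trans (truncnS_gt _) _.
    by rewrite ler_nat (leq_trans yn).
  have /andP[h1 h2] := H x.1.1 ltac:(rewrite /N in Nn; lia).
  have /andP[h3 h4] := H x.1.2 ltac:(rewrite /N in Nn; lia).
  have /andP[h5 h6] := H x.2 ltac:(rewrite /N in Nn; lia).
  have /andP[h7 h8] := H x.2^-1 ltac:(rewrite /N in Nn; lia).
  rewrite indicE mem_set// /W /box /X1 /X2 /X3; split; [|split]; rewrite /= in_itv/= ?h1 ?h2 ?h3 ?h4 ?h6 ?andbT//.
  by rewrite invf_plt ?posrE//.
move=> n hn; exists (fun x => g n x * \1_(W n) x); split => //; exact: P_nnsfun.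
Qed.

(** Cutoffs converge to indicators of intervals, so indicators of boxes have the property; the
    pi-lambda theorem extends it to measurable sets, one coordinate at a time, and simple functions
    approximate the others. *)
Lemma L2_density f : is_L2 f -> P f.
Proof.
move=> Lf; have [mf _] := Lf.
have Lp : is_L2 (fun x => Num.max (f x) 0).
  apply: (@L2_le _ _ f) => //; first by apply: measurable_maxr => //; exact: measurable_cst.
  by move=> x _; case: (leP (f x) 0) => h; rewrite ?normr0.
have Ln : is_L2 (fun x => Num.max (- f x) 0).
  apply: (@L2_le _ _ f) => //; first by apply: measurable_maxr; [exact: measurable_funN|exact: measurable_cst].
  by move=> x _; case: (leP (- f x) 0) => h; rewrite ?normr0 ?normrN.
apply: (@P_eq ((fun x => Num.max (f x) 0) \+ (-1 \*o (fun x => Num.max (- f x) 0)))) => //.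
- by apply: L2D => //; exact: L2Z.
- move=> x _; rewrite /= mulN1r; case: (leP (f x) 0) => h; case: (leP (- f x) 0) => h'; lra.
- by apply: P_lin => //; apply: P_ge0 => // x _; rewrite le_max lexx orbT.
Qed.

End closed_class.

(** By density, g is orthogonal to itself. *)
Lemma L2_test0 g : is_L2 g -> (forall psi, tst psi -> ip g psi = 0) -> nrm g = 0.
Proof.
move=> Lg g0; suff : ip g g = 0 by rewrite /nrm => ->; rewrite sqrtr0.
apply: (@L2_density (fun h => ip g h = 0)) => // [c f h Lf Lh fg hg|f Lf H].
  by rewrite ipDr ?ipZr// ?fg ?hg ?mulr0 ?addr0//; exact: L2Z.
apply/eqP; rewrite -normr_le0; apply/ler_addgt0Pl => e e0; rewrite addr0.
have c0 : 0 < nrm g + 1 by rewrite ltr_pwDr// nrm_ge0.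
have [h [Lh hg hf]] := H (e / (nrm g + 1)) (divr_gt0 e0 c0).
have -> : ip g f = ip g (f \- h) by rewrite ipBr// hg subr0.
apply: le_trans (ip_cs _ _) _ => //; first exact: L2B.
have := nrm_ge0 g => g1.
apply: (@le_trans _ _ ((nrm g + 1) * (e / (nrm g + 1)))).
  apply: ler_pM => //; [exact: nrm_ge0|by rewrite lerDl].
by rewrite mulrCA divff ?mulr1// gt_eqF.
Qed.

Lemma L2_test_eq f g : is_L2 f -> is_L2 g -> (forall psi, tst psi -> ip f psi = ip g psi) ->
  nrm (f \- g) = 0.
Proof.
move=> Lf Lg fg; apply: L2_test0; first exact: L2B.
by move=> psi tp; rewrite ipBl ?fg ?subrr//; exact: tst_L2.
Qed.

End density.

(** * Weak derivatives and difference quotients *)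

Section weak.
Context {R : realType}.
Implicit Types f g psi : R3 R -> R.
Local Notation D := (@half_space R).
Local Notation mu := (@leb3 R).
Local Notation RR := (measurableTypeR R).
Local Notation E3 := (RR * RR * RR)%type.

Inductive tspan : (R3 R -> R) -> Prop :=
| tspan_tst psi : tst psi -> tspan psi
| tspan_lin c f g : tspan f -> tspan g -> tspan (f \+ (c \*o g)).

Lemma tspan_L2 f : tspan f -> is_L2 f.
Proof. by elim=> [psi|c {}f g _ Lf _ Lg]; [exact: tst_L2|apply: L2D => //; exact: L2Z]. Qed.

Lemma tspan_dense f e : is_L2 f -> 0 < e -> exists2 g, tspan g & nrm (f \- g) <= e.
Proof.
move=> Lf; move: e.
apply: (@L2_density R (fun f => forall e, 0 < e -> exists2 g, tspan g & nrm (f \- g) <= e)) => //.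
- move=> psi tp e e0; exists psi; first exact: tspan_tst.
  rewrite (_ : psi \- psi = fun=> 0) ?nrm0 ?ltW//.
  by apply/funext => x /=; rewrite subrr.
- move=> c {Lf}f g Lf Lg fs gs e e0.
  have e2 : 0 < e / 2 by rewrite divr_gt0.
  have c1 : 0 < `|c| + 1 by rewrite ltr_pwDr.
  have [f1 sf1 hf] := fs _ e2; have [g1 sg1 hg] := gs _ (divr_gt0 e2 c1).
  have Lf1 := tspan_L2 sf1; have Lg1 := tspan_L2 sg1.
  exists (f1 \+ (c \*o g1)); first exact: tspan_lin.
  rewrite (_ : _ \- _ = (f \- f1) \+ (c \*o (g \- g1))); last first.
    by apply/funext => x /=; ring.
  apply: (le_trans (nrmD (L2B Lf Lf1) (L2Z c (L2B Lg Lg1)))).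
  rewrite nrmZ; last exact: L2B.
  rewrite (splitr e); apply: lerD => //.
  apply: le_trans (_ : (`|c| + 1) * (e / 2 / (`|c| + 1)) <= _).
    by apply: ler_pM => //; [exact: nrm_ge0|rewrite lerDl].
  by rewrite mulrCA divff ?mulr1// gt_eqF.
- move=> {Lf}f Lf H e e0.
  have e2 : 0 < e / 2 by rewrite divr_gt0.
  have [g [Lg gs hg]] := H _ e2; have [k sk hk] := gs _ e2.
  exists k => //; apply: le_trans (nrm_dist Lf Lg (tspan_L2 sk)) _.
  by rewrite (splitr e); exact: lerD.
Qed.

(** The norm is recovered from inner products with a dense set.  This turns estimates in norm
    into estimates for functions of one real variable. *)
Lemma nrm_le_tspan f C : is_L2 f -> 0 <= C ->
  (forall phi, tspan phi -> `|ip f phi| <= C * nrm phi) -> nrm f <= C.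
Proof.
move=> Lf C0 H; apply/ler_addgt0Pl => e e0.
have [f0|f0] := eqVneq (nrm f) 0; first by rewrite f0 addr_ge0 // ltW.
have nf : 0 < nrm f by rewrite lt_def f0 nrm_ge0.
pose d := e * nrm f / (nrm f + C + 1).
have s0 : 0 < nrm f + C + 1 by rewrite ltr_pwDr // addr_ge0// ltW.
have d0 : 0 < d by rewrite divr_gt0// mulr_gt0.
have [k sk hk] := tspan_dense Lf d0; have Lk := tspan_L2 sk.
have h1 : nrm f ^+ 2 <= nrm f * d + C * (nrm f + d).
  rewrite nrm2; have -> : ip f f = ip f (f \- k) + ip f k by rewrite ipBr// subrK.
  apply: lerD.
    apply: le_trans (ler_norm _) _; apply: le_trans (ip_cs Lf (L2B Lf Lk)) _.
    by rewrite ler_wpM2l// nrm_ge0.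
  apply: le_trans (ler_norm _) _; apply: le_trans (H _ sk) _; rewrite ler_wpM2l//.
  by apply: le_trans (nrm_sub Lk Lf) _; rewrite nrmBC lerD2l.
have h2 : d * (nrm f + C) <= e * nrm f.
  rewrite /d mulrAC ler_pdivrMr// ler_wpM2l ?mulr_ge0 ?(ltW e0) ?(ltW nf)//.
  by rewrite lerDl.
rewrite -(ler_pM2l nf) -expr2.
apply: le_trans h1 _; move: h2; rewrite mulrDr; nra.
Qed.

(** ** Continuity of translations in the mean *)

Lemma evec2_ge0 i (h : R) : 0 <= h -> 0 <= (h *: evec i : R3 R).2.
Proof. by move=> h0; rewrite /= /GRing.scale/= mulr_ge0. Qed.

Lemma tst_lip psi : tst psi -> exists2 C, 0 <= C &
  forall x i (h : R), `|psi (x + h *: evec i) - psi x| <= C * `|h|.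
Proof.
move=> [a [b [c [ta tb tc ->]]]].
have [La La0 la] := test1_lip ta; have [Lb Lb0 lb] := test1_lip tb; have [Lc Lc0 lc] := test1_lip tc.
have [Ca Ca0 ha] := test1_bounded ta; have [Cb Cb0 hb] := test1_bounded tb; have [Cc Cc0 hc] := test1_bounded tc.
exists (La * Cb * Cc + Ca * Lb * Cc + Ca * Cb * Lc).
  by rewrite !addr_ge0// !mulr_ge0.
move=> [[x y] z] i h; rewrite /tens /evec /= /GRing.scale/=.

have key La' Ca' Cb' (u v w : R) : 0 <= Ca' -> 0 <= Cb' -> `|u| <= La' * `|h| -> `|v| <= Ca' -> `|w| <= Cb' ->
    `|u * v * w| <= La' * Ca' * Cb' * `|h|.
  move=> Ca'0 Cb'0 hu hv hw; rewrite !normrM.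
  have -> : La' * Ca' * Cb' * `|h| = (La' * `|h|) * Ca' * Cb' by ring.
  by rewrite !ler_pM ?mulr_ge0.
have P1 := mulr_ge0 (mulr_ge0 La0 Cb0) Cc0.
have P2 := mulr_ge0 (mulr_ge0 Ca0 Lb0) Cc0.
have P3 := mulr_ge0 (mulr_ge0 Ca0 Cb0) Lc0.
have h0 := normr_ge0 h.
case: i => -[|[|[|//]]] ? /=; rewrite !mulr0 !mulr1 !addr0.
- have -> : a (x + h) * b y * c z - a x * b y * c z = (a (x + h) - a x) * b y * c z by ring.
  apply: (le_trans (key La Cb Cc _ _ _ Cb0 Cc0 _ (hb _) (hc _))).
    by have := la (x + h) x; rewrite [x + h]addrC addrK.
  by rewrite ler_wpM2r//; lra.
- have -> : a x * b (y + h) * c z - a x * b y * c z = (b (y + h) - b y) * a x * c z by ring.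
  apply: (le_trans (key Lb Ca Cc _ _ _ Ca0 Cc0 _ (ha _) (hc _))).
    by have := lb (y + h) y; rewrite [y + h]addrC addrK.
  by rewrite ler_wpM2r// [Lb * Ca]mulrC; lra.
- have -> : a x * b y * c (z + h) - a x * b y * c z = (c (z + h) - c z) * a x * b y by ring.
  apply: (le_trans (key Lc Ca Cb _ _ _ Ca0 Cb0 _ (ha _) (hb _))).
    by have := lc (z + h) z; rewrite [z + h]addrC addrK.
  by rewrite ler_wpM2r// -mulrA [Lc * _]mulrC; lra.
Qed.

Lemma sm1_taylor (P : pred R) (a : R -> R) : test1 P a ->
  exists2 C, 0 <= C & forall x h : R, `|a (x + h) - a x - h * derive1 a x| <= C * h ^+ 2.
Proof.
move=> ta; have [C C0 HC] := test1_lip (test1_derive ta); exists C => // x h.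
have [sa _] := ta.
have [h0|h0|->] := ltgtP h 0; last first.
- by rewrite addr0 subrr mul0r subrr normr0 expr0n mulr0.
- have [|||c cx e] := @MVT R a (derive1 a) x (x + h); first by rewrite ltrDl.
  + by move=> z _; exact: sm1_is_derive.
  + by apply: continuous_subspaceT => z; exact: sm1_continuous.
  rewrite e addrAC subrr add0r [_ * h]mulrC -mulrBr normrM.
  move: cx; rewrite in_itv/= => /andP[c1 c2].
  have := HC c x; have : `|c - x| <= `|h| by rewrite !ger0_norm; lra.
  rewrite -(real_normK (num_real h)) expr2; have := normr_ge0 h.
  move=> hh cx' H; rewrite mulrCA; apply: ler_wpM2l => //.
  by apply: le_trans H _; exact: ler_wpM2l.
- have [|||c cx e] := @MVT R a (derive1 a) (x + h) x; first by rewrite gtrDl.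
  + by move=> z _; exact: sm1_is_derive.
  + by apply: continuous_subspaceT => z; exact: sm1_continuous.
  have -> : a (x + h) - a x - h * derive1 a x = h * (derive1 a c - derive1 a x).
    by rewrite -(opprB (a x)) e; ring.
  rewrite normrM.
  move: cx; rewrite in_itv/= => /andP[c1 c2].
  have := HC c x; have : `|c - x| <= `|h| by rewrite !ler0_norm; lra.
  rewrite -(real_normK (num_real h)) expr2; have := normr_ge0 h.
  move=> hh cx' H; rewrite mulrCA; apply: ler_wpM2l => //.
  by apply: le_trans H _; exact: ler_wpM2l.
Qed.

Lemma tst_taylor psi i : tst psi -> exists2 C, 0 <= C &
  forall x (h : R), `|psi (x + h *: evec i) - psi x - h * 'D_(evec i) psi x| <= C * h ^+ 2.
Proof.
move=> [a [b [c [ta tb tc ->]]]].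
have [Ta Ta0 la] := sm1_taylor ta; have [Tb Tb0 lb] := sm1_taylor tb; have [Tc Tc0 lc] := sm1_taylor tc.
have [Ca Ca0 ha] := test1_bounded ta; have [Cb Cb0 hb] := test1_bounded tb; have [Cc Cc0 hc] := test1_bounded tc.
have [sa _] := ta; have [sb _] := tb; have [sc _] := tc.
have key La' Ca' Cb' (u v w : R) : 0 <= Ca' -> 0 <= Cb' -> `|u| <= La' -> `|v| <= Ca' -> `|w| <= Cb' ->
    `|u * v * w| <= La' * Ca' * Cb'.
  by move=> Ca'0 Cb'0 hu hv hw; rewrite !normrM !ler_pM ?mulr_ge0.
have P1 := mulr_ge0 (mulr_ge0 Ta0 Cb0) Cc0.
have P2 := mulr_ge0 (mulr_ge0 Tb0 Ca0) Cc0.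
have P3 := mulr_ge0 (mulr_ge0 Tc0 Ca0) Cb0.
exists (Ta * Cb * Cc + Tb * Ca * Cc + Tc * Ca * Cb); first by rewrite !addr_ge0.
move=> x h; rewrite (derive_tensE i x sa sb sc) /tens_d /tens /evec /=.
have h2 := sqr_ge0 h.
move: x => [[x y] z]; rewrite /GRing.scale/=.
case: i => -[|[|[|//]]] ? /=; rewrite !mulr0 !mulr1 !addr0.
- have -> : a (x + h) * b y * c z - a x * b y * c z - h * (derive1 a x * b y * c z) =
    (a (x + h) - a x - h * derive1 a x) * b y * c z by ring.
  apply: (le_trans (key _ _ _ _ _ _ Cb0 Cc0 (la _ _) (hb _) (hc _))); nra.
- have -> : a x * b (y + h) * c z - a x * b y * c z - h * (a x * derive1 b y * c z) =
    (b (y + h) - b y - h * derive1 b y) * a x * c z by ring.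
  apply: (le_trans (key _ _ _ _ _ _ Ca0 Cc0 (lb _ _) (ha _) (hc _))); nra.
- have -> : a x * b y * c (z + h) - a x * b y * c z - h * (a x * b y * derive1 c z) =
    (c (z + h) - c z - h * derive1 c z) * a x * b y by ring.
  apply: (le_trans (key _ _ _ _ _ _ Ca0 Cb0 (lc _ _) (ha _) (hb _))); nra.
Qed.

Lemma cube3_shift n x i (h : R) : `|h| <= 1 -> ~ cube3 n.+1 x -> ~ cube3 n (x + h *: evec i).
Proof.
rewrite ler_norml => /andP[h1 h2] xn [[/= a b] c]; apply: xn; move: a b c.
rewrite /evec /GRing.scale/= !in_itv/= => /andP[a1 a2] /andP[b1 b2] /andP[c1 c2].
have e : n.+1%:R = n%:R + 1 :> R by rewrite -natr1.
split; [split|]; rewrite /= in_itv/= e; apply/andP; case: i a1 a2 b1 b2 c1 c2 => -[|[|[|//]]] ? /=;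
  rewrite ?mulr0 ?mulr1 ?addr0 => *; split; lra.
Qed.

(** Translations are Lipschitz on tests, which are dense, and do not increase the norm. *)
Lemma sh_cont f i e : is_L2 f -> 0 < e -> exists2 d, 0 < d &
  forall h, 0 <= h <= d -> nrm (sh (h *: evec i) f \- f) <= e.
Proof.
move=> Lf; move: e.
apply: (@L2_density R (fun f => forall e, 0 < e -> exists2 d, 0 < d &
  forall h, 0 <= h <= d -> nrm (sh (h *: evec i) f \- f) <= e)) => //.
- move=> psi tp e e0; have [C C0 HC] := tst_lip tp; have [n pn] := tst_cube tp.
  pose K := (C + 1) * ((2 * n.+1%:R) ^+ 3 + 1).
  have n30 : 0 <= (2 * n.+1%:R : R) ^+ 3 by rewrite exprn_ge0.
  have K0 : 0 < K by rewrite mulr_gt0 // ltr_pwDr.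
  exists (Num.min 1 (e / K)); first by rewrite lt_min ltr01 divr_gt0.
  move=> h /andP[h0]; rewrite le_min => /andP[h1 he].
  have [|x _|x xn|_ H] := @L2_box R (sh (h *: evec i) psi \- psi) (C * h) n.+1.
  + apply: measurable_funB; [apply: measurable_sh; [exact: evec2_ge0|]|]; exact: tst_measurable.
  + by have := HC x i h; rewrite (ger0_norm h0).
  + rewrite /sh/= !pn ?subrr//; last by apply: cube3_shift => //; rewrite ger0_norm.
    move=> xn'; apply: xn; case: xn' => -[/= a b] c; move: a b c; rewrite !in_itv/=.
    have e' : n.+1%:R = n%:R + 1 :> R by rewrite -natr1.
    by move=> /andP[? ?] /andP[? ?] /andP[? ?]; split; [split|]; rewrite /= in_itv/= e'; apply/andP; split; lra.
  + rewrite -(@ler_pXn2r _ 2)// ?nnegrE ?nrm_ge0 ?(ltW e0)//.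
    apply: le_trans H _; move: he; rewrite ler_pdivlMr// => he.
    have hK : 0 <= h * K := mulr_ge0 h0 (ltW K0).
    have : (h * K) ^+ 2 <= e ^+ 2 by rewrite ler_pXn2r ?nnegrE ?(ltW e0).
    apply: le_trans; rewrite /K; set m := (2 * _) ^+ 3; have m0 : 0 <= m by [].
    have -> : (C * h) ^+ 2 * m = h ^+ 2 * (C ^+ 2 * m) by ring.
    rewrite [X in _ <= X]exprMn; apply: ler_wpM2l; first exact: sqr_ge0.
    by rewrite exprMn; apply: ler_pM; rewrite ?sqr_ge0//; nra.
- move=> c {Lf}f g Lf Lg fs gs e e0.
  have e2 : 0 < e / 2 by rewrite divr_gt0.
  have c1 : 0 < `|c| + 1 by rewrite ltr_pwDr.
  have [d1 d10 H1] := fs _ e2; have [d2 d20 H2] := gs _ (divr_gt0 e2 c1).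
  exists (Num.min d1 d2); first by rewrite lt_min d10.
  move=> h /andP[h0]; rewrite le_min => /andP[h1 h2].
  have v0 := @evec2_ge0 i h h0.
  rewrite (_ : _ \- _ = (sh (h *: evec i) f \- f) \+ (c \*o (sh (h *: evec i) g \- g))); last first.
    by apply/funext => x; rewrite /sh /=; ring.
  apply: (le_trans (nrmD (L2B (L2_sh v0 Lf) Lf) (L2Z c (L2B (L2_sh v0 Lg) Lg)))).
  rewrite nrmZ; last by apply: L2B => //; exact: L2_sh.
  rewrite (splitr e); apply: lerD; first by apply: H1; rewrite h0.
  apply: le_trans (_ : (`|c| + 1) * (e / 2 / (`|c| + 1)) <= _).
    by apply: ler_pM => //; [exact: nrm_ge0|rewrite lerDl|apply: H2; rewrite h0].
  by rewrite mulrCA divff ?mulr1// gt_eqF.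
- move=> {Lf}f Lf H e e0.
  have e3 : 0 < e / 3 by rewrite divr_gt0.
  have [g [Lg gs hg]] := H _ e3; have [d d0 Hd] := gs _ e3; exists d => // h hd.
  have /andP[h0 _] := hd; have v0 := @evec2_ge0 i h h0.
  apply: (le_trans (nrm_dist (L2_sh v0 Lf) (L2_sh v0 Lg) Lf)).
  have h1 : nrm (sh (h *: evec i) f \- sh (h *: evec i) g) <= e / 3.
    by apply: le_trans hg; exact: (nrm_sh v0 (L2B Lf Lg)).
  have h2 : nrm (sh (h *: evec i) g \- f) <= e / 3 + e / 3.
    apply: (le_trans (nrm_dist (L2_sh v0 Lg) Lg Lf)); apply: lerD; first exact: Hd.
    by rewrite nrmBC.
  by lra.
Qed.

End weak.

Section weak2.
Context {R : realType}.
Implicit Types f g psi : R3 R -> R.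
Local Notation D := (@half_space R).
Local Notation mu := (@leb3 R).
Local Notation RR := (measurableTypeR R).
Local Notation E3 := (RR * RR * RR)%type.

(** ** Weak derivatives *)

(** The boundary is not seen by the tests, which vanish near it. *)
Definition weak1 i a g : Prop := [/\ is_L2 a, is_L2 g &
  forall psi, tst psi -> ip a (fun x => 'D_(evec i) psi x) = - ip g psi].

Lemma derive_sh (w v x : R3 R) psi : 'D_v (sh w psi) x = 'D_v psi (x + w).
Proof.
suff E : (fun h : R => h^-1 *: ((sh w psi \o shift x) (h *: v) - sh w psi x)) =
  (fun h : R => h^-1 *: ((psi \o shift (x + w)) (h *: v) - psi (x + w))).
  by rewrite /derive E.
by apply/funext => h; rewrite /sh /= addrA.
Qed.

Lemma weak1_sh i (w : R3 R) a g : 0 <= w.2 -> weak1 i a g -> weak1 i (sh w a) (sh w g).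
Proof.
move=> w0 [La Lg H]; split; [exact: L2_sh|exact: L2_sh|] => psi tp.
rewrite !ip_sh_test//; last exact: tst_derive.
rewrite -(H _ (tst_shift w0 tp)); congr ip; apply/funext => x.
by rewrite derive_sh /sh.
Qed.

Lemma weak1_lin i c a g a' g' : weak1 i a g -> weak1 i a' g' ->
  weak1 i (a \+ (c \*o a')) (g \+ (c \*o g')).
Proof.
move=> [La Lg H] [La' Lg' H'].
split; [by apply: L2D => //; exact: L2Z|by apply: L2D => //; exact: L2Z|] => psi tp.
have Lp := tst_L2 tp; have LDp := tst_L2 (tst_derive i tp).
rewrite !ipDl ?ipZl ?H ?H'//; try exact: L2Z; ring.
Qed.

Lemma weak1Z i c a g : weak1 i a g -> weak1 i (c \*o a) (c \*o g).
Proof.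
move=> [La Lg H]; split; [exact: L2Z|exact: L2Z|] => psi tp.
have Lp := tst_L2 tp; have LDp := tst_L2 (tst_derive i tp).
by rewrite !ipZl ?H// mulrN.
Qed.

Lemma weak1B i a g a' g' : weak1 i a g -> weak1 i a' g' -> weak1 i (a \- a') (g \- g').
Proof.
move=> w w'; have := weak1_lin (-1) w w'; congr weak1; apply/funext => x /=; ring.
Qed.

Lemma weak1_uniq i a g g' : weak1 i a g -> weak1 i a g' -> nrm (g \- g') = 0.
Proof.
move=> [_ Lg H] [_ Lg' H']; apply: L2_test_eq => // psi tp.
by apply: oppr_inj; rewrite -H// H'.
Qed.

Lemma weak1_ext i a g a' g' : is_L2 a' -> is_L2 g' -> nrm (a \- a') = 0 -> nrm (g \- g') = 0 ->
  weak1 i a g -> weak1 i a' g'.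
Proof.
move=> La' Lg' aa gg [La Lg H]; split => // psi tp.
rewrite -(@ip_ext _ a a') -?(@ip_ext _ g g') ?H//; [exact: tst_L2|].
by apply: tst_L2; exact: tst_derive.
Qed.

(** ** Difference quotients *)

Definition dq i (h : R) f : R3 R -> R := fun x => h^-1 * (f (x + h *: evec i) - f x).

Lemma dqE i h f : dq i h f = h^-1 \*o (sh (h *: evec i) f \- f).
Proof. by []. Qed.

Lemma L2_dq i h f : 0 <= h -> is_L2 f -> is_L2 (dq i h f).
Proof.
by move=> h0 Lf; rewrite dqE; apply: L2Z; apply: L2B => //; apply: L2_sh => //; exact: evec2_ge0.
Qed.

Lemma weak1_dq i j h a g : 0 <= h -> weak1 i a g -> weak1 i (dq j h a) (dq j h g).
Proof.
by move=> h0 w; rewrite !dqE; apply: weak1Z; apply: weak1B => //; apply: weak1_sh => //; exact: evec2_ge0.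
Qed.

Lemma cube3_mono m n : (m <= n)%N -> cube3 m `<=` (cube3 n : set E3).
Proof.
rewrite -(ler_nat R) => mn [[x y] z] [[/= a b] c]; move: a b c; rewrite !in_itv/=.
by move=> /andP[? ?] /andP[? ?] /andP[? ?]; split; [split|]; rewrite /= in_itv/=; apply/andP; split; lra.
Qed.

Lemma quad_test i a psi : is_L2 a -> tst psi -> exists2 C, 0 <= C &
  forall s s' : R, 0 <= s <= 1 -> 0 <= s' <= 1 ->
  `|ip (sh (s' *: evec i) a) psi - ip (sh (s *: evec i) a) psi
    + (s' - s) * ip (sh (s *: evec i) a) (fun x => 'D_(evec i) psi x)| <= C * (s' - s) ^+ 2.
Proof.
move=> La tp.
have [C C0 HC] := tst_taylor i tp; have [n pn] := tst_cube tp.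
have tDp := tst_derive i tp.
have [n' pn'] := tst_cube tDp.
pose N := (maxn n n').+1.
exists (nrm a * (C * ((2 * N%:R) ^+ 3 + 1))).
  by rewrite !mulr_ge0 ?nrm_ge0// addr_ge0 ?exprn_ge0.
move=> s s' /andP[s0 s1] /andP[s0' s1'].
have v0 := @evec2_ge0 _ i _ s0; have v0' := @evec2_ge0 _ i _ s0'.
have tsp := tst_shift v0 tp; have tsp' := tst_shift v0' tp; have tsD := tst_shift v0 tDp.
rewrite !ip_sh_test//.
pose F := (sh (- (s' *: evec i)) psi \- sh (- (s *: evec i)) psi) \+
  ((s' - s) \*o sh (- (s *: evec i)) (fun x => 'D_(evec i) psi x)).
have L1 := tst_L2 tsp; have L2 := tst_L2 tsp'; have L3 := tst_L2 tsD.
have -> : ip a (sh (- (s' *: evec i)) psi) - ip a (sh (- (s *: evec i)) psi)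
  + (s' - s) * ip a (sh (- (s *: evec i)) (fun x => 'D_(evec i) psi x)) = ip a F.
  by rewrite /F (ipDr (L2B L2 L1) (L2Z _ L3) La) (ipBr L2 L1 La) (ipZr _ L3 La).
have FC x : `|F x| <= C * (s' - s) ^+ 2.
  have := HC (x - s *: evec i) (s - s').
  have -> : x - s *: evec i + (s - s') *: evec i = x - s' *: evec i.
    by rewrite scalerBl addrA subrK.
  have -> : (s - s') ^+ 2 = (s' - s) ^+ 2 by ring.
  by rewrite -[(s - s') * _]opprK -mulNr opprB opprK.
have F0 x : ~ cube3 N x -> F x = 0.
  move=> xN; have out (t : R) : 0 <= t <= 1 -> ~ cube3 (maxn n n') (x - t *: evec i).
    move=> /andP[t0 t1]; rewrite -scaleNr; apply: cube3_shift => //.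
    by rewrite normrN ger0_norm.
  rewrite /F /sh /= !pn ?pn' ?mulr0 ?subrr ?addr0//.
  - by move=> /(@cube3_mono n' (maxn n n') (leq_maxr _ _)); apply: out; rewrite s0.
  - by move=> /(@cube3_mono n (maxn n n') (leq_maxl _ _)); apply: out; rewrite s0.
  - by move=> /(@cube3_mono n (maxn n n') (leq_maxl _ _)); apply: out; rewrite s0'.
have mF : measurable_fun D F.
  by case: (L2D (L2B L2 L1) (L2Z (s' - s) L3)).
have [LF HF] := L2_box mF (fun x _ => FC x) F0.
apply: le_trans (ip_cs La LF) _; rewrite -mulrA; apply: ler_wpM2l; first exact: nrm_ge0.
have M0 : 0 <= (2 * N%:R : R) ^+ 3 by rewrite exprn_ge0.
have K0 : 0 <= C * ((2 * N%:R) ^+ 3 + 1) * (s' - s) ^+ 2.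
  apply: mulr_ge0 (sqr_ge0 _); apply: mulr_ge0 => //; exact: addr_ge0.
rewrite -(@ler_pXn2r _ 2)// ?nnegrE ?nrm_ge0//.
apply: le_trans HF _; set M := (2 * _) ^+ 3 in M0 *; set q := (s' - s) ^+ 2.
have -> : (C * q) ^+ 2 * M = (C * q) ^+ 2 * (M * 1) by rewrite mulr1.
have -> : (C * (M + 1) * q) ^+ 2 = (C * q) ^+ 2 * (M + 1) ^+ 2 by ring.
apply: ler_wpM2l; first exact: sqr_ge0.
by nra.
Qed.

Lemma quad_shift i a g phi : weak1 i a g -> tspan phi -> exists2 C, 0 <= C &
  forall s s' : R, 0 <= s <= 1 -> 0 <= s' <= 1 ->
  `|ip (sh (s' *: evec i) a) phi - ip (sh (s *: evec i) a) phi
    - (s' - s) * ip (sh (s *: evec i) g) phi| <= C * (s' - s) ^+ 2.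
Proof.
move=> w; have [La Lg H] := w; elim => {phi} [psi tp|c f g' sf [C1 C10 H1] sg [C2 C20 H2]]; last first.
  have Lf := tspan_L2 sf; have Lg' := tspan_L2 sg.
  exists (C1 + `|c| * C2); first by rewrite addr_ge0// mulr_ge0.
  move=> s s' hs hs'; have /andP[s0 s1] := hs; have /andP[s0' s1'] := hs'.
  have v0 := @evec2_ge0 _ i _ s0; have v0' := @evec2_ge0 _ i _ s0'.
  have L1 := L2_sh v0 La; have L2 := L2_sh v0' La; have L3 := L2_sh v0 Lg.
  have Lc := L2Z c Lg'.
  rewrite !ipDr// !ipZr//.
  have alg (x y z u v t d : R) : (x + c * u) - (y + c * v) - d * (z + c * t) =
    (x - y - d * z) + c * (u - v - d * t) by ring.
  rewrite alg.
  apply: le_trans (ler_normD _ _) _; rewrite [leRHS]mulrDl; apply: lerD; first exact: H1.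
  by rewrite normrM -mulrA ler_wpM2l// H2.
have [C C0 HC] := quad_test i La tp; exists C => // s s' hs hs'.
have := HC s s' hs hs'; have /andP[s0 _] := hs.
have [_ _ ->//] := weak1_sh (@evec2_ge0 _ i _ s0) w.
by rewrite mulrN.
Qed.

(** Inner products of translates with tests have increments that are linear up to quadratic errors,
    and for such functions the mean value inequality is elementary. *)
Section quadratic.
Variables (q r : R -> R) (C : R).
Hypothesis H : forall s s' : R, 0 <= s <= 1 -> 0 <= s' <= 1 ->
  `|q s' - q s - (s' - s) * r s| <= C * (s' - s) ^+ 2.

Lemma quad_mvt (h M : R) : 0 <= h <= 1 -> (forall s, 0 <= s <= h -> `|r s| <= M) ->
  `|q h - q 0| <= M * h.
Proof.
move=> /andP[h0 h1] rM.
have key n : (0 < n)%N -> `|q h - q 0| <= M * h + C * h ^+ 2 / n%:R.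
  move=> n0.
  have step k : (k <= n)%N -> `|q (h * (k%:R / n%:R)) - q 0| <= (M * h / n%:R + C * (h / n%:R) ^+ 2) * k%:R.
    elim: k => [|k IH] kn; first by rewrite mul0r !mulr0 subrr normr0.
    have nn0 : 0 < n%:R :> R by rewrite ltr0n.
    have hk j : (j <= n)%N -> 0 <= h * (j%:R / n%:R) <= h.
      move=> jn; rewrite mulr_ge0 ?divr_ge0//= -[leRHS]mulr1 ler_wpM2l//.
      by rewrite ler_pdivrMr// mul1r ler_nat.
    have hk1 j : (j <= n)%N -> 0 <= h * (j%:R / n%:R) <= 1.
      by move=> /hk /andP[-> /= /le_trans]; apply.
    have := H (hk1 k (ltnW kn)) (hk1 k.+1 kn).
    have -> : h * (k.+1%:R / n%:R) - h * (k%:R / n%:R) = h / n%:R.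
      by rewrite -mulrBr -mulrBl -natr1 addrAC subrr add0r mul1r.
    have := rM _ (hk k (ltnW kn)).
    set x := q _; set y := q _; set z := q 0 in IH *; set w := r _ => hw hxy.
    have {}IH := IH (ltnW kn); rewrite -/y in IH.
    have hn0 : 0 <= h / n%:R by rewrite divr_ge0.
    have : `|h / n%:R * w| <= M * h / n%:R.
      by rewrite normrM (ger0_norm hn0) mulrC -mulrA ler_wpM2r.
    rewrite -natr1 mulrDr mulr1.
    have -> : x - z = (y - z) + (h / n%:R * w) + (x - y - h / n%:R * w) by ring.
    move=> h2; apply: le_trans (ler_normD _ _) _; rewrite [leRHS]addrA; apply: lerD => //.
    by apply: le_trans (ler_normD _ _) _; exact: lerD.
  have := step n (leqnn n); rewrite divff ?pnatr_eq0 -?lt0n// mulr1.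
  have nn0 : n%:R != 0 :> R by rewrite pnatr_eq0 -lt0n.
  by move=> h2; apply: le_trans h2 _; rewrite le_eqVlt; apply/orP; left; apply/eqP; field.
apply/ler_addgt0Pl => e e0.
pose n := (Num.truncn (`|C| * h ^+ 2 / e)).+1.
apply: le_trans (key n isT) _; rewrite addrC lerD2r.
have n0 : 0 < n%:R :> R by rewrite ltr0n.
rewrite ler_pdivrMr// [e * _]mulrC -ler_pdivrMr//.
apply: le_trans (ltW (truncnS_gt _)); rewrite ler_wpM2r ?invr_ge0 ?(ltW e0)//.
by rewrite ler_wpM2r ?sqr_ge0// ler_norm.
Qed.

Lemma quad_is_derive (s : R) : 0 < s < 1 -> is_derive s (1 : R) q (r s).
Proof.
move=> /andP[s0 s1].
have h : k^-1 *: (q (k *: 1 + s) - q s) @[k --> (0:R)^'] --> r s.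
  apply/cvgrPdist_le => e e0.
  near=> k.
  have k0 : k != 0 by near: k; exact: nbhs_dnbhs_neq.
  have hk : `|k| <= Num.min (Num.min s (1 - s)) (e / (`|C| + 1)).
    near: k; apply: dnbhs0_le.
    by rewrite !lt_min s0 subr_gt0 s1 divr_gt0// ltr_pwDr.
  move: hk; rewrite !le_min => /andP[/andP[k1 k2] k3].
  have ks : 0 <= s + k <= 1 by move: k1 k2; rewrite !ler_norml => /andP[? ?] /andP[? ?]; apply/andP; split; lra.
  have := H (s := s) (s' := s + k) ltac:(rewrite !ltW//) ks.
  have -> : s + k - s = k by ring.
  rewrite /GRing.scale/= mulr1 [k + s]addrC => h.
  have kk : 0 < `|k| by rewrite normr_gt0.
  rewrite -(ler_pM2l kk) -normrM mulrBr mulrA divff// mul1r distrC.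
  apply: le_trans h _; rewrite -(real_normK (num_real k)) expr2 mulrCA ler_wpM2l//.
  have C1 : 0 < `|C| + 1 by rewrite ltr_pwDr.
  move: k3; rewrite ler_pdivlMr// => k3; apply: le_trans k3; rewrite mulrC ler_wpM2l//.
  by rewrite (le_trans (ler_norm _))// lerDl.
by apply: DeriveDef; [apply/cvg_ex; exists (r s)|exact/cvg_lim].
Unshelve. all: end_near. Qed.

End quadratic.

Lemma sh0 i f : sh ((0 : R) *: evec i) f = f.
Proof. by apply/funext => x; rewrite /sh scale0r addr0. Qed.

(** For a test phi, the inner product of phi with the translate of a by s is a differentiable
    function of s, whose derivative is the inner product with the translate of g. *)
Lemma weak1_mvt i a g g' (h d : R) : weak1 i a g -> is_L2 g' -> 0 <= h <= 1 ->
  (forall s, 0 <= s <= h -> nrm (sh (s *: evec i) g \- g') <= d) ->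
  nrm (sh (h *: evec i) a \- a \- (h \*o g')) <= h * d.
Proof.
move=> w Lg' hh Hd; have [La Lg _] := w; have /andP[h0 h1] := hh.
have d0 : 0 <= d by apply: le_trans (nrm_ge0 _) (Hd 0 _); rewrite lexx.
have v0 := @evec2_ge0 _ i _ h0.
have Lh := L2_sh v0 La.
apply: nrm_le_tspan; [by apply: L2B; [exact: L2B|exact: L2Z]|exact: mulr_ge0|].
move=> phi sp; have Lp := tspan_L2 sp; have [C C0 HC] := quad_shift w sp.
rewrite (ipBl (L2B Lh La) (L2Z h Lg') Lp) (ipBl Lh La Lp) (ipZl h Lg' Lp).
pose q s := ip (sh (s *: evec i) a) phi - s * ip g' phi.
pose r s := ip (sh (s *: evec i) g) phi - ip g' phi.
have -> : ip (sh (h *: evec i) a) phi - ip a phi - h * ip g' phi = q h - q 0.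
  by rewrite /q sh0 mul0r subr0; ring.
rewrite -mulrA mulrC; apply: (@quad_mvt q r C) => //.
- move=> s s' hs hs'; have := HC s s' hs hs'; rewrite /q /r; move: (ip _ _) (ip _ _) (ip _ _) (ip _ _) => x1 x2 x3 x4.
  by congr (`|_| <= _); ring.
- move=> s hs; rewrite /r; have /andP[s0 s1] := hs.
  have Ls := L2_sh (@evec2_ge0 _ i _ s0) Lg.
  rewrite -ipBl//; apply: le_trans (ip_cs (L2B Ls Lg') Lp) _.
  by rewrite ler_wpM2r ?nrm_ge0// Hd.
Qed.

(** The mean value inequality, compared with the zero function. *)
Lemma nrm_dq_le i h a g : 0 < h <= 1 -> weak1 i a g -> nrm (dq i h a) <= nrm g.
Proof.
move=> /andP[h0 h1] w; have [La Lg _] := w.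
have Ls s : 0 <= s -> is_L2 (sh (s *: evec i) a) by move=> s0; apply: L2_sh => //; exact: evec2_ge0.
have hh : 0 <= h <= 1 by rewrite (ltW h0).
have := @weak1_mvt i a g (fun=> 0) h (nrm g) w L20 hh.
have H : forall s, 0 <= s <= h -> nrm (sh (s *: evec i) g \- (fun=> 0)) <= nrm g.
  move=> s /andP[s0 _]; rewrite (_ : _ \- _ = sh (s *: evec i) g); last first.
    by apply/funext => x /=; rewrite subr0.
  by apply: nrm_sh => //; exact: evec2_ge0.
move=> /(_ H) {}H; rewrite dqE nrmZ; last by apply: L2B => //; exact: Ls (ltW h0).
rewrite (_ : _ \- _ = sh (h *: evec i) a \- a \- h \*o (fun=> 0)); last first.
  by apply/funext => x /=; rewrite mulr0 subr0.
by rewrite normfV (gtr0_norm h0) ler_pdivrMl.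
Qed.

(** The mean value inequality, compared with g, which its translates approach. *)
Lemma dq_cvg i a g e : weak1 i a g -> 0 < e -> exists2 d, 0 < d <= 1 &
  forall h, 0 < h <= d -> nrm (dq i h a \- g) <= e.
Proof.
move=> w e0; have [La Lg _] := w; have [d d0 Hd] := sh_cont i Lg e0.
exists (Num.min 1 d); first by rewrite lt_min ltr01 d0 ge_min lexx.
move=> h /andP[h0]; rewrite le_min => /andP[h1 hd].
have hh : 0 <= h <= 1 by rewrite (ltW h0).
have H : forall s, 0 <= s <= h -> nrm (sh (s *: evec i) g \- g) <= e.
  by move=> s /andP[s0 sh]; apply: Hd; rewrite s0 (le_trans sh).
have := weak1_mvt w Lg hh H.
rewrite (_ : dq i h a \- g = h^-1 \*o (sh (h *: evec i) a \- a \- h \*o g)); last first.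
  by apply/funext => x; rewrite /dq /sh /=; field; rewrite gt_eqF.
rewrite nrmZ; last first.
  apply: L2B; [|exact: L2Z]; apply: L2B => //; apply: L2_sh => //; exact: evec2_ge0 (ltW h0).
by rewrite normfV (gtr0_norm h0) ler_pdivrMl.
Qed.

Let pd (i : 'I_3) (k : nat) (a : R -> R) := if i == k :> nat then derive1 a else a.

Let pd_sm1 (i : 'I_3) (k : nat) a : sm1 a -> sm1 (pd i k a).
Proof. by rewrite /pd; case: ifP => _ sa; [exact: sm1_derive|exact: sa]. Qed.

Let tst_dE i a b c : sm1 a -> sm1 b -> sm1 c ->
  (fun x => 'D_(evec i) (tens a b c) x) = tens (pd i 0 a) (pd i 1 b) (pd i 2 c).
Proof.
move=> sa sb sc; apply/funext => x; rewrite derive_tensE// /tens_d /pd.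
by case: i => -[|[|[|//]]] ?.
Qed.

Let pdC i j k a : pd i k (pd j k a) = pd j k (pd i k a).
Proof. by rewrite /pd; case: ifP => _; case: ifP. Qed.

Lemma tst_derive_swap i j psi : tst psi ->
  (fun x => 'D_(evec j) (fun y => 'D_(evec i) psi y) x) = (fun x => 'D_(evec i) (fun y => 'D_(evec j) psi y) x).
Proof.
move=> [b [c [d [[sb _] [sc _] [sd _] ->]]]].
transitivity (fun x => 'D_(evec j) (tens (pd i 0 b) (pd i 1 c) (pd i 2 d)) x).
  by rewrite (tst_dE i sb sc sd).
rewrite (tst_dE j (@pd_sm1 i 0 _ sb) (@pd_sm1 i 1 _ sc) (@pd_sm1 i 2 _ sd)).
rewrite !(pdC j i) -(tst_dE i (@pd_sm1 j 0 _ sb) (@pd_sm1 j 1 _ sc) (@pd_sm1 j 2 _ sd)).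
by rewrite (tst_dE j sb sc sd).
Qed.

(** Derivatives of tests commute. *)
Lemma weak1_swap i j a ai aj aij : weak1 i a ai -> weak1 j a aj -> weak1 j ai aij -> weak1 i aj aij.
Proof.
move=> [La Li Hi] [_ Lj Hj] [_ Lij Hij].
split; [exact: Lj|exact: Lij|move=> psi tp].
have ti := tst_derive i tp; have tj := tst_derive j tp.
rewrite -(Hij _ tp).
apply: oppr_inj.
refine (etrans (etrans (esym (Hj _ ti)) _) (Hi _ tj)).
exact (congr1 (ip a) (tst_derive_swap i j tp)).
Qed.

End weak2.

Lemma ipE {R : realType} (f g : R3 R -> R) : ip f g = intO (fun x => f x * g x).
Proof. by []. Qed.

Lemma L2_meas {R : realType} (f : R3 R -> R) : is_L2 f -> measurable_fun half_space f.
Proof. by case. Qed.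

Opaque ip nrm is_L2.

Section line.
Context {R : realType}.
Implicit Types f g a phi psi : R3 R -> R.
Local Notation D := (@half_space R).
Local Notation mu := (@leb3 R).
Local Notation lam := (@lebesgue_measure R).
Local Notation RR := (measurableTypeR R).
Local Notation E3 := (RR * RR * RR)%type.

(** * Integration along coordinate lines *)

Lemma within_cont (A : set R) (r : R -> R) :
  (forall s e, A s -> 0 < e -> exists2 d, 0 < d &
    forall s', A s' -> `|s' - s| <= d -> `|r s' - r s| <= e) ->
  {within A, continuous r}.
Proof.
move=> H; apply/subspace_continuousP => s As; apply/cvgrPdist_le => e e0.
have [d d0 Hd] := H s e As e0; rewrite near_withinE.
apply/nbhs_ballP; exists d => //= s' /ltW ss As'.
by rewrite distrC; apply: Hd => //; rewrite distrC.
Qed.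

Lemma within_contP (A : set R) (r : R -> R) : {within A, continuous r} ->
  forall s e, A s -> 0 < e -> exists2 d, 0 < d &
    forall s', A s' -> `|s' - s| <= d -> `|r s' - r s| <= e.
Proof.
move=> /subspace_continuousP H s e As e0.
have /cvgrPdist_le /(_ e e0) := H s As.
rewrite near_withinE => /nbhs_ballP[d /= d0 Hd]; exists (d / 2); first by rewrite divr_gt0.
move=> s' As' ss; rewrite distrC; apply: Hd => //; rewrite /ball/= distrC.
by apply: le_lt_trans ss _; rewrite ltr_pdivrMr// ltr_pMr// ltr1n.
Qed.

Lemma sh_cont2 f i e : is_L2 f -> 0 < e -> exists2 d, 0 < d &
  forall s s', 0 <= s -> 0 <= s' -> `|s' - s| <= d ->
  nrm (sh (s' *: evec i) f \- sh (s *: evec i) f) <= e.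
Proof.
move=> Lf e0; have [d d0 H] := sh_cont i Lf e0; exists d => //.
have key s s' : 0 <= s -> s <= s' -> s' - s <= d ->
    nrm (sh (s' *: evec i) f \- sh (s *: evec i) f) <= e.
  move=> s0 ss sd.
  have ss0 : 0 <= s' - s by rewrite subr_ge0.
  rewrite (_ : _ \- _ = sh (s *: evec i) (sh ((s' - s) *: evec i) f \- f)); last first.
    by apply/funext => x; rewrite /sh /= -addrA -scalerDl subrKC.
  apply: le_trans (nrm_sh (@evec2_ge0 _ i _ s0) _) _.
    by apply: L2B => //; apply: L2_sh => //; exact: evec2_ge0.
  by apply: H; rewrite ss0.
move=> s s' s0 s0'; have [ss|ss] := leP s s'.
  by rewrite ger0_norm ?subr_ge0//; exact: key.
by rewrite distrC ger0_norm ?subr_ge0 ?(ltW ss)// nrmBC; exact: key (ltW ss).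
Qed.

Definition res (Q : set E3) f : R3 R -> R := fun x => \1_Q (x : E3) * f x.

Lemma L2_res Q f : measurable Q -> is_L2 f -> is_L2 (res Q f).
Proof.
move=> mQ Lf; apply: (L2_le _ Lf).
  by apply: measurable_funM; [apply: measurable_indic|exact: L2_meas Lf].
move=> x _; rewrite /res normrM ler_piMl// indicE ger0_norm//.
by case: (_ \in _).
Qed.

Lemma resB Q f g : res Q (f \- g) = res Q f \- res Q g.
Proof. by apply/funext => x; rewrite /res /= mulrBr. Qed.

Lemma ip_res Q f g : ip f (res Q g) = ip (res Q f) (res Q g).
Proof.
rewrite !ipE; apply: eq_Rintegral => x _; rewrite /res indicE.
by case: (_ \in _); rewrite ?mul1r// !mul0r mulr0.
Qed.

Lemma nrm_res Q f : measurable Q -> is_L2 f -> nrm (res Q f) <= nrm f.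
Proof.
move=> mQ Lf; apply: le_nrm => //; first exact: L2_res.
move=> x _; rewrite /res normrM ler_piMl// indicE ger0_norm//.
by case: (_ \in _).
Qed.

Section direction.
Variable i : 'I_3.
Local Notation S s f := (sh (s *: evec i) f).

Lemma L2_S s f : 0 <= s -> is_L2 f -> is_L2 (S s f).
Proof. by move=> s0 Lf; apply: L2_sh => //; exact: evec2_ge0. Qed.

Lemma ip_sh_cont g phi h : is_L2 g -> is_L2 phi ->
  {within `[0, h], continuous (fun s => ip (S s g) phi)}.
Proof.
move=> Lg Lp; apply: within_cont => s e; rewrite /= in_itv/= => /andP[s0 _] e0.
have n1 : 0 < nrm phi + 1 by rewrite ltr_wpDl ?nrm_ge0.
have [d d0 Hd] := sh_cont2 i Lg (divr_gt0 e0 n1); exists d => // s'.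
rewrite in_itv/= => /andP[s0' _] ss.
have L1 := L2_S s0 Lg; have L2 := L2_S s0' Lg.
rewrite -(ipBl L2 L1 Lp); apply: le_trans (ip_cs (L2B L2 L1) Lp) _.
apply: le_trans (_ : e / (nrm phi + 1) * (nrm phi + 1) <= _); last by rewrite divfK// gt_eqF.
apply: ler_pM; [exact: nrm_ge0|exact: nrm_ge0|exact: Hd|by rewrite lerDl].
Qed.

Lemma nrm_res_sh_cont Q g h : measurable Q -> is_L2 g ->
  {within `[0, h], continuous (fun s => nrm (res Q (S s g)) ^+ 2)}.
Proof.
move=> mQ Lg; apply: within_cont => s e; rewrite /= in_itv/= => /andP[s0 _] e0.
have n1 : 0 < 2 * nrm g + 1 by rewrite ltr_wpDl ?mulr_ge0 ?nrm_ge0.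
have [d d0 Hd] := sh_cont2 i Lg (divr_gt0 e0 n1); exists d => // s'.
rewrite in_itv/= => /andP[s0' _] ss.
have L1 := L2_S s0 Lg; have L2 := L2_S s0' Lg.
have M1 := L2_res mQ L1; have M2 := L2_res mQ L2.
have B (t : R) : 0 <= t -> nrm (res Q (S t g)) <= nrm g.
  move=> t0; apply: le_trans (nrm_res mQ (L2_S t0 Lg)) _; exact: nrm_sh (@evec2_ge0 _ i _ t0) Lg.
have b1 := B _ s0; have b2 := B _ s0'.
have d1 : `|nrm (res Q (S s' g)) - nrm (res Q (S s g))| <= e / (2 * nrm g + 1).
  apply: le_trans (Hd _ _ s0 s0' ss).
  apply: le_trans (nrm_res mQ (L2B L2 L1)); rewrite resB.
  have := nrm_sub M1 M2; have := nrm_sub M2 M1.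
  rewrite (nrmBC (res Q (S s g)) (res Q (S s' g))).
  move: (nrm _) (nrm _) (nrm _) => x y z; clear => h1 h2; rewrite ler_norml; apply/andP; split; lra.
rewrite subr_sqr normrM.
apply: le_trans (_ : e / (2 * nrm g + 1) * (2 * nrm g + 1) <= _); last by rewrite divfK// gt_eqF.
apply: ler_pM; rewrite ?normr_ge0// ger0_norm ?addr_ge0 ?nrm_ge0//.
by apply: le_trans (lerD b2 b1) _; rewrite -mulr2n mulr_natl lerDl.
Qed.

(** The fundamental theorem of calculus holds for tests by differentiation, and both sides are
    continuous in the test function. *)
Lemma line_fund a g phi h : weak1 i a g -> is_L2 phi -> 0 < h <= 1 ->
  ip (S h a) phi - ip a phi = \int[lam]_(s in `[0, h]) ip (S s g) phi.
Proof.
move=> w Lp /andP[h0 h1]; have [La Lg _] := w.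
have Lh := L2_S (ltW h0) La.
have int (f : R3 R -> R) : is_L2 f -> lam.-integrable `[0, h] (EFin \o (fun s => ip (S s g) f)).
  by move=> Lf; apply: continuous_compact_integrable; [exact: segment_compact|exact: ip_sh_cont].
have mI : measurable (`[0, h]%classic : set RR) by exact: measurable_itv.
apply: (@L2_density R (fun phi => ip (S h a) phi - ip a phi = \int[lam]_(s in `[0, h]) ip (S s g) phi)); last exact: Lp.
- move=> psi tp; have [C C0 HC] := quad_shift w (tspan_tst tp).
  have Lps := tst_L2 tp.
  have := @continuous_FTC2 R (fun s => ip (S s g) psi) (fun s => ip (S s a) psi) 0 h h0 (ip_sh_cont (h := h) Lg Lps).
  rewrite /Rintegral => -> //; first by rewrite /= sh0.
  + have dq s : s \in `]0, h[ -> is_derive s (1 : R) (fun s => ip (S s a) psi) (ip (S s g) psi).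
      rewrite in_itv/= => /andP[s0 sh]; apply: (quad_is_derive HC).
      by rewrite s0 (lt_le_trans sh).
    have /continuous_within_itvP := ip_sh_cont (h := h) La Lps => /(_ h0) [_ c1 c2].
    by split; [move=> s /dq []|exact: c1|exact: c2].
  + move=> s; rewrite in_itv/= => /andP[s0 sh].
    have [|_ <-] := quad_is_derive HC (s := s); first by rewrite s0 (lt_le_trans sh).
    by rewrite derive1E.
- move=> c f f' Lf Lf' Hf Hf'.
  have Lcf := L2Z c Lf'.
  rewrite (ipDr Lf Lcf Lh) (ipDr Lf Lcf La) (ipZr c Lf' Lh) (ipZr c Lf' La).
  rewrite (@eq_Rintegral _ _ _ lam `[0, h]%classic (fun s => ip (S s g) f + c * ip (S s g) f')); last first.
    move=> s; rewrite inE/= in_itv/= => /andP[s0 _]; have Ls := L2_S s0 Lg.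
    by rewrite (ipDr Lf Lcf Ls) (ipZr c Lf' Ls).
  rewrite RintegralD ?RintegralZl -?Hf -?Hf'//; [ring|exact: int|exact: int|].
  by apply: eq_integrable (integrableZl mI c (int _ Lf')) => // s _; rewrite /= EFinM.
- move=> f Lf H; apply/eqP; rewrite -subr_eq0 -normr_le0; apply/ler_addgt0Pl => e e0; rewrite addr0.
  pose K := nrm (S h a) + nrm a + nrm g + 1.
  have K0 : 0 < K by rewrite ltr_wpDl// !addr_ge0 ?nrm_ge0.
  have [f' [Lf' Hf' ff]] := H _ (divr_gt0 e0 K0).
  have Lff := L2B Lf Lf'.
  have -> : ip (S h a) f - ip a f - \int[lam]_(s in `[0, h]) ip (S s g) f =
     ip (S h a) (f \- f') - ip a (f \- f') - \int[lam]_(s in `[0, h]) ip (S s g) (f \- f').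
    rewrite (@eq_Rintegral _ _ _ lam `[0, h]%classic (fun s => ip (S s g) f - ip (S s g) f') (fun s => ip (S s g) (f \- f'))); last first.
      move=> s; rewrite inE/= in_itv/= => /andP[s0 _]; have Ls := L2_S s0 Lg.
      by rewrite (ipBr Lf Lf' Ls).
    rewrite RintegralB//; [|exact: int|exact: int]; rewrite -Hf' (ipBr Lf Lf' Lh) (ipBr Lf Lf' La); ring.
  have I : `|\int[lam]_(s in `[0, h]) ip (S s g) (f \- f')| <= nrm g * (e / K).
    apply: le_trans (le_normr_Rintegral mI (int _ Lff)) _.
    apply: le_trans (_ : \int[lam]_(s in `[0, h]) (nrm g * (e / K)) <= _).
      apply: le_Rintegral => //.
      - apply: eq_integrable (integrable_norm (int _ Lff)) => // s _.
      - apply: continuous_compact_integrable; [exact: segment_compact|].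
        by apply: continuous_subspaceT => x; exact: cvg_cst.
      move=> s; rewrite /= in_itv/= => /andP[s0 _]; have Ls := L2_S s0 Lg.
      apply: le_trans (ip_cs Ls Lff) _; apply: ler_pM => //; rewrite ?nrm_ge0//.
      by apply: nrm_sh => //; exact: evec2_ge0.
    rewrite Rintegral_cst//= lebesgue_measure_itv/= lte_fin h0/= subr0.
    by rewrite ler_piMr// mulr_ge0 ?nrm_ge0// divr_ge0 ?ltW.
  apply: le_trans (ler_normB _ _) _; apply: le_trans (lerD (ler_normB _ _) I) _.
  apply: le_trans (_ : (nrm (S h a) + nrm a + nrm g) * (e / K) <= _).
    rewrite !mulrDl; apply: lerD => //; apply: lerD; apply: le_trans (ip_cs _ Lff) _ => //;
    by rewrite ler_wpM2l ?nrm_ge0.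
  rewrite mulrCA ler_piMr ?(ltW e0)// ler_pdivrMr// mul1r /K; lra.
Qed.

End direction.
End line.

Section line.
Context {R : realType}.
Implicit Types f g a phi psi : R3 R -> R.
Local Notation D := (@half_space R).
Local Notation mu := (@leb3 R).
Local Notation lam := (@lebesgue_measure R).
Local Notation RR := (measurableTypeR R).
Local Notation E3 := (RR * RR * RR)%type.

Section direction.
Variable i : 'I_3.
Local Notation S s f := (sh (s *: evec i) f).

(** Tested with the increment itself, the fundamental theorem of calculus and the
    Cauchy-Schwarz inequality bound the norm of the increment. *)
Lemma line_increment Q a g h : measurable Q -> weak1 i a g -> 0 < h <= 1 ->
  nrm (res Q (S h a \- a)) ^+ 2 <= h * \int[lam]_(s in `[0, h]) nrm (res Q (S s g)) ^+ 2.
Proof.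
move=> mQ w hh; have /andP[h0 h1] := hh; have [La Lg _] := w.
have Lh := L2_S i (ltW h0) La.
have mI : measurable (`[0, h]%classic : set RR) by exact: measurable_itv.
pose d := res Q (S h a \- a).
have Ld : is_L2 d by apply: L2_res => //; exact: L2B.
have E : nrm d ^+ 2 = \int[lam]_(s in `[0, h]) ip (S s g) d.
  by rewrite -(line_fund w Ld hh) -ipBl// nrm2 /d -ip_res.
set M := \int[lam]_(s in `[0, h]) _.
have i1 : lam.-integrable `[0, h] (EFin \o (fun s => nrm (res Q (S s g)) ^+ 2)).
  by apply: continuous_compact_integrable; [exact: segment_compact|exact: nrm_res_sh_cont].
have i2 (c : R) : lam.-integrable `[0, h] (EFin \o (fun=> c)).
  apply: continuous_compact_integrable; [exact: segment_compact|].
  by apply: continuous_subspaceT => x; exact: cvg_cst.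
have i3 c : lam.-integrable `[0, h] (EFin \o (fun s => c * nrm (res Q (S s g)) ^+ 2)).
  by apply: eq_integrable (integrableZl mI c i1) => // s _; rewrite /= EFinM.
have : nrm d ^+ 2 <= \int[lam]_(s in `[0, h]) (h / 2 * nrm (res Q (S s g)) ^+ 2 + (2 * h)^-1 * nrm d ^+ 2).
  rewrite {1}E; apply: le_Rintegral => //.
  - by apply: continuous_compact_integrable; [exact: segment_compact|exact: ip_sh_cont].
  - by apply: eq_integrable (integrableD mI (i3 (h / 2)) (i2 ((2 * h)^-1 * nrm d ^+ 2))).
  move=> s; rewrite /= in_itv/= => /andP[s0 _]; have Ls := L2_S i s0 Lg.
  rewrite /d (ip_res Q) -/d; apply: le_trans (ler_norm _) _.
  apply: le_trans (ip_cs (L2_res mQ Ls) Ld) _.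
  set x := nrm _; set y := nrm d.
  have -> : h / 2 * x ^+ 2 + (2 * h)^-1 * y ^+ 2 = x * y + (2 * h)^-1 * (h * x - y) ^+ 2.
    by field; rewrite gt_eqF.
  by rewrite lerDl mulr_ge0 ?sqr_ge0// invr_ge0 mulr_ge0// ltW.
rewrite RintegralD ?RintegralZl// Rintegral_cst//= lebesgue_measure_itv/= lte_fin h0/= subr0 -/M.
rewrite -/d; move: (nrm d) => z H.
have {}H : z ^+ 2 <= h / 2 * M + z ^+ 2 / 2.
  apply: le_trans H _; rewrite le_eqVlt; apply/orP; left; apply/eqP; field.
  by rewrite gt_eqF.
have -> : h * M = 2 * (h / 2 * M + z ^+ 2 / 2) - z ^+ 2 by field.
by move: H; move: (h / 2 * M) => y; clear; lra.
Qed.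

Lemma line_average Q a g : measurable Q -> weak1 i a g ->
  nrm (res Q a) ^+ 2 <= 2 * (\int[lam]_(s in `[0, 1]) nrm (res Q (S s a)) ^+ 2
     + \int[lam]_(s in `[0, 1]) nrm (res Q (S s g)) ^+ 2).
Proof.
move=> mQ w; have [La Lg _] := w.
have ct f h : is_L2 f -> lam.-integrable `[0, h] (EFin \o (fun s => nrm (res Q (S s f)) ^+ 2)).
  by move=> Lf; apply: continuous_compact_integrable; [exact: segment_compact|exact: nrm_res_sh_cont].
have mI h : measurable (`[0, h]%classic : set RR) by exact: measurable_itv.
have i2 (c : R) : lam.-integrable `[0, 1] (EFin \o (fun=> c)).
  apply: continuous_compact_integrable; [exact: segment_compact|].
  by apply: continuous_subspaceT => x; exact: cvg_cst.
set G := \int[lam]_(s in `[0, 1]) nrm (res Q (S s g)) ^+ 2.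
have G0 : 0 <= G by apply: Rintegral_ge0 => s _; exact: sqr_ge0.
have H h : 0 <= h <= 1 -> nrm (res Q a) ^+ 2 <= 2 * nrm (res Q (S h a)) ^+ 2 + 2 * G.
  move=> /andP[]; rewrite le_eqVlt => /predU1P[<- _|h0 h1].
    rewrite sh0; have := sqr_ge0 (nrm (res Q a)); lra.
  have hh : 0 < h <= 1 by rewrite h0.
  have I := line_increment mQ w hh.
  have J : h * \int[lam]_(s in `[0, h]) nrm (res Q (S s g)) ^+ 2 <= G.
    apply: le_trans (_ : \int[lam]_(s in `[0, h]) nrm (res Q (S s g)) ^+ 2 <= _).
      by rewrite ler_piMl// Rintegral_ge0// => s _; exact: sqr_ge0.
    rewrite /G /Rintegral; apply: fine_le.
    - exact: integrable_fin_num (ct _ _ Lg).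
    - exact: integrable_fin_num (ct _ _ Lg).
    apply: ge0_subset_integral => //; [have /integrableP[] := ct _ 1 Lg; by []| |].
      by move=> s _; rewrite lee_fin sqr_ge0.
    by move=> s /=; rewrite !in_itv/= => /andP[-> /le_trans]; apply.
  have Lh := L2_S i (ltW h0) La.
  have L1 := L2_res mQ La; have L2 := L2_res mQ Lh; have L3 := L2_res mQ (L2B Lh La).
  have : nrm (res Q a) <= nrm (res Q (S h a)) + nrm (res Q (S h a \- a)).
    by rewrite resB nrmBC; exact: nrm_sub.
  have := nrm_ge0 (res Q a); have := nrm_ge0 (res Q (S h a)); have := nrm_ge0 (res Q (S h a \- a)).
  have := le_trans I J.
  set x := nrm _; set y := nrm _; set z := nrm _ => xG x0 y0 z0 xyz.
  have : z ^+ 2 <= (y + x) ^+ 2 by rewrite ler_pXn2r ?nnegrE ?addr_ge0.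
  have := sqr_ge0 (x - y); rewrite !sqrrD sqrrN; lra.
have -> : nrm (res Q a) ^+ 2 = \int[lam]_(s in `[0, 1]) (nrm (res Q a) ^+ 2).
  by rewrite Rintegral_cst//= lebesgue_measure_itv/= lte_fin ltr01/= subr0 mulr1.
have i3 c : lam.-integrable `[0, 1] (EFin \o (fun s => c * nrm (res Q (S s a)) ^+ 2)).
  by apply: eq_integrable (integrableZl (mI 1) c (ct _ 1 La)) => // s _; rewrite /= EFinM.
apply: le_trans (_ : \int[lam]_(s in `[0, 1]) (2 * nrm (res Q (S s a)) ^+ 2 + 2 * G) <= _).
  apply: le_Rintegral => //.
  by apply: eq_integrable (integrableD (mI 1) (i3 2) (i2 (2 * G))).
rewrite RintegralD ?RintegralZl//.
  by rewrite Rintegral_cst//= lebesgue_measure_itv/= lte_fin ltr01/= subr0 mulr1 mulrDr.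
exact: ct.
Qed.

End direction.
End line.

Section project.
Context {R : realType}.
Local Notation mu := (@leb3m R).
Local Notation lam := (@lebesgue_measure R).
Local Notation RR := (measurableTypeR R).
Local Notation E3 := (RR * RR * RR)%type.
Local Open Scope ereal_scope.
Implicit Types (A K F G : E3 -> \bar R) (x : E3) (s : RR).

Definition upd (i : 'I_3) x s : E3 :=
  if i == 0%N :> nat then ((s, x.1.2), x.2)
  else if i == 1%N :> nat then ((x.1.1, s), x.2) else (x.1, s).

Definition crd (i : 'I_3) x : R :=
  if i == 0%N :> nat then x.1.1 else if i == 1%N :> nat then x.1.2 else x.2.

Lemma upd_shift i (x : R3 R) (s : R) : (x + s *: evec i = upd i x (s + crd i x)%R :> R3 R)%R.
Proof.
have E (p q : R3 R) : p.1.1 = q.1.1 -> p.1.2 = q.1.2 -> p.2 = q.2 -> p = q.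
  by move: p q => [[? ?] ?] [[? ?] ?] /= -> -> ->.
by case: i => -[|[|[|//]]] ?; apply: E; rewrite /upd /crd/= /GRing.scale/= ?mulr0 ?mulr1 ?addr0 // addrC.
Qed.

Lemma measurable_upd i : measurable_fun setT (fun z : E3 * RR => upd i z.1 z.2).
Proof.
have m1 : measurable_fun setT (fun z : E3 * RR => z.1.1.1).
  do 2 apply: (measurableT_comp measurable_fst); exact: measurable_fst.
have m2 : measurable_fun setT (fun z : E3 * RR => z.1.1.2).
  apply: (measurableT_comp measurable_snd); apply: (measurableT_comp measurable_fst); exact: measurable_fst.
have m3 : measurable_fun setT (fun z : E3 * RR => z.1.2).
  apply: (measurableT_comp measurable_snd); exact: measurable_fst.
have m4 : measurable_fun setT (fun z : E3 * RR => z.2) by exact: measurable_snd.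
have m5 : measurable_fun setT (fun z : E3 * RR => z.1.1) by apply: (measurableT_comp measurable_fst); exact: measurable_fst.
case: i => -[|[|[|//]]] ?; rewrite /upd/=.
- exact: measurable_fun_pair (measurable_fun_pair m4 m2) m3.
- exact: measurable_fun_pair (measurable_fun_pair m1 m4) m3.
- exact: measurable_fun_pair m5 m4.
Qed.

Definition lint i K x := \int[lam]_s K (upd i x s).

Lemma lint_ge0 i K x : (forall y, 0 <= K y) -> 0 <= lint i K x.
Proof. by move=> K0; apply: integral_ge0 => s _. Qed.

Lemma measurable_lint i K : measurable_fun setT K -> (forall x, 0 <= K x) ->
  measurable_fun setT (lint i K).
Proof.
move=> mK K0; apply: (@measurable_fun_fubini_tonelli_F _ _ _ _ _ lam (fun z : E3 * RR => K (upd i z.1 z.2))) => //.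
by apply: measurableT_comp => //; exact: measurable_upd.
Qed.

Lemma measurable_line i K x : measurable_fun setT K -> measurable_fun setT (fun s => K (upd i x s)).
Proof.
move=> mK; apply: (measurableT_comp mK).
by case: i => -[|[|[|//]]] ?; rewrite /upd/=; do ?apply: measurable_fun_pair.
Qed.

Let sym1 (a k : RR -> \bar R) : measurable_fun setT a -> measurable_fun setT k ->
  (forall s, 0 <= a s) -> (forall s, 0 <= k s) ->
  \int[lam]_t (a t * \int[lam]_s k s) = \int[lam]_t (k t * \int[lam]_s a s).
Proof.
move=> ma mk a0 k0; rewrite !ge0_integralZr ?integral_ge0//.
by rewrite muleC.
Qed.

(** Both sides integrate over the pairs of points on a common line, by Tonelli's theorem. *)
Lemma lint_adj i A K : measurable_fun setT A -> measurable_fun setT K ->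
  (forall x, 0 <= A x) -> (forall x, 0 <= K x) ->
  \int[mu]_x (A x * lint i K x) = \int[mu]_x (K x * lint i A x).
Proof.
move=> mA mK A0 K0.
have m B C : measurable_fun setT B -> measurable_fun setT C -> (forall x, 0 <= C x) ->
    measurable_fun setT (fun x => B x * lint i C x).
  by move=> mB mC C0; apply: emeasurable_funM => //; exact: measurable_lint.
have p B C : (forall x, 0 <= B x) -> (forall x, 0 <= C x) -> forall x, 0 <= B x * lint i C x.
  by move=> B0 C0 x; rewrite mule_ge0// lint_ge0.
have mAK := m _ _ mA mK K0; have mKA := m _ _ mK mA A0.
have AK0 := p _ _ A0 K0; have KA0 := p _ _ K0 A0.
have sec (F : E3 -> \bar R) (t : RR) : measurable_fun setT F ->
    measurable_fun setT (fun x' : RR * RR => F (x', t)).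
  by move=> mF; apply: (measurableT_comp mF); apply: measurable_fun_pair.
move: mAK mKA AK0 KA0 {m p}; rewrite /lint; case: i => -[|[|[|//]]] ? mAK mKA AK0 KA0.
- rewrite (@fubini_tonelli2 _ _ _ _ _ (@leb2 R) lam _ mAK AK0).
  rewrite (@fubini_tonelli2 _ _ _ _ _ (@leb2 R) lam _ mKA KA0).
  apply: eq_integral => t _; rewrite /fubini_G.
  rewrite (@fubini_tonelli2 _ _ _ _ _ lam lam _ (sec _ t mAK)); last by move=> ?; exact: AK0.
  rewrite (@fubini_tonelli2 _ _ _ _ _ lam lam _ (sec _ t mKA)); last by move=> ?; exact: KA0.
  apply: eq_integral => y _; rewrite /fubini_G /upd/=.
  apply: (@sym1 (fun s => A ((s, y), t)) (fun s => K ((s, y), t))) => //.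
  + by apply: (measurableT_comp mA); do ?apply: measurable_fun_pair.
  + by apply: (measurableT_comp mK); do ?apply: measurable_fun_pair.
- rewrite (@fubini_tonelli2 _ _ _ _ _ (@leb2 R) lam _ mAK AK0).
  rewrite (@fubini_tonelli2 _ _ _ _ _ (@leb2 R) lam _ mKA KA0).
  apply: eq_integral => t _; rewrite /fubini_G.
  rewrite (@fubini_tonelli1 _ _ _ _ _ lam lam _ (sec _ t mAK)); last by move=> ?; exact: AK0.
  rewrite (@fubini_tonelli1 _ _ _ _ _ lam lam _ (sec _ t mKA)); last by move=> ?; exact: KA0.
  apply: eq_integral => y _; rewrite /fubini_F /upd/=.
  apply: (@sym1 (fun s => A ((y, s), t)) (fun s => K ((y, s), t))) => //.
  + by apply: (measurableT_comp mA); do ?apply: measurable_fun_pair.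
  + by apply: (measurableT_comp mK); do ?apply: measurable_fun_pair.
- rewrite (@fubini_tonelli1 _ _ _ _ _ (@leb2 R) lam _ mAK AK0).
  rewrite (@fubini_tonelli1 _ _ _ _ _ (@leb2 R) lam _ mKA KA0).
  apply: eq_integral => y _; rewrite /fubini_F /upd/=.
  apply: (@sym1 (fun s => A (y, s)) (fun s => K (y, s))) => //.
  + by apply: (measurableT_comp mA); do ?apply: measurable_fun_pair.
  + by apply: (measurableT_comp mK); do ?apply: measurable_fun_pair.
Qed.

Lemma lint3 K x (o1 : (0 < 3)%N) (o2 : (1 < 3)%N) (o3 : (2 < 3)%N) :
  measurable_fun setT K -> (forall x, 0 <= K x) ->
  lint (Ordinal o1) (lint (Ordinal o2) (lint (Ordinal o3) K)) x = \int[mu]_y K y.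
Proof.
move=> mK K0; rewrite (@fubini_tonelli1 _ _ _ _ _ (@leb2 R) lam _ mK K0).
have mF := @measurable_fun_fubini_tonelli_F _ _ _ _ _ lam _ mK K0.
rewrite (@fubini_tonelli1 _ _ _ _ _ lam lam _ mF)//.
by move=> y; apply: integral_ge0.
Qed.

(** A nonnegative weight is the increasing limit of combinations of indicators. *)
Lemma weight_le F G K : measurable_fun setT F -> measurable_fun setT G -> measurable_fun setT K ->
  (forall x, 0 <= F x) -> (forall x, 0 <= G x) -> (forall x, 0 <= K x) ->
  \int[mu]_x F x < +oo ->
  (forall Q, measurable Q -> \int[mu]_(x in Q) F x <= \int[mu]_(x in Q) G x) ->
  \int[mu]_x (F x * K x) <= \int[mu]_x (G x * K x).
Proof.
move=> mF mG mK F0 G0 K0 Ffin H.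
pose N k : set E3 := [set x | G x + (k.+1%:R^-1)%:E <= F x].
have k0 k : (0 <= k.+1%:R^-1 :> R)%R by rewrite invr_ge0.
have mN k : measurable (N k).
  rewrite -[N k]setTI; apply: measurable_lee => //.
  by apply: emeasurable_funD => //; exact: measurable_cst.
have N0 k : mu (N k) = 0.
  have mGN : measurable_fun (N k) G by exact: measurable_funTS.
  have h1 : \int[mu]_(x in N k) F x < +oo.
    by apply: le_lt_trans Ffin; apply: ge0_subset_integral.
  have h2 := H _ (mN k).
  have h3 : \int[mu]_(x in N k) G x + (k.+1%:R^-1)%:E * mu (N k) <= \int[mu]_(x in N k) F x.
    rewrite -integral_cst//= -ge0_integralD//.
    apply: ge0_le_integral => //.
    - by move=> x _; rewrite adde_ge0.
    - by apply: emeasurable_funD => //; exact: measurable_cst.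
    - exact: measurable_funTS.
  have gf : \int[mu]_(x in N k) G x \is a fin_num.
    rewrite ge0_fin_numE ?integral_ge0//; apply: le_lt_trans h1; apply: le_trans h3.
    by rewrite leeDl// mule_ge0.
  have := le_trans h3 h2; rewrite -{2}(adde0 (\int[mu]_(x in N k) G x)) leeD2lE// => h4.
  apply/eqP; rewrite -measure_le0; move: h4; rewrite pmule_rle0// lte_fin invr_gt0.
apply: ae_ge0_le_integral => //.
- by move=> x _; rewrite mule_ge0.
- exact: emeasurable_funM.
- by move=> x _; rewrite mule_ge0.
- exact: emeasurable_funM.
have neg : mu.-negligible (\bigcup_k N k).
  by apply: negligible_bigcup => k; exists (N k); split; [exact: mN|exact: N0|].
apply: negligibleS neg => x /= hx; apply: contrapT => nx; apply: hx => _.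
apply: lee_wpmul2r => //; rewrite leNgt; apply/negP => GF; apply: nx.
move: (G0 x) (F0 x) GF; case Gx : (G x) => [g| |]//; case Fx : (F x) => [f| |]//.
- rewrite !lee_fin lte_fin => g0 f0 gf.
  exists (Num.truncn (f - g)^-1) => //; rewrite /N/= Gx Fx -EFinD lee_fin.
  rewrite -lerBrDl -[leRHS]invrK lef_pV2 ?posrE ?ltr0n ?invr_gt0 ?subr_gt0//.
  exact/ltW/truncnS_gt.
- by move=> _ _ _; exists 0%N => //; rewrite /N/= Gx Fx -EFinD leey.
Qed.

End project.

Section product.
Context {R : realType}.
Local Notation D := (@half_space R).
Local Notation mu := (@leb3m R).
Local Notation lam := (@lebesgue_measure R).
Local Notation RR := (measurableTypeR R).
Local Notation E3 := (RR * RR * RR)%type.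
Implicit Types (f g a b : R3 R -> R) (K : E3 -> \bar R).

(** * Products of Sobolev functions *)

Definition sq f : E3 -> \bar R := (fun x => (f x ^+ 2)%:E) \_ D.

Lemma sq_ge0 f x : (0 <= sq f x)%E.
Proof. by rewrite /sq patchE; case: ifP => // _; rewrite lee_fin sqr_ge0. Qed.

Lemma measurable_sq f : is_L2 f -> measurable_fun setT (sq f).
Proof.
move=> Lf; apply/(measurable_restrictT _ measurable_half_spaceE).
by apply/measurable_EFinP; apply: measurable_funX; exact: L2_meas.
Qed.

Lemma integral_sq f (Q : set E3) : measurable Q -> is_L2 f ->
  (\int[mu]_(x in Q) sq f x = (nrm (res Q f) ^+ 2)%:E)%E.
Proof.
move=> mQ Lf; rewrite nrm2 -sqnormE; last exact: L2_res.
rewrite /sqnorm integral_mkcond [RHS]integral_mkcond; apply: eq_integral => x _.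
rewrite /sq /res !patchE indicE; case: ifP => xQ; case: ifP => xD //.
  by rewrite mul1r.
by rewrite mul0r expr0n.
Qed.

Lemma res_setT f : res setT f = f.
Proof. by apply/funext => x; rewrite /res indicT mul1r. Qed.

Lemma integral_sqT f : is_L2 f -> (\int[mu]_x sq f x = (nrm f ^+ 2)%:E)%E.
Proof. by move=> Lf; rewrite integral_sq// res_setT. Qed.

(** Tonelli's theorem bounds the average of the translates by line integrals. *)
Lemma average_lint i Q f : measurable Q -> is_L2 f ->
  ((\int[lam]_(s in `[0, 1]) nrm (res Q (sh (s *: evec i) f)) ^+ 2)%:E <=
   \int[mu]_(x in Q) lint i (sq f) x)%E.
Proof.
move=> mQ Lf.
have mI : measurable (`[0, 1]%classic : set RR) by exact: measurable_itv.
have it : lam.-integrable `[0, 1] (EFin \o (fun s => nrm (res Q (sh (s *: evec i) f)) ^+ 2)).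
  by apply: continuous_compact_integrable; [exact: segment_compact|exact: nrm_res_sh_cont].
rewrite /Rintegral fineK; last exact: integrable_fin_num.
have msq := measurable_sq Lf.
have mup := @measurable_upd R i.
have msh : measurable_fun setT (fun z : E3 * RR => (z.1 + z.2 *: evec i : E3)).
  rewrite (_ : (fun z => _) = (fun z : E3 * RR => upd i z.1 (z.2 + crd i z.1))); last first.
    by apply/funext => z; exact: upd_shift.
  apply: (measurableT_comp mup (g := fun z : E3 * RR => (z.1, z.2 + crd i z.1))).
  apply: measurable_fun_pair => //; apply: measurable_funD => //.
  case: i {it mup} => -[|[|[|//]]] ?; rewrite /crd/=.
  - by do 2 apply: (measurableT_comp measurable_fst).
  - by apply: (measurableT_comp measurable_snd); apply: (measurableT_comp measurable_fst).
  - by apply: (measurableT_comp measurable_snd).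
pose H (z : E3 * RR) : \bar R := ((\1_Q z.1)%:E * sq f (z.1 + z.2 *: evec i)%R)%E.
have mH : measurable_fun setT H.
  apply: emeasurable_funM; last by apply: measurableT_comp.
  apply/measurable_EFinP; apply: measurableT_comp => //; exact: measurable_indic.
have H0 z : (0 <= H z)%E by rewrite mule_ge0 ?sq_ge0// lee_fin.
apply: (@le_trans _ _ (\int[lam]_s \int[mu]_x H (x, s))%E).
  rewrite integral_mkcond; apply: ge0_le_integral => //.
  - by move=> s _; rewrite patchE; case: ifP => // _; rewrite lee_fin sqr_ge0.
  - by apply/(measurable_restrictT _ mI); have /integrableP[] := it.
  - exact: (@measurable_fun_fubini_tonelli_G _ _ _ _ _ mu _ mH H0).
  move=> s _; rewrite patchE; case: ifPn => [/set_mem/=|_]; last exact: integral_ge0.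
  rewrite in_itv/= => /andP[s0 _].
  have Ls : is_L2 (sh (s *: evec i) f) by apply: L2_sh => //; exact: evec2_ge0.
  rewrite -integral_sq// integral_mkcond; apply: ge0_le_integral => //.
  - by move=> x _; rewrite patchE; case: ifP => // _; exact: sq_ge0.
  - by apply/(measurable_restrictT _ mQ); apply: measurable_funTS; exact: measurable_sq.
  - by apply: (measurableT_comp mH); apply: measurable_fun_pair.
  move=> x _; rewrite /H/= patchE indicE; case: ifP => xQ; last by rewrite mule_ge0 ?sq_ge0.
  rewrite mul1e /sq !patchE; case: ifPn => [/set_mem xD|_]; last by case: ifP => // _; rewrite lee_fin sqr_ge0.
  by rewrite mem_set// ; apply: half_spaceD => //; exact: evec2_ge0.
rewrite -(@fubini_tonelli _ _ _ _ _ mu lam _ mH H0) [leRHS]integral_mkcond.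
apply: ge0_le_integral => //.
- by move=> x _; exact: integral_ge0.
- exact: (@measurable_fun_fubini_tonelli_F _ _ _ _ _ lam _ mH H0).
- apply/(measurable_restrictT _ mQ); apply: measurable_funTS.
  by apply: measurable_lint => //; exact: sq_ge0.
move=> x _; rewrite patchE; case: ifPn => xQ; last first.
  by rewrite integral0_eq// => s _; rewrite /H/= indicE (negPf xQ) mul0e.
rewrite /lint -(integral_shift1 (crd i x)); [|exact: measurable_line|by move=> s; exact: sq_ge0].
rewrite le_eqVlt; apply/orP; left; apply/eqP; apply: eq_integral => s _.
by rewrite /H/= indicE xQ mul1e; congr (sq f _); exact: upd_shift.
Qed.

(** The value of a at a point is controlled by the averages of a and g over a unit segment in
    direction i: one derivative buys the integral of the weight over the lines in direction i. *)
Lemma core_ineq i a g K : weak1 i a g -> measurable_fun setT K -> (forall x, 0 <= K x)%E ->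
  (\int[mu]_x (sq a x * K x) <=
    2%:E * (\int[mu]_x (sq a x * lint i K x) + \int[mu]_x (sq g x * lint i K x)))%E.
Proof.
move=> w mK K0; have [La Lg _] := w.
have ma := measurable_sq La; have mg := measurable_sq Lg.
have pa := @sq_ge0 a; have pg := @sq_ge0 g.
have mla := measurable_lint i ma pa; have mlg := measurable_lint i mg pg.
have pla x : (0 <= lint i (sq a) x)%E by exact: lint_ge0.
have plg x : (0 <= lint i (sq g) x)%E by exact: lint_ge0.
rewrite (lint_adj i ma mK pa K0) (lint_adj i mg mK pg K0).
have -> : (\int[mu]_x (K x * lint i (sq a) x) = \int[mu]_x (lint i (sq a) x * K x))%E.
  by apply: eq_integral => x _; rewrite muleC.
have -> : (\int[mu]_x (K x * lint i (sq g) x) = \int[mu]_x (lint i (sq g) x * K x))%E.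
  by apply: eq_integral => x _; rewrite muleC.
rewrite -ge0_integralD//; [|by move=> x _; rewrite mule_ge0|exact: emeasurable_funM|by move=> x _; rewrite mule_ge0|exact: emeasurable_funM].
rewrite -ge0_integralZl//; [|by apply: emeasurable_funD; exact: emeasurable_funM|by move=> x _; rewrite adde_ge0 ?mule_ge0].
have E x : (2%:E * (lint i (sq a) x * K x + lint i (sq g) x * K x) = (2%:E * (lint i (sq a) x + lint i (sq g) x)) * K x)%E.
  by rewrite -ge0_muleDl// muleA.
under [leRHS]eq_integral do rewrite E.
apply: weight_le => //.
- by apply: emeasurable_funM => //; apply: emeasurable_funD.
- by move=> x; rewrite mule_ge0// adde_ge0.
- by rewrite integral_sqT// ltry.
move=> Q mQ; rewrite integral_sq//.
rewrite ge0_integralZl//; [|by apply: emeasurable_funD; exact: measurable_funTS|by move=> x _; rewrite adde_ge0].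
rewrite ge0_integralD//; [|exact: measurable_funTS|exact: measurable_funTS].
apply: (@le_trans _ _ ((2 * (\int[lam]_(s in `[0, 1]) nrm (res Q (sh (s *: evec i) a)) ^+ 2
     + \int[lam]_(s in `[0, 1]) nrm (res Q (sh (s *: evec i) g)) ^+ 2))%:E)).
  by rewrite lee_fin; exact: line_average.
by rewrite EFinM [X in (_ * X <= _)%E]EFinD lee_wpmul2l// leeD// average_lint.
Qed.

(** All orders of differentiation are included and share one bound, so that estimates of
    products and commutators do not refer to multi-indices. *)
Fixpoint sob (m : nat) a (N : R) : Prop :=
  [/\ is_L2 a, nrm a ^+ 2 <= N &
   if m is m'.+1 then forall i, exists2 g, weak1 i a g & sob m' g N else True].

Lemma sob_L2 m a N : sob m a N -> is_L2 a.
Proof. by case: m => [|m] []. Qed.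

Lemma sob_nrm m a N : sob m a N -> nrm a ^+ 2 <= N.
Proof. by case: m => [|m] []. Qed.

Lemma sobS m a N : sob m.+1 a N -> sob m a N.
Proof.
elim: m a => [|m IH] a; first by case.
move=> [La Na H]; split => // i; have [g w sg] := H i; exists g => //; exact: IH.
Qed.

Lemma sob_leq m n a N : (m <= n)%N -> sob n a N -> sob m a N.
Proof. by move=> /subnK <-; elim: (n - m)%N => // k IH; rewrite addSn => /sobS. Qed.

(** The previous inequality passes to functions with one more derivative, since both a and its
    derivative in direction i have m of them. *)
Lemma core_step (m : nat) i (N B : R) K : measurable_fun setT K -> (forall x, 0 <= K x)%E ->
  (forall a, sob m a N -> \int[mu]_x (sq a x * lint i K x) <= B%:E)%E ->
  forall a, sob m.+1 a N -> (\int[mu]_x (sq a x * K x) <= (4 * B)%:E)%E.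
Proof.
move=> mK K0 H a sa; have [_ _ /(_ i)[g w sg]] := sa.
apply: (le_trans (core_ineq w mK K0)).
have -> : (4 * B)%:E = (2%:E * (B%:E + B%:E))%E by rewrite -EFinD -EFinM; congr EFin; ring.
by rewrite lee_wpmul2l// leeD//; apply: H => //; exact: sobS.
Qed.

Let o1 : (0 < 3)%N := isT.
Let o2 : (1 < 3)%N := isT.
Let o3 : (2 < 3)%N := isT.

Let weight_cst (c : \bar R) a N : (0 <= c)%E -> sob 0 a N -> (\int[mu]_x (sq a x * c) <= c * N%:E)%E.
Proof.
move=> c0 [La Na _]; rewrite ge0_integralZr//; [|exact: measurable_sq|by move=> x _; exact: sq_ge0].
by rewrite integral_sqT// muleC lee_wpmul2l// lee_fin.
Qed.

Lemma prod03 a b Na Nb : sob 0 a Na -> sob 3 b Nb ->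
  (\int[mu]_x (sq b x * sq a x) <= (64 * (Na * Nb))%:E)%E.
Proof.
move=> sa sb; have [La Ha _] := sa.
have ma := measurable_sq La; have pa := @sq_ge0 a.
pose K1 := lint (Ordinal o3) (sq a); pose K2 := lint (Ordinal o2) K1.
have mK1 : measurable_fun setT K1 by exact: measurable_lint.
have pK1 x : (0 <= K1 x)%E by exact: lint_ge0.
have mK2 : measurable_fun setT K2 by exact: measurable_lint.
have pK2 x : (0 <= K2 x)%E by exact: lint_ge0.
have -> : 64 * (Na * Nb) = 4 * (4 * (4 * (Na * Nb))) by ring.
apply: (@core_step 2 (Ordinal o3) Nb) sb => // {}b.
apply: (@core_step 1 (Ordinal o2) Nb) => // {}b.
apply: (@core_step 0 (Ordinal o1) Nb) => // {}b sb.
under eq_integral do rewrite lint3//.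
apply: (le_trans (weight_cst _ sb)); first exact: integral_ge0.
have Nb0 : 0 <= Nb by apply: le_trans (sob_nrm sb); exact: sqr_ge0.
by rewrite integral_sqT// -EFinM lee_fin ler_wpM2r.
Qed.

Lemma prod12 a b Na Nb : sob 1 a Na -> sob 2 b Nb ->
  (\int[mu]_x (sq a x * sq b x) <= (64 * (Na * Nb))%:E)%E.
Proof.
move=> sa sb; have Lb := sob_L2 sb; have mb := measurable_sq Lb; have pb := @sq_ge0 b.
have -> : 64 * (Na * Nb) = 4 * (4 * (4 * (Na * Nb))) by ring.
apply: (@core_step 0 (Ordinal o3) Na) sa => // {}a sa.
have [La Ha _] := sa; have ma := measurable_sq La; have pa := @sq_ge0 a.
rewrite lint_adj//.
pose K1 := lint (Ordinal o3) (sq a); pose K2 := lint (Ordinal o2) K1.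
have mK1 : measurable_fun setT K1 by exact: measurable_lint.
have pK1 x : (0 <= K1 x)%E by exact: lint_ge0.
have mK2 : measurable_fun setT K2 by exact: measurable_lint.
have pK2 x : (0 <= K2 x)%E by exact: lint_ge0.
apply: (@core_step 1 (Ordinal o2) Nb) sb => // {Lb mb pb}b.
apply: (@core_step 0 (Ordinal o1) Nb) => // {}b sb.
under eq_integral do rewrite lint3//.
apply: (le_trans (weight_cst _ sb)); first exact: integral_ge0.
have Nb0 : 0 <= Nb by apply: le_trans (sob_nrm sb); exact: sqr_ge0.
by rewrite integral_sqT// -EFinM lee_fin ler_wpM2r.
Qed.

(** With the square of one factor as weight, integrating it over a line in direction i costs
    one derivative of the other factor.  After three directions the weight is constant; p and q say
    how the three derivatives are shared. *)
Lemma sob_prod p q a b Na Nb : (3 <= p + q)%N -> sob p a Na -> sob q b Nb ->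
  is_L2 (a \* b) /\ nrm (a \* b) ^+ 2 <= 64 * (Na * Nb).
Proof.
move=> pq sa sb; have La := sob_L2 sa; have Lb := sob_L2 sb.
have mab : measurable_fun (D : set E3) (a \* b) by apply: measurable_funM; exact: L2_meas.
have I : (\int[mu]_x (sq a x * sq b x) <= (64 * (Na * Nb))%:E)%E.
  case: p pq sa => [|[|[|p]]] pq sa.
  - under eq_integral do rewrite muleC.
    by apply: prod03 sa _; apply: sob_leq sb; lia.
  - by apply: prod12 sa _; apply: sob_leq sb; lia.
  - under eq_integral do rewrite muleC.
    rewrite (mulrC Na); apply: prod12 (sob_leq _ sb) sa; lia.
  - rewrite (mulrC Na); apply: prod03 (sob_leq (leq0n _) sb) _.
    by apply: sob_leq sa.
have E : sqnorm (a \* b) = (\int[mu]_x (sq a x * sq b x))%E.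
  rewrite /sqnorm integral_mkcond; apply: eq_integral => x _; rewrite /sq !patchE.
  by case: ifP => //= _; rewrite ?mule0// -EFinM exprMn.
have Lab : is_L2 (a \* b).
  by split; [exact: mab|rewrite E; apply: le_lt_trans I _; exact: ltry].
by split => //; rewrite -lee_fin nrm2 -sqnormE// E.
Qed.

End product.

Section sobolev.
Context {R : realType}.
Local Notation D := (@half_space R).
Implicit Types (f g a b : R3 R -> R).

Lemma sob_mono m a N N' : N <= N' -> sob m a N -> sob m a N'.
Proof.
move=> NN; elim: m a => [|m IH] a [La Na H]; split => //; try exact: le_trans NN.
by move=> i; have [g w sg] := H i; exists g => //; exact: IH.
Qed.

Lemma sob_ge0 m a N : sob m a N -> 0 <= N.
Proof. by move=> /sob_nrm; apply: le_trans; exact: sqr_ge0. Qed.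

Lemma nrm_subrr g : nrm (g \- g) = 0.
Proof. by rewrite (_ : g \- g = fun=> 0) ?nrm0//; apply/funext => x /=; rewrite subrr. Qed.

Lemma sob_ext m a a' N : is_L2 a' -> nrm (a \- a') = 0 -> sob m a N -> sob m a' N.
Proof.
move=> La' aa sa; have La := sob_L2 sa; have E := nrm_ext La La' aa.
case: m sa => [|m] [_ Na H]; split => //; rewrite -?E//.
move=> i; have [g w sg] := H i; exists g => //.
by apply: weak1_ext w => //; [exact: sob_L2 sg|exact: nrm_subrr].
Qed.

Lemma sob_sh m (v : R3 R) a N : 0 <= v.2 -> sob m a N -> sob m (sh v a) N.
Proof.
move=> v0; elim: m a => [|m IH] a [La Na H].
  split=> //; first exact: L2_sh.
  by apply: le_trans Na; rewrite ler_pXn2r ?nnegrE ?nrm_ge0//; exact: nrm_sh.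
split; first exact: L2_sh.
  by apply: le_trans Na; rewrite ler_pXn2r ?nnegrE ?nrm_ge0//; exact: nrm_sh.
by move=> i; have [g w sg] := H i; exists (sh v g); [exact: weak1_sh|exact: IH].
Qed.

Lemma sob_dq m i h a N : 0 < h <= 1 -> sob m.+1 a N -> sob m (dq i h a) N.
Proof.
move=> hh; have /andP[h0 _] := hh.
have B m' a' : sob m'.+1 a' N -> nrm (dq i h a') ^+ 2 <= N.
  move=> [_ _ /(_ i)[g w sg]]; apply: le_trans (sob_nrm sg).
  by rewrite ler_pXn2r ?nnegrE ?nrm_ge0//; exact: nrm_dq_le.
elim: m a => [|m IH] a sa; have {}B := B _ _ sa; have [La Na H] := sa.
  by split => //; exact: L2_dq (ltW h0) La.
split => //; first exact: L2_dq (ltW h0) La.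
move=> j; have [gj wj sgj] := H j; exists (dq i h gj); first exact: weak1_dq (ltW h0) wj.
exact: IH.
Qed.

Lemma ord3P (j : 'I_3) : [\/ j = ord0, j = inord 1 | j = ord_max].
Proof.
case: j => -[|[|[|//]]] p; [constructor 1|constructor 2|constructor 3]; apply/val_inj => //=.
by rewrite inordK.
Qed.

Lemma common3 (P : 'I_3 -> R -> Prop) :
  (forall j, exists2 d, 0 < d <= 1 & forall h, 0 < h <= d -> P j h) ->
  exists2 d, 0 < d <= 1 & forall h, 0 < h <= d -> forall j, P j h.
Proof.
move=> H; have [d1 /andP[p1 q1] H1] := H ord0; have [d2 /andP[p2 _] H2] := H (inord 1).
have [d3 /andP[p3 _] H3] := H ord_max.
exists (Num.min d1 (Num.min d2 d3)); first by rewrite !lt_min p1 p2 p3 ge_min q1.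
move=> h; rewrite !le_min => /andP[h0 /and3P[h1 h2 h3]] j.
by case: (ord3P j) => ->; [apply: H1|apply: H2|apply: H3]; rewrite h0.
Qed.

Lemma sob_dq_cvg m i a g N e : sob m.+1 a N -> weak1 i a g -> 0 < e ->
  exists2 d, 0 < d <= 1 & forall h, 0 < h <= d -> sob m (dq i h a \- g) e.
Proof.
elim: m a g => [|m IH] a g sa w e0; have [La Lg _] := w.
all: have [d0 hd0 H0] : exists2 d, 0 < d <= 1 & forall h, 0 < h <= d -> nrm (dq i h a \- g) ^+ 2 <= e.
1,3: have s0 : 0 < Num.sqrt e by rewrite sqrtr_gt0.
1,2: have [d hd H] := dq_cvg w s0; exists d => // h hh.
1,2: by rewrite -(sqr_sqrtr (ltW e0)) ler_pXn2r ?nnegrE ?nrm_ge0 ?sqrtr_ge0//; exact: H.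
  exists d0 => // h hh; split; [|exact: H0|by []].
  by apply: L2B => //; apply: L2_dq => //; case/andP: hh => /ltW.
have [_ _ H] := sa.
have [g0 w0 sg0] : exists2 g, weak1 i a g & sob m.+1 g N := H i.
have sg : sob m.+1 g N by apply: sob_ext sg0 => //; exact: weak1_uniq w0 w.
have [d hd H1] : exists2 d, 0 < d <= 1 & forall h, 0 < h <= d -> forall j,
    exists2 g', weak1 j (dq i h a \- g) g' & sob m g' e.
  apply: common3 => j; have [gj wj sgj] := H j; have [_ _ /(_ j)[gij wij sgij]] := sg.
  have wji := weak1_swap w wj wij.
  have [d hd Hd] := IH _ _ sgj wji e0; exists d => // h hh.
  exists (dq i h gj \- gij); last exact: Hd.
  by apply: weak1B wij; apply: weak1_dq wj; case/andP: hh => /ltW.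
have /andP[a1 a2] := hd; have /andP[b1 b2] := hd0.
exists (Num.min d d0); first by rewrite lt_min a1 b1 ge_min a2.
move=> h; rewrite le_min => /andP[h0 /andP[h1 h2]]; split.
- by apply: L2B => //; apply: L2_dq => //; exact: ltW.
- by apply: H0; rewrite h0.
- by apply: H1; rewrite h0.
Qed.

(** ** Iterated difference quotients *)

Fixpoint Dw (h : R) (w : seq 'I_3) f : R3 R -> R :=
  if w is i :: w' then Dw h w' (dq i h f) else f.

(** The weak derivative of a along the letters of w, the first letter being
    differentiated first. *)
Fixpoint wk (w : seq 'I_3) a g : Prop :=
  if w is i :: w' then exists2 b, weak1 i a b & wk w' b g
  else [/\ is_L2 a, is_L2 g & nrm (a \- g) = 0].

Lemma sob_Dw m h w a N : 0 < h <= 1 -> sob (m + size w) a N -> sob m (Dw h w a) N.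
Proof.
move=> hh; elim: w a => [|i w IH] a /=; first by rewrite addn0.
by rewrite addnS => /(sob_dq i hh)/IH.
Qed.

Lemma dqB i h f g : dq i h (f \- g) = dq i h f \- dq i h g.
Proof. by apply/funext => x; rewrite /dq /=; ring. Qed.

Lemma dqD i h f g : dq i h (f \+ g) = dq i h f \+ dq i h g.
Proof. by apply/funext => x; rewrite /dq /=; ring. Qed.

Lemma dqZ i h c f : dq i h (c \*o f) = c \*o dq i h f.
Proof. by apply/funext => x; rewrite /dq /=; ring. Qed.

Lemma DwB h w f g : Dw h w (f \- g) = Dw h w f \- Dw h w g.
Proof. by elim: w f g => //= i w IH f g; rewrite dqB IH. Qed.

Lemma DwD h w f g : Dw h w (f \+ g) = Dw h w f \+ Dw h w g.
Proof. by elim: w f g => //= i w IH f g; rewrite dqD IH. Qed.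

Lemma DwZ h w c f : Dw h w (c \*o f) = c \*o Dw h w f.
Proof. by elim: w f => //= i w IH f; rewrite dqZ IH. Qed.

Lemma L2_Dw h w f : 0 <= h -> is_L2 f -> is_L2 (Dw h w f).
Proof. by move=> h0; elim: w f => //= i w IH f Lf; apply: IH; exact: L2_dq. Qed.

(** The constant blows up as h tends to 0, but only one step is considered at a time. *)
Lemma nrm_dq_fix i h : 0 < h -> exists2 C, 0 <= C & forall f, is_L2 f -> nrm (dq i h f) <= C * nrm f.
Proof.
move=> h0; exists (2 * h^-1); first by rewrite mulr_ge0// invr_ge0 ltW.
move=> f Lf; have Ls : is_L2 (sh (h *: evec i) f) by apply: L2_sh => //; exact: evec2_ge0 (ltW h0).
rewrite dqE nrmZ; last exact: L2B.
rewrite ger0_norm ?invr_ge0 ?(ltW h0)// [2 * _]mulrC -mulrA ler_wpM2l ?invr_ge0 ?(ltW h0)//.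
apply: le_trans (nrmB Ls Lf) _; rewrite mulr_natl mulr2n lerD2r; apply: nrm_sh => //.
exact: evec2_ge0 (ltW h0).
Qed.

Lemma nrm_Dw_fix h w : 0 < h -> exists2 C, 0 <= C & forall f, is_L2 f -> nrm (Dw h w f) <= C * nrm f.
Proof.
move=> h0; elim: w => [|i w [C C0 HC]] /=; first by exists 1 => // f _; rewrite mul1r.
have [C' C'0 HC'] := nrm_dq_fix i h0; exists (C * C'); first exact: mulr_ge0.
move=> f Lf; apply: le_trans (HC _ (L2_dq i (ltW h0) Lf)) _.
by rewrite -mulrA ler_wpM2l// HC'.
Qed.

(** The limit is taken in one quotient at a time: the first one converges in the Sobolev norm
    of order one less, and for a fixed step the others are bounded operators. *)
Lemma Dw_cvg w a g N e : sob (size w) a N -> wk w a g -> 0 < e ->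
  exists2 d, 0 < d <= 1 & forall h, 0 < h <= d -> nrm (Dw h w a \- g) <= e.
Proof.
elim: w a g e => [|i w IH] a g e sa /=.
  by move=> [_ _ ->] e0; exists 1 => [|h _]; [rewrite ltr01 lexx|exact: ltW].
move=> [b wb wkb] e0; have [_ _ /(_ i)[b' wb' sb']] := sa.
have [La Lb _] := wb.
have sb : sob (size w) b N by apply: sob_ext sb' => //; exact: weak1_uniq wb' wb.
have Lg : is_L2 g.
  by elim: w b wkb {IH sa sb' sb wb wb' Lb} => [|j w IH] b /=; [case|case=> c _ /IH].
have e2 : 0 < e / 2 by rewrite divr_gt0.
have [d1 /andP[p1 q1] H1] := IH _ _ _ sb wkb e2.
have e4 : 0 < (e / 2) ^+ 2 by rewrite exprn_gt0.
have [d2 /andP[p2 q2] H2] := sob_dq_cvg sa wb e4.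
exists (Num.min d1 d2); first by rewrite lt_min p1 p2 ge_min q1.
move=> h; rewrite le_min => /andP[h0 /andP[h1 h2]].
have hh : 0 < h <= 1 by rewrite h0 (le_trans h1).
have Lq := L2_dq i (ltW h0) La.
have LDq := L2_Dw w (ltW h0) Lq; have LDb := L2_Dw w (ltW h0) Lb.
apply: le_trans (nrm_dist LDq LDb Lg) _; rewrite [leRHS]splitr; apply: lerD; last first.
  by apply: H1; rewrite h0.
rewrite -DwB -(@ler_pXn2r _ 2)// ?nnegrE ?nrm_ge0 ?(ltW e2)//.
apply: (@sob_nrm _ 0); apply: sob_Dw => //.
by rewrite add0n; apply: H2; rewrite h0.
Qed.

Lemma wk_nrm w a g N : sob (size w) a N -> wk w a g -> nrm g ^+ 2 <= N /\ is_L2 g.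
Proof.
elim: w a => [|i w IH] a sa /=.
  by move=> [La Lg E]; rewrite -(nrm_ext La Lg E); split => //; exact: sob_nrm sa.
move=> [b wb wkb]; have [_ _ /(_ i)[b' wb' sb']] := sa; apply: IH wkb.
by have [_ Lb _] := wb; apply: sob_ext sb' => //; exact: weak1_uniq wb' wb.
Qed.

End sobolev.

Section commutator.
Context {R : realType}.
Local Notation D := (@half_space R).
Local Notation mu := (@leb3 R).
Local Notation RR := (measurableTypeR R).
Local Notation E3 := (RR * RR * RR)%type.
Implicit Types (f g a b x y X : R3 R -> R).

(** * Commutators of difference quotients with products *)

Lemma dqM i h a b : dq i h (a \* b) = (a \* dq i h b) \+ (dq i h a \* sh (h *: evec i) b).
Proof. by apply/funext => z; rewrite /dq /sh /=; ring. Qed.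

Lemma sob_prod_nrm p q a b Na Nb : (3 <= p + q)%N -> sob p a Na -> sob q b Nb ->
  is_L2 (a \* b) /\ nrm (a \* b) <= 8 * Num.sqrt (Na * Nb).
Proof.
move=> pq sa sb; have [Lab H] := sob_prod pq sa sb; split => //.
have NN : 0 <= Na * Nb := mulr_ge0 (sob_ge0 sa) (sob_ge0 sb).
have h8 : 0 <= 8 * Num.sqrt (Na * Nb) by rewrite mulr_ge0 ?sqrtr_ge0.
rewrite -(@ler_pXn2r _ 2)// ?nnegrE ?nrm_ge0//; apply: le_trans H _.
by rewrite exprMn sqr_sqrtr//; have -> : (8 : R) ^+ 2 = 64 by rewrite -natrX.
Qed.

Lemma L2_sob0 f : is_L2 f -> sob 0 f (nrm f ^+ 2).
Proof. by []. Qed.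

Lemma sob_mulL2 m a N f : (3 <= m)%N -> sob m a N -> is_L2 f ->
  is_L2 (a \* f) /\ nrm (a \* f) <= 8 * Num.sqrt N * nrm f.
Proof.
move=> m3 sa Lf; have [|L H] := @sob_prod_nrm m 0 a f N (nrm f ^+ 2) _ sa (L2_sob0 Lf).
  by rewrite addn0.
split => //; apply: le_trans H _.
by rewrite sqrtrM ?(sob_ge0 sa)// sqrtr_sqr ger0_norm ?nrm_ge0// mulrA.
Qed.

Lemma Dw_prod h w p q x y Nx Ny : 0 < h <= 1 -> (size w <= p)%N -> (size w <= q)%N ->
  (size w + 3 <= p + q)%N -> sob p x Nx -> sob q y Ny ->
  is_L2 (Dw h w (x \* y)) /\ nrm (Dw h w (x \* y)) <= 8 * 4 ^+ size w * Num.sqrt (Nx * Ny).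
Proof.
move=> hh; elim: w p q x y => [|i w IH] p q x y /=.
  by rewrite expr0 mulr1 add0n => _ _; exact: sob_prod_nrm.
case: p => // p; case: q => // q => wp wq pq sx sy.
have /andP[h0 _] := hh; have v0 := @evec2_ge0 _ i _ (ltW h0).
rewrite dqM DwD.
have [L1 B1] : is_L2 (Dw h w (x \* dq i h y)) /\
   nrm (Dw h w (x \* dq i h y)) <= 8 * 4 ^+ size w * Num.sqrt (Nx * Ny).
  by apply: (IH p.+1 q); [lia|lia|lia|exact: sx|exact: sob_dq sy].
have [L2 B2] : is_L2 (Dw h w (dq i h x \* sh (h *: evec i) y)) /\
   nrm (Dw h w (dq i h x \* sh (h *: evec i) y)) <= 8 * 4 ^+ size w * Num.sqrt (Nx * Ny).
  by apply: (IH p q.+1); [lia|lia|lia|exact: sob_dq sx|exact: sob_sh sy].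
split; first exact: L2D.
apply: le_trans (nrmD L1 L2) _; apply: le_trans (lerD B1 B2) _.
set s := Num.sqrt _; have s0 : 0 <= s := sqrtr_ge0 _.
have : 0 <= (4 : R) ^+ size w by rewrite exprn_ge0.
rewrite exprS; move: (4 ^+ _) => t t0; have := mulr_ge0 t0 s0; clear; lra.
Qed.

Definition Com h w a b : R3 R -> R := Dw h w (a \* b) \- (a \* Dw h w b).

Lemma Com_cons h i w a b :
  Com h (i :: w) a b = Com h w a (dq i h b) \+ Dw h w (dq i h a \* sh (h *: evec i) b).
Proof. by rewrite /Com /= dqM DwD; apply/funext => z /=; ring. Qed.

(** In the Leibniz rule for difference quotients each term of the commutator contains at least
    one difference of a, hence at most size w - 1 differences of b. *)
Lemma Com_bound h w p q a b Na Nb : 0 < h <= 1 -> (size w <= q.+1)%N -> (size w <= p)%N ->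
  (size w + 3 <= p + q)%N -> sob p a Na -> sob q b Nb ->
  is_L2 (Com h w a b) /\ nrm (Com h w a b) <= 8 * 4 ^+ size w * Num.sqrt (Na * Nb).
Proof.
move=> hh; elim: w p q a b => [|i w IH] p q a b.
  have -> : Com h [::] a b = fun=> 0 by apply/funext => z; rewrite /Com/= subrr.
  by move=> *; split; [exact: L20|rewrite nrm0 !mulr_ge0 ?sqrtr_ge0 ?exprn_ge0].
rewrite Com_cons /= => wq wp pq sa sb.
have /andP[h0 _] := hh; have v0 := @evec2_ge0 _ i _ (ltW h0).
case: p wp pq sa => // p wp pq sa.
have [L2 B2] : is_L2 (Dw h w (dq i h a \* sh (h *: evec i) b)) /\
   nrm (Dw h w (dq i h a \* sh (h *: evec i) b)) <= 8 * 4 ^+ size w * Num.sqrt (Na * Nb).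
  by apply: (@Dw_prod h w p q); [exact: hh|lia|lia|lia|exact: sob_dq sa|exact: sob_sh sb].
have [L1 B1] : is_L2 (Com h w a (dq i h b)) /\
   nrm (Com h w a (dq i h b)) <= 8 * 4 ^+ size w * Num.sqrt (Na * Nb).
  case: q wq pq sb {L2 B2} => [|q] wq pq sb.
    move: wq; rewrite ltnS leqn0 => /nilP ->.
    have -> : Com h [::] a (dq i h b) = fun=> 0 by apply/funext => z; rewrite /Com/= subrr.
    by split; [exact: L20|rewrite nrm0 !mulr_ge0 ?sqrtr_ge0 ?exprn_ge0].
  by apply: (IH p.+1 q); [lia|lia|lia|exact: sa|exact: sob_dq sb].
split; first exact: L2D.
apply: le_trans (nrmD L1 L2) _; apply: le_trans (lerD B1 B2) _.
set s := Num.sqrt _; have s0 : 0 <= s := sqrtr_ge0 _.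
have : 0 <= (4 : R) ^+ size w by rewrite exprn_ge0.
rewrite exprS; move: (4 ^+ _) => t t0; have := mulr_ge0 t0 s0; clear; lra.
Qed.

Lemma ComBl h w a a' b : Com h w (a \- a') b = Com h w a b \- Com h w a' b.
Proof.
rewrite /Com (_ : (a \- a') \* b = (a \* b) \- (a' \* b)); last first.
  by apply/funext => z /=; ring.
by rewrite DwB; apply/funext => z /=; ring.
Qed.

Lemma ComBr h w a b b' : Com h w a (b \- b') = Com h w a b \- Com h w a b'.
Proof.
rewrite /Com (_ : a \* (b \- b') = (a \* b) \- (a \* b')); last first.
  by apply/funext => z /=; ring.
by rewrite !DwB; apply/funext => z /=; ring.
Qed.

(** * The transport term *)

(** Functions that lose no mass under translation in direction j: either the
    translation is tangential to the boundary, or u vanishes there at a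
    linear rate. *)
Definition tangent (j : 'I_3) (u : R3 R -> R) : Prop :=
  (j != ord_max) \/
  exists2 C, 0 <= C & forall z, D z -> z.2 <= 1 -> `|u z| <= C * z.2.

Lemma norm_bool (b : bool) : `|b%:R : R| <= 1.
Proof. by case: b; rewrite ?normr1 ?normr0. Qed.

Lemma near_bd_small X e : is_L2 X -> 0 < e -> exists2 d, 0 < d <= 1 &
  forall h, 0 < h <= d -> nrm (fun z => X z * (z.2 <= h)%R%:R) <= e.
Proof.
move=> LX e0.
have mb (h : R) : measurable_fun (D : set E3) (fun z : E3 => (z.2 <= h)%R%:R : R).
  rewrite (_ : (fun z => _) = (\1_(`]-oo, h] : set RR) \o snd)%R); last first.
    by apply/funext => z; rewrite /= indicE; congr ((nat_of_bool _)%:R); apply/idP/idP => [|/set_mem/=];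
      rewrite ?in_itv//= => hh; apply/mem_set; rewrite /= in_itv.
  have mi : measurable_fun setT (\1_(`]-oo, h] : set RR) : RR -> R).
    by apply: measurable_indic; exact: measurable_itv.
  apply: measurable_funTS; exact: (measurableT_comp mi measurable_snd).
pose F (n : nat) z := X z * (1 - (z.2 <= n.+1%:R^-1)%R%:R).
have mF n : measurable_fun D (F n).
  apply: measurable_funM; first exact: L2_meas.
  by apply: measurable_funB; [exact: measurable_cst|exact: mb].
have [n Hn] : exists n, nrm (X \- F n) <= e.
  apply: (@nrm_dct R F X X) => //; first exact: L2_meas.
    move=> n z _; have -> : X z - F n z = X z * (z.2 <= n.+1%:R^-1)%R%:R by rewrite /F; ring.
    by rewrite normrM ler_piMr// norm_bool.
  move=> z Dz; have z0 : 0 < z.2 := Dz.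
  apply: cvg_near_cst; exists (Num.truncn (z.2)^-1) => // n /= hn.
  rewrite /F leNgt (_ : _ < _) ?subr0 ?mulr1//.
  rewrite -[ltRHS]invrK ltf_pV2 ?posrE ?invr_gt0 ?ltr0n//.
  by apply: lt_le_trans (truncnS_gt _) _; rewrite ler_nat.
exists n.+1%:R^-1; first by rewrite invr_gt0 ltr0n invf_le1 ?ler1n ?ltr0n.
move=> h /andP[h0 hn]; apply: le_trans Hn; apply: le_nrm.
- apply: (L2_le _ LX); first by apply: measurable_funM; [exact: L2_meas|exact: mb].
  by move=> z _; rewrite normrM ler_piMr// norm_bool.
- apply: (L2_le _ LX); first by apply: measurable_funB; [exact: L2_meas|exact: mF].
  move=> z _ /=; have -> : X z - F n z = X z * (z.2 <= n.+1%:R^-1)%R%:R by rewrite /F; ring.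
  by rewrite normrM ler_piMr// norm_bool.
move=> z _ /=; have -> : X z - F n z = X z * (z.2 <= n.+1%:R^-1)%R%:R by rewrite /F; ring.
rewrite !normrM ler_wpM2l//; case: (leP z.2 h) => [zh|_]; last by rewrite normr0.
by rewrite (le_trans zh hn).
Qed.

End commutator.

Section transport.
Context {R : realType}.
Local Notation D := (@half_space R).
Local Notation mu := (@leb3 R).
Local Notation RR := (measurableTypeR R).
Local Notation E3 := (RR * RR * RR)%type.
Implicit Types (f g a b u d X : R3 R -> R).

Lemma ip_mulC a X Y : ip (a \* X) Y = ip (a \* Y) X.
Proof. by rewrite !ipE; congr intO; apply/funext => z /=; ring. Qed.

Section shift_difference.
Variables (j : 'I_3) (u X : R3 R -> R) (N : R).
Hypotheses (su : sob 4 u N) (LX : is_L2 X).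
Local Notation S h f := (sh (h *: evec j) f).

Let su' h : 0 <= h -> sob 4 (S h u) N.
Proof. by move=> h0; apply: sob_sh => //; exact: evec2_ge0. Qed.

Let mulL2 m a f : sob m.+3 a N -> is_L2 f -> is_L2 (a \* f).
Proof. by move=> sa Lf; have [] := sob_mulL2 (isT : (3 <= m.+3)%N) sa Lf. Qed.

(** The mass gained by u X^2 under translation, divided by h. *)
Definition gain h := h^-1 * (ip (S h (u \* X)) (S h X) - ip (u \* X) X).

Lemma gainE h : 0 < h <= 1 ->
  gain h = ip (dq j h u \* X) X + ip (S h u \* dq j h X) (S h X \+ X).
Proof.
move=> hh; have /andP[h0 _] := hh; have h0' := ltW h0.
have LX' : is_L2 (S h X) by apply: L2_sh => //; exact: evec2_ge0.
have L1 := mulL2 su LX; have L2 := mulL2 (su' h0') LX; have L3 := mulL2 (su' h0') LX'.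
have -> : dq j h u \* X = h^-1 \*o ((S h u \* X) \- (u \* X)).
  by apply/funext => z; rewrite /dq /sh /=; ring.
have -> : S h u \* dq j h X = h^-1 \*o ((S h u \* S h X) \- (S h u \* X)).
  by apply/funext => z; rewrite /dq /sh /=; ring.
rewrite ipZl ?ipBl//; last exact: L2B.
have L4 : is_L2 (S h X \+ X) by exact: L2D.
rewrite (ipZl h^-1 (L2B L3 L2) L4) (ipBl L3 L2 L4) (ipDr LX' LX L3) (ipDr LX' LX L2).
rewrite /gain (ip_mulC _ (S h X) X) -mulrDr; congr (_ * _).
have -> : S h (u \* X) = S h u \* S h X by [].
by ring.
Qed.

(** A translation along the boundary preserves the integral.  In the normal direction only a
    layer of width h is lost, where u is of size h, so that the loss divided by h is bounded by the
    integral of X^2 over the layer. *)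
Lemma gain_tangent : tangent j u -> forall e, 0 < e -> exists2 d, 0 < d <= 1 &
  forall h, 0 < h <= d -> `|gain h| <= e.
Proof.
move=> tj e e0; have Lu := mulL2 su LX.
have [jm|jm] := boolP (j == ord_max); last first.
  exists 1 => [|h /andP[h0 _]]; first by rewrite ltr01 lexx.
  have v2 : (h *: evec j : R3 R).2 = 0.
    by rewrite /evec/= /GRing.scale/= (_ : (j == 2 :> nat) = false) ?mulr0//; apply: contraNF jm => /eqP jm; apply/eqP/val_inj.
  rewrite /gain (_ : ip (S h _) _ = ip (u \* X) X) ?subrr ?mulr0 ?normr0 ?(ltW e0)//.
  rewrite !ipE; apply: (@intO_shift R (h *: evec j) (fun z => (u \* X) z * X z)).
  - by rewrite v2.
  - exact: L2_mul.
  - by move=> z z0; rewrite v2 leNgt z0.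
case: tj => [/negP//|[C C0 HC]].
have C1 : 0 < C + 1 by rewrite ltr_wpDl.
have s0 : 0 < Num.sqrt (e / (C + 1)) by rewrite sqrtr_gt0 divr_gt0.
have [d /andP[d0 d1] Hd] := near_bd_small LX s0; exists d; first by rewrite d0.
move=> h hh; have /andP[h0 hd] := hh; have h1 := le_trans hd d1.
have v2 : (h *: evec j : R3 R).2 = h by rewrite (eqP jm) /evec/= /GRing.scale/= mulr1.
pose chi z : R := ((z : R3 R).2 <= h)%R%:R.
pose X1 z := X z * chi z; pose X2 z := X z * (1 - chi z).
have mchi : measurable_fun (D : set E3) chi.
  have mi : measurable_fun setT (\1_(`]-oo, h] : set RR) : RR -> R).
    by apply: measurable_indic; exact: measurable_itv.
  rewrite (_ : chi = (\1_(`]-oo, h] : set RR) \o snd)%R); last first.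
    by apply/funext => z; rewrite /chi /= indicE; congr ((nat_of_bool _)%:R); apply/idP/idP => [|/set_mem/=];
      rewrite ?in_itv//= => zh; apply/mem_set; rewrite /= in_itv.
  apply: measurable_funTS; exact: (measurableT_comp mi measurable_snd).
have chi01 z : chi z = 0 \/ chi z = 1 by rewrite /chi; case: (z.2 <= h); [right|left].
have LX1 : is_L2 X1.
  apply: (L2_le _ LX); first by apply: measurable_funM; [exact: L2_meas|exact: mchi].
  by move=> z _; rewrite normrM ler_piMr// norm_bool.
have LX2 : is_L2 X2.
  apply: (L2_le _ LX).
    by apply: measurable_funM; [exact: L2_meas|apply: measurable_funB; [exact: measurable_cst|exact: mchi]].
  by move=> z _; rewrite normrM ler_piMr// /chi; case: (z.2 <= h); rewrite ?subrr ?subr0 ?normr1 ?normr0.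
have L1 := mulL2 su LX1; have L2 := mulL2 su LX2.
have E1 : ip (u \* X) X = ip (u \* X1) X1 + ip (u \* X2) X2.
  have -> : ip (u \* X1) X1 = ip (u \* X1) X.
    by rewrite !ipE; congr intO; apply/funext => z; rewrite /X1 /=; case: (chi01 z) => ->; ring.
  have -> : ip (u \* X2) X2 = ip (u \* X2) X.
    by rewrite !ipE; congr intO; apply/funext => z; rewrite /X2 /=; case: (chi01 z) => ->; ring.
  by rewrite -ipDl//; congr (ip _ X); apply/funext => z; rewrite /X1 /X2 /=; ring.
have E2 : ip (S h (u \* X)) (S h X) = ip (u \* X2) X2.
  rewrite !ipE -(@intO_shift R (h *: evec j) (fun z => (u \* X2) z * X2 z)).
  - apply: eq_Rintegral => z; rewrite inE => z0; rewrite /X2 /chi /sh /=.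
    have -> : ((z + h *: evec j).2 <= h) = false.
      have : 0 < z.2 := z0; rewrite -[X in _ <= X]v2.
      by have -> : (z + h *: evec j).2 = z.2 + (h *: evec j : R3 R).2 by []; rewrite gerDr leNgt => ->.
    by rewrite subr0 mulr1.
  - by rewrite v2 ltW.
  - exact: L2_mul.
  - by move=> z z0; rewrite v2 => zh; rewrite /X2 /chi zh subrr !mulr0.
rewrite /gain E1 E2 opprD addrC subrK mulrN normrN normrM normfV (gtr0_norm h0).
rewrite ler_pdivrMl//; apply: le_trans (ip_cs L1 LX1) _.
have B : nrm (u \* X1) <= C * h * nrm X1.
  rewrite -[C * h]ger0_norm ?mulr_ge0 ?(ltW h0)// -nrmZ//; apply: le_nrm => //; first exact: L2Z.
  move=> z z0; rewrite /= /X1 /chi; case: (leP z.2 h) => zh; last by rewrite mulr0 mulr0 mulr0 normr0.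
  rewrite !mulr1 !normrM; apply: ler_wpM2r => //.
  rewrite (ger0_norm C0) (gtr0_norm h0).
  by apply: le_trans (HC z z0 (le_trans zh h1)) _; rewrite ler_wpM2l.
have B2 : nrm X1 ^+ 2 <= e / (C + 1).
  rewrite -(sqr_sqrtr (ltW (divr_gt0 e0 C1))) ler_pXn2r ?nnegrE ?nrm_ge0 ?sqrtr_ge0//.
  exact: Hd hh.
apply: le_trans (ler_wpM2r (nrm_ge0 X1) B) _.
have -> : C * h * nrm X1 * nrm X1 = h * (C * nrm X1 ^+ 2) by ring.
rewrite ler_wpM2l ?(ltW h0)//; apply: le_trans (ler_wpM2l C0 B2) _.
by rewrite mulrCA ler_piMr ?(ltW e0)// ler_pdivrMr// mul1r lerDl.
Qed.

End shift_difference.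

(** The product rule for difference quotients expresses the gain of u X^2 by differences of u
    and X separately.  Its limit is the integrated divergence of u X^2, without reference to a
    derivative of X^2. *)
Lemma transport_zero j u d X Xj N : sob 4 u N -> weak1 j u d -> tangent j u ->
  weak1 j X Xj -> ip (d \* X) X + 2 * ip (u \* Xj) X = 0.
Proof.
move=> su wu tj wX; have [LX LXj _] := wX.
have N0 := sob_ge0 su; have [Lu Ld _] := wu.
have mulL2 m a f M : sob m.+3 a M -> is_L2 f -> is_L2 (a \* f).
  by move=> sa Lf; have [] := sob_mulL2 (isT : (3 <= m.+3)%N) sa Lf.
have mulB m a f M : sob m.+3 a M -> is_L2 f -> nrm (a \* f) <= 8 * Num.sqrt M * nrm f.
  by move=> sa Lf; have [] := sob_mulL2 (isT : (3 <= m.+3)%N) sa Lf.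
have sd : sob 3 d N.
  have [d' wd' sd'] : exists2 g, weak1 j u g & sob 3 g N by case: su => _ _; apply.
  apply: sob_ext sd' => //; exact: weak1_uniq wd' wu.
pose c := 8 * Num.sqrt N; have c0 : 0 <= c by rewrite mulr_ge0 ?sqrtr_ge0.
pose K := 8 * nrm X ^+ 2 + 2 * c * nrm X + 2 * c * nrm Xj * nrm X + c * nrm Xj + 1.
have p1 : 0 <= 8 * nrm X ^+ 2 by rewrite mulr_ge0 ?sqr_ge0.
have p2 : 0 <= 2 * c * nrm X by rewrite mulr_ge0 ?nrm_ge0// mulr_ge0.
have p3 : 0 <= 2 * c * nrm Xj * nrm X by rewrite !mulr_ge0 ?nrm_ge0.
have p4 : 0 <= c * nrm Xj by rewrite mulr_ge0 ?nrm_ge0.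
have K0 : 0 < K by rewrite ltr_wpDl// !addr_ge0.
apply/eqP; rewrite -normr_le0; apply/ler_addgt0Pl => e e0; rewrite addr0.
have e2 : 0 < e / 2 by rewrite divr_gt0.
pose eta := e / 2 / K; have eta0 : 0 < eta by rewrite divr_gt0.
have [d1 /andP[d10 d11] H1] := gain_tangent su LX tj e2.
have [d2 /andP[d20 _] H2] := sob_dq_cvg su wu (exprn_gt0 2 eta0).
have [d3 /andP[d30 _] H3] := dq_cvg wX eta0.
have [d4 d40 H4] := sh_cont j LX eta0.
pose h := Num.min (Num.min d1 d2) (Num.min (Num.min d3 d4) eta).
have h0 : 0 < h by rewrite !lt_min d10 d20 d30 d40.
have : h <= h by []; rewrite {2}/h !le_min => /andP[/andP[h1 h2] /andP[/andP[h3 h4] h5]].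
have hh : 0 < h <= 1 by rewrite h0 (le_trans h1).
have {}H1 := H1 h; have {}H2 := H2 h; have {}H3 := H3 h; have {}H4 := H4 h.
move: H1 H2 H3 H4; rewrite h0 (ltW h0) h1 h2 h3 h4 => /(_ isT) H1 /(_ isT) H2 /(_ isT) H3 /(_ isT) H4.
pose u' := sh (h *: evec j) u; pose X' := sh (h *: evec j) X; pose q := dq j h X.
have v0 := @evec2_ge0 _ j _ (ltW h0).
have su' : sob 4 u' N by exact: sob_sh.
have LX' : is_L2 X' by exact: L2_sh.
have Lq : is_L2 q by apply: L2_dq => //; exact: ltW.
have sdu : sob 3 (dq j h u) N by exact: sob_dq.
have nX' : nrm X' <= nrm X by exact: nrm_sh.
have LXX : is_L2 (X' \+ X) by exact: L2D.
have nXX : nrm (X' \+ X) <= 2 * nrm X.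
  by apply: le_trans (nrmD LX' LX) _; rewrite mulr_natl mulr2n lerD2r.
have LqX := L2B Lq LXj; have LXB := L2B LX' LX.
have split1 : ip (dq j h u \* X) X - ip (d \* X) X = ip ((dq j h u \- d) \* X) X.
  rewrite -ipBl//; [|exact: mulL2 sdu LX|exact: mulL2 sd LX].
  by congr (ip _ X); apply/funext => z /=; ring.
have split2 : ip (u' \* q) (X' \+ X) - 2 * ip (u \* Xj) X = 
    ip (u' \* (q \- Xj)) (X' \+ X) + h * ip (dq j h u \* Xj) (X' \+ X) + ip (u \* Xj) (X' \- X).
  have -> : u' \* (q \- Xj) = (u' \* q) \- (u' \* Xj) by apply/funext => z /=; ring.
  have -> : dq j h u = h^-1 \*o (u' \- u) by exact: dqE.
  have -> : (h^-1 \*o (u' \- u)) \* Xj = h^-1 \*o ((u' \* Xj) \- (u \* Xj)).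
    by apply/funext => z /=; ring.
  have La := mulL2 _ _ _ _ su' Lq; have Lb := mulL2 _ _ _ _ su' LXj; have Lc := mulL2 _ _ _ _ su LXj.
  rewrite (ipBl La Lb LXX) (ipZl h^-1 (L2B Lb Lc) LXX) (ipBl Lb Lc LXX).
  rewrite (ipDr LX' LX Lc) (ipBr LX' LX Lc) mulrA divff ?gt_eqF// mul1r; ring.
have B1 : `|ip (dq j h u \* X) X - ip (d \* X) X| <= eta * (8 * nrm X ^+ 2).
  rewrite split1; apply: le_trans (ip_cs (mulL2 _ _ _ _ H2 LX) LX) _.
  apply: le_trans (ler_wpM2r (nrm_ge0 _) (mulB _ _ _ _ H2 LX)) _.
  by rewrite sqrtr_sqr (gtr0_norm eta0) le_eqVlt; apply/orP; left; apply/eqP; ring.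
have B2 : `|ip (u' \* (q \- Xj)) (X' \+ X)| <= eta * (2 * c * nrm X).
  apply: le_trans (ip_cs (mulL2 _ _ _ _ su' LqX) LXX) _.
  apply: le_trans (ler_pM (nrm_ge0 _) (nrm_ge0 _) (mulB _ _ _ _ su' LqX) nXX) _.
  rewrite -/c; apply: le_trans (_ : c * eta * (2 * nrm X) <= _).
    by rewrite ler_wpM2r ?mulr_ge0 ?nrm_ge0// ler_wpM2l.
  by rewrite le_eqVlt; apply/orP; left; apply/eqP; ring.
have B3 : `|h * ip (dq j h u \* Xj) (X' \+ X)| <= eta * (2 * c * nrm Xj * nrm X).
  rewrite normrM (gtr0_norm h0); apply: ler_pM => //; first exact: ltW.
  apply: le_trans (ip_cs (mulL2 _ _ _ _ sdu LXj) LXX) _.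
  apply: le_trans (ler_pM (nrm_ge0 _) (nrm_ge0 _) (mulB _ _ _ _ sdu LXj) nXX) _.
  by rewrite -/c le_eqVlt; apply/orP; left; apply/eqP; ring.
have B4 : `|ip (u \* Xj) (X' \- X)| <= eta * (c * nrm Xj).
  apply: le_trans (ip_cs (mulL2 _ _ _ _ su LXj) LXB) _.
  apply: le_trans (ler_pM (nrm_ge0 _) (nrm_ge0 _) (mulB _ _ _ _ su LXj) H4) _.
  by rewrite -/c mulrC.
have := gainE j su LX hh; rewrite -/u' -/X' -/q => G.
set L := ip (d \* X) X + _.
have -> : L = gain j u X h - ((ip (dq j h u \* X) X - ip (d \* X) X) + (ip (u' \* q) (X' \+ X) - 2 * ip (u \* Xj) X)).
  by rewrite G /L; ring.
rewrite split2; apply: le_trans (ler_normB _ _) _; rewrite [leRHS]splitr; apply: lerD => //.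
apply: le_trans (ler_normD _ _) _; apply: le_trans (lerD (lexx _) (ler_normD _ _)) _.
apply: le_trans (lerD (lexx _) (lerD (ler_normD _ _) (lexx _))) _.
apply: le_trans (lerD B1 (lerD (lerD B2 B3) B4)) _.
have -> : e / 2 = eta * K by rewrite /eta divfK// gt_eqF.
rewrite -!mulrDr; apply: ler_wpM2l; first exact: ltW.
by rewrite /K !addrA lerDl.
Qed.

End transport.

Section rates.
Context {R : realType}.
Variable T : R.
Hypothesis T0 : 0 < T.
Implicit Types (G : R -> R) (t s : R).

(** * One-sided derivatives on a time interval *)

Lemma within_dnbhsI t (A : set R) (d : R) : 0 < d ->
  (forall s, 0 <= s <= T -> s != t -> `|s - t| <= d -> A s) -> within `[0, T] t^' A.
Proof.
move=> d0 H; rewrite /within/= /dnbhs /within/=; apply/nbhs_ballP.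
exists d => //= s /ltW; rewrite distrC => st snt; rewrite in_itv/= => sT; exact: H.
Qed.

Lemma within_dnbhsE t (A : set R) : within `[0, T] t^' A -> exists2 d, 0 < d &
  forall s, 0 <= s <= T -> s != t -> `|s - t| <= d -> A s.
Proof.
move=> /nbhs_ballP[d /= d0 H]; exists (d / 2); first by rewrite divr_gt0.
move=> s sT st sd; apply: H => //.
by rewrite /ball/= distrC; apply: le_lt_trans sd _; rewrite ltr_pdivrMr// ltr_pMr// ltr1n.
Qed.

Lemma near_time t d : 0 <= t <= T -> 0 < d -> exists s, [/\ 0 <= s <= T, s != t & `|s - t| <= d].
Proof.
move=> /andP[t0 tT] d0; have [tlt|tge] := ltP t T.
  pose m := Num.min d (T - t); have m0 : 0 < m by rewrite lt_min d0 subr_gt0.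
  have md : m <= d by rewrite ge_min lexx.
  have mT : m <= T - t by rewrite ge_min lexx orbT.
  exists (t + m); split; first by apply/andP; split; lra.
    by rewrite -subr_eq0 addrAC subrr add0r gt_eqF.
  by rewrite addrAC subrr add0r gtr0_norm.
have tE : t = T by apply/eqP; rewrite eq_le tT.
pose m := Num.min d T; have m0 : 0 < m by rewrite lt_min d0.
have md : m <= d by rewrite ge_min lexx.
have mT : m <= T by rewrite ge_min lexx orbT.
exists (t - m); split; first by apply/andP; split; lra.
  by rewrite -subr_eq0 addrAC subrr add0r oppr_eq0 gt_eqF.
by rewrite addrAC subrr add0r normrN gtr0_norm.
Qed.

Lemma within_dnbhs_proper t : 0 <= t <= T -> ProperFilter (within `[0, T] t^').
Proof.
move=> tT; apply: Build_ProperFilter_ex => A /within_dnbhsE[d d0 H].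
by have [s [s1 s2 s3]] := near_time tT d0; exists s; exact: H.
Qed.

Definition quot G t s := (G s - G t) / (s - t).

(** The bound is part of the notion because rates are summed over multi-indices. *)
Definition rate G t (B : R) := exists2 L, quot G t @ within `[0, T] t^' --> L & `|L| <= B.

Lemma rateD G G' t B B' : rate G t B -> rate G' t B' -> rate (G \+ G') t (B + B').
Proof.
move=> [L cL BL] [L' cL' BL']; exists (L + L').
  rewrite (_ : quot _ _ = quot G t \+ quot G' t); first exact: cvgD.
  by apply/funext => s; rewrite /quot /=; ring.
by apply: le_trans (ler_normD _ _) _; exact: lerD.
Qed.

Lemma rate_eq G G' t B : (forall s, 0 <= s <= T -> G s = G' s) -> 0 <= t <= T -> rate G t B -> rate G' t B.
Proof.
move=> E tT [L cL BL]; exists L => //.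
apply: cvg_trans cL; apply: near_eq_cvg; apply: (@within_dnbhsI _ _ 1) => // s sT _ _.
by rewrite /quot !E.
Qed.

Lemma rate_time G t B : 0 <= t <= T -> rate G t B ->
  time_derivable T G t /\ `|time_deriv T G t| <= B.
Proof.
move=> tT [L cL BL]; have PF := within_dnbhs_proper tT.
have -> : time_deriv T G t = L by exact: cvg_lim cL.
by split => //; apply/cvg_ex; exists L.
Qed.

(** Uniformity in h makes the difference quotient of the limit Cauchy at t. *)
Lemma rate_intro t G (Gh : R -> R -> R) (Fh : R -> R) B : 0 <= t <= T ->
  (forall e, 0 < e -> exists2 d, 0 < d & forall h s, 0 < h <= 1 -> 0 <= s <= T -> `|s - t| <= d ->
     `|Gh h s - Gh h t - (s - t) * Fh h| <= e * `|s - t|) ->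
  (forall s e, 0 <= s <= T -> 0 < e -> exists2 d, 0 < d <= 1 & forall h, 0 < h <= d -> `|Gh h s - G s| <= e) ->
  (forall h, 0 < h <= 1 -> `|Fh h| <= B) -> rate G t B.
Proof.
move=> tT H1 H2 H3; have PF := within_dnbhs_proper tT.
have close e : 0 < e -> exists2 d, 0 < d & forall s, 0 <= s <= T -> s != t -> `|s - t| <= d ->
    exists2 d', 0 < d' <= 1 & forall h, 0 < h <= d' -> `|quot G t s - Fh h| <= e.
  move=> e0; have e2 : 0 < e / 2 by rewrite divr_gt0.
  have [d d0 Hd] := H1 _ e2; exists d => // s sT st sd.
  have n0 : 0 < `|s - t| by rewrite normr_gt0 subr_eq0.
  have e4 : 0 < e / 2 * `|s - t| / 2 by rewrite divr_gt0// mulr_gt0.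
  have [d1 /andP[p1 q1] Hd1] := H2 s _ sT e4; have [d2 /andP[p2 _] Hd2] := H2 t _ tT e4.
  exists (Num.min d1 d2); first by rewrite lt_min p1 p2 ge_min q1.
  move=> h; rewrite le_min => /andP[h0 /andP[h1 h2]].
  have hh : 0 < h <= 1 by rewrite h0 (le_trans h1).
  have {}Hd := Hd h s hh sT sd.
  have {}Hd1 := Hd1 h; have {}Hd2 := Hd2 h; move: Hd1 Hd2; rewrite h0 h1 h2 => /(_ isT) Hd1 /(_ isT) Hd2.
  rewrite -(ler_pM2l n0) -normrM mulrBr /quot mulrC divfK ?subr_eq0//.
  have -> : G s - G t - (s - t) * Fh h = (Gh h s - Gh h t - (s - t) * Fh h) - (Gh h s - G s) + (Gh h t - G t) by ring.
  apply: le_trans (ler_normD _ _) _; apply: le_trans (lerD (ler_normB _ _) (lexx _)) _.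
  apply: le_trans (lerD (lerD Hd Hd1) Hd2) _.
  by rewrite le_eqVlt; apply/orP; left; apply/eqP; field.
have cau : cauchy (quot G t @ within `[0, T] t^').
  apply: cauchy_exP => e e0; have e4 : 0 < e / 4 by rewrite divr_gt0.
  have [d d0 Hd] := close _ e4; have [s [sT st sd]] := near_time tT d0.
  have [d1 /andP[p1 _] H1'] := Hd s sT st sd.
  exists (quot G t s); apply: (within_dnbhsI d0) => s' sT' st' sd'.
  have [d2 /andP[p2 _] H2'] := Hd s' sT' st' sd'.
  pose h := Num.min d1 d2; have h0 : 0 < h by rewrite lt_min p1.
  have h1 : h <= d1 by rewrite ge_min lexx.
  have h2 : h <= d2 by rewrite ge_min lexx orbT.
  have {}H1' := H1' h; have {}H2' := H2' h; move: H1' H2'; rewrite h0 h1 h2 => /(_ isT) H1' /(_ isT) H2'.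
  rewrite /ball/=; have -> : quot G t s - quot G t s' = (quot G t s - Fh h) - (quot G t s' - Fh h) by ring.
  apply: le_lt_trans (ler_normB _ _) _; apply: le_lt_trans (lerD H1' H2') _.
  by rewrite -mulrDr -[X in _ < X]mulr1 ltr_pM2l//; lra.
have cq : cvg (quot G t @ within `[0, T] t^') by exact: cauchy_cvg cau.
have [L cL] := (cvg_ex _).1 cq.
exists L => //; apply/ler_addgt0Pl => e e0.
have [d d0 Hd] := close _ e0.
have : \forall s \near within `[0, T] t^', `|quot G t s| <= e + B.
  apply: (within_dnbhsI d0) => s sT st sd; have [d1 /andP[p1 q1] H1'] := Hd s sT st sd.
  have -> : quot G t s = (quot G t s - Fh d1) + Fh d1 by ring.
  apply: le_trans (ler_normD _ _) _; apply: lerD; [by apply: H1'; rewrite p1 lexx|by apply: H3; rewrite p1 q1//].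
move=> nB; apply/ler_addgt0Pl => e' e'0.
have [s [/= qs Ls]] := filter_ex (filterI nB (cvgr_dist_le _ _ cL _ e'0)).
have -> : L = (L - quot G t s) + quot G t s by ring.
by apply: le_trans (ler_normD _ _) _; exact: lerD.
Qed.

End rates.

Section trilinear.
Context {R : realType}.
Local Notation D := (@half_space R).
Implicit Types (f g a b u d X : R3 R -> R).

(** * The transport energy identity *)

Let alg0 (x y z a b : R) : 0 <= x -> 0 <= y -> 0 <= z -> z <= x + y -> x ^+ 2 <= a -> y ^+ 2 <= b ->
  z ^+ 2 <= 2 * (a + b).
Proof.
move=> x0 y0 z0 zxy hx hy; have : z ^+ 2 <= (x + y) ^+ 2 by rewrite ler_pXn2r ?nnegrE ?addr_ge0.
have := sqr_ge0 (x - y); rewrite sqrrB sqrrD; lra.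
Qed.

Let alg1 (x y c : R) : x <= 8 * c -> y <= 2048 * c -> 0 <= c -> x + 2 * y <= 5000 * c.
Proof. lra. Qed.

Let alg2 (x1 x2 x3 y1 y2 y3 c : R) : x1 <= 8 * c -> x2 <= 8 * c -> x3 <= 8 * c ->
  y1 <= 2048 * c -> y2 <= 2048 * c -> y3 <= 2048 * c -> 0 <= c ->
  x1 + x2 + x3 + 2 * (y1 + y2 + y3) <= 15000 * c.
Proof. lra. Qed.

Lemma sob_der m i a g N : sob m.+1 a N -> weak1 i a g -> sob m g N.
Proof.
move=> sa w; have [g' w' sg'] : exists2 g, weak1 i a g & sob m g N by case: sa => _ _; apply.
by have [_ Lg _] := w; apply: sob_ext sg' => //; exact: weak1_uniq w' w.
Qed.

Let alg3 (p1 p2 p3 p4 q1 q2 q3 q4 e1 e2 e3 e4 e5 e6 : R) : e1 = p1 - p2 -> e2 = p2 - p3 -> e3 = p3 - p4 ->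
  e4 = q1 - q2 -> e5 = q2 - q3 -> e6 = q3 - q4 ->
  (p1 - 2 * q1) - (p4 - 2 * q4) = (e1 + e2 + e3) - 2 * (e4 + e5 + e6).
Proof. by move=> -> -> -> -> -> ->; ring. Qed.

Let alg4 (x1 x2 x3 y1 y2 y3 : R) : `|(x1 + x2 + x3) - 2 * (y1 + y2 + y3)| <=
  `|x1| + `|x2| + `|x3| + 2 * (`|y1| + `|y2| + `|y3|).
Proof.
apply: le_trans (ler_normB _ _) _; rewrite normrM ger0_norm//; apply: lerD.
  by apply: le_trans (ler_normD _ _) _; apply: lerD => //; exact: ler_normD.
by apply: ler_wpM2l => //; apply: le_trans (ler_normD _ _) _; apply: lerD => //; exact: ler_normD.
Qed.

Let alg5 (x y z : R) : x + 2 * z = 0 -> - 2 * (y + z) = x - 2 * y.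
Proof. lra. Qed.

Lemma weak1D i a g a' g' : weak1 i a g -> weak1 i a' g' -> weak1 i (a \+ a') (g \+ g').
Proof.
move=> w w'; have := weak1_lin 1 w w'; congr weak1; apply/funext => x /=; ring.
Qed.

Lemma sobD m a b Na Nb : sob m a Na -> sob m b Nb -> sob m (a \+ b) (2 * (Na + Nb)).
Proof.
have B a' b' m' : sob m' a' Na -> sob m' b' Nb -> nrm (a' \+ b') ^+ 2 <= 2 * (Na + Nb).
  move=> sa sb; have La := sob_L2 sa; have Lb := sob_L2 sb.
  by apply: alg0 (nrm_ge0 a') (nrm_ge0 b') (nrm_ge0 _) (nrmD La Lb) (sob_nrm sa) (sob_nrm sb).
elim: m a b => [|m IH] a b sa sb; have La := sob_L2 sa; have Lb := sob_L2 sb; have {}B := B _ _ _ sa sb.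
  by split => //; exact: L2D.
split => //; first exact: L2D.
move=> i; have [g w sg] : exists2 g, weak1 i a g & sob m g Na by case: sa => _ _; apply.
have [g' w' sg'] : exists2 g, weak1 i b g & sob m g Nb by case: sb => _ _; apply.
exists (g \+ g'); [exact: weak1D w w'|exact: IH].
Qed.

Lemma weak1_Dw j h w a g : 0 <= h -> weak1 j a g -> weak1 j (Dw h w a) (Dw h w g).
Proof. by move=> h0; elim: w a g => //= i w IH a g wa; apply: IH; exact: weak1_dq. Qed.

(** What is left of the rate of change of |D_w f|^2, in one direction, when the transport of the
    square is integrated by parts. *)
Definition tri h w u d f g : R :=
  ip (d \* Dw h w f) (Dw h w f) - 2 * ip (Com h w u g) (Dw h w f).

Section fixed_word.
Variables (h : R) (w : seq 'I_3).
Hypotheses (hh : 0 < h <= 1) (w4 : (size w <= 4)%N).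

Let h0 : 0 <= h. Proof. by case/andP: hh => /ltW. Qed.

Let DX f F : sob 4 f F -> is_L2 (Dw h w f) /\ nrm (Dw h w f) <= Num.sqrt F.
Proof.
move=> sf; have s0 : sob 0 (Dw h w f) F by apply: sob_Dw => //; rewrite add0n; exact: sob_leq sf.
split; first exact: sob_L2 s0.
rewrite -(@ler_pXn2r _ 2)// ?nnegrE ?nrm_ge0 ?sqrtr_ge0//.
by apply: le_trans (sob_nrm s0) _; rewrite sqr_sqrtr//; exact: sob_ge0 sf.
Qed.

Let mulX d X U : sob 3 d U -> is_L2 X -> is_L2 (d \* X) /\ nrm (d \* X) <= 8 * Num.sqrt U * nrm X.
Proof. exact: sob_mulL2. Qed.

(** The constant of Com_bound for words of length four, times that of sob_mulL2. *)
Let k4 : (8 : R) * 4 ^+ size w <= 2048.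
Proof.
have -> : (2048 : R) = 8 * 4 ^+ 4 by rewrite -natrX -natrM.
by rewrite ler_wpM2l// ler_weXn2l// ler1n.
Qed.

Let ComX u g U F : sob 4 u U -> sob 3 g F ->
  is_L2 (Com h w u g) /\ nrm (Com h w u g) <= 2048 * (Num.sqrt U * Num.sqrt F).
Proof.
move=> su sg; have w7 : (size w + 3 <= 4 + 3)%N by rewrite leq_add2r.
have [] := @Com_bound R h w 4 3 u g U F hh w4 w4 w7 su sg.
rewrite sqrtrM ?(sob_ge0 su)// => L B; split => //; apply: le_trans B _.
by apply: ler_wpM2r k4; rewrite mulr_ge0 ?sqrtr_ge0.
Qed.

(** The divergence of u has three derivatives and is bounded; the commutator is a product. *)
Lemma tri_bound j u d f g U F : sob 4 u U -> weak1 j u d -> sob 4 f F -> weak1 j f g ->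
  `|tri h w u d f g| <= 5000 * (Num.sqrt U * F).
Proof.
move=> su wu sf wf; have sd := sob_der su wu; have sg := sob_der sf wf.
have [LX BX] := DX sf; have [L1 B1] := mulX sd LX; have [L2 B2] := ComX su sg.
have F0 := sob_ge0 sf; rewrite -(sqr_sqrtr F0).
set a := Num.sqrt U in B1 B2 *; set b := Num.sqrt F in BX B2 *.
have a0 : 0 <= a := sqrtr_ge0 _; have b0 : 0 <= b := sqrtr_ge0 _.
have C1 := ip_cs L1 LX; have C2 := ip_cs L2 LX.
have D1 : `|ip (d \* Dw h w f) (Dw h w f)| <= 8 * (a * b ^+ 2).
  apply: le_trans C1 _; apply: le_trans (ler_pM (nrm_ge0 _) (nrm_ge0 _) B1 BX) _.
  rewrite -!mulrA; apply: ler_wpM2l => //; apply: ler_wpM2l => //.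
  by rewrite expr2; apply: ler_wpM2r.
have D2 : `|ip (Com h w u g) (Dw h w f)| <= 2048 * (a * b ^+ 2).
  apply: le_trans C2 _; apply: le_trans (ler_pM (nrm_ge0 _) (nrm_ge0 _) B2 BX) _.
  by rewrite expr2 !mulrA.
apply: le_trans (ler_normB _ _) _; rewrite normrM ger0_norm//.
have ab : 0 <= a * b ^+ 2 by rewrite mulr_ge0 ?sqr_ge0.
exact: alg1.
Qed.

(** The expression is linear in (u, d) and quadratic in (f, g), hence continuous in them,
    uniformly in h. *)
Lemma tri_diff j u u' d d' f f' g g' M eta : 1 <= M -> 0 <= eta ->
  sob 4 u M -> sob 4 u' M -> sob 4 f M -> sob 4 f' M ->
  sob 4 (u' \- u) (eta ^+ 2) -> sob 4 (f' \- f) (eta ^+ 2) ->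
  weak1 j u d -> weak1 j u' d' -> weak1 j f g -> weak1 j f' g' ->
  `|tri h w u' d' f' g' - tri h w u d f g| <= 15000 * (eta * M).
Proof.
move=> M1 e0 su su' sf sf' sdu sdf wu wu' wf wf'.
have wdu := weak1B wu' wu; have wdf := weak1B wf' wf.
have sd := sob_der su wu; have sg := sob_der sf wf.
have sdd := sob_der sdu wdu; have sdg := sob_der sdf wdf.
have sg' := sob_der sf' wf'; have sd' := sob_der su' wu'.
pose X := Dw h w f; pose X' := Dw h w f'.
have [LX BX] := DX sf; have [LX' BX'] := DX sf'; have [] := DX sdf; rewrite DwB -/X -/X' => LdX BdX.
rewrite -/X -/X' in LX BX LX' BX'.
have M0 : 0 <= M by apply: le_trans M1.
set m := Num.sqrt M in BX BX'; have m0 : 0 <= m := sqrtr_ge0 _.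
have mm : m * m = M by rewrite -expr2 sqr_sqrtr.
have m1 : 1 <= m by rewrite -[1]sqrtr1 ler_sqrt.
have mM : m <= M by rewrite -mm ler_peMl.
rewrite sqrtr_sqr (ger0_norm e0) in BdX.
have [A1 a1] := mulX sdd LX'; have [A2 a2] := mulX sd LX'; have [A3 a3] := mulX sd LdX.
have [A4 a4] := ComX sdu sg'; have [A5 a5] := ComX su sdg; have [A6 a6] := ComX su sg.
have [A7 _] := mulX sd' LX'; have [A8 _] := mulX sd LX; have [A9 _] := ComX su' sg'; have [A0 _] := ComX su sg'.
rewrite sqrtr_sqr (ger0_norm e0) -/m in a1 a4; rewrite -/m in a2 a3 a6.
rewrite sqrtr_sqr (ger0_norm e0) -/m in a5.
have E : tri h w u' d' f' g' - tri h w u d f g =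
   (ip ((d' \- d) \* X') X' + ip (d \* X') (X' \- X) + ip (d \* (X' \- X)) X)
   - 2 * (ip (Com h w (u' \- u) g') X' + ip (Com h w u (g' \- g)) X' + ip (Com h w u g) (X' \- X)).
  have e1 : ip ((d' \- d) \* X') X' = ip (d' \* X') X' - ip (d \* X') X'.
    by rewrite -(ipBl A7 A2 LX'); congr (ip _ X'); apply/funext => z /=; ring.
  have e2 := ipBr LX' LX A2.
  have e3 : ip (d \* (X' \- X)) X = ip (d \* X') X - ip (d \* X) X.
    by rewrite -(ipBl A2 A8 LX); congr (ip _ X); apply/funext => z /=; ring.
  have e4 : ip (Com h w (u' \- u) g') X' = ip (Com h w u' g') X' - ip (Com h w u g') X'.
    by rewrite -(ipBl A9 A0 LX') -ComBl.
  have e5 : ip (Com h w u (g' \- g)) X' = ip (Com h w u g') X' - ip (Com h w u g) X'.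
    by rewrite -(ipBl A0 A6 LX') -ComBr.
  have e6 := ipBr LX' LX A6.
  exact: alg3 e1 e2 e3 e4 e5 e6.
rewrite E.
have K (P Q : R3 R -> R) (p q c : R) : is_L2 P -> is_L2 Q -> nrm P <= p -> nrm Q <= q -> p * q <= c -> `|ip P Q| <= c.
  move=> LP LQ hp hq; apply: le_trans; apply: le_trans (ip_cs LP LQ) _.
  by apply: ler_pM => //; exact: nrm_ge0.
have em : eta * m <= eta * M by rewrite ler_wpM2l.
have emm : eta * m * m = eta * M by rewrite -mulrA mm.
have N1 : 8 * eta * nrm X' <= 8 * (eta * m) by rewrite -mulrA !ler_wpM2l.
have N2 : 8 * m * nrm X' <= 8 * M by rewrite -mulrA -mm !ler_wpM2l.
have N3 : 8 * m * nrm (X' \- X) <= 8 * (eta * m) by rewrite -mulrA (mulrC eta) !ler_wpM2l.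
have c1 : `|ip ((d' \- d) \* X') X'| <= 8 * (eta * M).
  by apply: K A1 LX' (le_trans a1 N1) BX' _; rewrite -mulrA emm.
have c2 : `|ip (d \* X') (X' \- X)| <= 8 * (eta * M).
  by apply: K A2 LdX (le_trans a2 N2) BdX _; rewrite -mulrA (mulrC M).
have c3 : `|ip (d \* (X' \- X)) X| <= 8 * (eta * M).
  by apply: K A3 LX (le_trans a3 N3) BX _; rewrite -mulrA emm.
have c4 : `|ip (Com h w (u' \- u) g') X'| <= 2048 * (eta * M).
  by apply: K A4 LX' a4 BX' _; rewrite -mulrA emm.
have c5 : `|ip (Com h w u (g' \- g)) X'| <= 2048 * (eta * M).
  by apply: K A5 LX' a5 BX' _; rewrite -mulrA (mulrC m) emm.
have c6 : `|ip (Com h w u g) (X' \- X)| <= 2048 * (eta * M).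
  by apply: K A6 LdX a6 BdX _; rewrite -mulrA mm (mulrC M).
have eM : 0 <= eta * M by rewrite mulr_ge0.
exact: le_trans (alg4 _ _ _ _ _ _) (alg2 c1 c2 c3 c4 c5 c6 eM).
Qed.

(** Half of the loss of a derivative is integrated away: only the divergence
    term and the commutator remain. *)
Lemma tri_energy j u d f g U F : sob 4 u U -> weak1 j u d -> tangent j u ->
  sob 4 f F -> weak1 j f g ->
  is_L2 (Dw h w (u \* g)) /\ - 2 * ip (Dw h w (u \* g)) (Dw h w f) = tri h w u d f g.
Proof.
move=> su wu tj sf wf; have sg := sob_der sf wf.
have [LX _] := DX sf; have [LC _] := ComX su sg.
have wX := weak1_Dw w h0 wf; have [_ LXj _] := wX.
have [LuX _] : is_L2 (u \* Dw h w g) /\ nrm (u \* Dw h w g) <= 8 * Num.sqrt U * nrm (Dw h w g).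
  exact: sob_mulL2 su LXj.
have E : Dw h w (u \* g) = Com h w u g \+ (u \* Dw h w g).
  by apply/funext => z; rewrite /Com /=; ring.
rewrite E; split; first exact: L2D.
rewrite (ipDl LC LuX LX) /tri; have := transport_zero su wu tj wX.
exact: alg5.
Qed.

End fixed_word.
End trilinear.

Section energy.
Context {R : realType}.
Local Notation D := (@half_space R).
Implicit Types (A : R -> R3 R -> R).

(** * Evolution of Sobolev norms under transport *)

Lemma nrm2D (f g : R3 R -> R) : is_L2 f -> is_L2 g ->
  nrm (f \+ g) ^+ 2 = nrm f ^+ 2 + 2 * ip g f + nrm g ^+ 2.
Proof.
move=> Lf Lg; rewrite !nrm2 (ipDl Lf Lg (L2D Lf Lg)) (ipDr Lf Lg Lf) (ipDr Lf Lg Lg) (ipC f g).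
by move: (ip _ _) (ip _ _) (ip _ _) => x y z; ring.
Qed.

Lemma nrm2_is_derive (T : R) A (A' : R3 R -> R) (xi : R) : 0 < xi < T -> (forall s, 0 <= s <= T -> is_L2 (A s)) -> is_L2 A' ->
  (forall e, 0 < e -> exists2 d, 0 < d & forall s, 0 <= s <= T -> `|s - xi| <= d ->
     nrm (A s \- A xi \- ((s - xi) \*o A')) <= e * `|s - xi|) ->
  is_derive xi (1 : R) (fun s => nrm (A s) ^+ 2) (2 * ip A' (A xi)).
Proof.
move=> /andP[x0 xT] LA LA' H; have Lx : is_L2 (A xi) by apply: LA; rewrite !ltW.
have h : k^-1 *: (nrm (A (k *: 1 + xi)) ^+ 2 - nrm (A xi) ^+ 2) @[k --> (0:R)^'] --> 2 * ip A' (A xi).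
  apply/cvgrPdist_le => e e0.
  pose a := nrm (A xi); pose b := nrm A'.
  have a0 : 0 <= a := nrm_ge0 _; have b0 : 0 <= b := nrm_ge0 _.
  have c1 : 0 < 2 * a + 1 by rewrite ltr_wpDl// mulr_ge0.
  have c2 : 0 < (b + 1) ^+ 2 by rewrite exprn_gt0// ltr_wpDl.
  have e2 : 0 < e / 2 by rewrite divr_gt0.
  pose e1 := Num.min 1 (e / 2 / (2 * a + 1)); have e10 : 0 < e1 by rewrite lt_min ltr01 divr_gt0.
  have e11 : e1 <= 1 by rewrite ge_min lexx.
  have e12 : 2 * e1 * a <= e / 2.
    have : e1 * (2 * a + 1) <= e / 2 by rewrite -ler_pdivlMr// ge_min lexx orbT.
    by apply: le_trans; rewrite mulrDr mulr1 mulrCA mulrA lerDl ltW.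
  have [d d0 Hd] := H _ e10.
  near=> k.
  have k0 : k != 0 by near: k; exact: nbhs_dnbhs_neq.
  have hk : `|k| <= Num.min (Num.min xi (T - xi)) (Num.min d (e / 2 / (b + 1) ^+ 2)).
    near: k; apply: dnbhs0_le.
    by rewrite !lt_min x0 subr_gt0 xT d0 divr_gt0.
  move: hk; rewrite !le_min => /andP[/andP[k1 k2] /andP[k3 k4]].
  have ks : 0 <= xi + k <= T.
    move: k1 k2; rewrite !ler_norml => /andP[k1 _] /andP[_ k2]; apply/andP; split.
      by rewrite -lerBlDl sub0r.
    by rewrite -lerBrDl.
  have LAk := LA _ ks; rewrite /GRing.scale/= mulr1 [k + xi]addrC.
  have kE : xi + k - xi = k by ring.
  have {}Hd := Hd _ ks; rewrite kE in Hd; have {}Hd := Hd k3.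
  pose r := A (xi + k) \- A xi \- (k \*o A'); pose D := A (xi + k) \- A xi.
  have LkA := L2Z k LA'; have LD : is_L2 D by exact: L2B.
  have Lr : is_L2 r by exact: L2B.
  have ED : D = (k \*o A') \+ r by apply/funext => z; rewrite /D /r /=; ring.
  have EA : A (xi + k) = A xi \+ D by apply/funext => z; rewrite /D /=; ring.
  have nD : nrm D <= `|k| * (b + 1).
    rewrite ED; apply: le_trans (nrmD LkA Lr) _; rewrite nrmZ// mulrDr; apply: lerD => //.
    by apply: le_trans Hd _; rewrite mulrC ler_wpM2l.
  have I : ip D (A xi) = k * ip A' (A xi) + ip r (A xi) by rewrite {1}ED (ipDl LkA Lr Lx) (ipZl k LA' Lx).
  rewrite EA (nrm2D Lx LD) I -/a.
  have kk : 0 < `|k| by rewrite normr_gt0.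
  have B1 : `|ip r (A xi)| <= `|k| * (e1 * a).
    apply: le_trans (ip_cs Lr Lx) _; rewrite mulrA (mulrC `|k|).
    by apply: ler_wpM2r => //; exact: Hd.
  have B2 : nrm D ^+ 2 <= `|k| * (`|k| * (b + 1) ^+ 2).
    have -> : `|k| * (`|k| * (b + 1) ^+ 2) = (`|k| * (b + 1)) ^+ 2 by ring.
    by rewrite ler_pXn2r ?nnegrE ?nrm_ge0// mulr_ge0// addr_ge0.
  have B3 : `|k| * (b + 1) ^+ 2 <= e / 2 by rewrite -ler_pdivlMr.
  rewrite -(ler_pM2l kk) -normrM.
  move: B1 B2; set x := ip r _; set y := nrm D ^+ 2; set z := ip A' _ => B1 B2.
  have y0 : 0 <= y := sqr_ge0 _.
  have -> : k * (2 * z - k^-1 * (a ^+ 2 + 2 * (k * z + x) + y - a ^+ 2)) = - (2 * x + y) by field.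
  rewrite normrN; apply: le_trans (ler_normD _ _) _; rewrite normrM (ger0_norm y0) (ger0_norm (ler0n R 2)).
  apply: le_trans (lerD (ler_wpM2l (ler0n R 2) B1) B2) _.
  have -> : 2 * (`|k| * (e1 * a)) + `|k| * (`|k| * (b + 1) ^+ 2) = `|k| * (2 * e1 * a + `|k| * (b + 1) ^+ 2) by ring.
  by rewrite ler_wpM2l// [leRHS]splitr lerD.
by apply: DeriveDef; [apply/cvg_ex; exists (2 * ip A' (A xi))|exact/cvg_lim].
Unshelve. all: end_near. Qed.

(** Dominates the numerical constants in tri_bound and tri_diff. *)
Definition ctri : R := 15000.

Lemma ctri_gt0 : 0 < ctri. Proof. by rewrite ltr0n. Qed.

Let c3_gt0 : 0 < 3 * ctri. Proof. exact: mulr_gt0 (ltr0n R 3) ctri_gt0. Qed.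

Lemma nrm_sqdist (a b : R3 R -> R) (eta e : R) : is_L2 a -> is_L2 b -> nrm (a \- b) <= eta -> eta <= 1 ->
  eta * (2 * nrm b + 1) <= e -> `|nrm a ^+ 2 - nrm b ^+ 2| <= e.
Proof.
move=> La Lb ab eta1 eK; have x1 := nrm_sub La Lb; have x2 := nrm_sub Lb La.
rewrite (nrmBC b a) in x2; have e0 := le_trans (nrm_ge0 _) ab.
have dz : `|nrm a - nrm b| <= eta.
  by rewrite ler_norml; apply/andP; split; move: (nrm _) (nrm _) (nrm _) x1 x2 ab => x y z; lra.
rewrite subr_sqr normrM; apply: le_trans eK; apply: ler_pM => //.
rewrite ger0_norm ?addr_ge0 ?nrm_ge0//; apply: le_trans (lerD (le_trans x1 (lerD (lexx _) ab)) (lexx _)) _.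
by rewrite (_ : nrm b + eta + nrm b = 2 * nrm b + eta); [rewrite lerD2l|ring].
Qed.

Definition cont_sob (T : R) m A := forall t, 0 <= t <= T ->
  (exists N, sob m (A t) N) /\
  forall e, 0 < e -> exists2 d, 0 < d & forall s, 0 <= s <= T -> `|s - t| <= d -> sob m (A s \- A t) e.

Variables (T : R) (f : R -> R3 R -> R) (u g d : 'I_3 -> R -> R3 R -> R).
Hypothesis T0 : 0 < T.
Hypothesis cf : cont_sob T 4 f.
Hypothesis cu : forall j, cont_sob T 4 (u j).
Hypothesis wf : forall t j, 0 <= t <= T -> weak1 j (f t) (g j t).
Hypothesis wu : forall t j, 0 <= t <= T -> weak1 j (u j t) (d j t).
Hypothesis tu : forall t j, 0 <= t <= T -> tangent j (u j t).

(** The transport term u . grad f. *)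
Definition transp t : R3 R -> R :=
  (u ord0 t \* g ord0 t) \+ (u (inord 1) t \* g (inord 1) t) \+ (u ord_max t \* g ord_max t).

Hypothesis strong : forall t e, 0 <= t <= T -> 0 < e -> exists2 d, 0 < d &
  forall s, 0 <= s <= T -> `|s - t| <= d -> nrm (f s \- f t \+ ((s - t) \*o transp t)) <= e * `|s - t|.

Lemma L2f t : 0 <= t <= T -> is_L2 (f t).
Proof. by move=> tT; have [[N /sob_L2 ]] := cf tT. Qed.

Lemma L2_ug t j : 0 <= t <= T -> is_L2 (u j t \* g j t).
Proof.
move=> tT; have [[U sU] _] := cu j tT; have [_ Lg _] := @wf t j tT.
by have [] := sob_mulL2 (isT : (3 <= 4)%N) sU Lg.
Qed.

Lemma L2_transp t : 0 <= t <= T -> is_L2 (transp t).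
Proof. by move=> tT; apply: L2D; [apply: L2D|]; exact: L2_ug. Qed.

Section word.
Variable w : seq 'I_3.
Hypothesis w4 : (size w <= 4)%N.

Definition flux h t : R :=
  tri h w (u ord0 t) (d ord0 t) (f t) (g ord0 t)
  + tri h w (u (inord 1) t) (d (inord 1) t) (f t) (g (inord 1) t)
  + tri h w (u ord_max t) (d ord_max t) (f t) (g ord_max t).

Let algf (x y z a b c : R) : - 2 * x = a -> - 2 * y = b -> - 2 * z = c -> 2 * - (x + y + z) = a + b + c.
Proof. lra. Qed.

Lemma fluxE h t : 0 < h <= 1 -> 0 <= t <= T ->
  2 * - ip (Dw h w (transp t)) (Dw h w (f t)) = flux h t.
Proof.
move=> hh tT; have [[F sF] _] := cf tT.
have E j : is_L2 (Dw h w (u j t \* g j t)) /\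
    - 2 * ip (Dw h w (u j t \* g j t)) (Dw h w (f t)) = tri h w (u j t) (d j t) (f t) (g j t).
  have [[U sU] _] := cu j tT.
  exact: (@tri_energy R h w hh w4 j (u j t) (d j t) (f t) (g j t) U F sU (@wu t j tT) (@tu t j tT) sF (@wf t j tT)).
have [L1 E1] := E ord0; have [L2 E2] := E (inord 1); have [L3 E3] := E ord_max.
have h0 : 0 <= h by case/andP: hh => /ltW.
have LX := L2_Dw w h0 (L2f tT).
rewrite /transp !DwD (ipDl (L2D L1 L2) L3 LX) (ipDl L1 L2 LX).
exact: algf E1 E2 E3.
Qed.

Lemma flux_bound h t U F : 0 < h <= 1 -> 0 <= t <= T ->
  (forall j, sob 4 (u j t) U) -> sob 4 (f t) F -> `|flux h t| <= 3 * ctri * (Num.sqrt U * F).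
Proof.
move=> hh tT sU sF.
have E j : `|tri h w (u j t) (d j t) (f t) (g j t)| <= ctri * (Num.sqrt U * F).
  apply: le_trans (tri_bound hh w4 (sU j) (@wu t j tT) sF (@wf t j tT)) _.
  by apply: ler_wpM2r; [rewrite mulr_ge0 ?sqrtr_ge0 ?(sob_ge0 sF)|rewrite ler_nat].
set x := Num.sqrt U * F in E *; have -> : 3 * ctri * x = ctri * x + ctri * x + ctri * x by move: ctri => c; ring.
by apply: le_trans (ler_normD _ _) _; apply: lerD (E _); apply: le_trans (ler_normD _ _) _; apply: lerD.
Qed.

Lemma cont_bound A t : cont_sob T 4 A -> 0 <= t <= T -> exists2 N, 1 <= N & exists2 dl, 0 < dl &
  forall s, 0 <= s <= T -> `|s - t| <= dl -> sob 4 (A s) N.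
Proof.
move=> cA tT; have [[N sN] H] := cA t tT; have [dl dl0 Hd] := H 1 ltr01.
have N0 := sob_ge0 sN; exists (2 * (N + 1)); first by rewrite mulrDr mulr1; have := mulr_ge0 (ler0n R 2) N0; lra.
exists dl => // s sT sd; have := sobD sN (Hd s sT sd).
by rewrite (_ : A t \+ (A s \- A t) = A s)//; apply/funext => z /=; ring.
Qed.

Lemma common_time (P : 'I_3 -> R -> Prop) t : (forall j, exists2 dl, 0 < dl & forall s, 0 <= s <= T -> `|s - t| <= dl -> P j s) ->
  exists2 dl, 0 < dl & forall s, 0 <= s <= T -> `|s - t| <= dl -> forall j, P j s.
Proof.
move=> H; have [d1 p1 H1] := H ord0; have [d2 p2 H2] := H (inord 1); have [d3 p3 H3] := H ord_max.
exists (Num.min d1 (Num.min d2 d3)); first by rewrite !lt_min p1 p2 p3.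
move=> s sT; rewrite !le_min => /and3P[h1 h2 h3] j.
by case: (ord3P j) => ->; [exact: H1|exact: H2|exact: H3].
Qed.

Lemma flux_cont t e : 0 <= t <= T -> 0 < e -> exists2 dl, 0 < dl & forall h s, 0 < h <= 1 ->
  0 <= s <= T -> `|s - t| <= dl -> `|flux h s - flux h t| <= e.
Proof.
move=> tT e0.
have [Nf Nf1 [d1 d10 H1]] := cont_bound cf tT.
have Hu j : exists2 N, 1 <= N & exists2 dl, 0 < dl & forall s, 0 <= s <= T -> `|s - t| <= dl -> sob 4 (u j s) N.
  exact: cont_bound (cu j) tT.
have [N1 p1 [e1 q1 K1]] := Hu ord0; have [N2 p2 [e2 q2 K2]] := Hu (inord 1); have [N3 p3 [e3 q3 K3]] := Hu ord_max.
pose M := Nf + N1 + N2 + N3.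
have M1 : 1 <= M by rewrite /M; lra.
have Mf : Nf <= M by rewrite /M; lra.
have Mu1 : N1 <= M by rewrite /M; lra.
have Mu2 : N2 <= M by rewrite /M; lra.
have Mu3 : N3 <= M by rewrite /M; lra.
have M0 : 0 < M by apply: lt_le_trans M1.
pose eta := e / (3 * ctri * M); have eta0 : 0 < eta by apply: divr_gt0 e0 _; exact: mulr_gt0 c3_gt0 M0.
have n0 : 0 < eta ^+ 2 by rewrite exprn_gt0.
have [_ Cf] := cf tT; have [d2 d20 H2] := Cf _ n0.
have [d3 d30 H3] : exists2 dl, 0 < dl & forall s, 0 <= s <= T -> `|s - t| <= dl -> forall j, sob 4 (u j s \- u j t) (eta ^+ 2).
  by apply: common_time => j; have [_ Cu] := cu j tT; exact: Cu.
exists (Num.min (Num.min d1 (Num.min e1 (Num.min e2 e3))) (Num.min d2 d3)); first by rewrite !lt_min d10 q1 q2 q3 d20.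
move=> h s hh sT; rewrite !le_min => /andP[/and4P[s1 s2 s3 s4] /andP[s5 s6]].
have tt : `|t - t| = 0 by rewrite subrr normr0.
have uM r j : 0 <= r <= T -> `|r - t| <= Num.min e1 (Num.min e2 e3) -> sob 4 (u j r) M.
  move=> rT; rewrite !le_min => /and3P[r1 r2 r3].
  by case: (ord3P j) => ->; [apply: sob_mono Mu1 (K1 _ rT r1)|apply: sob_mono Mu2 (K2 _ rT r2)|apply: sob_mono Mu3 (K3 _ rT r3)].
have E j : `|tri h w (u j s) (d j s) (f s) (g j s) - tri h w (u j t) (d j t) (f t) (g j t)| <= ctri * (eta * M).
  apply: (@tri_diff R h w hh w4 j) => //.
  - exact: ltW.
  - by apply: uM => //; rewrite tt !le_min (ltW q1) (ltW q2) (ltW q3).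
  - by apply: uM => //; rewrite !le_min s2 s3 s4.
  - by apply: sob_mono Mf (H1 _ tT _); rewrite tt ltW.
  - by apply: sob_mono Mf (H1 _ sT s1).
  - exact: H3.
  - exact: H2.
  - exact: wu.
  - exact: wu.
  - exact: wf.
  - exact: wf.
have -> : e = ctri * (eta * M) + ctri * (eta * M) + ctri * (eta * M).
  have c0 := gt_eqF ctri_gt0; rewrite /eta; move: ctri c0 => c c0; field; rewrite c0/=.
  by rewrite gt_eqF.
rewrite /flux opprD addrACA; apply: le_trans (ler_normD _ _) _; apply: lerD (E _).
by rewrite opprD addrACA; apply: le_trans (ler_normD _ _) _; apply: lerD (E _).
Qed.

Let Gh h s := nrm (Dw h w (f s)) ^+ 2.

Lemma Gh_derive h t : 0 < h <= 1 -> 0 < t < T -> is_derive t (1 : R) (Gh h) (flux h t).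
Proof.
move=> hh tT; have tT' : 0 <= t <= T by case/andP: tT => /ltW -> /ltW ->.
have /andP[h0 _] := hh; have h0' := ltW h0.
have Lv := L2_transp tT'; have LDv := L2_Dw w h0' Lv; have LX := L2_Dw w h0' (L2f tT').
have -> : flux h t = 2 * ip ((-1) \*o Dw h w (transp t)) (Dw h w (f t)).
  by rewrite -(fluxE hh tT') (ipZl (-1) LDv LX) mulN1r.
apply: (@nrm2_is_derive T (fun s => Dw h w (f s))) => //.
- by move=> s sT; apply: L2_Dw => //; exact: L2f.
- exact: L2Z.
move=> e e0; have [C C0 HC] := nrm_Dw_fix w h0.
have C1 : 0 < C + 1 by rewrite ltr_wpDl.
have [dl dl0 H] := strong tT' (divr_gt0 e0 C1); exists dl => // s sT sd.
have -> : Dw h w (f s) \- Dw h w (f t) \- ((s - t) \*o ((-1) \*o Dw h w (transp t))) =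
    Dw h w (f s \- f t \+ ((s - t) \*o transp t)).
  by rewrite (DwD h w (f s \- f t) ((s - t) \*o transp t)) (DwB h w (f s) (f t)) (DwZ h w (s - t) (transp t)); apply/funext => z /=; ring.
have L : is_L2 (f s \- f t \+ ((s - t) \*o transp t)).
  by apply: L2D; [apply: L2B; exact: L2f|exact: L2Z].
apply: le_trans (HC _ L) _; apply: le_trans (ler_wpM2l C0 (H s sT sd)) _.
rewrite mulrA; apply: ler_wpM2r => //.
by rewrite mulrCA ler_piMr ?(ltW e0)// ler_pdivrMr// mul1r lerDl.
Qed.

Lemma Gh_cont h a b : 0 < h <= 1 -> 0 <= a -> b <= T -> {within `[a, b], continuous (Gh h)}.
Proof.
move=> /andP[h0 _] a0 bT; apply: within_cont => s e; rewrite /= in_itv/= => /andP[sa sb] e0.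
have sT : 0 <= s <= T by rewrite (le_trans a0 sa) (le_trans sb bT).
have [C C0 HC] := nrm_Dw_fix w h0.
have LX := L2_Dw w (ltW h0) (L2f sT).
pose n := nrm (Dw h w (f s)); have nn0 : 0 <= n := nrm_ge0 _.
pose K := 2 * n + 1; have K0 : 0 < K by rewrite ltr_wpDl// mulr_ge0.
pose eta := Num.min 1 (e / K); have eta0 : 0 < eta by rewrite lt_min ltr01 divr_gt0.
have eta1 : eta <= 1 by rewrite ge_min lexx.
have eK : eta * K <= e by rewrite -ler_pdivlMr// ge_min lexx orbT.
have C1 : 0 < C + 1 by rewrite ltr_wpDl.
have r0 : 0 < (eta / (C + 1)) ^+ 2 by rewrite exprn_gt0// divr_gt0.
have [_ /(_ _ r0)[dl dl0 H]] := cf sT; exists dl => // s'; rewrite in_itv/= => /andP[sa' sb'] sd.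
have sT' : 0 <= s' <= T by rewrite (le_trans a0 sa') (le_trans sb' bT).
have LX' := L2_Dw w (ltW h0) (L2f sT').
have B : nrm (f s' \- f s) <= eta / (C + 1).
  have := sob_nrm (H s' sT' sd); rewrite ler_pXn2r ?nnegrE ?nrm_ge0 ?divr_ge0 ?(ltW eta0) ?(ltW C1)//.
have B' : nrm (Dw h w (f s') \- Dw h w (f s)) <= eta.
  rewrite -DwB; apply: le_trans (HC _ (L2B (L2f sT') (L2f sT))) _.
  apply: le_trans (ler_wpM2l C0 B) _.
  by rewrite mulrCA ler_piMr ?(ltW eta0)// ler_pdivrMr// mul1r lerDl.
exact: nrm_sqdist LX' LX B' eta1 eK.
Qed.

(** At a fixed step the norm is differentiable in time, and the mean value theorem applies;
    the modulus of continuity of the flux does not depend on the step. *)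
Lemma Gh_incr t e : 0 <= t <= T -> 0 < e -> exists2 dl, 0 < dl & forall h s, 0 < h <= 1 ->
  0 <= s <= T -> `|s - t| <= dl -> `|Gh h s - Gh h t - (s - t) * flux h t| <= e * `|s - t|.
Proof.
move=> tT e0; have [dl dl0 H] := flux_cont tT e0; exists dl => // h s hh sT sd.
have /andP[t0 tT'] := tT; have /andP[s0 sT'] := sT.
have [st|ts|->] := ltgtP s t; last by rewrite !subrr mul0r subrr normr0 mulr0.
- have [||c] := @MVT R (Gh h) (flux h) s t st.
  + move=> x; rewrite in_itv/= => /andP[sx xt]; apply: Gh_derive => //.
    by rewrite (le_lt_trans s0 sx) (lt_le_trans xt tT').
  + exact: Gh_cont.
  rewrite in_itv/= => /andP[sc ct] E.
  have -> : Gh h s - Gh h t - (s - t) * flux h t = (flux h c - flux h t) * (s - t).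
    by rewrite -[Gh h s - Gh h t]opprB E; ring.
  rewrite normrM ler_wpM2r//; apply: H => //.
    by rewrite (le_trans s0 (ltW sc)) (le_trans (ltW ct) tT').
  by apply: le_trans sd; rewrite !ltr0_norm ?subr_lt0//; lra.
- have [||c] := @MVT R (Gh h) (flux h) t s ts.
  + move=> x; rewrite in_itv/= => /andP[sx xt]; apply: Gh_derive => //.
    by rewrite (le_lt_trans t0 sx) (lt_le_trans xt sT').
  + exact: Gh_cont.
  rewrite in_itv/= => /andP[sc ct] E.
  have -> : Gh h s - Gh h t - (s - t) * flux h t = (flux h c - flux h t) * (s - t) by rewrite E; ring.
  rewrite normrM ler_wpM2r//; apply: H => //.
    by rewrite (le_trans t0 (ltW sc)) (le_trans (ltW ct) sT').
  by apply: le_trans sd; rewrite !gtr0_norm ?subr_gt0//; lra.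
Qed.

(** The squared norms of difference quotients converge to those of derivatives while their
    rates of change stay bounded. *)
Lemma energy_rate p t U F : 0 <= t <= T -> (forall s, 0 <= s <= T -> wk w (f s) (p s)) ->
  (forall j, sob 4 (u j t) U) -> sob 4 (f t) F ->
  rate T (fun s => nrm (p s) ^+ 2) t (3 * ctri * (Num.sqrt U * F)).
Proof.
move=> tT Hp sU sF; apply: (rate_intro T0 (Gh := Gh) (Fh := fun h => flux h t)) => //.
- by move=> e e0; exact: Gh_incr.
- move=> s e sT e0; have [[N sN] _] := cf sT; have sN' := sob_leq w4 sN.
  have [pN Lp] := wk_nrm sN' (Hp s sT).
  pose n := nrm (p s); have nn0 : 0 <= n := nrm_ge0 _.
  pose K := 2 * n + 1; have K0 : 0 < K by rewrite ltr_wpDl// mulr_ge0.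
  pose eta := Num.min 1 (e / K); have eta0 : 0 < eta by rewrite lt_min ltr01 divr_gt0.
  have eta1 : eta <= 1 by rewrite ge_min lexx.
  have eK : eta * K <= e by rewrite -ler_pdivlMr// ge_min lexx orbT.
  have [dl dl1 H] := Dw_cvg sN' (Hp s sT) eta0; exists dl => // h hd.
  have h0 : 0 < h by case/andP: hd.
  have LX := L2_Dw w (ltW h0) (L2f sT); have B' := H h hd.
  exact: nrm_sqdist LX Lp B' eta1 eK.
- by move=> h hh; exact: flux_bound.
Qed.

End word.
End energy.

Section link.
Context {R : realType}.
Local Notation D := (@half_space R).
Implicit Types (f g : R3 R -> R) (al be : 'I_3 -> nat).

(** * Sobolev spaces in terms of first order weak derivatives *)

Lemma is_wderiv_L2 al f g : is_wderiv al f g -> is_L2 g.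
Proof. by case. Qed.

Lemma is_wderiv_ip al f g psi : is_wderiv al f g -> tst psi ->
  ip f (pderiv al psi) = (-1) ^+ mlen al * ip g psi.
Proof. by move=> [_ H] tp; rewrite !ipE; apply: H; exact: tst_test_function. Qed.

Lemma is_wderiv_uniq al f g g' : is_wderiv al f g -> is_wderiv al f g' -> nrm (g \- g') = 0.
Proof.
move=> w w'; apply: L2_test_eq; [exact: is_wderiv_L2 w|exact: is_wderiv_L2 w'|] => psi tp.
have := is_wderiv_ip w tp; rewrite (is_wderiv_ip w' tp) => /esym.
by apply: mulfI; rewrite expf_neq0// oppr_eq0 oner_neq0.
Qed.

Lemma is_wderiv0 f : is_L2 f -> is_wderiv (fun=> 0%N) f f.
Proof.
move=> Lf; split => // phi _; rewrite (_ : mlen _ = 0%N); last by rewrite /mlen big1.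
rewrite expr0 mul1r; have -> : (fun _ : 'I_3 => 0%N) = alpha3 0 0 0.
  by apply/funext => i; rewrite /alpha3; case: ifP => // _; case: ifP.
by rewrite pderiv_alpha3.
Qed.

(** Both derivatives are tested with a derivative of the same test. *)
Lemma is_wderiv_weak1 be i f g g' : is_wderiv be f g -> is_wderiv (add1 be i) f g' -> weak1 i g g'.
Proof.
move=> w w'; split; [exact: is_wderiv_L2 w|exact: is_wderiv_L2 w'|] => psi tp.
have := is_wderiv_ip w (tst_derive i tp); rewrite -(pderiv_add1 be i tp) (is_wderiv_ip w' tp).
rewrite mlen_add1 exprS -mulrA mulN1r -mulrN => /esym.
by apply: mulfI; rewrite expf_neq0// oppr_eq0 oner_neq0.
Qed.

Lemma wderivP n f al : in_H n f -> (mlen al <= n)%N -> is_wderiv al f (wderiv al f).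
Proof. by move=> [_ H] /H[g wg]; rewrite /wderiv; apply: xgetPex; exists g. Qed.

Definition HN n f : R :=
  \sum_(al : {ffun 'I_3 -> 'I_n.+1} | (\sum_(i < 3) al i <= n)%N) nrm (wderiv (fun i => al i) f) ^+ 2.

Lemma Hnorm2E n f : in_H n f -> Hnorm2 n f = (HN n f)%:E.
Proof.
move=> Hf; rewrite /Hnorm2 asboolT// /HN -sumEFin; apply: eq_bigr => al aln.
by rewrite nrm2 -sqnormE//; apply: is_wderiv_L2; exact: wderivP Hf aln.
Qed.

Lemma HN_ge0 n f : 0 <= HN n f.
Proof. by apply: sumr_ge0 => al _; exact: sqr_ge0. Qed.

Lemma nrm_wderiv n f be : (mlen be <= n)%N -> nrm (wderiv be f) ^+ 2 <= HN n f.
Proof.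
move=> ben; have bi i : (be i <= n)%N.
  by apply: leq_trans ben; rewrite /mlen (bigD1 i)//= leq_addr.
pose al : {ffun 'I_3 -> 'I_n.+1} := [ffun i => inord (be i)].
have E : (fun i => al i : nat) = be by apply/funext => i; rewrite ffunE inordK ?ltnS.
rewrite /HN (bigD1 al)/= ?E//; last by move: ben; rewrite -E.
by rewrite lerDl; apply: sumr_ge0 => a _; exact: sqr_ge0.
Qed.

Lemma sob_wderiv n m f be : in_H n f -> (mlen be + m <= n)%N -> sob m (wderiv be f) (HN n f).
Proof.
move=> Hf; elim: m be => [|m IH] be.
  rewrite addn0 => bn; split => //; first exact: is_wderiv_L2 (wderivP Hf bn).
  exact: nrm_wderiv.
rewrite addnS => bn; have bn' : (mlen be <= n)%N by lia.
split; [exact: is_wderiv_L2 (wderivP Hf bn')|exact: nrm_wderiv|] => i.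
exists (wderiv (add1 be i) f); last by apply: IH; rewrite mlen_add1 addSn.
apply: is_wderiv_weak1 (wderivP Hf bn') (wderivP Hf _).
by rewrite mlen_add1; lia.
Qed.

Lemma mlen0 : mlen (fun=> 0%N) = 0%N.
Proof. by rewrite /mlen big1. Qed.

Lemma nrm_wderiv0 n f : in_H n f -> nrm (wderiv (fun=> 0%N) f \- f) = 0.
Proof.
move=> Hf; have [Lf _] := Hf.
by apply: is_wderiv_uniq (wderivP Hf _) (is_wderiv0 Lf); rewrite mlen0.
Qed.

Lemma in_H_sob n f : in_H n f -> sob n f (HN n f).
Proof.
move=> Hf; have [Lf _] := Hf; apply: sob_ext (nrm_wderiv0 Hf) _ => //.
by apply: sob_wderiv => //; rewrite mlen0.
Qed.

Definition letters (w : seq 'I_3) : 'I_3 -> nat := fun j => count_mem j w.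

Lemma wk_ext w a a' g : is_L2 a' -> nrm (a \- a') = 0 -> wk w a g -> wk w a' g.
Proof.
move=> La' aa; case: w => [|i w] /=.
  move=> [La Lg E]; split => //.
  have h : nrm (a' \- g) <= nrm (a' \- a) + nrm (a \- g) by exact: nrm_dist.
  by apply/eqP; rewrite eq_le nrm_ge0 andbT; apply: le_trans h _; rewrite nrmBC aa E addr0.
move=> [b wb wkb]; exists b => //; have [_ Lb _] := wb.
by apply: weak1_ext wb => //; exact: nrm_subrr.
Qed.

Lemma wk_wderiv_add n f w be : in_H n f -> (mlen be + size w <= n)%N ->
  wk w (wderiv be f) (wderiv (fun j => (be j + letters w j)%N) f).
Proof.
move=> Hf; elim: w be => [|i w IH] be /=.
  rewrite addn0 => bn; have L := is_wderiv_L2 (wderivP Hf bn).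
  have -> : (fun j => (be j + letters [::] j)%N) = be by apply/funext => j; rewrite /letters addn0.
  by split => //; exact: nrm_subrr.
rewrite addnS => bn; have bn' : (mlen be <= n)%N by lia.
exists (wderiv (add1 be i) f).
  apply: is_wderiv_weak1 (wderivP Hf bn') (wderivP Hf _).
  by rewrite mlen_add1; lia.
have -> : (fun j => (be j + letters (i :: w) j)%N) = (fun j => (add1 be i j + letters w j)%N).
  by apply/funext => j; rewrite /letters /add1 /= (eq_sym i j); lia.
by apply: IH; rewrite mlen_add1 addSn.
Qed.

Lemma wk_wderiv n f w : in_H n f -> (size w <= n)%N -> wk w f (wderiv (letters w) f).
Proof.
move=> Hf wn; have [Lf _] := Hf; apply: wk_ext (nrm_wderiv0 Hf) _ => //.
by apply: (@wk_wderiv_add n) => //; rewrite mlen0.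
Qed.

Definition word al : seq 'I_3 := flatten [seq nseq (al i) i | i <- enum 'I_3].

Lemma letters_word al : letters (word al) = al.
Proof.
apply/funext => j; rewrite /letters /word count_flatten -map_comp sumnE big_map big_enum/=.
rewrite (bigD1 j)//= count_nseq/= eqxx mul1n big1 ?addn0// => i ij.
by rewrite count_nseq/= (negPf ij).
Qed.

Lemma size_word al : size (word al) = mlen al.
Proof.
rewrite /word size_flatten /shape -map_comp sumnE big_map big_enum/= /mlen.
by apply: eq_bigr => i _; rewrite size_nseq.
Qed.

Lemma Hnorm2_fin_in_H n f : (Hnorm2 n f < +oo)%E -> in_H n f.
Proof. by rewrite /Hnorm2; case: asboolP. Qed.

Lemma cont_H_sob T n (f : R -> R3 R -> R) : cont_H T n f -> cont_sob T n f.
Proof.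
move=> H t tT; have [|Hf cf] := H t; first by rewrite in_itv.
split; first by exists (HN n (f t)); exact: in_H_sob.
move=> e e0; have nA : nbhs (0%E : \bar R) [set y | (y < e%:E)%E].
  exact: (@nbhs_open_ereal_lt R 0 (fun=> e)).
have /nbhs_ballP[d /= d0 Hd] := cf _ nA.
exists (d / 2); first by rewrite divr_gt0.
move=> s sT sd; have /= h : (Hnorm2 n (f s \- f t)%R < e%:E)%E.
  apply: Hd; last by rewrite in_itv.
  by rewrite /ball/= distrC; apply: le_lt_trans sd _; rewrite ltr_pdivrMr// ltr_pMr// ltr1n.
have Hi : in_H n (f s \- f t) by apply: Hnorm2_fin_in_H; apply: lt_trans h _; exact: ltry.
by apply: sob_mono (in_H_sob Hi); move: h; rewrite Hnorm2E// lte_fin => /ltW.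
Qed.

End link.

Section weak_time.
Context {R : realType}.
Local Notation lam := (@lebesgue_measure R).
Local Notation RR := (measurableTypeR R).
Variable T : R.
Hypothesis T0 : 0 < T.
Implicit Types (p r F G eta zeta : R -> R).

(** * From weak to strong time derivatives *)

Local Notation I F := (\int[lam]_(t in `]0, T[) F t).
Local Notation ct F := {within `[0, T], continuous F}.

Lemma ct_integrable F : ct F -> lam.-integrable `]0, T[ (EFin \o F).
Proof.
move=> cF; apply: (@integrableS _ _ _ lam (`[0, T]%classic : set RR)).
- exact: measurable_itv.
- exact: measurable_itv.
- by move=> x /=; rewrite !in_itv/= => /andP[/ltW -> /ltW ->].
- by apply: continuous_compact_integrable => //; exact: segment_compact.
Qed.

Lemma ctM F G : ct F -> ct G -> ct (F \* G).
Proof. by move=> cF cG x; apply: (@cvgM _ (subspace `[0, T])); [exact: cF|exact: cG]. Qed.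

Lemma ctT F : continuous F -> ct F.
Proof. by move=> cF; exact: continuous_subspaceT. Qed.

Lemma int_lin c F G : ct F -> ct G -> I (fun t => F t + c * G t) = I F + c * I G.
Proof.
move=> cF cG; have mI : measurable (`]0, T[%classic : set RR) by exact: measurable_itv.
have iF := ct_integrable cF; have iG := ct_integrable cG.
rewrite RintegralD//; first by rewrite RintegralZl.
by apply: eq_integrable (integrableZl mI c iG) => // s _; rewrite /= EFinM.
Qed.

Lemma int_Z c F : ct F -> I (fun t => c * F t) = c * I F.
Proof.
move=> cF; have mI : measurable (`]0, T[%classic : set RR) by exact: measurable_itv.
by rewrite RintegralZl//; exact: ct_integrable.
Qed.

Lemma int_le F G : ct F -> ct G -> (forall t, 0 < t < T -> `|F t| <= G t) -> `|I F| <= I G.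
Proof.
move=> cF cG FG; have mI : measurable (`]0, T[%classic : set RR) by exact: measurable_itv.
have iF := ct_integrable cF; have iG := ct_integrable cG.
apply: le_trans (le_normr_Rintegral mI iF) _; apply: le_Rintegral => //.
  by apply: eq_integrable (integrable_norm iF).
Qed.

Lemma int_eq F G : (forall t, 0 < t < T -> F t = G t) -> I F = I G.
Proof. by move=> FG; apply: eq_Rintegral => t; rewrite inE/= in_itv/=; exact: FG. Qed.

Lemma derive1_shift zeta (s x : R) : derive1 (fun t => zeta (t - s)) x = derive1 zeta (x - s).
Proof.
rewrite /derive1; suff -> : (fun h : R => h^-1 *: (zeta (h + x - s) - zeta (x - s))) =
  (fun h : R => h^-1 *: (zeta (h + (x - s)) - zeta (x - s))) by [].
by apply/funext => h; rewrite addrA.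
Qed.

Lemma continuous_shift zeta (s : R) : continuous zeta -> continuous (fun t => zeta (t - s)).
Proof.
move=> cz x; apply: (@continuous_comp _ _ _ (fun t : R => t - s) zeta); last exact: cz.
by apply: cvgB; [exact: cvg_id|exact: cvg_cst].
Qed.

Definition hat (d : R) : R -> R := cutoff 1 (- d) d.

Lemma hat_mass d s : 0 < d -> d <= s -> s <= T - d ->
  I (fun t => hat d (t - s)) = fine (\int[lam]_t (hat d t)%:E)%E.
Proof.
move=> d0 ds sd; rewrite /Rintegral; congr fine.
have mh : measurable_fun [set: RR] (fun t : RR => (hat d t)%:E).
  by apply/measurable_EFinP; apply: continuous_measurable_fun; apply: sm1_continuous; exact: cutoff_sm1.
have h0 (x : R) : (0 <= (hat d x)%:E)%E by rewrite lee_fin; exact: cutoff_ge0.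
rewrite -(integral_shift1 (- s) mh h0) integral_mkcond; apply: eq_integral => t _.
rewrite patchE; case: ifPn => // /negP tI; rewrite /hat cutoff_out//.
apply/negP => /andP[t1 t2]; apply: tI; apply/mem_set; rewrite /= in_itv/=; apply/andP; split; lra.
Qed.

Lemma hat_mass_gt0 d s : 0 < d -> d <= s -> s <= T - d -> 0 < I (fun t => hat d (t - s)).
Proof.
move=> d0 ds sd.
have ch : continuous (hat d) by apply: sm1_continuous; exact: cutoff_sm1.
have h0 : 0 < hat d 0.
  by rewrite /hat /cutoff mul1r opprK add0r subr0 mul1r /flat d0 mulr_gt0// expr0 invr1 mul1r expR_gt0.
have h2 : 0 < hat d 0 / 2 by rewrite divr_gt0.
have /cvgrPdist_le /(_ _ h2) /nbhs_ballP[k /= k0 Hk] := ch 0.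
pose m := Num.min (k / 2) d; have m0 : 0 < m by rewrite lt_min d0 divr_gt0.
have md : m <= d by rewrite ge_min lexx orbT.
have mk : m < k by rewrite gt_min ltr_pdivrMr// ltr_pMr// ltr1n.
have cs : ct (fun t => hat d (t - s)).
  by apply: ctT; exact: continuous_shift.
apply: (@lt_le_trans _ _ (\int[lam]_(t in `]s - m, s[) (hat d 0 / 2))).
  rewrite Rintegral_cst//= lebesgue_measure_itv/= lte_fin gtrBl m0/= opprB addrCA subrr addr0.
  by rewrite mulr_gt0.
rewrite /Rintegral; apply: fine_le.
- apply: integrable_fin_num => //; apply: (@integrableS _ _ _ lam (`]0, T[%classic : set RR)) => //.
    by move=> t /=; rewrite !in_itv/= => /andP[? ?]; apply/andP; split; lra.
  by apply: (@ct_integrable (fun=> hat d 0 / 2)); apply: ctT => x; exact: cvg_cst.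
- by apply: integrable_fin_num => //; exact: (ct_integrable cs).
apply: (@le_trans _ _ (\int[lam]_(t in `](s - m)%R, s[) (hat d (t - s)%R)%:E)%E).
  apply: ge0_le_integral => //.
  - by move=> t _; rewrite lee_fin ltW.
  - apply: measurable_funTS; apply/measurable_EFinP; apply: continuous_measurable_fun.
    exact: continuous_shift.
  move=> t /=; rewrite in_itv/= => /andP[t1 t2]; rewrite lee_fin.
  have : `|hat d 0 - hat d (t - s)| <= hat d 0 / 2.
    by apply: Hk; rewrite /ball/= sub0r normrN ltr0_norm ?subr_lt0//; lra.
  by rewrite ler_norml => /andP[_]; lra.
apply: ge0_subset_integral => //.
- apply: measurable_funTS; apply/measurable_EFinP; apply: continuous_measurable_fun.
  exact: continuous_shift.
- by move=> t _; rewrite lee_fin; exact: cutoff_ge0.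
- by move=> t /=; rewrite !in_itv/= => /andP[? ?]; apply/andP; split; lra.
Qed.

Lemma hat_test d s : 0 < d -> d < s -> s < T - d -> test1 [pred t | 0 < t < T] (fun t => hat d (t - s)).
Proof.
move=> d0 ds sd; split.
  rewrite (_ : (fun t => _) = (fun t => hat d (1 * t + - s))); first by apply: sm1_comp_affine; exact: cutoff_sm1.
  by apply/funext => t; rewrite mul1r.
exists (s - d), (s + d); split; [by apply/andP; split; lra|by apply/andP; split; lra|].
move=> x; apply: contraNeq => h; apply: contraNT h => h.
rewrite /hat cutoff_out//; apply: contra h => /andP[h1 h2]; apply/andP; split; lra.
Qed.

Let win (x t d e : R) : d <= e / 3 -> `|t - (x + d + d / 2)| <= d -> `|t - x| <= e.
Proof. by rewrite !ler_norml => h /andP[? ?]; apply/andP; split; lra. Qed.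

Let win' (x t d e : R) : d <= e / 3 -> `|t - (x - d - d / 2)| <= d -> `|t - x| <= e.
Proof. by rewrite !ler_norml => h /andP[? ?]; apply/andP; split; lra. Qed.

Let inside (a b d s t : R) : 0 < d -> - d < t - s < d -> a + d + d / 2 <= s -> s <= b - d - d / 2 ->
  a <= t <= b.
Proof. by move=> d0 /andP[? ?] ? ?; apply/andP; split; lra. Qed.

Let split_error (z pa pb ca cb a b d m : R) : z * (pb - pa + (b - a) * m) =
  (cb + (b - d - d / 2 - (a + d + d / 2)) * m * z - ca) - (cb - z * pb) + (ca - z * pa) + z * (3 * d * m).
Proof. by field. Qed.

Let sum_up (x y z : R) : z <= y -> 0 <= x -> z + x / 4 + x / 4 + x * 3 / 8 <= y + x.
Proof. lra. Qed.

Let alg_m (d y e : R) : 0 <= d -> d * (8 * (y + 1)) <= e -> 3 * d * y <= e * 3 / 8.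
Proof. nra. Qed.

(** Averages of p against a bump of small width d are differentiable in the centre of the bump,
    since the bump can be differentiated, and their derivative is an average of - r.  The mean value
    inequality for the averages passes to p as d tends to 0. *)
Lemma weak_increment p r (a b m M : R) : ct p -> ct r ->
  (forall eta, test1 [pred t | 0 < t < T] eta -> I (fun t => derive1 eta t * p t) = I (fun t => eta t * r t)) ->
  0 <= a -> a < b -> b <= T -> (forall t, a <= t <= b -> `|r t - m| <= M) ->
  `|p b - p a + (b - a) * m| <= M * (b - a).
Proof.
move=> cp cr W a0 ab bT rM.
have M0 : 0 <= M by apply: le_trans (rM a _); [exact: normr_ge0|rewrite lexx ltW].
apply/ler_addgt0Pl => e e0.
have e4 : 0 < e / 4 by rewrite divr_gt0.
have aT : a <= T by rewrite (le_trans (ltW ab)).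
have aI : `[0, T]%classic a by rewrite /= in_itv/= a0.
have [da da0 Ha] := within_contP cp aI e4.
have b0 : 0 <= b by rewrite (le_trans a0 (ltW ab)).
have bI : `[0, T]%classic b by rewrite /= in_itv/= b0.
have [db db0 Hb] := within_contP cp bI e4.
have m1 : 0 < 8 * (`|m| + 1) by rewrite mulr_gt0// ltr_wpDl.
(* The bumps centred at a' and b' are supported in [a, b], where p is close to p a and p b. *)
pose d := Num.min (Num.min (da / 3) (db / 3)) (Num.min ((b - a) / 4) (e / (8 * (`|m| + 1)))).
have ba0 : 0 < b - a by rewrite subr_gt0.
have d0 : 0 < d by rewrite !lt_min !divr_gt0.
have : d <= d by []; rewrite {2}/d !le_min => /andP[/andP[d1 d2] /andP[d3 d4]].
pose a' := a + d + d / 2; pose b' := b - d - d / 2.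
have L0 : 0 < b' - a' by rewrite /a' /b'; lra.
have ch : continuous (hat d) by apply: sm1_continuous; exact: cutoff_sm1.
have cs s : ct (fun t => hat d (t - s)).
  by apply: ctT; exact: continuous_shift.
have cds s : ct (fun t => derive1 (hat d) (t - s)).
  by apply: ctT; apply: continuous_shift; apply: sm1_continuous; apply: sm1_derive; exact: cutoff_sm1.
have cst (k : R) : ct (fun _ : R => k) by apply: ctT => x; exact: cvg_cst.
have cabs : ct (fun t => `|p t|) by move=> x; apply: (@cvg_norm _ (subspace `[0, T])); exact: cp.
pose Z := fine (\int[lam]_t (hat d t)%:E)%E.
have ZE s : d <= s -> s <= T - d -> I (fun t => hat d (t - s)) = Z by move=> *; exact: hat_mass.
have a'd : d < a' by rewrite /a'; lra.
have b'd : b' < T - d by rewrite /b'; lra.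
have a'b' : a' < b' by rewrite -subr_gt0.
have a'T : a' <= T - d by exact: ltW (lt_trans a'b' b'd).
have Z0 : 0 < Z by rewrite -(ZE a' (ltW a'd) a'T); exact: (hat_mass_gt0 d0 (ltW a'd) a'T).
pose c s := I (fun t => hat d (t - s) * p t).
have near s (x : R) (k : R) : d <= s -> s <= T - d -> (forall t, 0 < t < T -> `|t - s| <= d -> `|p t - x| <= k) ->
    `|c s - Z * x| <= k * Z.
  move=> ds sd H; rewrite -(ZE s ds sd).
  have -> : c s - I (fun t => hat d (t - s)) * x = I (fun t => hat d (t - s) * (p t - x)).
    have := int_lin (- x) (ctM (cs s) cp) (cs s); rewrite mulNr (mulrC x) => <-.
    by apply: int_eq => t _ /=; ring.
  rewrite -(int_Z k (cs s)).
  apply: int_le => [||t tT].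
  - by apply: (ctM (cs s)) => x'; apply: (@cvgB _ (subspace `[0, T])); [exact: cp|exact: cvg_cst].
  - exact: (ctM (cst k) (cs s)).
  rewrite normrM (ger0_norm (cutoff_ge0 _ _ _ _)) mulrC.
  have [td|td] := boolP (- d < t - s < d); last by rewrite /hat (cutoff_out _ td) !mulr0.
  apply: ler_wpM2r; first exact: cutoff_ge0.
  by apply: H => //; rewrite ler_norml; case/andP: td => /ltW -> /ltW ->.
have [P0 [C C0 HC]] : exists P0 : pred R, exists2 C, 0 <= C &
    forall x h : R, `|hat d (x + h) - hat d x - h * derive1 (hat d) x| <= C * h ^+ 2.
  exists predT; apply: (@sm1_taylor R predT); split; first exact: cutoff_sm1.
  exists (- d), d; split => // x; apply: contraNeq => h; apply: contraNT h => h.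
  by rewrite /hat cutoff_out//; apply: contra h => /andP[/ltW -> /ltW ->].
pose sg s := a' + s * (b' - a').
have sgI s : 0 <= s <= 1 -> a' <= sg s <= b'.
  move=> /andP[s0 s1]; rewrite /sg lerDl (mulr_ge0 s0 (ltW L0))/=.
  by have := ler_wpM2r (ltW L0) s1; rewrite mul1r -lerBrDl.
pose q s := c (sg s) + s * ((b' - a') * m * Z).
pose rr s := (b' - a') * (m * Z - I (fun t => hat d (t - sg s) * r t)).
have Q s s' : 0 <= s <= 1 -> 0 <= s' <= 1 ->
    `|q s' - q s - (s' - s) * rr s| <= (C * (b' - a') ^+ 2 * I (fun t => `|p t|)) * (s' - s) ^+ 2.
  move=> hs hs'; have /andP[s1 s2] := sgI _ hs; have /andP[s1' s2'] := sgI _ hs'.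
  have te : test1 [pred t | 0 < t < T] (fun t => hat d (t - sg s)).
    by apply: hat_test => //; [exact: lt_le_trans a'd s1|exact: le_lt_trans s2 b'd].
  have := W _ te; rewrite (int_eq (G := fun t => derive1 (hat d) (t - sg s) * p t)); last first.
    by move=> t _; rewrite derive1_shift.
  move=> E.
  have dsg : sg s' - sg s = (s' - s) * (b' - a') by rewrite /sg; ring.
  have -> : q s' - q s - (s' - s) * rr s =
     c (sg s') - c (sg s) + (sg s' - sg s) * I (fun t => derive1 (hat d) (t - sg s) * p t).
    by rewrite E dsg /q /rr; move: (Rintegral _ _ _) (c _) (c _) => x y z; ring.
  have -> : c (sg s') - c (sg s) + (sg s' - sg s) * I (fun t => derive1 (hat d) (t - sg s) * p t) =
     I (fun t => (hat d (t - sg s') - hat d (t - sg s) + (sg s' - sg s) * derive1 (hat d) (t - sg s)) * p t).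
    have c1 := ctM (cs (sg s)) cp; have c1' := ctM (cs (sg s')) cp; have c2 := ctM (cds (sg s)) cp.
    have cd : ct (fun t => hat d (t - sg s') * p t + -1 * (hat d (t - sg s) * p t)).
      move=> x; apply: (@cvgD _ (subspace `[0, T])); first exact: c1'.
      by apply: (@cvgM _ (subspace `[0, T])); [exact: cvg_cst|exact: c1].
    have := int_lin (sg s' - sg s) cd c2; rewrite (int_lin (-1) c1' c1) mulN1r => <-.
    by apply: int_eq => t _ /=; ring.
  have -> : C * (b' - a') ^+ 2 * I (fun t => `|p t|) * (s' - s) ^+ 2 = I (fun t => C * (sg s' - sg s) ^+ 2 * `|p t|).
    by rewrite (int_Z _ cabs) dsg; move: (Rintegral _ _ _) => x; ring.
  apply: int_le => [||t tT].
  - apply: (ctM _ cp) => x; apply: (@cvgD _ (subspace `[0, T])).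
      by apply: (@cvgB _ (subspace `[0, T])); exact: cs.
    by apply: (@cvgM _ (subspace `[0, T])); [exact: cvg_cst|exact: cds].
  - exact: (ctM (cst _) cabs).
  rewrite normrM ler_wpM2r//; have := HC (t - sg s) (sg s - sg s').
  by rewrite addrA subrK -sqrrN opprB -mulNr opprB -(mulNr (sg s - sg s')) opprB.
have rB s : 0 <= s <= 1 -> `|rr s| <= (b' - a') * (M * Z).
  move=> hs; have /andP[s1 s2] := sgI _ hs; rewrite /rr normrM (gtr0_norm L0) ler_wpM2l ?(ltW L0)//.
  have ds : d <= sg s by rewrite (le_trans (ltW a'd) s1).
  have sd : sg s <= T - d by rewrite (le_trans s2 (ltW b'd)).
  rewrite -(ZE _ ds sd).
  have -> : m * I (fun t => hat d (t - sg s)) - I (fun t => hat d (t - sg s) * r t) =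
     - I (fun t => hat d (t - sg s) * (r t - m)).
    have := int_lin (- m) (ctM (cs (sg s)) cr) (cs (sg s)); rewrite -(int_eq (F := fun t => hat d (t - sg s) * (r t - m))).
      by move=> ->; rewrite mulNr opprB.
    by move=> t _ /=; ring.
  rewrite -(int_Z M (cs (sg s))).
  rewrite normrN; apply: int_le => [||t tT].
  - by apply: (ctM (cs _)) => x'; apply: (@cvgB _ (subspace `[0, T])); [exact: cr|exact: cvg_cst].
  - exact: (ctM (cst M) (cs _)).
  rewrite normrM (ger0_norm (cutoff_ge0 _ _ _ _)) mulrC.
  have [td|td] := boolP (- d < t - sg s < d); last by rewrite /hat (cutoff_out _ td) !mulr0.
  apply: ler_wpM2r; first exact: cutoff_ge0.
  exact: rM (inside d0 td s1 s2).
have := quad_mvt Q (h := 1) (M := (b' - a') * (M * Z)).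
rewrite lexx ler01 => /(_ isT rB).
rewrite /q /sg mul0r mul1r mul0r addr0 addr0 mul1r subrKC mulr1 => QQ.
have Na : `|c a' - Z * p a| <= e / 4 * Z.
  apply: near => [||t /andP[t0 tT] td]; [exact: ltW|exact: ltW (lt_trans a'b' b'd)|].
  by apply: Ha; [rewrite /= in_itv/= !ltW|exact: win d1 td].
have Nb : `|c b' - Z * p b| <= e / 4 * Z.
  apply: near => [||t /andP[t0 tT] td]; [exact: ltW (lt_trans a'd a'b')|exact: ltW|].
  by apply: Hb; [rewrite /= in_itv/= !ltW|exact: win' d2 td].
rewrite -(ler_pM2l Z0) -{1}(gtr0_norm Z0) -normrM.
rewrite (split_error Z (p a) (p b) (c a') (c b') a b d m) -/a' -/b'.
apply: le_trans (ler_normD _ _) _; apply: le_trans (lerD (ler_normD _ _) (lexx _)) _.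
apply: le_trans (lerD (lerD (ler_normB _ _) (lexx _)) (lexx _)) _.
apply: le_trans (lerD (lerD (lerD QQ Nb) Na) (lexx _)) _.
have md : `|Z * (3 * d * m)| <= Z * (e * 3 / 8).
  rewrite normrM (gtr0_norm Z0) ler_wpM2l ?(ltW Z0)// normrM normrM (gtr0_norm d0) (ger0_norm (ler0n R 3)).
  have : d * (8 * (`|m| + 1)) <= e by rewrite -ler_pdivlMr.
  exact: alg_m (ltW d0).
apply: le_trans (lerD (lexx _) md) _.
have -> : Z * (e + M * (b - a)) = Z * M * (b - a) + Z * e by ring.
have Ze : 0 <= Z * e by rewrite mulr_ge0 ?ltW.
have ZM : (b' - a') * (M * Z) <= Z * M * (b - a).
  rewrite mulrC (mulrC M); apply: ler_wpM2l; first by rewrite mulr_ge0// ltW.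
  by rewrite /a' /b'; move: d0; clear; lra.
have -> : e / 4 * Z = Z * e / 4 by ring.
have -> : Z * (e * 3 / 8) = Z * e * 3 / 8 by ring.
exact: sum_up ZM Ze.
Qed.

End weak_time.

Section weak_strong.
Context {R : realType}.
Local Notation lam := (@lebesgue_measure R).
Local Notation RR := (measurableTypeR R).
Variable T : R.
Hypothesis T0 : 0 < T.
Implicit Types (f v g : R -> R3 R -> R) (psi phi : R3 R -> R).

Local Notation I F := (\int[lam]_(t in `]0, T[) F t).
Local Notation ct F := {within `[0, T], continuous F}.

Lemma cont_sob_L2 m f t : cont_sob T m f -> 0 <= t <= T -> is_L2 (f t).
Proof. by move=> cf tT; have [[N /sob_L2]] := cf t tT. Qed.

Lemma cont_sob_nrm m f t e : cont_sob T m f -> 0 <= t <= T -> 0 < e -> exists2 d, 0 < d &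
  forall s, 0 <= s <= T -> `|s - t| <= d -> nrm (f s \- f t) <= e.
Proof.
move=> cf tT e0; have [_ /(_ _ (exprn_gt0 2 e0))[d d0 H]] := cf t tT.
exists d => // s sT sd; have := sob_nrm (H s sT sd).
by rewrite ler_pXn2r ?nnegrE ?nrm_ge0 ?(ltW e0).
Qed.

Lemma cont_ip m f phi : cont_sob T m f -> is_L2 phi -> ct (fun t => ip (f t) phi).
Proof.
move=> cf Lp; apply: within_cont => t e; rewrite /= in_itv/= => tT e0.
have n1 : 0 < nrm phi + 1 by rewrite ltr_wpDl ?nrm_ge0.
have [d d0 Hd] := cont_sob_nrm cf tT (divr_gt0 e0 n1); exists d => // s.
rewrite in_itv/= => sT sd; have Ls := cont_sob_L2 cf sT; have Lt := cont_sob_L2 cf tT.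
rewrite -(ipBl Ls Lt Lp); apply: le_trans (ip_cs (L2B Ls Lt) Lp) _.
apply: le_trans (_ : e / (nrm phi + 1) * (nrm phi + 1) <= _); last by rewrite divfK// gt_eqF.
apply: ler_pM; [exact: nrm_ge0|exact: nrm_ge0|exact: Hd|by rewrite lerDl].
Qed.

Lemma sm1_ct eta : sm1 eta -> ct eta.
Proof. by move=> se; apply: continuous_subspaceT; exact: sm1_continuous. Qed.

(** Tested with a function of space, f becomes a real function with weak derivative - v, which
    obeys the mean value inequality; the norm is recovered from the tests. *)
Lemma weak_strong m m' f v : cont_sob T m f -> cont_sob T m' v ->
  (forall eta psi, test1 [pred t | 0 < t < T] eta -> tst psi ->
     I (fun t => derive1 eta t * ip (f t) psi) = I (fun t => eta t * ip (v t) psi)) ->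
  forall t e, 0 <= t <= T -> 0 < e -> exists2 d, 0 < d &
  forall s, 0 <= s <= T -> `|s - t| <= d -> nrm (f s \- f t \+ ((s - t) \*o v t)) <= e * `|s - t|.
Proof.
move=> cf cv W t e tT e0.
have W' phi : tspan phi -> forall eta, test1 [pred t | 0 < t < T] eta ->
    I (fun t => derive1 eta t * ip (f t) phi) = I (fun t => eta t * ip (v t) phi).
  elim=> {phi} [psi tp eta te|c phi psi sp Hp sq Hq eta te]; first exact: W.
  have Lp := tspan_L2 sp; have Lq := tspan_L2 sq; have Lcq := L2Z c Lq.
  have [se _] := te; have ce := sm1_ct se; have cde := sm1_ct (sm1_derive se).
  rewrite (@int_eq _ _ _ (fun t => derive1 eta t * ip (f t) phi + c * (derive1 eta t * ip (f t) psi))); last first.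
    move=> s /andP[s0 sT]; have sT' : 0 <= s <= T by rewrite (ltW s0) ltW.
    have Lf := cont_sob_L2 cf sT'; rewrite (ipDr Lp Lcq Lf) (ipZr c Lq Lf); move: (ip _ _) (ip _ _) => x y; ring.
  rewrite (@int_eq _ _ (fun t => eta t * ip (v t) _) (fun t => eta t * ip (v t) phi + c * (eta t * ip (v t) psi))); last first.
    move=> s /andP[s0 sT]; have sT' : 0 <= s <= T by rewrite (ltW s0) ltW.
    have Lv := cont_sob_L2 cv sT'; rewrite (ipDr Lp Lcq Lv) (ipZr c Lq Lv); move: (ip _ _) (ip _ _) => x y; ring.
  rewrite (int_lin c (ctM cde (cont_ip cf Lp)) (ctM cde (cont_ip cf Lq))).
  rewrite (int_lin c (ctM ce (cont_ip cv Lp)) (ctM ce (cont_ip cv Lq))).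
  by rewrite (Hp eta te) (Hq eta te).
have [d d0 Hd] := cont_sob_nrm cv tT e0; exists d => // s sT sd.
have Lft := cont_sob_L2 cf tT; have Lfs := cont_sob_L2 cf sT; have Lv := cont_sob_L2 cv tT.
have LD := L2B Lfs Lft; have LZ := L2Z (s - t) Lv.
apply: nrm_le_tspan; [exact: L2D|by rewrite mulr_ge0// ltW|] => phi sp.
have Lp := tspan_L2 sp; have M0 : 0 <= e * nrm phi by rewrite mulr_ge0 ?nrm_ge0// ltW.
rewrite (ipDl LD LZ Lp) (ipBl Lfs Lft Lp) (ipZl _ Lv Lp).
have rM x : 0 <= x <= T -> `|x - t| <= d -> `|ip (v x) phi - ip (v t) phi| <= e * nrm phi.
  move=> xT xd; have Lx := cont_sob_L2 cv xT.
  rewrite -(ipBl Lx Lv Lp); apply: le_trans (ip_cs (L2B Lx Lv) Lp) _.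
  by rewrite ler_wpM2r ?nrm_ge0// Hd.
have /andP[t0 tT'] := tT; have /andP[s0 sT'] := sT.
have key a b : 0 <= a -> a < b -> b <= T -> (forall x, a <= x <= b -> `|x - t| <= d) ->
    `|ip (f b) phi - ip (f a) phi + (b - a) * ip (v t) phi| <= e * nrm phi * (b - a).
  move=> a0 ab bT H; apply: (weak_increment (cont_ip cf Lp) (cont_ip cv Lp) (W' _ sp)) => // x xab.
  by apply: rM; [case/andP: xab => ? ?; apply/andP; split; lra|exact: H].
rewrite mulrAC; have [st|ts|->] := ltgtP s t; last by rewrite !subrr mul0r addr0 normr0 mulr0.
- have E (x y c : R) : x - y + (s - t) * c = - (y - x + (t - s) * c) by ring.
  rewrite E normrN (ltr0_norm (_ : s - t < 0)) ?subr_lt0// opprB.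
  apply: key => // x /andP[sx xt].
  by apply: le_trans sd; rewrite !ler0_norm ?subr_le0 ?(ltW st)// lerN2 lerD2r.
- rewrite (gtr0_norm (_ : 0 < s - t)) ?subr_gt0//; apply: key => // x /andP[tx xs].
  by apply: le_trans sd; rewrite !ger0_norm ?subr_ge0 ?(ltW ts)// lerD2r.
Qed.

(** The function 0 has weak derivative - r, so its increments, which vanish, approximate those of
    a primitive of r. *)
Lemma fund0 (r : R -> R) : ct r ->
  (forall eta, test1 [pred t | 0 < t < T] eta -> I (fun t => eta t * r t) = 0) ->
  forall t, 0 <= t <= T -> r t = 0.
Proof.
move=> cr W t tT; apply/eqP; rewrite -normr_le0; apply/ler_addgt0Pl => e e0; rewrite addr0.
have tI : `[0, T]%classic t by rewrite /= in_itv/=.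
have [d d0 Hd] := within_contP cr tI e0.
have c0 : ct (fun _ : R => 0 : R) by apply: ctT => x; exact: cvg_cst.
have W0 eta : test1 [pred t | 0 < t < T] eta -> I (fun t => derive1 eta t * 0) = I (fun t => eta t * r t).
  move=> te; rewrite (W eta te); transitivity (I (fun _ : R => 0 : R)).
    by apply: int_eq => s _; rewrite mulr0.
  by rewrite Rintegral_cst ?mul0r//; exact: measurable_itv.
have key a b : 0 <= a -> a < b -> b <= T -> (forall x, a <= x <= b -> `|x - t| <= d) -> `|r t| <= e.
  move=> a0 ab bT H.
  have := weak_increment c0 cr W0 a0 ab bT (m := r t) (M := e) _.
  rewrite subrr add0r normrM (gtr0_norm (_ : 0 < b - a)) ?subr_gt0// mulrC.
  rewrite ler_pM2r ?subr_gt0//; apply => x xab; apply: Hd; last exact: H.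
  by rewrite /= in_itv/=; case/andP: xab => ? ?; apply/andP; split; lra.
have [s [sT st sd]] := near_time T0 tT d0.
have /andP[t0 tT'] := tT; have /andP[s0 sT'] := sT.
move: st; rewrite neq_lt => /orP[st|ts].
- apply: (key s t) => // x /andP[sx xt].
  by apply: le_trans sd; rewrite !ler0_norm ?subr_le0 ?(ltW st)// lerN2 lerD2r.
- apply: (key t s) => // x /andP[tx xs].
  by apply: le_trans sd; rewrite !ger0_norm ?subr_ge0 ?(ltW ts)// lerD2r.
Qed.

(** A material derivative is known only through its integrals against tests of space-time.
    With a tensor test they determine its inner product with a function of space at every time, by
    continuity in time. *)
Lemma Dt_null (u : 'I_3 -> R -> R3 R -> R) f :
  (forall eta psi, test1 [pred t | 0 < t < T] eta -> tst psi ->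
    I (fun t => intO (fun x => f t x * ('D_1 (fun s => eta s * psi x) t +
          \sum_(i < 3) 'D_(evec i) (fun y => u i t y * (eta t * psi y)) x))) = 0) ->
  forall t, 0 <= t <= T -> is_L2 (Dt T u f t) /\ nrm (Dt T u f t) = 0.
Proof.
move=> H t tT; rewrite /Dt; case: xgetP => [g _ [cg Hg]|_]; last by split; [exact: L20|exact: nrm0].
have cg' : cont_sob T 0 g := cont_H_sob cg.
have Lg := cont_sob_L2 cg' tT; split => //; apply: L2_test0 => // psi tp.
have Lp := tst_L2 tp.
apply: (@fund0 (fun t => ip (g t) psi) (cont_ip cg' Lp)); last exact: tT.
move=> eta te; have E := Hg _ (test_function_time te tp).
have E0 := etrans (esym (H eta psi te tp)) E.
apply: oppr_inj; rewrite oppr0; apply: esym; apply: etrans E0 _; congr (- _).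
apply: int_eq => s /andP[s0 sT]; have sT' : 0 <= s <= T by rewrite (ltW s0) ltW.
have Ls := cont_sob_L2 cg' sT'.
rewrite -(ipZr (eta s) Lp Ls) ipE; congr intO; apply/funext => x /=; ring.
Qed.

End weak_strong.

Section continuous3.
Context {R : realType}.
Local Notation D := (@half_space R).
Local Notation mu := (@leb3 R).
Local Notation RR := (measurableTypeR R).
Local Notation E3 := (RR * RR * RR)%type.

(** * Continuous functions of space *)

Let cell (k : nat * (int * int * int)) : set E3 :=
  (`](k.2.1.1%:~R - 1) / k.1.+1%:R, (k.2.1.1%:~R + 1) / k.1.+1%:R[ `*`
   `](k.2.1.2%:~R - 1) / k.1.+1%:R, (k.2.1.2%:~R + 1) / k.1.+1%:R[) `*`
   `](k.2.2%:~R - 1) / k.1.+1%:R, (k.2.2%:~R + 1) / k.1.+1%:R[.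

Let cell_dist (a : int) (n : nat) (x y : R) :
  (a%:~R - 1) / n.+1%:R < x < (a%:~R + 1) / n.+1%:R ->
  (a%:~R - 1) / n.+1%:R < y < (a%:~R + 1) / n.+1%:R -> `|x - y| < 2 / n.+1%:R.
Proof.
move=> /andP[x1 x2] /andP[y1 y2].
have E : 2 / n.+1%:R = (a%:~R + 1) / n.+1%:R - (a%:~R - 1) / n.+1%:R :> R by rewrite -mulrBl; congr (_ / _); ring.
rewrite {}E; move: (_ / _) (_ / _) x1 x2 y1 y2 => p q *; rewrite ltr_norml; apply/andP; split; lra.
Qed.

Let cell_floor (n : nat) (x : R) :
  ((Num.floor (n.+1%:R * x))%:~R - 1) / n.+1%:R < x < ((Num.floor (n.+1%:R * x))%:~R + 1) / n.+1%:R.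
Proof.
have n0 : 0 < n.+1%:R :> R by [].
rewrite ltr_pdivrMr// ltr_pdivlMr// !(mulrC x).
have /andP[] := floor_itv (n.+1%:R * x); rewrite intrD mulr1z.
by set a : R := (Num.floor _)%:~R; set b := n.+1%:R * x => h1 h2; apply/andP; split; lra.
Qed.

(** An open set is a union of cubes with rational centres and sides. *)
Lemma open3_measurable (U : set (R3 R)) : open U -> measurable (U : set E3).
Proof.
move=> oU.
have -> : U = \bigcup_k (if `[< cell k `<=` U >] then cell k else set0).
  apply/seteqP; split; last by move=> x [k _]; case: asboolP => // kU; exact: kU.
  move=> x Ux; have /nbhs_ballP[e /= e0 He] : nbhs x U by apply: open_nbhs_nbhs.
  pose n := Num.truncn (2 / e).
  have ne : 2 / n.+1%:R < e by rewrite ltr_pdivrMr// mulrC -ltr_pdivrMr//; exact: truncnS_gt.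
  pose k := (n, (Num.floor (n.+1%:R * x.1.1), Num.floor (n.+1%:R * x.1.2), Num.floor (n.+1%:R * x.2))).
  have kx : cell k x by split; [split|]; rewrite /= in_itv/=; exact: cell_floor.
  exists k => //; case: asboolP => // nk; exfalso; apply: nk => y [[/= y1 y2] y3].
  move: y1 y2 y3; rewrite !in_itv/= => y1 y2 y3.
  apply: He; split; [split|]; rewrite /ball/=; apply: lt_trans ne;
    by apply: cell_dist (cell_floor n _) _.
apply: countable_bigcupT_measurable; first exact: countableP.
move=> k; case: asboolP => // _; apply: measurableX; [apply: measurableX|]; exact: measurable_itv.
Qed.

Lemma continuous3_measurable (A : R3 R -> R) : continuous A -> measurable_fun setT (A : E3 -> RR).
Proof.
move=> /continuousP cA; apply: (measurability _ (RGenOpens.measurableE R)).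
move=> _ [_ [a [b ->] <-]]; rewrite setTI; apply: open3_measurable; exact/cA/interval_open.
Qed.

Lemma intO_cube (A : R3 R -> R) n (C : R) : continuous A -> (forall x, `|A x| <= C) ->
  (forall x, ~ cube3 n x -> A x = 0) ->
  [/\ is_L2 A, mu.-integrable D (EFin \o A) & `|intO A| <= C * (2 * n%:R) ^+ 3].
Proof.
move=> cA HAC A0; have C0 : 0 <= C by apply: le_trans (HAC 0); exact: normr_ge0.
have mA : measurable_fun D A by apply: measurable_funTS; exact: continuous3_measurable.
have [LA nA] := L2_box mA (fun x _ => HAC x) A0.
pose o : R3 R -> R := \1_(cube3 n : set E3).
have mo : measurable_fun (D : set E3) o.
  by apply: measurable_indic; exact: measurable_cube3.
have o1 x : D x -> `|o x| <= 1 by move=> _; rewrite /o indicE; exact: norm_bool.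
have o0 x : ~ cube3 n x -> o x = 0 by move=> nx; rewrite /o indicE memNset.
have [Lo no] := L2_box mo o1 o0.
have Ao : A = A \* o.
  apply/funext => x /=; rewrite /o indicE; have [/set_mem|/negP nx] := boolP (x \in _); first by rewrite mulr1.
  by rewrite mulr0 A0// => xc; apply: nx; exact/mem_set.
split => //; first by rewrite Ao; exact: L2_mul.
have -> : intO A = ip A o by rewrite ipE {1}Ao.
apply: le_trans (ip_cs LA Lo) _; rewrite expr1n mul1r in no.
have m0 : 0 <= (2 * n%:R : R) ^+ 3 by rewrite exprn_ge0.
rewrite -(@ler_pXn2r _ 2)// ?nnegrE ?mulr_ge0 ?nrm_ge0//.
move: nA no m0; move: (_ ^+ 3) => L nA no L0.
rewrite exprMn [(C * L) ^+ 2]exprMn; apply: le_trans (ler_pM (sqr_ge0 _) (sqr_ge0 _) nA no) _.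
by rewrite -mulrA -expr2.
Qed.

End continuous3.

Section unif.
Context {R : realType} {V : normedModType R}.

(** Near-covering compactness gives a uniform modulus even though G is assumed continuous at the
    points of K only. *)
Lemma unif_dir (K : set V) (G : V -> R) (v : V) (e : R) : compact K ->
  (forall z, K z -> {for z, continuous G}) -> 0 < e ->
  exists2 d, 0 < d & forall z s, K z -> `|s| <= d -> `|G (z + s *: v) - G z| <= e.
Proof.
move=> /compact_near_coveringP cK cG e0.
have e2 : 0 < e / 2 by rewrite divr_gt0.
have H := cK R (nbhs (0 : R)) (fun s z => `|G (z + s *: v) - G z| <= e) _ _.
have /nbhs_ballP[d /= d0 Hd] : \forall s \near nbhs (0 : R), K `<=` (fun z => `|G (z + s *: v) - G z| <= e).
  apply: H => z Kz.
  have c1 : (fun p : V * R => p.1 + p.2 *: v) p @[p --> (z, 0 : R)] --> z + (0 : R) *: v.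
    apply: cvgD; first exact: cvg_fst.
    by apply: cvgZ; [exact: cvg_snd|exact: cvg_cst].
  rewrite scale0r addr0 in c1.
  have c2 : (fun p : V * R => G (p.1 + p.2 *: v)) p @[p --> (z, 0 : R)] --> G z.
    by apply: (cvg_comp _ _ c1); exact: cG.
  have c3 : (fun p : V * R => G p.1) p @[p --> (z, 0 : R)] --> G z.
    by apply: (cvg_comp _ _ cvg_fst); exact: cG.
  have h1 := cvgr_dist_le _ _ c2 _ e2; have h2 := cvgr_dist_le _ _ c3 _ e2.
  apply: filterS (filterI (h1 _) (h2 _)) => -[x' s] /= [H1 H2].
  have -> : G (x' + s *: v) - G x' = - (G z - G (x' + s *: v)) + (G z - G x') by ring.
  by rewrite (splitr e); apply: le_trans (ler_normD _ _) _; rewrite normrN; exact: lerD.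
exists (d / 2); first by rewrite divr_gt0.
move=> z s Kz sd; apply: Hd => //; rewrite /ball/= sub0r normrN.
by apply: le_lt_trans sd _; rewrite ltr_pdivrMr// ltr_pMr// ltr1n.
Qed.

Lemma compact_bound (K : set V) (G : V -> R) : compact K ->
  (forall z, K z -> {for z, continuous G}) -> exists2 C, 0 <= C & forall z, K z -> `|G z| <= C.
Proof.
move=> cK cG.
have cGK : {within K, continuous G}.
  apply/subspace_continuousP => z Kz; apply: cvg_within_filter; exact: cG.
have := compact_bounded (continuous_compact cGK cK).
move=> [M [_ /(_ (`|M| + 1))]]; rewrite (le_lt_trans (ler_norm M)) ?ltrDl// => /(_ isT) H.
by exists (`|M| + 1) => [|z Kz]; [rewrite addr_ge0|apply: H; exists z].
Qed.

End unif.

Section directional.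
Context {R : realType} {V : normedModType R}.
Implicit Types (K U : set V) (F G : V -> R) (v z : V).

Lemma for_cont F z l : F z = l -> F @ z --> l -> {for z, continuous F}.
Proof. by move=> <-. Qed.

Lemma unif_open K U v : compact K -> open U -> K `<=` U ->
  exists2 d, 0 < d & forall z s, K z -> `|s| <= d -> U (z + s *: v).
Proof.
move=> cK oU KU; have h2 : 0 < 1 / 2 :> R by rewrite divr_gt0.
have c1 z : K z -> {for z, continuous (\1_U : V -> R)}.
  move=> /KU Uz; apply: (@for_cont _ _ 1); first by rewrite indicE mem_set.
  apply: cvg_near_cst.
  have : \forall y \near z, U y by apply: open_nbhs_nbhs.
  by apply: filterS => y Uy; rewrite indicE mem_set.
have [d d0 Hd] := @unif_dir R V K (\1_U) v _ cK c1 h2.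
exists d => // z s Kz sd; have := Hd z s Kz sd.
rewrite !indicE (mem_set (KU _ Kz)); have [/set_mem//|_] := boolP (_ \in _).
by rewrite sub0r normrN normr1; lra.
Qed.

Lemma quot_line F v z (s : R) :
  (fun k : R => k^-1 *: (F (z + (k *: 1 + s) *: v) - F (z + s *: v))) =
  (fun k : R => k^-1 *: ((F \o shift (z + s *: v)) (k *: v) - F (z + s *: v))).
Proof.
apply/funext => k; congr (_ *: (F _ - _)); rewrite /= /shift scalerDl addrA [RHS]addrC addrAC.
by congr (_ + _ + _); rewrite [_ *: 1]mulr1.
Qed.

Lemma derivable_line F v z (s : R) : derivable F (z + s *: v) v ->
  is_derive s 1 (fun s => F (z + s *: v)) ('D_v F (z + s *: v)).
Proof.
move=> dF; apply: DeriveDef.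
  by rewrite /derivable quot_line.
by rewrite /derive quot_line.
Qed.

Lemma dir_mvt F v z h : 0 <= h -> (forall s, 0 <= s <= h -> derivable F (z + s *: v) v) ->
  exists2 s, 0 <= s <= h & F (z + h *: v) - F z = h * 'D_v F (z + s *: v).
Proof.
move=> h0 dF; have [||s sh E] := @MVT_segment R (fun s => F (z + s *: v)) (fun s => 'D_v F (z + s *: v)) 0 h h0.
- move=> s; rewrite in_itv/= => /andP[s0 sh]; apply: derivable_line; apply: dF.
  by rewrite (ltW s0) ltW.
- apply: derivable_within_continuous => r; rewrite in_itv/= => rh.
  by have [] := derivable_line (dF r rh).
by exists s; [rewrite in_itv/= in sh|move: E; rewrite scale0r addr0 subr0 mulrC].
Qed.

(** The mean value theorem on the segment from z, along which the derivative varies by at most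
    e, uniformly near K. *)
Lemma dir_taylor K U F v e : compact K -> open U -> K `<=` U ->
  (forall z, U z -> derivable F z v) -> (forall z, U z -> {for z, continuous ('D_v F)}) -> 0 < e ->
  exists2 d, 0 < d & forall z h, K z -> `|h| <= d -> 
    `|F (z + h *: v) - F z - h * 'D_v F z| <= e * `|h|.
Proof.
move=> cK oU KU dF cF e0.
have [d1 d10 H1] := unif_open v cK oU KU.
have [d2 d20 H2] := unif_dir v cK (fun z Kz => cF z (KU z Kz)) e0.
exists (Num.min d1 d2); first by rewrite lt_min d10.
move=> z h Kz; rewrite le_min => /andP[h1 h2].
have [h0|h0] := leP 0 h.
- have [s|s /andP[s0 sh] ->] := @dir_mvt F v z h h0.
    move=> /andP[s0 sh]; apply: dF; apply: H1 => //; rewrite ger0_norm// (le_trans sh)//.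
    exact: le_trans (ler_norm _) h1.
  rewrite -mulrBr normrM mulrC ler_wpM2r//; apply: H2 => //.
  by rewrite ger0_norm// (le_trans sh)// (le_trans (ler_norm _) h2).
have h0' : 0 <= - h by rewrite oppr_ge0 ltW.
have hN : `|h| = - h by rewrite ltr0_norm.
have [s|s /andP[s0 sh]] := @dir_mvt F v (z + h *: v) (- h) h0'.
  move=> /andP[s0 sh]; rewrite -addrA -scalerDl; apply: dF; apply: H1 => //.
  by rewrite ler_norml; apply/andP; split; lra.
rewrite -[in F (_ + _ + _)]addrA -scalerDl subrr scale0r addr0 -addrA -scalerDl => E.
have -> : F (z + h *: v) - F z - h * 'D_v F z = h * ('D_v F (z + (h + s) *: v) - 'D_v F z).
  by rewrite -[F (z + _) - _]opprB E; ring.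
rewrite normrM mulrC ler_wpM2r//; apply: H2 => //.
by rewrite ler_norml; apply/andP; split; lra.
Qed.

Lemma derive_translate F v w z : 'D_v (fun y => F (y + w)) z = 'D_v F (z + w).
Proof.
rewrite /derive; suff -> : (fun h : R => h^-1 *: (((fun y => F (y + w)) \o shift z) (h *: v) - F (z + w))) =
  (fun h : R => h^-1 *: ((F \o shift (z + w)) (h *: v) - F (z + w))) by [].
by apply/funext => h; rewrite /= /shift -addrA.
Qed.

Lemma derivable_shift F v w z : derivable F (z + w) v -> derivable (fun y => F (y + w)) z v.
Proof.
rewrite /derivable; suff -> : (fun h : R => h^-1 *: (((fun y => F (y + w)) \o shift z) (h *: v) - F (z + w))) =
  (fun h : R => h^-1 *: ((F \o shift (z + w)) (h *: v) - F (z + w))) by [].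
by apply/funext => h; rewrite /= /shift -addrA.
Qed.

Lemma continuous_at_shift F w z : {for z + w, continuous F} -> {for z, continuous (fun y => F (y + w))}.
Proof.
move=> cF; apply: (@cvg_comp _ _ _ (fun y => y + w) F _ (nbhs (z + w))) => //.
by apply: cvgD; [exact: cvg_id|exact: cvg_cst].
Qed.

(** ** Functions that are C^1 in given directions *)

(** The family v contains the coordinate directions of space, or those of space-time. *)
Definition c1 {J : Type} (v : J -> V) U F := forall z, U z ->
  {for z, continuous F} /\ forall a, derivable F z (v a) /\ {for z, continuous ('D_(v a) F)}.

Section c1.
Context {J : Type} (v : J -> V) (U : set V).
Hypothesis oU : open U.

Let nearU z : U z -> \forall y \near z, U y.
Proof. by move=> Uz; apply: open_nbhs_nbhs. Qed.

Lemma cont_eq F G z : U z -> (forall y, U y -> F y = G y) -> {for z, continuous F} -> {for z, continuous G}.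
Proof.
move=> Uz FG cF; apply: (@for_cont _ _ (F z)); first by rewrite FG.
apply: cvg_trans cF; by apply: near_eq_cvg; near=> y; rewrite FG//; near: y; exact: nearU.
Unshelve. all: end_near. Qed.

Lemma c1_ext F G : (forall z, U z -> F z = G z) -> c1 v U F -> c1 v U G.
Proof.
move=> FG cF z Uz; have [c d] := cF z Uz; split; first exact: cont_eq FG c.
have E y a : U y -> 'D_(v a) F y = 'D_(v a) G y.
  by move=> Uy; apply: near_eq_derive; near=> x; apply: FG; near: x; exact: nearU.
move=> a; have [da ca] := d a; split.
  by apply: near_eq_derivable da; near=> x; apply: FG; near: x; exact: nearU.
by apply: cont_eq ca => // y Uy; exact: E.
Unshelve. all: end_near. Qed.

Lemma addfE F G : (fun z => F z + G z) = F + G. Proof. by []. Qed.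
Lemma mulfE F G : (fun z => F z * G z) = F * G. Proof. by []. Qed.

Lemma c1_cst k : c1 v U (fun=> k).
Proof.
move=> z Uz; split; first exact: cvg_cst.
move=> a; split; first exact: derivable_cst.
by apply: (@cont_eq (fun=> 0)) => //; [move=> y _; rewrite derive_cst|exact: cvg_cst].
Qed.

Lemma c1D F G : c1 v U F -> c1 v U G -> c1 v U (fun z => F z + G z).
Proof.
move=> cF cG z Uz; have [cf df] := cF z Uz; have [cg dg] := cG z Uz.
split; first exact: cvgD.
move=> a; have [dfa cfa] := df a; have [dga cga] := dg a; rewrite addfE.
split; first exact (derivableD dfa dga).
apply: (@cont_eq (fun z => 'D_(v a) F z + 'D_(v a) G z) _ _ Uz); last exact: (cvgD cfa cga).
move=> y Uy; have [_ /(_ a)[dfy _]] := cF y Uy; have [_ /(_ a)[dgy _]] := cG y Uy.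
by rewrite (deriveD dfy dgy).
Qed.

Lemma c1M F G : c1 v U F -> c1 v U G -> c1 v U (fun z => F z * G z).
Proof.
move=> cF cG z Uz; have [cf df] := cF z Uz; have [cg dg] := cG z Uz.
split; first exact: cvgM.
move=> a; have [dfa cfa] := df a; have [dga cga] := dg a; rewrite mulfE.
split; first exact (derivableM dfa dga).
apply: (@cont_eq (fun z => F z * 'D_(v a) G z + G z * 'D_(v a) F z) _ _ Uz); last first.
  by apply: cvgD; [exact: (cvgM cf cga)|exact: (cvgM cg cfa)].
move=> y Uy; have [_ /(_ a)[dfy _]] := cF y Uy; have [_ /(_ a)[dgy _]] := cG y Uy.
by rewrite (deriveM dfy dgy).
Qed.

Lemma c1N F : c1 v U F -> c1 v U (fun z => - F z).
Proof.
move=> cF; apply: c1_ext (c1M (c1_cst (-1)) cF) => z _; exact: mulN1r.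
Qed.

Lemma c1V F : (forall z, U z -> F z != 0) -> c1 v U F -> c1 v U (fun z => (F z)^-1).
Proof.
move=> F0 cF z Uz; have [cf df] := cF z Uz.
have Fz := F0 z Uz; split; first exact: cvgV.
move=> a; have [dfa cfa] := df a; split; first exact: derivableV.
apply: (@cont_eq (fun z => - (F z ^- 2) * 'D_(v a) F z) _ _ Uz); last first.
  apply: cvgM cfa; apply: cvgN; apply: cvgV; first by rewrite expf_neq0.
  by rewrite expr2; exact: (cvgM cf cf).
move=> y Uy; have [_ /(_ a)[dfy _]] := cF y Uy.
by rewrite (deriveV (F0 y Uy) dfy).
Qed.

Lemma c1_sub U' F : U' `<=` U -> c1 v U F -> c1 v U' F.
Proof. by move=> s c z /s; exact: c. Qed.

(** F vanishes near every point outside K. *)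
Lemma c1_glue K F : compact K -> K `<=` U -> (forall z, ~ K z -> F z = 0) -> c1 v U F -> c1 v setT F.
Proof.
move=> cK KU F0 cF z _; have [Kz|nK] := pselect (K z); first by apply: cF; exact: KU.
have oK : open (~` K) by apply: closed_openC; apply: compact_closed => //; exact: norm_hausdorff.
have nF : \forall y \near z, ~ K y by apply: open_nbhs_nbhs.
have z0 : F z = 0 by exact: F0.
have nE : \forall y \near z, F y = 0 by apply: filterS nF => y; exact: F0.
split; first by apply: (for_cont z0); apply: cvg_near_cst.
have d0 a y : ~ K y -> 'D_(v a) F y = 0.
  move=> nKy; rewrite (@near_eq_derive _ _ _ _ (fun=> 0)) ?derive_cst//.
  have : \forall y' \near y, ~ K y' by apply: open_nbhs_nbhs.
  by apply: filterS => y'; exact: F0.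
move=> a; split.
  apply: near_eq_derivable (derivable_cst (0 : R) z (v a)).
  by apply: filterS nE => y ->.
apply: (@for_cont _ _ 0); first exact: d0.
apply: cvg_near_cst; by apply: filterS nF => y; exact: d0.
Qed.

End c1.
End directional.

Section spacetime.
Context {R : realType}.
Local Notation D := (@half_space R).
Local Notation mu := (@leb3 R).
Local Notation lam := (@lebesgue_measure R).
Local Notation RR := (measurableTypeR R).
Local Notation E3 := (RR * RR * RR)%type.
Local Notation Z := (R * R3 R)%type.
Variable T : R.
Hypothesis T0 : 0 < T.
Implicit Types (H G A S : Z -> R) (z : Z).
Local Notation I F := (\int[lam]_(t in `]0, T[) F t).
Local Notation ct F := {within `[0, T], continuous F}.

(** * Integration by parts in space-time *)

(** The direction None is that of time. *)
Definition stv (a : option 'I_3) : Z := if a is Some i then (0, evec i) else (1, 0).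

Definition slab : set Z := [set z | 0 < z.1 < T /\ D z.2].

Definition stbox (n : nat) : set Z :=
  `[n.+1%:R^-1, T - n.+1%:R^-1] `*`
  ((`[- n.+1%:R, n.+1%:R] `*` `[- n.+1%:R, n.+1%:R]) `*` `[n.+1%:R^-1, n.+1%:R]).

Lemma stboxP n z : stbox n z <-> [/\ n.+1%:R^-1 <= z.1 <= T - n.+1%:R^-1,
  `|z.2.1.1| <= n.+1%:R, `|z.2.1.2| <= n.+1%:R & n.+1%:R^-1 <= z.2.2 <= n.+1%:R].
Proof.
rewrite !ler_norml; split.
  by move=> [] /=; rewrite in_itv/= => -> [[]]/=; rewrite !in_itv/= => -> ->.
by move=> [h1 h2 h3 h4]; split; [|split; [split|]]; rewrite /= in_itv.
Qed.

Lemma compact_stbox n : compact (stbox n).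
Proof.
by apply: compact_setX; [|apply: compact_setX; [apply: compact_setX|]]; exact: segment_compact.
Qed.

Lemma stbox_slab n : stbox n `<=` slab.
Proof.
move=> z /stboxP[/andP[h1 h2] _ _ /andP[h3 _]].
have n0 : 0 < n.+1%:R^-1 :> R by rewrite invr_gt0.
split; last exact: lt_le_trans h3.
by move: (n.+1%:R^-1) n0 h1 h2 => k n0 h1 h2; apply/andP; split; lra.
Qed.

Lemma stbox_mono m n : (m <= n)%N -> stbox m `<=` stbox n.
Proof.
move=> mn z /stboxP[/andP[h1 h2] h3 h4 /andP[h5 h6]]; apply/stboxP.
have nm : n.+1%:R^-1 <= m.+1%:R^-1 :> R by rewrite lef_pV2 ?posrE// ler_nat.
have mn' : m.+1%:R <= n.+1%:R :> R by rewrite ler_nat.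
split; [|exact: le_trans mn'|exact: le_trans mn'|].
  by move: (_^-1) (_^-1) nm h1 h2 => a b *; apply/andP; split; lra.
by apply/andP; split; [exact: le_trans nm h5|exact: le_trans h6 mn'].
Qed.

Lemma stbox_cube n z : stbox n z -> cube3 n.+1 z.2.
Proof.
move=> /stboxP[_ h3 h4 /andP[h5 h6]]; rewrite !ler_norml in h3 h4.
have n0 : 0 < n.+1%:R^-1 :> R by rewrite invr_gt0.
split; [split|]; rewrite /= in_itv//=; apply/andP; split; last by [].
apply: (@le_trans _ _ 0); first by rewrite oppr_le0 ler0n.
exact: ltW (lt_le_trans n0 h5).
Qed.

Lemma stbox_shift n a z s : stbox n z -> `|s| <= (2 * n.+1%:R)^-1 -> stbox n.*2.+1 (z + s *: stv a).
Proof.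
move=> /stboxP[/andP[h1 h2] h3 h4 /andP[h5 h6]] hs; apply/stboxP.
rewrite (_ : (n.*2.+2)%:R = 2 * n.+1%:R :> R); last by rewrite -natrM mul2n doubleS.
have n1 : 1 <= n.+1%:R :> R by rewrite ler1n.
rewrite invfM in hs *; have i0 : 0 < n.+1%:R^-1 :> R by rewrite invr_gt0.
have i1 : n.+1%:R^-1 <= 1 :> R by rewrite invf_le1.
have key (b : bool) : `|s * b%:R| <= 2^-1 * n.+1%:R^-1.
  by case: b; rewrite ?mulr1// mulr0 normr0 mulr_ge0// ltW.
move: (n.+1%:R^-1) i0 i1 h1 h2 h5 key => k i0 i1 h1 h2 h5 key.
have key2 (x : R) (b : bool) : `|x| <= n.+1%:R -> `|x + s * b%:R| <= 2 * n.+1%:R.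
  by move=> xn; apply: le_trans (ler_normD _ _) _; have := key b; lra.
case: a => [i|] /=; rewrite ?mulr0 ?addr0 ?mulr1; split.
- by apply/andP; split; lra.
- exact: key2.
- exact: key2.
- by move: (key (i == 2 :> nat)); rewrite ler_norml => /andP[? ?]; apply/andP; split; rewrite -[s *: _]/(s * _); lra.
- change (2^-1 * k <= z.1 + s * 1 <= T - 2^-1 * k); rewrite mulr1.
  by move: (key true); rewrite mulr1 ler_norml => /andP[? ?]; apply/andP; split; lra.
- exact: (key2 z.2.1.1 false h3).
- exact: (key2 z.2.1.2 false h4).
- by apply/andP; split; lra.
Qed.

Lemma open_slab : open slab.
Proof.
rewrite openE => z [/andP[z0 zT] zD]; rewrite /interior.
have c1 : (fun z : Z => z.1) y @[y --> z] --> z.1 by exact: cvg_fst.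
have c2 : (fun z : Z => z.2.2) y @[y --> z] --> z.2.2.
  by apply: (cvg_comp snd snd); [exact: cvg_snd|case: (z.2) => ? ?; exact: cvg_snd].
have h1 : \forall y \near z, 0 < (y : Z).1 by apply: (cvgr_gt z.1 c1).
have h2 : \forall y \near z, (y : Z).1 < T by apply: (cvgr_lt z.1 c1).
have h3 : \forall y \near z, 0 < (y : Z).2.2 by apply: (cvgr_gt z.2.2 c2).
by apply: filterS (filterI (filterI h1 h2) h3) => y [[h4 h5] h6]; split => //; apply/andP.
Qed.

Definition off n H := forall z, ~ stbox n z -> H z = 0.

Lemma off_mono m n H : (m <= n)%N -> off m H -> off n H.
Proof. by move=> mn o z nz; apply: o => /(stbox_mono mn). Qed.

Definition cc H := continuous H /\ exists n, off n H.

Lemma cc_bound H : cc H -> exists2 C, 0 <= C & forall z, `|H z| <= C.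
Proof.
move=> [cH [n oH]]; have [C C0 HC] := compact_bound (@compact_stbox n) (fun z _ => cH z).
exists C => // z; have [/HC//|/oH->] := pselect (stbox n z); by rewrite normr0.
Qed.

Definition sl H t : R3 R -> R := fun x => H (t, x).

Lemma continuous_sl H t : continuous H -> continuous (sl H t).
Proof.
move=> cH x; apply: (@cvg_comp _ _ _ (fun x => (t, x)) H _ (nbhs (t, x))); last exact: cH.
by apply: (@cvg_pair _ _ _ (nbhs x) (nbhs t) (nbhs x) _ _ _ (fun=> t) id); [exact: cvg_cst|exact: cvg_id].
Qed.

Lemma sl_cube H n t C : continuous H -> off n H -> (forall z, `|H z| <= C) ->
  [/\ is_L2 (sl H t), mu.-integrable D (EFin \o sl H t) & `|intO (sl H t)| <= C * (2 * n.+1%:R) ^+ 3].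
Proof.
move=> cH oH HC; apply: intO_cube => [|x|x nx]; [exact: continuous_sl|exact: HC|].
by apply: oH => /stbox_cube.
Qed.

Lemma cc_int H t : cc H -> mu.-integrable D (EFin \o sl H t).
Proof. by move=> ccH; have [C _ HC] := cc_bound ccH; case: ccH => cH [n oH]; case: (sl_cube t cH oH HC). Qed.

Lemma intO_lin (c : R) (F G : R3 R -> R) : mu.-integrable D (EFin \o F) -> mu.-integrable D (EFin \o G) ->
  intO (fun x => F x + c * G x) = intO F + c * intO G.
Proof.
move=> iF iG; have mD := @measurable_half_spaceE R.
rewrite /intO RintegralD//; first by rewrite RintegralZl.
by apply: eq_integrable (integrableZl mD c iG) => // s _; rewrite /= EFinM.
Qed.

Lemma cc_lin c H G : cc H -> cc G -> cc (fun z => H z + c * G z).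
Proof.
move=> [cH [m oH]] [cG [n oG]]; split.
  by move=> z; apply: cvgD; [exact: cH|apply: cvgM; [exact: cvg_cst|exact: cG]].
exists (maxn m n) => z nz; rewrite (off_mono (leq_maxl m n) oH)// (off_mono (leq_maxr m n) oG)//.
by rewrite mulr0 addr0.
Qed.

Lemma cc_unif H a e : cc H -> 0 < e -> exists2 d, 0 < d &
  forall z s, `|s| <= d -> `|H (z + s *: stv a) - H z| <= e.
Proof.
move=> [cH [n oH]] e0.
have [d d0 Hd] := unif_dir (stv a) (@compact_stbox n) (fun z _ => cH z) e0; exists d => // z s sd.
have [/Hd->//|nz] := pselect (stbox n z).
have [zs|nzs] := pselect (stbox n (z + s *: stv a)); last by rewrite (oH _ nz) (oH _ nzs) subrr normr0 ltW.
have := Hd _ (- s) zs; rewrite normrN scaleNr addrK => /(_ sd).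
by rewrite distrC.
Qed.

Definition J H := I (fun t => intO (sl H t)).

Lemma cc_time H : cc H -> continuous (fun t => intO (sl H t)).
Proof.
move=> ccH t; apply/cvgrPdist_le => e e0.
have [cH [n oH]] := ccH.
have m0 : 0 < (2 * n.+1%:R) ^+ 3 :> R by rewrite exprn_gt0// mulr_gt0.
have [d d0 Hd] := cc_unif None ccH (divr_gt0 e0 m0).
apply/nbhs_ballP; exists d => // s; rewrite /ball/= => sd.
have -> : intO (sl H t) - intO (sl H s) = intO (sl (fun z => H z + -1 * H (z + (s - t) *: stv None)) t).
  have := intO_lin (-1) (cc_int t ccH) (cc_int s ccH); rewrite mulN1r => <-.
  congr intO; apply/funext => x; rewrite /sl; congr (_ + _ * H _).
  by congr (_, _); rewrite /= ?scaler0 ?addr0// [_ *: 1]mulr1 addrC subrK.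
have b x : `|sl (fun z => H z + -1 * H (z + (s - t) *: stv None)) t x| <= e / (2 * n.+1%:R) ^+ 3.
  by rewrite /sl mulN1r distrC; apply: Hd; rewrite distrC ltW.
have cs : continuous (fun z => H (z + (s - t) *: stv None)) by move=> z; apply: continuous_at_shift; exact: cH.
set G := (fun z => _) in b *; have cG : continuous G.
  move=> z; apply: cvgD; first exact: cH.
  by apply: cvgM; [exact: cvg_cst|exact: cs].
have G0 x : ~ cube3 n.+1 x -> sl G t x = 0.
  move=> nx; rewrite /sl /G !oH ?mulr0 ?addr0//.
    by move=> /stbox_cube /=; rewrite scaler0 addr0.
  by move=> /stbox_cube.
have [_ _] := intO_cube (continuous_sl cG) b G0.
by rewrite divfK// gt_eqF.
Qed.

Lemma J_lin c H G : cc H -> cc G -> J (fun z => H z + c * G z) = J H + c * J G.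
Proof.
move=> ccH ccG; rewrite /J -int_lin; [|apply: ctT; exact: cc_time|apply: ctT; exact: cc_time].
by apply: int_eq => t _; rewrite -intO_lin; [|exact: cc_int|exact: cc_int].
Qed.

Lemma lam_T : fine (lam `]0, T[) = T.
Proof. by rewrite lebesgue_measure_itv/= lte_fin T0/= subr0. Qed.

Lemma J_bound H n C : continuous H -> off n H -> (forall z, `|H z| <= C) -> `|J H| <= C * (2 * n.+1%:R) ^+ 3 * T.
Proof.
move=> cH oH HC; have ccH : cc H by split => //; exists n.
apply: le_trans (int_le (G := fun=> C * (2 * n.+1%:R) ^+ 3) _ _ _) _.
- by apply: ctT; exact: cc_time.
- by apply: ctT => x; exact: cvg_cst.
- by move=> t _; case: (sl_cube t cH oH HC).
rewrite Rintegral_cst//; apply: ler_wpM2l; last by rewrite (_ : fine _ = T)//; exact: lam_T.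
by apply: le_trans (normr_ge0 (intO (sl H 0))) _; case: (sl_cube 0 cH oH HC).
Qed.

Lemma J_eq H G : (forall z, slab z -> H z = G z) -> J H = J G.
Proof.
move=> HG; apply: int_eq => t tT; rewrite /intO; apply: eq_Rintegral => x; rewrite inE => Dx.
by apply: HG; split.
Qed.

Lemma J_time (p : R -> R) h : continuous p -> (forall t, ~~ (0 < t < T) -> p t = 0) ->
  (forall t, ~~ (0 < t < T) -> p (t + h) = 0) -> I (fun t => p (t + h)) = I p.
Proof.
move=> cp p0 ph0; have mp : measurable_fun setT (EFin \o p).
  by apply/measurable_EFinP; exact: continuous_measurable_fun.
have key (q : RR -> \bar R) : measurable_fun setT q -> (forall t, (0 <= q t)%E) ->
    (forall t, ~~ (0 < t < T) -> q t = 0%E) -> (forall t, ~~ (0 < t < T) -> q (t + h) = 0%E) ->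
    (\int[lam]_(t in `]0%R, T[) q (t + h)%R = \int[lam]_(t in `]0%R, T[) q t)%E.
  move=> mq q0 qz qh; rewrite integral_mkcond [RHS]integral_mkcond.
  transitivity (\int[lam]_t q (t + h)%R)%E.
    apply: eq_integral => t _; rewrite patchE; case: ifPn => // /negP tI; rewrite qh//.
    by apply/negP => tT; apply: tI; apply/mem_set; rewrite /= in_itv.
  rewrite (integral_shift1 h mq q0).
  apply: eq_integral => t _; rewrite patchE; case: ifPn => // /negP tI; rewrite qz//.
  by apply/negP => tT; apply: tI; apply/mem_set; rewrite /= in_itv.
rewrite /Rintegral; congr fine; rewrite integralE [RHS]integralE; congr (_ - _)%E.
- transitivity (\int[lam]_(t in `]0%R, T[) ((EFin \o p)^\+) (t + h)%R)%E.
    by apply: eq_integral => t _; rewrite !funeposE.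
  apply: (key ((EFin \o p)^\+)%E) => [||t tT|t tT]; first exact: measurable_funepos.
  + by [].
  + by rewrite funeposE /= p0// maxxx.
  + by rewrite funeposE /= ph0// maxxx.
- transitivity (\int[lam]_(t in `]0%R, T[) ((EFin \o p)^\-) (t + h)%R)%E.
    by apply: eq_integral => t _; rewrite !funenegE.
  apply: (key ((EFin \o p)^\-)%E) => [||t tT|t tT]; first exact: measurable_funeneg.
  + by [].
  + by rewrite funenegE /= p0// oppr0 maxxx.
  + by rewrite funenegE /= ph0// oppr0 maxxx.
Qed.

Lemma J_shift H n a h : continuous H -> off n H -> 0 <= h <= (2 * n.+1%:R)^-1 ->
  J (fun z => H (z + h *: stv a)) = J H.
Proof.
move=> cH oH /andP[h0 hn]; have ccH : cc H by split => //; exists n.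
have n0 : 0 < n.+1%:R^-1 :> R by rewrite invr_gt0.
have hn' : h < n.+1%:R^-1.
  by apply: le_lt_trans hn _; rewrite invfM gtr_pMl// invf_lt1// ltr1n.
case: a => [i|].
  rewrite /J; apply: int_eq => t _; transitivity (intO (fun x => sl H t (x + h *: evec i))).
    by congr intO; apply/funext => x; rewrite /sl /=; congr H; congr (_, _); rewrite /= scaler0 addr0.
  apply: intO_shift; [|exact: cc_int|].
    by rewrite /= mulr_ge0.
  move=> x Dx xh; apply: oH => /stboxP[_ _ _ /andP[/= h1 _]].
  move: xh; rewrite /= -[h *: _]/(h * _); apply/negP; rewrite -ltNge; apply: lt_le_trans h1.
  by apply: le_lt_trans hn'; rewrite ler_piMr//; case: (_ == _).
transitivity (I (fun t => intO (sl H (t + h)))).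
  apply: int_eq => t _; congr intO; apply/funext => x; rewrite /sl; congr H.
  by congr (_, _); rewrite /= ?scaler0 ?addr0// [_ *: 1]mulr1.
have z0 t : ~ (n.+1%:R^-1 <= t <= T - n.+1%:R^-1) -> intO (sl H t) = 0.
  move=> nt; rewrite /intO (_ : sl H t = fun=> 0); last by apply/funext => x; rewrite /sl oH// => /stboxP[/=].
  by rewrite Rintegral_cst ?mul0r//; exact: measurable_half_spaceE.
apply: J_time; first exact: cc_time.
- move=> t; apply: contraNeq => h1; apply: contraNT h1 => h1; apply/eqP/z0; move: h1 n0 hn'; move: (_^-1) => k h1 n0 hn' /andP[h2 h3].
  by move/negP: h1; apply; apply/andP; split; lra.
- move=> t; apply: contraNeq => h1; apply: contraNT h1 => h1; apply/eqP/z0; move: h1 n0 hn'; move: (_^-1) => k h1 n0 hn' /andP[h2 h3].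
  by move/negP: h1; apply; apply/andP; split; lra.
Qed.

End spacetime.

Lemma derive_off {R : realType} {V : normedModType R} (K : set V) (F : V -> R) (v z : V) :
  compact K -> (forall z, ~ K z -> F z = 0) -> ~ K z -> 'D_v F z = 0.
Proof.
move=> cK F0 nK; rewrite (@near_eq_derive _ _ _ _ (fun=> 0)) ?derive_cst//.
have oK : open (~` K) by apply: closed_openC; apply: compact_closed => //; exact: norm_hausdorff.
have : \forall y \near z, ~ K y by apply: open_nbhs_nbhs.
by apply: filterS => y; exact: F0.
Qed.

Lemma big_option3 {R : realType} (F : option 'I_3 -> R) : \sum_a F a = F None + \sum_i F (Some i).
Proof.
rewrite (bigD1 None)//=; congr (_ + _).
rewrite (reindex_omap Some id) => [|[i|]//]; by apply: eq_bigl => i; rewrite /= eqxx.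
Qed.

Section parts.
Context {R : realType}.
Local Notation D := (@half_space R).
Local Notation Z := (R * R3 R)%type.
Variable T : R.
Hypothesis T0 : 0 < T.
Implicit Types (H G A S F : Z -> R) (z : Z) (U : set Z).
Local Notation C1 := (c1 (@stv R)).
Local Notation slab := (slab T).
Local Notation stbox := (stbox T).
Local Notation off := (off T).
Local Notation J := (J T).
Local Notation cc := (cc T).

Lemma off_shift n a h H : off n H -> `|h| <= (2 * n.+1%:R)^-1 -> off n.*2.+1 (fun z => H (z + h *: stv a)).
Proof.
move=> oH hh z nz; apply: oH => zs; apply: nz.
have := stbox_shift a zs (s := - h); rewrite normrN => /(_ hh).
by rewrite scaleNr addrK.
Qed.

Lemma stbox_dbl n : stbox n `<=` stbox n.*2.+1.
Proof. by apply: stbox_mono; rewrite -addnn leqW// leq_addr. Qed.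

Lemma off_mono2 n H : off n H -> off n.*2.+1 H.
Proof. by apply: off_mono; rewrite -addnn leqW// leq_addr. Qed.

Lemma cc_mul U F A n : open U -> stbox n `<=` U -> (forall z, U z -> {for z, continuous F}) ->
  continuous A -> off n A -> cc (fun z => F z * A z) /\ off n (fun z => F z * A z).
Proof.
move=> oU KU cF cA oA; have oFA : off n (fun z => F z * A z) by move=> z nz; rewrite oA ?mulr0.
split => //; split; last by exists n.
move=> z; have [Kz|nK] := pselect (stbox n z); first by apply: (cvgM (cF z (KU z Kz))); exact: cA.
have oK : open (~` stbox n).
  by apply: closed_openC; apply: compact_closed; [exact: norm_hausdorff|exact: compact_stbox].
apply: (@for_cont _ _ _ _ 0); first exact: oFA.
have : \forall y \near z, ~ stbox n y by apply: open_nbhs_nbhs.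
by move=> h; apply: cvg_near_cst; apply: filterS h => y; exact: oFA.
Qed.

Lemma c1_cont (A : Z -> R) : C1 setT A -> continuous A.
Proof. by move=> cA z; have [] := cA z I. Qed.

Lemma c1_dcont a (A : Z -> R) : C1 setT A -> continuous ('D_(stv a) A).
Proof. by move=> cA z; have [_ /(_ a)[]] := cA z I. Qed.

Lemma off_derive a A n : off n A -> off n ('D_(stv a) A).
Proof. by move=> oA z; apply: derive_off; [exact: compact_stbox|exact: oA]. Qed.

Let small (x C : R) : 0 <= C -> (forall e, 0 < e -> `|x| <= e * C) -> x = 0.
Proof.
move=> C0 H; apply/eqP; rewrite -normr_le0; apply/ler_addgt0Pr => e e0; rewrite add0r.
have C1 : 0 < C + 1 by rewrite ltr_wpDl.
apply: le_trans (H _ (divr_gt0 e0 C1)) _; rewrite mulrAC ler_pdivrMr//.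
by rewrite ler_wpM2l ?(ltW e0)// lerDl.
Qed.

(** The integral is invariant under translations, and the difference quotient converges
    uniformly to the derivative. *)
Lemma J_derive a A n : C1 setT A -> off n A -> J ('D_(stv a) A) = 0.
Proof.
move=> cA oA; set N := n.*2.+1.
have CT0 : 0 <= (2 * N.+1%:R) ^+ 3 * T :> R by rewrite mulr_ge0 ?(ltW T0)// exprn_ge0// mulr_ge0.
apply: (small CT0) => e e0.
have cAc := c1_cont cA; have cAd := @c1_dcont a _ cA.
have [d d0 Hd] := dir_taylor (@compact_stbox R T N) openT (@subsetT _ _)
  (fun z _ => proj1 ((cA z I).2 a)) (fun z _ => cAd z) e0.
have n0 : 0 < (2 * n.+1%:R)^-1 :> R by rewrite invr_gt0 mulr_gt0.
pose h := Num.min d (2 * n.+1%:R)^-1; have h0 : 0 < h by rewrite lt_min d0.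
have hd : h <= d by rewrite ge_min lexx.
have hn : h <= (2 * n.+1%:R)^-1 by rewrite ge_min lexx orbT.
have hN : `|h| = h by rewrite gtr0_norm.
pose As z := A (z + h *: stv a).
have oAs : off N As by apply: (off_shift a oA); rewrite hN.
have cAs : continuous As by move=> z; apply: continuous_at_shift; exact: cAc.
have oA' := off_mono2 oA; have oD := (@off_derive a _ _ oA').
pose H z := (As z + -1 * A z) + - h * 'D_(stv a) A z.
have ccAs : cc As by split => //; exists N.
have ccA : cc A by split => //; exists N.
have ccD : cc ('D_(stv a) A) by split => //; exists N.
have JH : J H = - h * J ('D_(stv a) A).
  rewrite (J_lin (- h) (cc_lin (-1) ccAs ccA) ccD) (J_lin (-1) ccAs ccA).
  rewrite (J_shift a cAc oA); last by rewrite (ltW h0).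
  by rewrite mulN1r subrr add0r.
have [cH _] := cc_lin (- h) (cc_lin (-1) ccAs ccA) ccD.
have oH : off N H by move=> z nz; rewrite /H oAs// oA'// oD// !mulr0 !addr0.
have bH z : `|H z| <= e * h.
  have [Kz|nz] := pselect (stbox N z); last by rewrite oH// normr0 mulr_ge0// ltW.
  by have := Hd z h Kz; rewrite hN => /(_ hd); rewrite /H /As mulN1r mulNr.
have := J_bound T0 cH oH bH; rewrite JH mulNr normrN normrM hN.
have -> : e * h * (2 * N.+1%:R) ^+ 3 * T = h * (e * ((2 * N.+1%:R) ^+ 3 * T)).
  by move: (_ ^+ 3) => x; ring.
by rewrite ler_pM2l.
Qed.

Lemma J_parts U a F A n : open U -> stbox n `<=` U -> C1 U F -> C1 setT A -> off n A ->
  J (fun z => 'D_(stv a) F z * A z) = - J (fun z => F z * 'D_(stv a) A z).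
Proof.
move=> oU KU cF cA oA.
have oFA : off n (fun z => F z * A z) by move=> z nz; rewrite oA ?mulr0.
have cFA : C1 setT (fun z => F z * A z).
  apply: (c1_glue (@compact_stbox R T n) KU oFA); apply: c1M => //; exact: c1_sub cA.
have [cc1 _] := cc_mul oU KU (fun z Uz => ((cF z Uz).2 a).2) (c1_cont cA) oA.
have [cc2 _] := cc_mul oU KU (fun z Uz => (cF z Uz).1) (@c1_dcont a _ cA) (@off_derive a _ _ oA).
have := J_derive a cFA oFA.
have -> : 'D_(stv a) (fun z => F z * A z) = (fun z => F z * 'D_(stv a) A z + 1 * ('D_(stv a) F z * A z)).
  apply/funext => z; have [Kz|nz] := pselect (stbox n z).
    rewrite mulfE (deriveM ((cF z (KU z Kz)).2 a).1 ((cA z I).2 a).1) mul1r; congr (_ + _).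
    exact: mulrC.
  by rewrite (off_derive _ oFA)// (off_derive _ oA)// oA// !mulr0 addr0.
by rewrite (J_lin 1 cc2 cc1) mul1r addrC => /eqP; rewrite addr_eq0 => /eqP.
Qed.

Let alg (h x1 x2 x3 x4 x5 e B1 B2 X : R) : 0 < h ->
  `|x1 + -1 * x2 + - h * x3| <= e * h * B1 * X * T -> `|x5 + h * x4| <= e * h * B2 * X * T ->
  x1 + -1 * x2 = - x5 -> `|x3 - x4| <= e * ((B1 + B2) * (X * T)).
Proof.
move=> h0 J1 J2 E3; rewrite -(ler_pM2l h0) -{1}(gtr0_norm h0) -normrM.
have -> : h * (x3 - x4) = - (x1 + -1 * x2 + - h * x3) - (x5 + h * x4) + (x1 + -1 * x2 + x5) by ring.
rewrite E3 addNr addr0; apply: le_trans (ler_normB _ _) _; rewrite normrN -E3.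
apply: le_trans (lerD J1 J2) _.
by rewrite le_eqVlt; apply/orP; left; apply/eqP; ring.
Qed.

(** S has no second derivatives.  The derivative of A in direction i is replaced by a difference
    quotient, which a translation moves onto S; the quotient of S can be integrated by parts in
    direction a before the step tends to 0. *)
Lemma J_swap a i S A n : C1 slab S -> C1 setT A -> off n A ->
  J (fun z => 'D_(stv a) S z * 'D_(stv (Some i)) A z) = J (fun z => 'D_(stv (Some i)) S z * 'D_(stv a) A z).
Proof.
move=> cS cA oA; set N := n.*2.+1; set v := stv (Some i).
have Kn := @compact_stbox R T n; have KN := @compact_stbox R T N.
have nW := @stbox_slab R T n; have NW := @stbox_slab R T N; have oW := @open_slab R T.
have cAc := c1_cont cA; have cAi := @c1_dcont (Some i) _ cA; have cAa := @c1_dcont a _ cA.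
have cSa z : slab z -> {for z, continuous ('D_(stv a) S)} by move=> Wz; case: ((cS z Wz).2 a).
have cSi z : slab z -> {for z, continuous ('D_v S)} by move=> Wz; case: ((cS z Wz).2 (Some i)).
have oA' := off_mono2 oA.
have oDi := (@off_derive (Some i) _ _ oA); have oDa := (@off_derive a _ _ oA).
have oDi' := off_mono2 oDi; have oDa' := off_mono2 oDa.
have [ccl ofl] := cc_mul oW nW cSa cAi oDi; have [ccr ofr] := cc_mul oW nW cSi cAa oDa.
have [B1 B10 HB1] := compact_bound KN (fun z Kz => cSa z (NW z Kz)).
have [B2 B20 HB2] : exists2 B, 0 <= B & forall z, `|'D_(stv a) A z| <= B.
  by apply: (@cc_bound R T); split => //; exists n.
set CT := (2 * N.+1%:R) ^+ 3 * T : R.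
have CT0 : 0 <= CT by rewrite mulr_ge0 ?(ltW T0)// exprn_ge0// mulr_ge0.
apply/eqP; rewrite -subr_eq0; apply/eqP.
apply: (small (C := (B1 + B2) * CT)) => [|e e0]; first by rewrite mulr_ge0// addr_ge0.
have [d1 d10 H1] := dir_taylor KN openT (@subsetT _ _)
  (fun z _ => proj1 ((cA z I).2 (Some i))) (fun z _ => cAi z) e0.
have [d2 d20 H2] := dir_taylor Kn oW nW (fun z Wz => proj1 ((cS z Wz).2 (Some i))) cSi e0.
have [d3 d30 H3] := unif_open v KN oW NW.
have n0 : 0 < (2 * n.+1%:R)^-1 :> R by rewrite invr_gt0 mulr_gt0.
pose h := Num.min (Num.min d1 d2) (Num.min d3 (2 * n.+1%:R)^-1).
have h0 : 0 < h by rewrite !lt_min d10 d20 d30.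
have : h <= h by []; rewrite {2}/h !le_min => /andP[/andP[h1 h2] /andP[h3 hn]].
have hN : `|h| = h by rewrite gtr0_norm.
have hNN : `|- h| = h by rewrite normrN.
pose As z := A (z + h *: v).
have oAs : off N As by apply: (off_shift (Some i) oA); rewrite hN.
have cAs : continuous As by move=> z; apply: continuous_at_shift; exact: cAc.
pose Sm z := S (z + - h *: v).
(* S is translated backwards; the step is so small that the box of A stays in the slab. *)
pose U := slab `&` [set z | slab (z + - h *: v)].
have oU : open U.
  apply: openI => //; have cs : continuous (fun z : Z => z + - h *: v).
    by move=> z; apply: cvgD; [exact: cvg_id|exact: cvg_cst].
  by move/continuousP: cs => /(_ _ oW).
have nU : stbox n `<=` U.
  move=> z Kz; split; first exact: nW.
  by apply: H3; [exact: stbox_dbl|rewrite hNN].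
have cSm : C1 U Sm.
  move=> z [_ Uz]; have [c d] := cS _ Uz; split; first exact: continuous_at_shift.
  move=> b; have [db cb] := d b; split; first exact: derivable_shift.
  rewrite (_ : 'D_(stv b) Sm = fun y => 'D_(stv b) S (y + - h *: v)); first exact: (continuous_at_shift cb).
  by apply/funext => y; exact: (@derive_translate R _ S (stv b) (- h *: v) y).
have cDf : C1 U (fun z => Sm z + - S z).
  by apply: (c1D oU cSm); apply: (c1N oU); apply: c1_sub cS => z [].
pose F z := 'D_(stv a) S z.
pose Fm z := 'D_(stv a) S (z + - h *: v).
have cFm z : U z -> {for z, continuous Fm} by move=> [_ Uz]; exact: (continuous_at_shift (cSa _ Uz)).
have [ccFA oFA] := cc_mul oW nW cSa cAc oA.
have [ccFmA oFmA] := cc_mul oU nU cFm cAc oA.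
have [ccFAs oFAs] := cc_mul oW NW cSa cAs oAs.
have E2 : J (fun z => F z * As z) = J (fun z => Fm z * A z).
  rewrite -(J_shift (Some i) (proj1 ccFmA) oFmA (h := h)); last by rewrite (ltW h0).
  by congr J; apply/funext => z; rewrite /Fm /F -/v scaleNr addrK.
have cDfc z : U z -> {for z, continuous (fun z => Sm z + - S z)} by move=> Uz; case: (cDf z Uz).
have [ccD oD] := cc_mul oU nU cDfc cAa oDa.
have E3 : J (fun z => Fm z * A z + -1 * (F z * A z)) = - J (fun z => (Sm z + - S z) * 'D_(stv a) A z).
  rewrite -(J_parts a oU nU cDf cA oA); congr J; apply/funext => z.
  have [Kz|nz] := pselect (stbox n z); last by rewrite (oA _ nz) !mulr0 addr0.
  have [sz sz'] := nU z Kz; have [_ /(_ a)[dm _]] := cSm z (nU z Kz); have [_ /(_ a)[ds _]] := cS z sz.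
  have -> : 'D_(stv a) (fun z => Sm z + - S z) z = 'D_(stv a) Sm z - 'D_(stv a) S z by exact: deriveB.
  by rewrite (@derive_translate R _ S (stv a) (- h *: v) z) mulN1r mulrBl.
rewrite (J_lin (-1) ccFmA ccFA) -E2 in E3.
have eB1 : 0 <= e * h * B1 := mulr_ge0 (mulr_ge0 (ltW e0) (ltW h0)) B10.
have eB2 : 0 <= e * h * B2 := mulr_ge0 (mulr_ge0 (ltW e0) (ltW h0)) B20.
pose G1 z := (F z * As z + -1 * (F z * A z)) + - h * (F z * 'D_v A z).
have cc1 := cc_lin (- h) (cc_lin (-1) ccFAs ccFA) ccl.
have b1 z : `|G1 z| <= e * h * B1.
  have [Kz|nz] := pselect (stbox N z); last first.
    by rewrite /G1 (oAs _ nz) (oA' _ nz) (oDi' _ nz) !mulr0 !addr0 normr0; exact: eB1.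
  have -> : G1 z = (A (z + h *: v) - A z - h * 'D_v A z) * F z by rewrite /G1 /As; ring.
  rewrite normrM; apply: (ler_pM (normr_ge0 _) (normr_ge0 _) _ (HB1 z Kz)).
  by have := H1 z h Kz; rewrite hN => /(_ h1).
have o1 : off N G1 by move=> z nz; rewrite /G1 (oAs _ nz) (oA' _ nz) (oDi' _ nz) !mulr0 !addr0.
have J1 := J_bound T0 (proj1 cc1) o1 b1.
rewrite (J_lin (- h) (cc_lin (-1) ccFAs ccFA) ccl) (J_lin (-1) ccFAs ccFA) in J1.
pose G2 z := (Sm z + - S z) * 'D_(stv a) A z + h * ('D_v S z * 'D_(stv a) A z).
have cc2 := cc_lin h ccD ccr.
have b2 z : `|G2 z| <= e * h * B2.
  have [Kz|nz] := pselect (stbox n z); last first.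
    by rewrite /G2 (oDa _ nz) !mulr0 addr0 normr0; exact: eB2.
  have -> : G2 z = (S (z + - h *: v) - S z - (- h) * 'D_v S z) * 'D_(stv a) A z by rewrite /G2 /Sm; ring.
  rewrite normrM; apply: (ler_pM (normr_ge0 _) (normr_ge0 _) _ (HB2 z)).
  by have := H2 z (- h) Kz; rewrite hNN => /(_ h2).
have o2 : off N G2.
  by move=> z nz; rewrite /G2 (oDa' _ nz) !mulr0 addr0.
have J2 := J_bound T0 (proj1 cc2) o2 b2.
rewrite (J_lin h ccD ccr) in J2.
exact: (alg h0 J1 J2 E3).
Qed.

End parts.

(** ** The transport equations in weak form *)

Section weak_transport.
Context {R : realType}.
Local Notation D := (@half_space R).
Local Notation Z := (R * R3 R)%type.
Variable T : R.
Hypothesis T0 : 0 < T.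
Implicit Types (H G A S F : Z -> R) (z : Z) (U : set Z).
Local Notation C1 := (c1 (@stv R)).
Local Notation slab := (slab T).
Local Notation stbox := (stbox T).
Local Notation off := (off T).
Local Notation J := (J T).
Local Notation cc := (cc T).

Lemma J0 : J (fun=> 0) = 0.
Proof.
apply/eqP; rewrite -normr_le0; have c0 : continuous (fun _ : Z => 0 : R) by move=> z; exact: cvg_cst.
have := J_bound (n := 0) (C := 0) T0 c0 (fun z _ => erefl); rewrite !mul0r; apply => z.
by rewrite normr0.
Qed.

Lemma J_sum (I : finType) (H : I -> Z -> R) : (forall i, cc (H i)) ->
  J (fun z => \sum_i H i z) = \sum_i J (H i).
Proof.
move=> cH; suff [] : cc (fun z => \sum_(i <- index_enum I) H i z) /\
    J (fun z => \sum_(i <- index_enum I) H i z) = \sum_(i <- index_enum I) J (H i) by [].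
elim: (index_enum I) => [|i r [cr Jr]].
  have -> : (fun z => \sum_(i <- [::]) H i z) = fun=> 0 by apply/funext => z; rewrite big_nil.
  rewrite big_nil J0; split => //; split; first by move=> z; exact: cvg_cst.
  by exists 0%N.
have -> : (fun z => \sum_(j <- i :: r) H j z) = (fun z => H i z + 1 * \sum_(j <- r) H j z).
  by apply/funext => z; rewrite big_cons mul1r.
by split; [exact: cc_lin|rewrite J_lin// big_cons Jr mul1r].
Qed.

Lemma stbox_glue F A n : C1 slab F -> C1 setT A -> off n A -> 
  C1 setT (fun z => F z * A z) /\ off n (fun z => F z * A z).
Proof.
move=> cF cA oA; have oFA : off n (fun z => F z * A z) by move=> z nz; rewrite (oA _ nz) mulr0.
split => //; apply: (c1_glue (@compact_stbox R T n) (@stbox_slab R T n) oFA).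
by apply: (c1M (@open_slab R T) cF); exact: c1_sub cA.
Qed.

Variables (X : option 'I_3 -> Z -> R) (phi : Z -> R) (n : nat).
Hypotheses (cX : forall a, C1 slab (X a)) (cphi : C1 setT phi) (ophi : off n phi).

Let Xp a z := X a z * phi z.
Let cXp a : C1 setT (Xp a). Proof. by case: (stbox_glue (cX a) cphi ophi). Qed.
Let oXp a : off n (Xp a). Proof. by case: (stbox_glue (cX a) cphi ophi). Qed.

(** Integration by parts moves the derivatives onto S, where they add up to its material
    derivative. *)
Lemma J_transport S : C1 slab S -> (forall z, slab z -> \sum_a X a z * 'D_(stv a) S z = 0) ->
  J (fun z => S z * \sum_a 'D_(stv a) (Xp a) z) = 0.
Proof.
move=> cS eS.
have nW := @stbox_slab R T n; have oW := @open_slab R T.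
have cc1 a : cc (fun z => S z * 'D_(stv a) (Xp a) z).
  by case: (cc_mul oW nW (fun z Wz => (cS z Wz).1) (@c1_dcont _ a _ (cXp a)) (off_derive a (@oXp a))).
have cc2 a : cc (fun z => 'D_(stv a) S z * Xp a z).
  by case: (cc_mul oW nW (fun z Wz => ((cS z Wz).2 a).2) (c1_cont (cXp a)) (@oXp a)).
transitivity (J (fun z => \sum_a S z * 'D_(stv a) (Xp a) z)).
  by congr J; apply/funext => z; rewrite mulr_sumr.
rewrite (J_sum cc1); apply: oppr_inj; rewrite oppr0 -sumrN.
transitivity (\sum_a J (fun z => 'D_(stv a) S z * Xp a z)).
  by apply: eq_bigr => a _; rewrite (J_parts T0 a oW nW cS (cXp a) (@oXp a)).
rewrite -(J_sum cc2); transitivity (J (fun=> 0)); last exact: J0.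
apply: J_eq => z Wz.
transitivity ((\sum_a X a z * 'D_(stv a) S z) * phi z); last by rewrite eS// mul0r.
by rewrite mulr_suml; apply: eq_bigr => a _; rewrite /Xp; ring.
Qed.

Variable b : 'I_3 -> Z -> R.
Hypothesis cb : forall i, C1 slab (b i).

Let alg (s x d : option 'I_3 -> R) (c e : 'I_3 -> R) (db dx : 'I_3 -> option 'I_3 -> R) (f : R) :
  \sum_a x a * s a = 0 -> (forall i, dx i None = 0) ->
  (forall k, \sum_a x a * db k a = \sum_i c i * dx i (Some k)) ->
  (\sum_i c i * s (Some i)) * \sum_a d a =
  \sum_i \sum_a (s (Some i) * (c i * d a + (x a * f) * db i a) + -1 * (s a * (x a * e i + (c i * f) * dx i a))).
Proof.
move=> h1 h2 h3.
transitivity (\sum_i (c i * s (Some i) * (\sum_a d a)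
  + f * (s (Some i) * (\sum_a x a * db i a)) - (e i * (\sum_a x a * s a) + f * (c i * \sum_a s a * dx i a)))).
  rewrite h1 big_split/= sumrN big_split/= -mulr_suml.
  under [X in _ + X - _]eq_bigr do rewrite h3.
  under [X in _ - X]eq_bigr do rewrite mulr0 add0r big_option3 h2 mulr0 add0r.
  rewrite -!mulr_sumr -addrA; suff -> : \sum_i s (Some i) * (\sum_j c j * dx j (Some i)) =
    \sum_i c i * (\sum_j s (Some j) * dx i (Some j)) by rewrite subrr addr0.
  under eq_bigr do rewrite mulr_sumr; rewrite exchange_big/=; apply: eq_bigr => i _.
  by rewrite mulr_sumr; apply: eq_bigr => j _; ring.
apply: eq_bigr => i _; rewrite !mulr_sumr -!big_split/= -sumrB; apply: eq_bigr => a _; ring.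
Qed.

Let alg0 (x y : R) : x = y -> y + -1 * x = 0.
Proof. by move=> ->; rewrite mulN1r subrr. Qed.

(** Exchange the derivatives d_a and d_i in the integrals of d_i S d_a A, with A = b_i X_a phi,
    and sum over i and a.  The product rule leaves the integral in question, a multiple of the material
    derivative of S, and D_t b - b . grad X. *)
Lemma J_frozen S : C1 slab S -> (forall z, slab z -> \sum_a X a z * 'D_(stv a) S z = 0) ->
  (forall z, X None z = 1) ->
  (forall k z, slab z -> \sum_a X a z * 'D_(stv a) (b k) z = \sum_i b i z * 'D_(stv (Some i)) (X (Some k)) z) ->
  J (fun z => (\sum_i b i z * 'D_(stv (Some i)) S z) * \sum_a 'D_(stv a) (Xp a) z) = 0.
Proof.
move=> cS eS X0 eb.
have nW := @stbox_slab R T n; have oW := @open_slab R T.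
pose A i a z := b i z * Xp a z.
have cA i a : C1 setT (A i a) by case: (stbox_glue (cb i) (cXp a) (@oXp a)).
have oA i a : off n (A i a) by case: (stbox_glue (cb i) (cXp a) (@oXp a)).
have cc1 i a : cc (fun z => 'D_(stv (Some i)) S z * 'D_(stv a) (A i a) z).
  by case: (cc_mul oW nW (fun z Wz => ((cS z Wz).2 (Some i)).2) (@c1_dcont _ a _ (cA i a)) (off_derive a (oA i a))).
have cc2 i a : cc (fun z => 'D_(stv a) S z * 'D_(stv (Some i)) (A i a) z).
  by case: (cc_mul oW nW (fun z Wz => ((cS z Wz).2 a).2) (@c1_dcont _ (Some i) _ (cA i a)) (off_derive (Some i) (oA i a))).
pose H i a z := 'D_(stv (Some i)) S z * 'D_(stv a) (A i a) z + -1 * ('D_(stv a) S z * 'D_(stv (Some i)) (A i a) z).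
have JH i a : J (H i a) = 0.
  exact: etrans (J_lin (-1) (cc1 i a) (cc2 i a)) (alg0 (J_swap T0 a i cS (cA i a) (oA i a))).
have ccH p : cc (H p.1 p.2) := cc_lin (-1) (cc1 p.1 p.2) (cc2 p.1 p.2).
transitivity (J (fun z => \sum_p H p.1 p.2 z)); last first.
  by rewrite (J_sum ccH); apply: big1 => p _; exact: JH.
apply: J_eq => z Wz.
have cbp i : C1 setT (fun z => b i z * phi z) by case: (stbox_glue (cb i) cphi ophi).
rewrite -(pair_bigA _ (fun i a => H i a z))/=.
rewrite (alg (fun a => 'D_(stv a) (Xp a) z) (fun i => 'D_(stv (Some i)) (fun z => b i z * phi z) z) (phi z)
  (eS z Wz) (dx := fun i a => 'D_(stv (Some i)) (X a) z) _ (fun k => eb k z Wz)); last first.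
  by move=> i; (have -> : X None = fun=> 1 by apply/funext); rewrite derive_cst.
apply: eq_bigr => i _; apply: eq_bigr => a _; rewrite /H; congr (_ * _ + -1 * (_ * _)).
  by rewrite /A mulfE (deriveM ((cb i Wz).2 a).1 ((cXp a I).2 a).1).
have -> : A i a = fun z => X a z * (b i z * phi z) by apply/funext => y; rewrite /A /Xp mulrCA.
by rewrite mulfE (deriveM ((cX a Wz).2 (Some i)).1 ((cbp i z I).2 (Some i)).1).
Qed.

End weak_transport.

Section slices.
Context {R : realType}.
Local Notation Z := (R * R3 R)%type.
Implicit Types (G : R -> R3 R -> R).

Lemma quot_time G t x :
  (fun h : R => h^-1 *: (((fun z : Z => G z.1 z.2) \o shift (t, x)) (h *: stv None) - G t x)) =
  (fun h : R => h^-1 *: ((G^~ x \o shift t) (h *: 1) - G t x)).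
Proof.
apply/funext => h; rewrite /= /shift /=; congr (_ *: (G _ _ - _)).
by rewrite scaler0 add0r.
Qed.

Lemma quot_space G t x i :
  (fun h : R => h^-1 *: (((fun z : Z => G z.1 z.2) \o shift (t, x)) (h *: stv (Some i)) - G t x)) =
  (fun h : R => h^-1 *: ((G t \o shift x) (h *: evec i) - G t x)).
Proof.
apply/funext => h; rewrite /= /shift /=; congr (_ *: (G _ _ - _)).
by rewrite scaler0 add0r.
Qed.

Lemma derive_time G t x : 'D_(stv None) (fun z : Z => G z.1 z.2) (t, x) = 'D_1 (G^~ x) t.
Proof. by rewrite /derive quot_time. Qed.

Lemma derivable_time G t x : derivable (G^~ x) t 1 -> derivable (fun z : Z => G z.1 z.2) (t, x) (stv None).
Proof. by rewrite /derivable quot_time. Qed.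

Lemma derive_space G t x i : 'D_(stv (Some i)) (fun z : Z => G z.1 z.2) (t, x) = 'D_(evec i) (G t) x.
Proof. by rewrite /derive quot_space. Qed.

Lemma derivable_space G t x i : derivable (G t) x (evec i) -> 
  derivable (fun z : Z => G z.1 z.2) (t, x) (stv (Some i)).
Proof. by rewrite /derivable quot_space. Qed.

Variable T : R.
Hypothesis T0 : 0 < T.

Lemma time_deriv_inside (h : R -> R) t : 0 < t < T -> time_derivable T h t ->
  derivable h t 1 /\ time_deriv T h t = 'D_1 h t.
Proof.
move=> tT; move=> c.
have /andP[t0 tT'] := tT; have tT'' : 0 <= t <= T by rewrite !ltW.
pose L := time_deriv T h t.
have cL : (fun s => (h s - h t) / (s - t)) @ within `[0, T] t^' --> L.
  by rewrite /L /time_deriv; exact: c.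
suff q : (fun k : R => k^-1 *: ((h \o shift t) (k *: 1) - h t)) @ 0^' --> L.
  have dh : derivable h t 1 by apply/cvg_ex; exists L.
  by split; [exact: dh|apply: esym; exact: (cvg_lim (@norm_hausdorff _ _) q)].
apply/cvgrPdist_le => e e0.
have /within_dnbhsE[d d0 Hd] : \forall s \near within `[0, T] t^', `|L - (h s - h t) / (s - t)| <= e.
  by move/cvgrPdist_le: cL; apply.
pose m := Num.min d (Num.min t (T - t)).
have m0 : 0 < m by rewrite !lt_min d0 t0 subr_gt0.
have : m <= m by []; rewrite {2}/m !le_min => /andP[m1 /andP[m2 m3]].
apply/nbhs_ballP; exists m => // k; rewrite /ball/= sub0r normrN => km kn0.
have kt : k *: 1 + t = t + k by rewrite addrC; congr (_ + _); exact: mulr1.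
have := Hd (t + k); rewrite addrAC subrr add0r /= kt mulrC; apply.
- by move: km; rewrite ltr_norml => /andP[? ?]; apply/andP; split; lra.
- by rewrite -subr_eq0 addrAC subrr add0r.
- exact: le_trans (ltW km) m1.
Qed.

End slices.

(** ** The chain rule *)

Section chain.
Context {R : realType} {V : normedModType R}.
Variable rho : R * R -> R.
Hypothesis srho : smooth rho.
Local Notation e1 := ((1, 0) : R * R).
Local Notation e2 := ((0, 1) : R * R).

Let srho1 v : continuous ('D_v rho). Proof. by case: (srho [:: v]). Qed.
Let srhod v z : derivable rho z v. Proof. by case: (srho [::]). Qed.

Let slope1 (P S e : R) : 0 < e -> exists2 d, 0 < d & forall h s, `|h| <= d -> `|s - S| <= d ->
  `|rho (P + h, s) - rho (P, s) - h * 'D_e1 rho (P, S)| <= e * `|h|.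
Proof.
move=> e0; have e20 : 0 < e / 2 by rewrite divr_gt0.
have cK : compact ([set P] `*` `[S - 1, S + 1] : set (R * R)).
  by apply: compact_setX; [exact: compact_set1|exact: segment_compact].
have [d1 d10 H1] := dir_taylor cK openT (@subsetT _ _) (fun z _ => @srhod e1 z) (fun z _ => @srho1 e1 z) e20.
have /nbhs_ballP[d2 /= d20 H2] : \forall y \near (P, S), `|'D_e1 rho (P, S) - 'D_e1 rho y| <= e / 2.
  by move/cvgrPdist_le: (@srho1 e1 (P, S)); apply.
exists (Num.min (Num.min d1 (d2 / 2)) 1); first by rewrite !lt_min d10 divr_gt0 ?ltr01.
move=> h s; rewrite !le_min => /andP[/andP[h1 h2] h3] /andP[/andP[s1 s2] s3].
have K : ([set P] `*` `[S - 1, S + 1]) (P, s).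
  by split => //=; rewrite in_itv/=; move: s3; rewrite ler_norml => /andP[? ?]; apply/andP; split; lra.
have := H1 _ h K h1.
have -> : (P, s) + h *: e1 = (P + h, s) by congr (_, _); rewrite /= ?scaler0 ?addr0//; congr (_ + _); exact: mulr1.
move=> A1; have A2 : `|'D_e1 rho (P, S) - 'D_e1 rho (P, s)| <= e / 2.
  apply: H2; split; first exact: ballxx.
  by rewrite /ball/= distrC; apply: le_lt_trans s2 _; rewrite ltr_pdivrMr// ltr_pMr// ltr1n.
have -> : rho (P + h, s) - rho (P, s) - h * 'D_e1 rho (P, S) =
  (rho (P + h, s) - rho (P, s) - h * 'D_e1 rho (P, s)) - h * ('D_e1 rho (P, S) - 'D_e1 rho (P, s)) by ring.
apply: le_trans (ler_normB _ _) _; rewrite normrM (splitr e) mulrDl; apply: lerD => //.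
by rewrite mulrC ler_wpM2r.
Qed.

Let slope2 (P S e : R) : 0 < e -> exists2 d, 0 < d & forall h, `|h| <= d ->
  `|rho (P, S + h) - rho (P, S) - h * 'D_e2 rho (P, S)| <= e * `|h|.
Proof.
move=> e0; have cK : compact [set (P, S)] by exact: compact_set1.
have [d d0 H] := dir_taylor cK openT (@subsetT _ _) (fun z _ => @srhod e2 z) (fun z _ => @srho1 e2 z) e0.
exists d => // h hd; have := H (P, S) h erefl hd.
suff -> : (P, S) + h *: e2 = (P, S + h) by [].
by congr (_, _); rewrite /= ?scaler0 ?addr0//; congr (_ + _); exact: mulr1.
Qed.

Let posM (a b c d : R) : 0 <= a -> 0 <= b -> 0 <= c -> 0 <= d -> 0 < a + b + 2 + c + d.
Proof. lra. Qed.

Let leM1 (a b c d x : R) : x <= a + 1 -> 0 <= b -> 0 <= c -> 0 <= d -> x <= a + b + 2 + c + d.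
Proof. lra. Qed.

Let leM2 (a b c d x : R) : x <= b + 1 -> 0 <= a -> 0 <= c -> 0 <= d -> x <= a + b + 2 + c + d.
Proof. lra. Qed.

Let algM (k e a b c d : R) :
  k * ((a + b + 2 + c + d) * e) = k * ((c + d) * e) + e * (k * (a + 1)) + e * (k * (b + 1)).
Proof. ring. Qed.

(** The uniform Taylor expansions in each of the two variables replace differentiability. *)
Lemma chain2 (p s : V -> R) z v : derivable p z v -> derivable s z v ->
  is_derive z v (fun y => rho (p y, s y))
    ('D_e1 rho (p z, s z) * 'D_v p z + 'D_e2 rho (p z, s z) * 'D_v s z).
Proof.
move=> dp ds; set L := _ + _.
pose q (f : V -> R) (k : R) := k^-1 *: ((f \o shift z) (k *: v) - f z).
have qp : q p @ 0^' --> 'D_v p z by exact: dp.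
have qs : q s @ 0^' --> 'D_v s z by exact: ds.
suff Q : q (fun y => rho (p y, s y)) @ 0^' --> L.
  apply: DeriveDef; first by apply/cvg_ex; exists L.
  exact: (cvg_lim (@norm_hausdorff _ _) Q).
apply/cvgrPdist_le => e e0.
set dpz := 'D_v p z in qp L *; set dsz := 'D_v s z in qs L *.
set r1 := 'D_e1 rho _ in L *; set r2 := 'D_e2 rho _ in L *.
pose M := `|dpz| + `|dsz| + 2 + `|r1| + `|r2|.
have M0 : 0 < M by exact: posM.
pose e' := Num.min 1 (e / (2 * M)); have e'0 : 0 < e' by rewrite lt_min ltr01 divr_gt0// mulr_gt0.
have [d1 d10 H1] := slope1 (p z) (s z) e'0.
have [d2 d20 H2] := slope2 (p z) (s z) e'0.
have h1 : \forall k \near 0^', `|dpz - q p k| <= e' by move/cvgrPdist_le: qp; apply.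
have h2 : \forall k \near 0^', `|dsz - q s k| <= e' by move/cvgrPdist_le: qs; apply.
pose m := Num.min d1 d2 / M; have m0 : 0 < m by rewrite divr_gt0// lt_min d10.
have h3 : \forall k \near 0^', `|k : R| <= m /\ k != 0.
  apply/nbhs_ballP; exists m => //= k; rewrite /ball/= sub0r normrN => km kn0.
  by split => //; exact: ltW.
apply: filterS (filterI (filterI h1 h2) h3) => k [[A1 A2] [km k0]].
pose hp := p (k *: v + z) - p z; pose hs := s (k *: v + z) - s z.
have hpE : hp = k * q p k by rewrite /q -[_ *: _]/(_ * _) mulrA mulfV// mul1r.
have hsE : hs = k * q s k by rewrite /q -[_ *: _]/(_ * _) mulrA mulfV// mul1r.
have e'1 : e' <= 1 by rewrite ge_min lexx.
have e'M : 2 * M * e' <= e by rewrite mulrC -ler_pdivlMr ?mulr_gt0// ge_min lexx orbT.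
have C1 : `|q p k| <= `|dpz| + 1.
  have -> : q p k = dpz - (dpz - q p k) by ring.
  by apply: le_trans (ler_normB _ _) _; rewrite lerD2l (le_trans A1).
have C2 : `|q s k| <= `|dsz| + 1.
  have -> : q s k = dsz - (dsz - q s k) by ring.
  by apply: le_trans (ler_normB _ _) _; rewrite lerD2l (le_trans A2).
have B1 : `|q p k| <= M by exact: leM1.
have B2 : `|q s k| <= M by exact: leM2.
have sm (x : R) : `|x| <= M -> `|k * x| <= Num.min d1 d2.
  by move=> xM; rewrite normrM; apply: le_trans (ler_pM _ _ km xM) _ => //; rewrite /m divfK// gt_eqF.
have hp1 : `|hp| <= d1 by rewrite hpE; apply: le_trans (sm _ B1) _; rewrite ge_min lexx.
have hs1 : `|hs| <= d1 by rewrite hsE; apply: le_trans (sm _ B2) _; rewrite ge_min lexx.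
have hs2 : `|hs| <= d2 by rewrite hsE; apply: le_trans (sm _ B2) _; rewrite ge_min lexx orbT.
have E1 := H1 hp (s (k *: v + z)) hp1 hs1.
have E2 := H2 hs hs2.
rewrite !subrKC -/r1 -/r2 in E1 E2.
have k0' : 0 < `|k| by rewrite normr_gt0.
rewrite -(ler_pM2l k0') -normrM.
have -> : k * (L - q (fun y => rho (p y, s y)) k) =
   k * (r1 * (dpz - q p k) + r2 * (dsz - q s k)) - (rho (p (k *: v + z), s (k *: v + z)) - rho (p z, s (k *: v + z)) - hp * r1)
   - (rho (p z, s (k *: v + z)) - rho (p z, s z) - hs * r2).
  rewrite {1}/q -[_ *: _]/(_ * _) mulrBr mulrA mulfV// mul1r /L hpE hsE /= /shift; ring.
apply: le_trans (ler_normB _ _) _; apply: le_trans (lerD (ler_normB _ _) (lexx _)) _.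
apply: le_trans (lerD (lerD (lexx _) E1) E2) _; rewrite hpE hsE (normrM k (_ + _)) (normrM k (q p k)) (normrM k (q s k)).
have T1 : `|r1 * (dpz - q p k) + r2 * (dsz - q s k)| <= (`|r1| + `|r2|) * e'.
  by apply: le_trans (ler_normD _ _) _; rewrite !normrM mulrDl; apply: lerD; rewrite ler_wpM2l.
apply: le_trans (_ : `|k| * (M * e') <= _); last first.
  rewrite ler_pM2l//; apply: le_trans e'M; rewrite -mulrA mulr_natl mulr2n lerDl.
  by rewrite mulr_ge0 ?ltW.
rewrite /M algM; apply: lerD; [apply: lerD|]; first by rewrite ler_pM2l.
  by rewrite ler_pM2l// ler_pM2l.
by rewrite ler_pM2l// ler_pM2l.
Qed.

End chain.

Section solution.
Context {R : realType}.
Local Notation D := (@half_space R).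
Local Notation Z := (R * R3 R)%type.
Local Notation C1 := (c1 (@stv R)).
Variable T : R.
Hypothesis T0 : 0 < T.
Local Notation slab := (slab T).
Local Notation off := (off T).
Local Notation lam := (@lebesgue_measure R).
Local Notation I F := (\int[lam]_(t in `]0, T[) F t).

(** * The transported quantities of the flow *)

Lemma within_slab (A : set Z) (F : Z -> R) z : {within A, continuous F} -> slab `<=` A -> slab z ->
  {for z, continuous F}.
Proof.
move=> /subspace_continuousP c sA Wz; have := c z (sA z Wz); rewrite within_interior//.
rewrite /interior; have : nbhs z slab by apply: open_nbhs_nbhs; split => //; exact: open_slab.
exact: filterS.
Qed.

Lemma slab_in t x : slab (t, x) -> t \in `[0, T].
Proof. by move=> [/= /andP[t0 tT] _]; rewrite in_itv/= !ltW. Qed.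

Lemma field_time f z : C1_field T f -> slab z ->
  derivable (fun z : Z => f z.1 z.2) z (stv None) /\
  'D_(stv None) (fun z : Z => f z.1 z.2) z = time_deriv T (f^~ z.2) z.1.
Proof.
case: z => t x [_ df _ _] Wz; have tT := slab_in Wz; have [/= tT' Dx] := Wz.
have [dt _] := df t x tT Dx; have [d E] := time_deriv_inside tT' dt.
by split; [exact: derivable_time|rewrite derive_time E].
Qed.

Lemma field_space f i z : C1_field T f -> slab z ->
  derivable (fun z : Z => f z.1 z.2) z (stv (Some i)).
Proof.
case: z => t x [_ df _ _] Wz; have tT := slab_in Wz; have [/= _ Dx] := Wz.
by have [_ /(_ i) dx] := df t x tT Dx; exact: derivable_space.
Qed.

Lemma field_c1 f : C1_field T f -> C1 slab (fun z => f z.1 z.2).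
Proof.
move=> cf z Wz; have [c0 df ct cx] := cf.
have sub : slab `<=` `[0, T] `*` D.
  by move=> y [/andP[y0 yT] Dy]; split => //=; rewrite in_itv/= !ltW.
split.
  apply: within_slab c0 _ Wz => y /sub[y1 y2]; split => //; exact: subset_closure.
case=> [i|].
  split; first exact: field_space.
  apply: (cont_eq (@open_slab R T) Wz (F := fun z => 'D_(evec i) (f z.1) z.2)); last exact: within_slab (cx i) sub Wz.
  by move=> [t x] _; rewrite derive_space.
split; first by case: (field_time cf Wz).
apply: (cont_eq (@open_slab R T) Wz (F := fun z => time_deriv T (f^~ z.2) z.1)); last exact: within_slab ct sub Wz.
by move=> y Wy; case: (field_time cf Wy).
Qed.

Lemma test_c1 eta psi : test1 [pred t | 0 < t < T] eta -> tst psi ->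
  C1 setT (fun z => eta z.1 * psi z.2).
Proof.
move=> te tp z _; have [sm _] := test_function_time te tp.
split; first by have [c _] := sm [::]; exact: c.
move=> a; split; first by have [_ d] := sm [::]; exact: d.
by have [c _] := sm [:: stv a]; exact: c.
Qed.

Lemma test_off eta psi : test1 [pred t | 0 < t < T] eta -> tst psi ->
  exists n, off n (fun z => eta z.1 * psi z.2).
Proof.
move=> [_ [p [q [/andP[p0 _] /andP[_ qT] eo]]]] tp.
have [m0 om] := tst_cube tp.
have [c [c0 oc]] : exists c : R, 0 < c /\ forall x, x.2 < c -> psi x = 0.
  have [a [b [g [_ _ [_ [c [d [c0 _ oc]]]] ->]]]] := tp; exists c; split => // x xc.
  by rewrite /tens oc ?mulr0// negb_and -ltNge xc.
have H x : 0 < x -> exists n, n.+1%:R^-1 <= x :> R.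
  move=> x0; exists (Num.truncn x^-1); rewrite -[leRHS]invrK lef_pV2 ?posrE ?invr_gt0//.
  exact/ltW/truncnS_gt.
have qT' : 0 < T - q by rewrite subr_gt0.
have [n1 h1] := H _ p0; have [n2 h2] := H _ qT'; have [n3 h3] := H _ c0.
pose n := maxn (maxn n1 n2) (maxn n3 m0).
have mono k x : (k <= n)%N -> k.+1%:R^-1 <= x -> n.+1%:R^-1 <= x :> R.
  by move=> kn; apply: le_trans; rewrite lef_pV2 ?posrE// ler_nat.
have {}h1 : n.+1%:R^-1 <= p by apply: mono h1; rewrite /n !leq_max leqnn.
have {}h2 : n.+1%:R^-1 <= T - q by apply: mono h2; rewrite /n !leq_max leqnn orbT.
have {}h3 : n.+1%:R^-1 <= c by apply: mono h3; rewrite /n !leq_max leqnn !orbT.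
exists n => -[t x] nz /=; have [tp'|/eo->] := boolP (p <= t <= q); last by rewrite mul0r.
have [xc|cx] := ltP x.2 c; first by rewrite oc ?mulr0.
rewrite om ?mulr0// => /(cube3_mono (n := n.+1)) [].
  by rewrite leqW// /n !leq_max leqnn !orbT.
move=> [/= x1 x2] x3; apply: nz; apply/stboxP => /=; move: x1 x2 x3; rewrite /= !in_itv/= => x1 x2 /andP[_ x3].
have /andP[p1 q1] := tp'.
split; [|by rewrite ler_norml|by rewrite ler_norml|by rewrite x3 (le_trans h3)].
by move: h1 h2; move: (_^-1) => k h1 h2; apply/andP; split; lra.
Qed.

End solution.

Section physics.
Context {R : realType}.
Local Notation D := (@half_space R).
Local Notation Z := (R * R3 R)%type.
Local Notation C1 := (c1 (@stv R)).
Variables (rho : R * R -> R) (rho0 : R).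
Hypothesis Hrho : equation_of_state rho rho0.
Variables (eps T : R) (w : unknown -> R -> R3 R -> R).
Hypotheses (eps0 : 0 < eps) (T0 : 0 < T).
Hypothesis cw : forall k, C1_field T (w k).
Hypothesis eqw : forall t x, t \in `[0, T] -> half_space x ->
  forall k, mhd_lhs rho eps (fun k' => w k' t x) (fun k' => time_deriv T ((w k')^~ x) t)
                    (fun i k' => 'D_(evec i) (w k' t) x) k = 0.
Local Notation slab := (slab T).
Local Notation lam := (@lebesgue_measure R).
Local Notation I F := (\int[lam]_(t in `]0, T[) F t).

Let W k (z : Z) := w k z.1 z.2.
Let X (a : option 'I_3) : Z -> R := if a is Some i then W (Vel i) else fun=> 1.
Let r (z : Z) := rho (1 + eps * W Prs z, W Ent z).
Let b k (z : Z) := (r z)^-1 * W (Mag k) z.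
Let flow (f : Z -> R) z := \sum_a X a z * 'D_(stv a) f z.
Let divu z := \sum_i 'D_(stv (Some i)) (W (Vel i)) z.

Let cW k : C1 slab (W k). Proof. exact: field_c1. Qed.
Let cX a : C1 slab (X a). Proof. by case: a => [i|]; [exact: cW|apply: c1_cst; exact: open_slab]. Qed.
Let r0 z : 0 < r z.
Proof. by have [_ h1 h2 _] := Hrho; exact: lt_le_trans (h2 _). Qed.

Let flowE k z : slab z -> flow (W k) z =
  time_deriv T ((w k)^~ z.2) z.1 + \sum_(j < 3) w (Vel j) z.1 z.2 * 'D_(evec j) (w k z.1) z.2.
Proof.
move=> Wz; rewrite /flow big_option3 mul1r; have [_ E] := field_time (cw k) Wz.
apply: (congr2 (fun a b : R => a + b)); first exact: E.
by apply: eq_bigr => i _; case: z {E} Wz => t x Wz; rewrite derive_space.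
Qed.

Let divE z : divu z = \sum_(j < 3) 'D_(evec j) (w (Vel j) z.1) z.2.
Proof. by apply: eq_bigr => i _; case: z => t x; rewrite derive_space. Qed.

Let eqz z k : slab z -> mhd_lhs rho eps (fun k' => w k' z.1 z.2) (fun k' => time_deriv T ((w k')^~ z.2) z.1)
                    (fun i k' => 'D_(evec i) (w k' z.1) z.2) k = 0.
Proof. by case: z => t x Wz; apply: eqw; [exact: (slab_in Wz)|case: Wz]. Qed.

Let flow_Ent z : slab z -> flow (W Ent) z = 0.
Proof. by move=> Wz; rewrite (flowE _ Wz); exact: (eqz Ent Wz). Qed.

Let flow_Mag i z : slab z -> flow (W (Mag i)) z =
  \sum_j W (Mag j) z * 'D_(stv (Some j)) (W (Vel i)) z - W (Mag i) z * divu z.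
Proof.
move=> Wz; rewrite (flowE _ Wz) divE.
under [X in _ = X - _]eq_bigr => j _.
  rewrite (_ : 'D_(stv (Some j)) (W (Vel i)) z = 'D_(evec j) (w (Vel i) z.1) z.2); last first.
    by case: z Wz => t x Wz; rewrite derive_space.
  over.
by have /eqP := eqz (Mag i) Wz; rewrite subr_eq0 => /eqP.
Qed.

Let algP (s p f d : R) : 0 < s -> s^-1 * p * f + eps^-1 * d = 0 -> p * (eps * f) = - (s * d).
Proof.
move=> s0 E; have e1 : s * eps * (s^-1 * p * f + eps^-1 * d) = 0 by rewrite E mulr0.
apply/eqP; rewrite -addr_eq0 -e1; apply/eqP; field.
by rewrite !gt_eqF.
Qed.

Let flow_Prs z : slab z ->
  'D_((1, 0) : R * R) rho (1 + eps * W Prs z, W Ent z) * (eps * flow (W Prs) z) = - (r z * divu z).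
Proof.
move=> Wz; rewrite (flowE _ Wz) divE; exact: (algP (r0 z) (eqz Prs Wz)).
Qed.

Let srho : smooth rho. Proof. by case: Hrho. Qed.

Let cont2 (g : R * R -> R) z : continuous g -> slab z ->
  {for z, continuous (fun z => g (1 + eps * W Prs z, W Ent z))}.
Proof.
move=> cg Wz; have [c1 _] := cW Prs Wz; have [c2 _] := cW Ent Wz.
apply: (@cvg_comp _ _ _ (fun z => (1 + eps * W Prs z, W Ent z)) g _ (nbhs (1 + eps * W Prs z, W Ent z))); last exact: cg.
apply: (@cvg_pair _ _ _ (nbhs z) (nbhs (1 + eps * W Prs z)) (nbhs (W Ent z))); last exact: c2.
by apply: cvgD; [exact: cvg_cst|apply: cvgM => //; exact: cvg_cst].
Qed.

Let dr a z : slab z -> is_derive z (stv a) r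
  ('D_((1, 0) : R * R) rho (1 + eps * W Prs z, W Ent z) * (eps * 'D_(stv a) (W Prs) z) +
   'D_((0, 1) : R * R) rho (1 + eps * W Prs z, W Ent z) * 'D_(stv a) (W Ent) z).
Proof.
move=> Wz; have [_ /(_ a)[d1 _]] := cW Prs Wz; have [_ /(_ a)[d2 _]] := cW Ent Wz.
have dp : is_derive z (stv a) (fun z => 1 + eps * W Prs z) (eps * 'D_(stv a) (W Prs) z).
  have h1 : derivable (fun _ : Z => eps) z (stv a) by exact: derivable_cst.
  have h2 : derivable (fun _ : Z => 1 : R) z (stv a) by exact: derivable_cst.
  have h3 := derivableM h1 d1.
  apply: DeriveDef; first exact: (derivableD h2 h3).
  by rewrite (deriveD h2 h3) (deriveM h1 d1) !derive_cst add0r scaler0 addr0.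
have [dp1 dp2] := dp.
by have := chain2 srho dp1 d2; rewrite dp2.
Qed.

Let cr : C1 slab r.
Proof.
move=> z Wz; split; first by apply: cont2 => //; case: (srho [::]).
move=> a; split; first by case: (dr a Wz).
apply: (cont_eq (@open_slab R T) Wz (F := fun z =>
 'D_((1, 0) : R * R) rho (1 + eps * W Prs z, W Ent z) * (eps * 'D_(stv a) (W Prs) z) +
   'D_((0, 1) : R * R) rho (1 + eps * W Prs z, W Ent z) * 'D_(stv a) (W Ent) z)).
  by move=> y Wy; case: (dr a Wy).
have [_ /(_ a)[_ c1]] := cW Prs Wz; have [_ /(_ a)[_ c2]] := cW Ent Wz.
have cD v : continuous ('D_v rho) by have [c _] := srho [:: v]; exact: c.
apply: cvgD; apply: cvgM.
- exact: (@cont2 ('D_((1, 0) : R * R) rho) z (cD _) Wz).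
- by apply: cvgM; [exact: cvg_cst|exact: c1].
- exact: (@cont2 ('D_((0, 1) : R * R) rho) z (cD _) Wz).
- exact: c2.
Qed.

Let cri : C1 slab (fun z => (r z)^-1).
Proof. by apply: (c1V (@open_slab R T)) cr => z _; rewrite gt_eqF. Qed.

Let cb k : C1 slab (b k).
Proof. exact: (c1M (@open_slab R T) cri (cW (Mag k))). Qed.

(** Conservation of mass, from the pressure equation and the transport of the entropy. *)
Let flow_r z : slab z -> flow r z = - (r z * divu z).
Proof.
move=> Wz; transitivity ('D_((1, 0) : R * R) rho (1 + eps * W Prs z, W Ent z) * (eps * flow (W Prs) z) +
  'D_((0, 1) : R * R) rho (1 + eps * W Prs z, W Ent z) * flow (W Ent) z); last first.
  by rewrite (flow_Prs Wz) (flow_Ent Wz) mulr0 addr0.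
rewrite /flow !mulr_sumr -big_split/=; apply: eq_bigr => a _.
by have [_ ->] := dr a Wz; move: ('D_(1, 0) rho _) ('D_(0, 1) rho _) => *; ring.
Qed.

(** The frozen-in law: conservation of mass cancels the compression term of the induction
    equation. *)
Let flow_b k z : slab z -> flow (b k) z = \sum_i b i z * 'D_(stv (Some i)) (X (Some k)) z.
Proof.
move=> Wz; have rz : r z != 0 by rewrite gt_eqF.
transitivity ((r z)^-1 * flow (W (Mag k)) z - W (Mag k) z * ((r z) ^- 2 * flow r z)).
  rewrite /flow !mulr_sumr -sumrB; apply: eq_bigr => a _.
  have [_ /(_ a)[d1 _]] := cri Wz; have [_ /(_ a)[d2 _]] := cW (Mag k) Wz; have [_ /(_ a)[d3 _]] := cr Wz.
  rewrite /b mulfE (deriveM d1 d2) (deriveV rz d3) /=.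
  rewrite -![_ *: _]/(_ * _); ring.
rewrite (flow_r Wz) (flow_Mag _ Wz) mulrBr mulr_sumr -addrA -[RHS]addr0; congr (_ + _).
  by apply: eq_bigr => i _; rewrite /b /=; ring.
by field.
Qed.

Let to_J f eta psi : test1 [pred t | 0 < t < T] eta -> tst psi ->
  I (fun t => intO (fun x => f t x * ('D_1 (fun s => eta s * psi x) t +
          \sum_(i < 3) 'D_(evec i) (fun y => w (Vel i) t y * (eta t * psi y)) x))) =
  J T (fun z : Z => f z.1 z.2 * \sum_a 'D_(stv a) (fun z => X a z * (eta z.1 * psi z.2)) z).
Proof.
move=> te tp; apply: int_eq => t _; congr intO; apply/funext => x; rewrite /sl/=.
have E1 := derive_time (fun s x => eta s * psi x) t x.
have E2 i := derive_space (fun t y => w (Vel i) t y * (eta t * psi y)) t x i.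
have E0 : (fun z : Z => X None z * (eta z.1 * psi z.2)) = (fun z => eta z.1 * psi z.2).
  by apply/funext => z; rewrite mul1r.
rewrite big_option3 E0; apply: (congr1 (fun s : R => f t x * s)).
apply: (congr2 (fun a b : R => a + b)); first exact: (esym E1).
apply: eq_bigr => i _; exact: (esym (E2 i)).
Qed.

Lemma weak_Ent eta psi : test1 [pred t | 0 < t < T] eta -> tst psi ->
  I (fun t => intO (fun x => w Ent t x * ('D_1 (fun s => eta s * psi x) t +
          \sum_(i < 3) 'D_(evec i) (fun y => w (Vel i) t y * (eta t * psi y)) x))) = 0.
Proof.
move=> te tp; rewrite (to_J _ te tp); have [n on] := test_off te tp.
exact: (J_transport T0 cX (test_c1 te tp) on (cW Ent) flow_Ent).
Qed.

Lemma weak_magS eta psi : test1 [pred t | 0 < t < T] eta -> tst psi ->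
  I (fun t => intO (fun x => magS rho eps w t x * ('D_1 (fun s => eta s * psi x) t +
          \sum_(i < 3) 'D_(evec i) (fun y => w (Vel i) t y * (eta t * psi y)) x))) = 0.
Proof.
move=> te tp; rewrite (to_J _ te tp); have [n on] := test_off te tp.
have := J_frozen T0 cX (test_c1 te tp) on cb (cW Ent) flow_Ent (fun=> erefl) flow_b.
apply: etrans; congr J; apply/funext => -[t x]; congr (_ * _).
rewrite /magS mulr_sumr; apply: eq_bigr => j _.
by rewrite derive_space mulrA.
Qed.

End physics.

Section classical.
Context {R : realType}.
Local Notation D := (@half_space R).
Local Notation mu := (@leb3 R).
Local Notation RR := (measurableTypeR R).
Local Notation E3 := (RR * RR * RR)%type.
Local Notation C1 := (c1 (@evec R)).
Implicit Types (f g A u : R3 R -> R).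

(** * Classical functions against weak derivatives *)

Lemma compact_cube3 n : compact (cube3 n : set (R3 R)).
Proof. by apply: compact_setX; [apply: compact_setX|]; exact: segment_compact. Qed.

Lemma box_L2 A n C : continuous A -> (forall x, `|A x| <= C) -> (forall x, ~ cube3 n x -> A x = 0) ->
  is_L2 A /\ nrm A ^+ 2 <= C ^+ 2 * (2 * n%:R) ^+ 3.
Proof.
move=> cA HC A0; apply: L2_box => //; apply: measurable_funTS; exact: continuous3_measurable.
Qed.

Lemma cont_box_L2 A n : continuous A -> (forall x, ~ cube3 n x -> A x = 0) -> is_L2 A.
Proof.
move=> cA A0; have [C C0 HC] := compact_bound (@compact_cube3 n) (fun z _ => cA z).
have [] // := @box_L2 A n C cA _ A0.
by move=> x; have [/HC//|/A0->] := pselect (cube3 n x); rewrite normr0.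
Qed.

(** A need not be a tensor.  The difference quotients of A converge uniformly, and translation
    moves them onto f, where they converge in the mean. *)
Lemma ip_derive i f g A n : weak1 i f g -> C1 setT A -> (forall x, ~ cube3 n x -> A x = 0) ->
  (forall x, x.2 <= 0 -> A x = 0) ->
  [/\ is_L2 A, is_L2 ('D_(evec i) A) & ip f ('D_(evec i) A) = - ip g A].
Proof.
move=> wf cA A0 An; have [Lf Lg _] := wf.
have cAc : continuous A by move=> z; case: (cA z I).
have cAd : continuous ('D_(evec i) A) by move=> z; case: ((cA z I).2 i).
have LA := cont_box_L2 cAc A0.
have A0' x : ~ cube3 n x -> 'D_(evec i) A x = 0 by apply: derive_off A0; exact: compact_cube3.
have LA' := cont_box_L2 cAd A0'.
split => //; apply/eqP; rewrite -subr_eq0 opprK; apply/eqP.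
(* All supports lie in a cube of volume V. *)
pose V : R := (2 * n.+1%:R) ^+ 3; have V0 : 0 <= V by rewrite exprn_ge0// mulr_ge0.
apply/eqP; rewrite -normr_le0; apply/ler_addgt0Pr => e e0; rewrite add0r.
pose k := nrm f * (1 + V) + nrm A + 1.
have k0 : 0 < k.
  by rewrite /k ltr_wpDl// addr_ge0 ?nrm_ge0// mulr_ge0 ?nrm_ge0// addr_ge0.
have ek : 0 < e / k by rewrite divr_gt0.
have [d d0 Hd] := dir_taylor (@compact_cube3 n.+1) openT (@subsetT _ _)
   (fun z _ => proj1 ((cA z I).2 i)) (fun z _ => cAd z) ek.
have [d' /andP[d'0 d'1] Hd'] := dq_cvg wf ek.
pose h := Num.min d d'; have h0 : 0 < h by rewrite lt_min d0.
have hd : h <= d by rewrite ge_min lexx.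
have hd' : h <= d' by rewrite ge_min lexx orbT.
have h1 : h <= 1 by exact: le_trans d'1.
have hN : `|- h| = h by rewrite normrN gtr0_norm.
pose As x := A (x + - h *: evec i).
have cAs : continuous As by move=> z; apply: continuous_at_shift; exact: cAc.
have nn (x : E3) : ~ cube3 n.+1 x -> ~ cube3 n x by move=> nx /(cube3_mono (leqnSn n)).
have As0 x : ~ cube3 n.+1 x -> As x = 0.
  by move=> nx; apply/A0/cube3_shift; rewrite ?hN.
have LAs := cont_box_L2 cAs As0.
have L2d : is_L2 (dq i h f) by apply: L2_dq => //; exact: ltW.
have v0 : 0 <= (h *: evec i : R3 R).2 by rewrite /= mulr_ge0// ltW.
have E1 : ip f As = ip (sh (h *: evec i) f) A.
  rewrite !ipE -(intO_shift (v := h *: evec i) (F := fun x => f x * As x)) //.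
  - by congr intO; apply/funext => x; rewrite /sh /As scaleNr addrK.
  - exact: L2_mul.
  - move=> x _ xv; have -> : As x = 0; last by rewrite mulr0.
    by rewrite /As scaleNr; apply: An; change (x.2 - (h *: evec i : R3 R).2 <= 0); rewrite subr_le0.
pose E x := 'D_(evec i) A x - h^-1 * (A x - As x).
have cE : continuous E.
  move=> z; apply: cvgB; first exact: cAd.
  by apply: cvgM; [exact: cvg_cst|apply: cvgB; [exact: cAc|exact: cAs]].
have E0 x : ~ cube3 n.+1 x -> E x = 0.
  by move=> nx; rewrite /E (As0 _ nx) (A0 _ (nn _ nx)) (A0' _ (nn _ nx)) subrr mulr0 subr0.
have Eb x : `|E x| <= e / k.
  have [cx|nx] := pselect (cube3 n.+1 x); last by rewrite (E0 _ nx) normr0 ltW.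
  have -> : E x = h^-1 * (A (x + - h *: evec i) - A x - (- h) * 'D_(evec i) A x).
    by rewrite /E /As; field; rewrite gt_eqF.
  rewrite normrM gtr0_norm ?invr_gt0// ler_pdivrMl//.
  by rewrite (mulrC h); have := Hd x (- h) cx; rewrite hN; apply.
have [LE nE] := box_L2 cE Eb E0.
have nE' : nrm E <= e / k * (1 + V).
  rewrite -(@ler_pXn2r _ 2)// ?nnegrE ?nrm_ge0//; last by rewrite mulr_ge0 ?(ltW ek)// addr_ge0.
  apply: le_trans nE _; rewrite [leRHS]exprMn -/V; apply: ler_wpM2l; first exact: sqr_ge0.
  rewrite sqrrD expr1n mul1r mulr2n; have := sqr_ge0 V; move: (V ^+ 2) => V2; move: V0; clear; lra.
have E2 : ip f ('D_(evec i) A) + ip g A = ip f E + - ip (dq i h f \- g) A.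
  have -> : 'D_(evec i) A = E \+ (h^-1 \*o (A \- As)) by apply/funext => x; rewrite /E /= subrK.
  have LB := L2B LA LAs.
  rewrite (ipDr LE (L2Z h^-1 LB) Lf) (ipZr h^-1 LB Lf) (ipBr LA LAs Lf) (ipBl L2d Lg LA) E1 dqE.
  have Ls : is_L2 (sh (h *: evec i) f) by exact: L2_sh.
  rewrite (ipZl h^-1 (L2B Ls Lf) LA) (ipBl Ls Lf LA).
  by move: (ip _ _) (ip _ _) (ip _ _) (ip _ _) => a b c d''; ring.
rewrite E2; apply: le_trans (ler_normD _ _) _; rewrite normrN.
apply: le_trans (lerD (ip_cs Lf LE) (ip_cs (L2B L2d Lg) LA)) _.
apply: le_trans (_ : nrm f * (e / k * (1 + V)) + e / k * nrm A <= _).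
  by apply: lerD; [rewrite ler_wpM2l ?nrm_ge0|rewrite ler_wpM2r ?nrm_ge0// Hd' ?h0].
have -> : nrm f * (e / k * (1 + V)) + e / k * nrm A = e / k * (k - 1) by rewrite /k; ring.
by rewrite mulrBr divfK ?gt_eqF// mulr1 gerBl ltW.
Qed.

Lemma leb3_box (a : R3 R) (r : R) : 0 < r ->
  mu ((`]a.1.1 - r, a.1.1 + r[ `*` `]a.1.2 - r, a.1.2 + r[) `*` `]a.2 - r, a.2 + r[) = ((2 * r) ^+ 3)%:E.
Proof.
move=> r0; pose I (x : R) : set RR := [set` `]x - r, x + r[].
have m1 x : measurable (I x) by exact: measurable_itv.
have m2 : measurable (I a.1.1 `*` I a.1.2 : set (RR * RR)) by exact: measurableX.
have E : mu ((I a.1.1 `*` I a.1.2) `*` I a.2) = (leb2 (I a.1.1 `*` I a.1.2) * lebesgue_measure (I a.2))%E.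
  exact: (@product_measure1E _ _ _ _ R (@leb2 R) (@lebesgue_measure R) _ _ m2 (m1 _)).
have E2 : leb2 (I a.1.1 `*` I a.1.2) = (lebesgue_measure (I a.1.1) * lebesgue_measure (I a.1.2))%E.
  exact: product_measure1E.
have L x : lebesgue_measure (I x) = (2 * r)%:E.
  rewrite /I lebesgue_measure_itv/= lte_fin ifT; last by lra.
  by rewrite -EFinB; congr EFin; ring.
by apply: etrans E _; rewrite E2 !L -!EFinM; congr EFin; ring.
Qed.

(** Multiplication by v is a bounded operator on L^2; applied to indicators of small cubes around
    x, it bounds v at x. *)
Lemma sob_sup v N : sob 3 v N -> (forall x, D x -> {for x, continuous v}) ->
  forall x, D x -> `|v x| <= 8 * Num.sqrt N.
Proof.
move=> sv cv x Dx; rewrite leNgt; apply/negP => vx; set C := 8 * Num.sqrt N in vx.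
(* C + e is half-way between C and |v x|. *)
pose e := (`|v x| - C) / 2; have e0 : 0 < e by rewrite divr_gt0// subr_gt0.
have /nbhs_ballP[d /= d0 Hd] : \forall y \near x, `|v x - v y| <= e by move/cvgrPdist_le: (cv x Dx); apply.
pose r := Num.min d x.2; have r0 : 0 < r by rewrite lt_min d0.
have rd : r <= d by rewrite ge_min lexx.
have rx : r <= x.2 by rewrite ge_min lexx orbT.
pose Q : set E3 := (`]x.1.1 - r, x.1.1 + r[ `*` `]x.1.2 - r, x.1.2 + r[) `*` `]x.2 - r, x.2 + r[.
have mQ : measurable Q by apply: measurableX; [apply: measurableX|]; exact: measurable_itv.
have QD : Q `<=` D.
  by move=> y [_ /=]; rewrite in_itv/= => /andP[y1 _]; apply: le_lt_trans y1; rewrite subr_ge0.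
have Qb (y : R3 R) : Q y -> C + e <= `|v y|.
  move=> [[/= y1 y2] y3]; move: y1 y2 y3; rewrite !in_itv/= => y1 y2 y3.
  have bl (a b : R) : a - r < b < a + r -> ball a d b.
    by rewrite /ball/= => /andP[? ?]; apply: lt_le_trans rd; rewrite ltr_norml; apply/andP; split; lra.
  have : `|v x - v y| <= e by apply: Hd; split; [split|]; exact: bl.
  have E : C + e + e = `|v x| by rewrite /e; lra.
  move=> h; have := ler_normD (v x - v y) (v y); rewrite subrK -E => h'.
  by rewrite -(lerD2r e); apply: le_trans h' _; rewrite addrC lerD2l.
pose f : R3 R -> R := \1_Q.
pose n := (Num.truncn (`|x.1.1| + `|x.1.2| + `|x.2| + r)).+1.
have nE : `|x.1.1| + `|x.1.2| + `|x.2| + r <= n%:R by apply/ltW/truncnS_gt.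
have Qn : Q `<=` cube3 n.
  have kk (a b M : R) : a - r < b < a + r -> `|a| + r <= M -> - M <= b <= M.
    by move=> /andP[? ?]; have := ler_norm a; have := ler_norm (- a); rewrite normrN => *; apply/andP; split; lra.
  have n1 := normr_ge0 x.1.1; have n2 := normr_ge0 x.1.2; have n3 := normr_ge0 x.2.
  move=> y [[/= y1 y2] y3]; move: y1 y2 y3; rewrite !in_itv/= => y1 y2 y3.
  by split; [split|]; rewrite /= in_itv/=; [apply: kk y1 _|apply: kk y2 _|apply: kk y3 _];
    move: nE n1 n2 n3; clear; lra.
have Lf : is_L2 f.
  have mf : measurable_fun (D : set E3) f by apply: measurable_funTS; exact: measurable_indic.
  have bf y : D y -> `|f y| <= 1 by move=> _; rewrite /f indicE; exact: norm_bool.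
  have zf y : ~ cube3 n y -> f y = 0 by move=> ny; rewrite /f indicE memNset// => /Qn.
  by have [] := L2_box mf bf zf.
have f0 : 0 < nrm f.
  rewrite lt_neqAle nrm_ge0 andbT; apply/eqP => /esym f0.
  have [A [mA A0 sA]] := nrm_eq0 Lf f0.
  have QA : Q `<=` A.
    move=> y Qy; apply: sA => /(_ (QD y Qy)); rewrite /f indicE mem_set// => /eqP.
    by rewrite oner_eq0.
  have : (mu Q <= mu A)%E by apply: le_measure => //; rewrite inE.
  by rewrite leb3_box// A0 lee_fin leNgt exprn_gt0// mulr_gt0.
have [LV nV] := sob_mulL2 (isT : (3 <= 3)%N) sv Lf.
have C0 : 0 <= C + e by rewrite addr_ge0 ?(ltW e0)// mulr_ge0 ?sqrtr_ge0.
have : nrm ((C + e) \*o f) <= nrm (v \* f).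
  apply: le_nrm => [||y Dy]; [exact: L2Z|exact: LV|] => /=.
  rewrite !normrM (ger0_norm C0) /f indicE; have [/set_mem Qy|_] := boolP (y \in Q); last by rewrite !normr0 !mulr0.
  by rewrite !normr1 !mulr1; exact: Qb.
rewrite nrmZ// (ger0_norm C0) => /le_trans /(_ nV).
by rewrite ler_pM2r// gerDl leNgt e0.
Qed.

Let line_last (z : R3 R) (s : R) : (z.1, s) + (z.2 - s) *: evec ord_max = z.
Proof.
case: z => [[z1 z2] z3] /=.
by congr (_, _, _); rewrite /= ?scaler0 ?addr0// [_ *: 1]mulr1 addrC subrK.
Qed.

(** The difference quotients of u in the normal direction are bounded by sob_sup, so that u grows
    at most linearly from its boundary value 0. *)
Lemma tangent_last u N : sob 4 u N -> (forall x, D x -> {for x, continuous u}) ->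
  (forall x e, D x -> 0 < e -> exists2 d, 0 < d & forall s, 0 < s <= d -> `|u (x.1, s)| <= e) ->
  tangent ord_max u.
Proof.
move=> su cu bu; right; exists (8 * Num.sqrt N); first by rewrite mulr_ge0 ?sqrtr_ge0.
move=> z Dz z1; apply/ler_addgt0Pr => e e0; have [d d0 Hd] := bu z e Dz e0.
pose s := Num.min d (z.2 / 2); have s0 : 0 < s by rewrite lt_min d0 divr_gt0.
have sd : s <= d by rewrite ge_min lexx.
have sz : s <= z.2 / 2 by rewrite ge_min lexx orbT.
have Dz' : 0 < z.2 := Dz.
pose h := z.2 - s; have hh : 0 < h <= 1 by rewrite /h; apply/andP; split; lra.
have /andP[h0 _] := hh.
have zE : (z.1, s) + h *: evec ord_max = z.
  exact: line_last.
have cq x : D x -> {for x, continuous (dq ord_max h u)}.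
  move=> Dx; apply: cvgM; first exact: cvg_cst.
  apply: cvgB; last exact: cu.
  by apply: continuous_at_shift; apply: cu; apply: half_spaceD => //; rewrite /= mulr_ge0// ltW.
have := sob_sup (sob_dq ord_max hh su) cq (x := (z.1, s)) s0.
rewrite /dq zE normrM gtr0_norm ?invr_gt0// ler_pdivrMl// => H.
have := ler_normD (u z - u (z.1, s)) (u (z.1, s)); rewrite subrK => /le_trans; apply.
apply: lerD; last by apply: Hd; rewrite s0.
apply: le_trans H _; rewrite mulrC ler_wpM2l ?mulr_ge0 ?sqrtr_ge0//.
by rewrite /h; move: s0; lra.
Qed.

End classical.

(** ** Fields at a fixed time *)

Section slice.
Context {R : realType}.
Local Notation D := (@half_space R).
Local Notation Z := (R * R3 R)%type.
Local Notation C1 := (c1 (@evec R)).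
Variable T : R.
Hypothesis T0 : 0 < T.
Implicit Types (f psi : R3 R -> R).
Local Notation lam := (@lebesgue_measure R).
Local Notation I F := (\int[lam]_(t in `]0, T[) F t).

Lemma sum3 (F : 'I_3 -> R) : \sum_i F i = F ord0 + F (inord 1) + F ord_max.
Proof.
rewrite !big_ord_recl big_ord0 addr0 addrA; congr (F _ + F _ + F _); apply/val_inj => //=.
by rewrite inordK.
Qed.

Lemma cont_slice (F : Z -> R) t x : {for (t, x), continuous F} -> {for x, continuous (fun x => F (t, x))}.
Proof.
move=> cF; apply: (@cvg_comp _ _ _ (fun x => (t, x)) F _ (nbhs (t, x))); last exact: cF.
by apply: (@cvg_pair _ _ _ (nbhs x) (nbhs t) (nbhs x) _ _ _ (fun=> t) id); [exact: cvg_cst|exact: cvg_id].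
Qed.

Lemma open_half_space : open D.
Proof.
rewrite openE => x Dx; rewrite /interior; have Dx' : 0 < x.2 := Dx.
apply/nbhs_ballP; exists x.2 => // y [_]; rewrite /ball/= ltr_norml => /andP[_].
by rewrite /half_space/= ltrBlDr ltrDl.
Qed.

Lemma field_slice G t : C1_field T G -> 0 < t < T -> C1 D (G t).
Proof.
move=> cG tT x Dx; have Wx : slab T (t, x) by [].
have [c0 d0] := field_c1 cG Wx; split; first exact: (cont_slice c0).
move=> i; have [_ cd] := d0 (Some i); split.
  have [_ df _ _] := cG; have [_ /(_ i)] := df t x (slab_in Wx) Dx; exact.
apply: (cont_eq open_half_space Dx (F := fun y => 'D_(stv (Some i)) (fun z : Z => G z.1 z.2) (t, y))).
  by move=> y _; exact: derive_space.
exact: (cont_slice cd).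
Qed.

Lemma field_within G t x e : C1_field T G -> 0 <= t <= T -> closure D x -> 0 < e ->
  exists2 d, 0 < d & forall y, closure D y -> ball x d y -> `|G t x - G t y| <= e.
Proof.
move=> [c0 _ _ _] tT Dx e0; pose A : set Z := `[0, T] `*` closure D.
have At y : closure D y -> A (t, y) by move=> ?; split => //=; rewrite in_itv.
have H : (fun z : Z => G z.1 z.2) @ within A (nbhs (t, x)) --> G t x.
  exact: ((subspace_continuousP _ _).1 c0 (t, x) (At x Dx)).
have : \forall z \near within A (nbhs (t, x)), `|G t x - G z.1 z.2| <= e.
  by move/cvgrPdist_le: H; apply.
move=> /nbhs_ballP[d /= d0 Hd]; exists d => // y Dy xy.
by apply: (Hd (t, y)); [split => //; exact: ballxx|exact: At].
Qed.

Lemma field_cont0 G t x : C1_field T G -> 0 <= t <= T -> D x -> {for x, continuous (G t)}.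
Proof.
move=> cG tT Dx; apply/cvgrPdist_le => e e0.
have [d d0 Hd] := field_within cG tT (subset_closure Dx) e0.
have nD : nbhs x D by apply: open_nbhs_nbhs; split => //; exact: open_half_space.
have nB : nbhs x (ball x d) by exact: nbhsx_ballx.
apply: filterS (filterI nB nD) => y [By Dy]; apply: Hd => //; exact: subset_closure.
Qed.

Lemma field_tangent G N t : C1_field T G -> 0 <= t <= T -> (forall x, half_space_bd x -> G t x = 0) ->
  sob 4 (G t) N -> tangent ord_max (G t).
Proof.
move=> cG tT G0 sG; apply: tangent_last sG _ _; first by move=> x; exact: field_cont0.
move=> x e Dx e0; have cl (y : R3 R) : 0 <= y.2 -> closure D y.
  move=> y0 B /nbhs_ballP[d /= d0 Hd]; exists (y.1, y.2 + d / 2); split.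
    by rewrite /half_space/= ltr_wpDl// divr_gt0.
  apply: Hd; split; first exact: ballxx.
  rewrite /ball/= opprD addrA subrr sub0r normrN gtr0_norm ?divr_gt0//.
  by rewrite ltr_pdivrMr// ltr_pMr// ltr1n.
have [d d0 Hd] := field_within cG tT (cl (x.1, 0) (lexx _)) e0.
exists (d / 2) => [|s /andP[s0 sd]]; first by rewrite divr_gt0.
have := Hd (x.1, s) (cl (x.1, s) (ltW s0)); rewrite (G0 (x.1, 0))// sub0r normrN; apply.
split; first exact: ballxx.
rewrite /ball/= sub0r normrN gtr0_norm//; apply: le_lt_trans sd _.
by rewrite ltr_pdivrMr// ltr_pMr// ltr1n.
Qed.

Lemma ip_sum (f : R3 R -> R) (F : 'I_3 -> R3 R -> R) : is_L2 f -> (forall i, is_L2 (F i)) ->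
  is_L2 (fun x => \sum_i F i x) /\ ip f (fun x => \sum_i F i x) = \sum_i ip f (F i).
Proof.
move=> Lf LF; have -> : (fun x => \sum_i F i x) = (F ord0 \+ F (inord 1)) \+ F ord_max.
  by apply/funext => x; rewrite sum3.
split; first by apply: L2D => //; exact: L2D.
by rewrite (ipDr (L2D (LF _) (LF _)) (LF _) Lf) (ipDr (LF _) (LF _) Lf) sum3.
Qed.

Variable u : 'I_3 -> R -> R3 R -> R.
Hypothesis cu : forall i, C1_field T (u i).

(** The operator dual to the material derivative, applied to a test function. *)
Definition dual (eta : R -> R) psi t : R3 R -> R := fun x =>
  'D_1 (fun s => eta s * psi x) t + \sum_(i < 3) 'D_(evec i) (fun y => u i t y * (eta t * psi y)) x.

Lemma dual_ip f (g : 'I_3 -> R -> R3 R -> R) eta psi t : sm1 eta -> tst psi -> 0 < t < T ->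
  (forall i, weak1 i f (g i t)) -> (forall i, is_L2 (u i t \* g i t)) ->
  is_L2 (dual eta psi t) /\
  ip f (dual eta psi t) = derive1 eta t * ip f psi - eta t * ip (transp u g t) psi.
Proof.
move=> se tp tT wf Lug; have Lp := tst_L2 tp.
have Lf : is_L2 f by case: (wf ord0).
have [p1 [q1 [p2 [q2 [p3 [q3 [P3 _ off]]]]]]] := tst_supp tp; have [n on] := tst_cube tp.
pose K : set (R3 R) := `[p1, q1] `*` `[p2, q2] `*` `[p3, q3].
have cK : compact K by do ![apply: compact_setX]; exact: segment_compact.
have KD : K `<=` D.
  by move=> [[x y] z] [_ /=]; rewrite in_itv/= => /andP[/(lt_le_trans P3)].
have oD := open_half_space.
have cpsi : C1 D (fun y => eta t * psi y).
  apply: (c1M oD); first by apply: c1_cst.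
  have [sm _] := tst_test_function tp; move=> x Dx; split; first by have [c _] := sm [::]; exact: c.
  move=> a; split; first by have [_ d] := sm [::]; exact: d.
  by have [c _] := sm [:: evec a]; exact: c.
(* The product of the velocity and the test is of class C^1 once extended by zero. *)
pose A i y := u i t y * (eta t * psi y).
have key i : [/\ is_L2 (A i), is_L2 ('D_(evec i) (A i)) & ip f ('D_(evec i) (A i)) = - (eta t * ip (u i t \* g i t) psi)].
  have offA x : ~ K x -> A i x = 0 by move=> /off h; rewrite /A h !mulr0.
  have cA : C1 setT (A i).
    by apply: (c1_glue cK KD offA); apply: (c1M oD) => //; exact: field_slice.
  have A0 x : ~ cube3 n x -> A i x = 0 by move=> /on h; rewrite /A h !mulr0.
  have An x : x.2 <= 0 -> A i x = 0 by move=> h; rewrite /A (tst_out tp h) !mulr0.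
  have [L1 L2' ->] := ip_derive (wf i) cA A0 An; split => //; congr (- _).
  rewrite -(ipZr (eta t) Lp (Lug i)) !ipE; congr intO; apply/funext => x; rewrite /A/=; ring.
have E1 : dual eta psi t = (derive1 eta t \*o psi) \+ (fun x => \sum_i 'D_(evec i) (A i) x).
  apply/funext => x; rewrite /dual/=; congr (_ + _).
  have [de] : derivable eta t 1 /\ True by split => //; exact: (se 0%N t).
  by rewrite (deriveMr (psi x) de) mulrC derive1E.
have LA' i : is_L2 ('D_(evec i) (A i)) by case: (key i).
have [LS IS] := ip_sum (F := fun i => 'D_(evec i) (A i)) Lf LA'.
have LZ := L2Z (derive1 eta t) Lp.
rewrite E1; split; first exact: L2D.
rewrite (ipDr LZ LS Lf) (ipZr _ Lp Lf) IS; congr (_ + _).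
rewrite sum3; have [_ _ ->] := key ord0; have [_ _ ->] := key (inord 1); have [_ _ ->] := key ord_max.
rewrite /transp (ipDl (L2D (Lug _) (Lug _)) (Lug _) Lp) (ipDl (Lug _) (Lug _) Lp).
by move: (ip _ _) (ip _ _) (ip _ _) => x y z; ring.
Qed.

End slice.

Section field.
Context {R : realType}.
Local Notation D := (@half_space R).
Variables (T eps : R) (u : 'I_3 -> R -> R3 R -> R).
Hypothesis T0 : 0 < T.
Hypothesis cu : forall i, C1_field T (u i).
Implicit Types (a g psi : R3 R -> R).
Local Notation lam := (@lebesgue_measure R).
Local Notation I F := (\int[lam]_(t in `]0, T[) F t).

(** * Null fields *)

Lemma weak1_null i (f : R3 R -> R) : is_L2 f -> nrm f = 0 -> weak1 i f (fun=> 0).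
Proof.
move=> Lf f0; split; [exact: Lf|exact: L20|] => psi tp.
rewrite (ip_nrm0l Lf (tst_L2 (tst_derive i tp)) f0).
by rewrite (ip_nrm0l L20 (tst_L2 tp) nrm0) oppr0.
Qed.

Lemma wk_null w a g : is_L2 a -> nrm a = 0 -> wk w a g -> nrm g = 0.
Proof.
elim: w a => [|i w IH] a La a0 /=; first by move=> [_ Lg E]; rewrite -(nrm_ext La Lg E).
move=> [b wb]; apply: IH; first by case: wb.
have := weak1_uniq wb (weak1_null i La a0).
have [_ Lb _] := wb; move=> E; by rewrite (nrm_ext Lb L20 E) nrm0.
Qed.

Lemma HN_null n (f : R3 R -> R) : in_H n f -> nrm f = 0 -> HN n f = 0.
Proof.
move=> Hf f0; have [Lf _] := Hf; apply: big1 => al aln.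
have := @wk_wderiv _ n f (word (fun i => al i : nat)) Hf; rewrite size_word letters_word => /(_ aln) w.
by rewrite (wk_null Lf f0 w) expr0n.
Qed.

Definition null_field (f : R -> R3 R -> R) := forall t, 0 <= t <= T -> is_L2 (f t) /\ nrm (f t) = 0.

(** The weak form of the transport equation. *)
Definition transported (f : R -> R3 R -> R) := forall eta psi, test1 [pred t | 0 < t < T] eta -> tst psi ->
  I (fun t => intO (fun x => f t x * dual u eta psi t x)) = 0.

Lemma null_transported f : null_field f -> transported f.
Proof.
move=> Hf eta psi te tp; have [se _] := te.
rewrite (int_eq (G := fun=> 0)); first by rewrite Rintegral_cst ?mul0r//; exact: measurable_itv.
move=> t tT; have [|Lf f0] := Hf t; first by case/andP: tT => /ltW -> /ltW ->.
have Lz i : is_L2 (u i t \* (fun=> 0)) by apply: L2_eq L20 => x _ /=; rewrite mulr0.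
have [Ld _] := dual_ip cu (g := fun _ _ _ => 0) se tp tT (fun i => weak1_null i Lf f0) Lz.
by rewrite -ipE; exact: ip_nrm0l.
Qed.

(** A transported field has null material derivative, and a null field is transported. *)
Lemma eDt_null f m : transported f -> null_field (eDt T u eps m.+1 f).
Proof.
move=> Hf; suff H : transported (eDt T u eps m f).
  move=> t tT; have [L n0] := Dt_null T0 H tT.
  have -> : eDt T u eps m.+1 f t = eps \*o Dt T u (eDt T u eps m f) t by [].
  by split; [exact: L2Z|rewrite nrmZ// n0 mulr0].
elim: m => [//|m IH]; apply: null_transported => t tT.
have [L n0] := Dt_null T0 IH tT.
have -> : eDt T u eps m.+1 f t = eps \*o Dt T u (eDt T u eps m f) t by [].
by split; [exact: L2Z|rewrite nrmZ// n0 mulr0].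
Qed.

(** * The energy estimate for a transported field *)

Definition gw (j : 'I_3) a : R3 R -> R := xget (fun=> 0) [set g | weak1 j a g].

Lemma gwP m j a N : sob m.+1 a N -> weak1 j a (gw j a).
Proof.
move=> sa; have [g w _] : exists2 g, weak1 j a g & sob m g N by case: sa => _ _; apply.
by apply: (xgetPex (P := [set g | weak1 j a g]) (fun=> 0)); exists g.
Qed.

Hypothesis su : forall i, cont_sob T 4 (u i).
Hypothesis bu : forall t x, 0 <= t <= T -> half_space_bd x -> u ord_max t x = 0.

Section one_field.
Variable f : R -> R3 R -> R.
Hypotheses (cf : cont_sob T 4 f) (Hf : transported f).
Let g j t := gw j (f t).
Let d j t := gw j (u j t).

Let wf t j : 0 <= t <= T -> weak1 j (f t) (g j t).
Proof. by move=> tT; have [[N sN] _] := cf tT; exact: gwP sN. Qed.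

Let wu t j : 0 <= t <= T -> weak1 j (u j t) (d j t).
Proof. by move=> tT; have [[N sN] _] := su j tT; exact: gwP sN. Qed.

Let tu t j : 0 <= t <= T -> tangent j (u j t).
Proof.
move=> tT; have [->|jm] := eqVneq j ord_max; last by left.
have [[N sN] _] := su ord_max tT.
by apply: (field_tangent (cu ord_max) tT _ sN) => x; exact: bu.
Qed.

Let Lug t j : 0 <= t <= T -> is_L2 (u j t \* g j t).
Proof.
move=> tT; have [[N sN] _] := su j tT; have [_ Lg _] := wf j tT.
by have [] := sob_mulL2 (isT : (3 <= 4)%N) sN Lg.
Qed.

Let alg8 (k x y : R) : 0 < k -> 8 * k * (x + 1) + 8 * y * k <= k * (8 * (x + 1) + 8 * y + 1).
Proof.
move=> k0; have -> : k * (8 * (x + 1) + 8 * y + 1) = 8 * k * (x + 1) + 8 * y * k + k by ring.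
by rewrite lerDl ltW.
Qed.

Let alg3 (x : R) : x / 3 + x / 3 + x / 3 <= x.
Proof. lra. Qed.

Let product_small j t e : 0 <= t <= T -> 0 < e -> exists2 dl, 0 < dl &
  forall s, 0 <= s <= T -> `|s - t| <= dl -> nrm ((u j s \* g j s) \- (u j t \* g j t)) <= e.
Proof.
move=> tT e0; have [[U sU] Cu] := su j tT; have [[F sF] Cf] := cf tT.
have [_ Lgt _] := wf j tT.
pose K := 8 * (nrm (g j t) + 1) + 8 * Num.sqrt U + 1.
have K0 : 0 < K by rewrite /K ltr_wpDl// addr_ge0// mulr_ge0 ?sqrtr_ge0// addr_ge0 ?nrm_ge0.
pose e' := Num.min 1 (e / K); have e'0 : 0 < e' by rewrite lt_min ltr01 divr_gt0.
have e'1 : e' <= 1 by rewrite ge_min lexx.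
have e'K : e' * K <= e by rewrite -ler_pdivlMr// ge_min lexx orbT.
have [d1 d10 H1] := Cu _ (exprn_gt0 2 e'0); have [d2 d20 H2] := Cf _ (exprn_gt0 2 e'0).
exists (Num.min d1 d2); first by rewrite lt_min d10.
move=> s sT; rewrite le_min => /andP[s1 s2].
have {}H1 := H1 s sT s1; have {}H2 := H2 s sT s2; have [_ Lgs _] := wf j sT.
have sg : sob 3 (g j s \- g j t) (e' ^+ 2) := sob_der H2 (weak1B (wf j sT) (wf j tT)).
have ng : nrm (g j s \- g j t) <= e'.
  by have := sob_nrm sg; rewrite ler_pXn2r ?nnegrE ?nrm_ge0// ltW.
have ngs : nrm (g j s) <= nrm (g j t) + 1.
  by apply: le_trans (nrm_sub Lgs Lgt) _; rewrite lerD2l (le_trans ng).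
have LB := L2B Lgs Lgt.
have [L1 n1] := sob_mulL2 (isT : (3 <= 4)%N) H1 Lgs; have [L2' n2] := sob_mulL2 (isT : (3 <= 4)%N) sU LB.
rewrite sqrtr_sqr (gtr0_norm e'0) in n1.
have -> : (u j s \* g j s) \- (u j t \* g j t) = ((u j s \- u j t) \* g j s) \+ (u j t \* (g j s \- g j t)).
  by apply/funext => x /=; ring.
apply: le_trans (nrmD L1 L2') _; apply: le_trans (lerD n1 n2) _.
apply: le_trans (_ : 8 * e' * (nrm (g j t) + 1) + 8 * Num.sqrt U * e' <= _).
  by apply: lerD; apply: ler_wpM2l => //; rewrite mulr_ge0 ?sqrtr_ge0// ltW.
by apply: le_trans e'K; rewrite /K; exact: alg8.
Qed.

Let algT (a b c a' b' c' : R) : (a + b + c) - (a' + b' + c') = (a - a') + (b - b') + (c - c').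
Proof. ring. Qed.

Let transp_cont : cont_sob T 0 (transp u g).
Proof.
move=> t tT; have LT s : 0 <= s <= T -> is_L2 (transp u g s).
  by move=> sT; apply: L2D; [apply: L2D|]; exact: Lug.
split; first by exists (nrm (transp u g t) ^+ 2); split => //; exact: LT.
move=> e e0; have e3 : 0 < Num.sqrt e / 3 by rewrite divr_gt0 ?sqrtr_gt0.
have [d1 d10 H1] := product_small ord0 tT e3; have [d2 d20 H2] := product_small (inord 1) tT e3.
have [d3 d30 H3] := product_small ord_max tT e3.
exists (Num.min d1 (Num.min d2 d3)); first by rewrite !lt_min d10 d20.
move=> s sT; rewrite !le_min => /and3P[s1 s2 s3].
have {}H1 := H1 s sT s1; have {}H2 := H2 s sT s2; have {}H3 := H3 s sT s3.
split => //; first by apply: L2B; exact: LT.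
rewrite -(sqr_sqrtr (ltW e0)) ler_pXn2r ?nnegrE ?nrm_ge0 ?sqrtr_ge0//.
have B j : is_L2 ((u j s \* g j s) \- (u j t \* g j t)) by apply: L2B; exact: Lug.
have -> : transp u g s \- transp u g t = ((u ord0 s \* g ord0 s) \- (u ord0 t \* g ord0 t)) \+
  ((u (inord 1) s \* g (inord 1) s) \- (u (inord 1) t \* g (inord 1) t)) \+
  ((u ord_max s \* g ord_max s) \- (u ord_max t \* g ord_max t)).
  apply/funext => x; exact: algT.
apply: le_trans (nrmD (L2D (B _) (B _)) (B _)) _.
apply: le_trans (lerD (nrmD (B _) (B _)) (lexx _)) _.
exact: le_trans (lerD (lerD H1 H2) H3) (alg3 _).
Qed.

Let strong t e : 0 <= t <= T -> 0 < e -> exists2 dl, 0 < dl &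
  forall s, 0 <= s <= T -> `|s - t| <= dl -> nrm (f s \- f t \+ ((s - t) \*o transp u g t)) <= e * `|s - t|.
Proof.
have W eta psi : test1 [pred t | 0 < t < T] eta -> tst psi ->
    I (fun t => derive1 eta t * ip (f t) psi) = I (fun t => eta t * ip (transp u g t) psi); last first.
  exact: (weak_strong cf transp_cont W).
move=> te tp; have [se _] := te.
have Lp := tst_L2 tp; have ce := sm1_ct (T := T) se; have cde := sm1_ct (T := T) (sm1_derive se).
have := Hf te tp; rewrite (int_eq (G := fun t => derive1 eta t * ip (f t) psi + -1 * (eta t * ip (transp u g t) psi))); last first.
  move=> s sT; have sT' : 0 <= s <= T by case/andP: sT => /ltW -> /ltW ->.
  have [_ E] := dual_ip cu se tp sT (fun i => wf i sT') (fun i => Lug i sT').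
  by rewrite -ipE E mulN1r.
rewrite (int_lin (-1) (ctM cde (cont_ip cf Lp)) (ctM ce (cont_ip transp_cont Lp))) mulN1r.
by move/eqP; rewrite subr_eq0 => /eqP.
Qed.

Lemma word_rate t U F w : (size w <= 4)%N -> 0 <= t <= T -> (forall s, 0 <= s <= T -> in_H 4 (f s)) ->
  (forall j, sob 4 (u j t) U) -> sob 4 (f t) F ->
  rate T (fun s => nrm (wderiv (letters w) (f s)) ^+ 2) t (3 * ctri * (Num.sqrt U * F)).
Proof.
move=> w4 tT Hin sU sF.
apply: (@energy_rate R T f u g d T0 cf su (fun t j => @wf t j) (fun t j => @wu t j) (fun t j => @tu t j) strong w w4
  (fun s => wderiv (letters w) (f s)) t U F tT _ sU sF).
by move=> s sT; apply: wk_wderiv; [exact: Hin|].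
Qed.

Lemma rate_sum (A : Type) (r : seq A) (P : pred A) (G : A -> R -> R) t B : 0 <= t <= T ->
  (forall i, P i -> rate T (G i) t B) -> 0 <= B ->
  rate T (fun s => \sum_(i <- r | P i) G i s) t ((size r)%:R * B).
Proof.
move=> tT HG B0; elim: r => [|i r IH].
  apply: (@rate_eq _ T (fun=> 0)) => //; first by move=> s _; rewrite big_nil.
  exists 0; last by rewrite normr0 mul0r.
  rewrite (_ : quot _ _ = fun=> 0); first exact: cvg_cst.
  by apply/funext => s; rewrite /quot subrr mul0r.
have [Pi|Pi] := boolP (P i).
  apply: (@rate_eq _ T (G i \+ (fun s => \sum_(j <- r | P j) G j s))) => //.
    by move=> s _; rewrite big_cons Pi.
  by rewrite /= -natr1 mulrDl mul1r addrC; apply: rateD => //; exact: HG.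
apply: (@rate_eq _ T (fun s => \sum_(j <- r | P j) G j s)) => //.
  by move=> s _; rewrite big_cons (negPf Pi).
have [L cL BL] := IH; exists L => //; apply: le_trans BL _.
by rewrite ler_wpM2r// ler_nat.
Qed.

Lemma HN_rate t U F : 0 <= t <= T -> (forall s, 0 <= s <= T -> in_H 4 (f s)) ->
  (forall j, sob 4 (u j t) U) -> sob 4 (f t) F ->
  rate T (fun s => HN 4 (f s)) t ((size (index_enum {ffun 'I_3 -> 'I_5}))%:R * (3 * ctri * (Num.sqrt U * F))).
Proof.
move=> tT Hin sU sF; apply: rate_sum => //; last first.
  by rewrite mulr_ge0 ?mulr_ge0 ?sqrtr_ge0 ?(sob_ge0 sF)// ler0n.
move=> al aln; have := @word_rate t U F (word (fun i => al i : nat)) _ tT Hin sU sF.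
by rewrite letters_word size_word; apply.
Qed.

End one_field.
End field.

Section final.
Context {R : realType}.
Variables (rho : R * R -> R) (rho0 eps T : R) (w0 : unknown -> R3 R -> R) (w : unknown -> R -> R3 R -> R).
Hypothesis Hrho : equation_of_state rho rho0.
Hypotheses (eps0 : 0 < eps) (T0 : 0 < T).
Hypothesis sol : mhd_solution rho eps T w w0.
Local Notation u := (u_of w).
Local Notation m := (magS rho eps w).

(** * The entropy estimate *)

Let reg k : energy_regular eps T w (w k). Proof. by case: sol => -[_ [h _]] _ _ _ _. Qed.
Let regm : energy_regular eps T w m. Proof. by case: sol => -[_ [_ h]] _ _ _ _. Qed.
Let cw k : C1_field T (w k). Proof. by case: sol => -[h _] _ _ _ _. Qed.

Let et k l (f : R -> R3 R -> R) t : R := HN (4 - k - l) (eDt T u eps (k + l.*2) f t).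

Let term_fin f k l t : energy_regular eps T w f -> (k + l <= 4)%N -> 0 <= t <= T ->
  energy_term eps T w k l f t = (et k l f t)%:E.
Proof.
move=> [_ H] kl tT; have [|Hin _] := H k l kl t; first by rewrite in_itv.
exact: Hnorm2E.
Qed.

Let et_ge0 k l f t : 0 <= et k l f t. Proof. exact: HN_ge0. Qed.

Let in_H4 f t : energy_regular eps T w f -> 0 <= t <= T -> in_H 4 (f t).
Proof. by move=> [_ H] tT; have [|Hin _] := H 0%N 0%N isT t; first by rewrite in_itv. Qed.

Let cont4 f : energy_regular eps T w f -> cont_sob T 4 f.
Proof. by move=> [_ H]; apply: cont_H_sob; exact: (H 0%N 0%N isT). Qed.

Let cu i : C1_field T (u i). Proof. exact: cw. Qed.

Let et_null f k l t : energy_regular eps T w f -> transported T u f -> (k + l <= 4)%N -> (0 < k + l.*2)%N ->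
  0 <= t <= T -> et k l f t = 0.
Proof.
move=> Hf tf kl kl0 tT; have [_ H] := Hf; have [|Hin _] := H k l kl t; first by rewrite in_itv.
apply: HN_null Hin _; move: kl0; case: (k + l.*2)%N => // n _.
by case: (eDt_null eps T0 cu n tf tT).
Qed.

Let trS : transported T u (w Ent).
Proof.
move=> eta psi te tp; apply: (weak_Ent (rho := rho) (eps := eps) T0 cw _ te tp).
by case: sol => _ h _ _ _; exact: h.
Qed.

Let trm : transported T u m.
Proof.
move=> eta psi te tp; apply: (weak_magS Hrho eps0 T0 cw _ te tp).
by case: sol => _ h _ _ _; exact: h.
Qed.

Let kl4 (l : 'I_5) (k : 'I_(5 - l)) : (k + l <= 4)%N.
Proof. by case: k => k /=; case: l => l /= l5; lia. Qed.

(** Only the terms without a material derivative survive. *)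
Lemma entropy_energyE t : 0 <= t <= T ->
  entropy_energy rho eps T w t = (HN 4 (w Ent t) + HN 4 (m t))%:E.
Proof.
move=> tT; rewrite /entropy_energy.
transitivity (\sum_(l < 5) \sum_(k < 5 - l) (et k l (w Ent) t + et k l m t)%:E)%E.
  apply: eq_bigr => l _; apply: eq_bigr => k _.
  by rewrite (term_fin (reg Ent) (kl4 k) tT) (term_fin regm (kl4 k) tT).
have z (l : nat) (k : nat) : (k + l <= 4)%N -> (0 < k + l.*2)%N -> (et k l (w Ent) t + et k l m t)%:E = 0%E.
  by move=> h1 h2; rewrite (et_null (reg Ent) trS h1 h2 tT) (et_null regm trm h1 h2 tT) addr0.
rewrite big_ord_recl [X in (_ + X)%E]big1 ?adde0; last first.
  by move=> l _; apply: big1 => k _; apply: z; [exact: kl4|rewrite addn_gt0 double_gt0 /= orbT].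
have -> : (\sum_(k < 5 - @ord0 4) (et k (@ord0 4) (w Ent) t + et k (@ord0 4) m t)%:E)%E =
  (\sum_(k < 5) (et k 0 (w Ent) t + et k 0 m t)%:E)%E by [].
rewrite big_ord_recl [X in (_ + X)%E]big1 ?adde0// => k _.
by apply: z; rewrite ?addn0//= ltnS.
Qed.

Let e k l t : R := et k l (w Prs) t + \sum_(i < 3) et k l (w (Vel i)) t + \sum_(i < 3) et k l (w (Mag i)) t
  + et k l (w Ent) t + et k l m t.

Let energyE t : 0 <= t <= T -> energy rho eps T w t = (\sum_(l < 5) \sum_(k < 5 - l) e k l t)%:E.
Proof.
move=> tT; rewrite /energy -sumEFin; apply: eq_bigr => l _; rewrite -sumEFin; apply: eq_bigr => k _.
have S (c : 'I_3 -> unknown) : (\sum_(i < 3) energy_term eps T w k l (w (c i)) t)%E = (\sum_(i < 3) et k l (w (c i)) t)%:E.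
  by rewrite -sumEFin; apply: eq_bigr => i _; exact: term_fin (reg _) (kl4 k) tT.
exact: (congr2 adde (congr2 adde (congr2 adde (congr2 adde (term_fin (reg Prs) (kl4 k) tT) (S Vel)) (S Mag))
  (term_fin (reg Ent) (kl4 k) tT)) (term_fin regm (kl4 k) tT)).
Qed.

Let e_ge0 k l t : 0 <= e k l t.
Proof. by rewrite /e !addr_ge0// sumr_ge0. Qed.

Let energy_ge t : 0 <= t <= T -> e 0 0 t <= fine (energy rho eps T w t).
Proof.
move=> tT; rewrite energyE//= big_ord_recl /=.
apply: le_trans (_ : \sum_(k < 5) e k 0 t <= _); last first.
  by rewrite lerDl; apply: sumr_ge0 => l _; exact: sumr_ge0.
by rewrite big_ord_recl lerDl; exact: sumr_ge0.
Qed.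

Let le5 (a b c d f x : R) : 0 <= a -> 0 <= b -> 0 <= c -> 0 <= d -> 0 <= f -> a + b + c + d + f <= x ->
  [/\ b <= x, d <= x & f <= x].
Proof. by move=> *; split; lra. Qed.

Let energy_parts t : 0 <= t <= T -> let X := fine (energy rho eps T w t) in
  [/\ \sum_(i < 3) et 0 0 (w (Vel i)) t <= X, et 0 0 (w Ent) t <= X & et 0 0 m t <= X].
Proof.
move=> tT X; have s (c : 'I_3 -> unknown) : 0 <= \sum_(i < 3) et 0 0 (w (c i)) t by exact: sumr_ge0.
exact: (le5 (et_ge0 0 0 (w Prs) t) (s Vel) (s Mag) (et_ge0 0 0 (w Ent) t) (et_ge0 0 0 m t) (energy_ge tT)).
Qed.

Let energy_Vel t i : 0 <= t <= T -> HN 4 (u i t) <= fine (energy rho eps T w t).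
Proof.
move=> tT; have [h _ _] := energy_parts tT; apply: le_trans h.
have h : et 0 0 (w (Vel i)) t <= \sum_(j < 3) et 0 0 (w (Vel j)) t.
  by rewrite (bigD1 i)//= lerDl; exact: sumr_ge0.
exact: h.
Qed.

Let energy_Ent t : 0 <= t <= T -> HN 4 (w Ent t) <= fine (energy rho eps T w t).
Proof. by move=> tT; have [_ h _] := energy_parts tT; exact: h. Qed.

Let energy_m t : 0 <= t <= T -> HN 4 (m t) <= fine (energy rho eps T w t).
Proof. by move=> tT; have [_ _ h] := energy_parts tT; exact: h. Qed.

Lemma energy_fine_ge0 t : 0 <= t <= T -> 0 <= fine (energy rho eps T w t).
Proof. by move=> tT; apply: le_trans (energy_Ent tT); exact: HN_ge0. Qed.

(** For S and for m, one contribution of energy_rate for each multi-index. *)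
Definition cent : R := 2 * ((size (index_enum {ffun 'I_3 -> 'I_5}))%:R * (3 * ctri)).

Lemma entropy_rate t : 0 <= t <= T ->
  rate T (fun s => fine (entropy_energy rho eps T w s)) t
    (cent * (Num.sqrt (fine (energy rho eps T w t)) * fine (energy rho eps T w t))).
Proof.
move=> tT; pose X := fine (energy rho eps T w t).
have su i : cont_sob T 4 (u i) by apply: cont4; exact: reg.
have bu s x : 0 <= s <= T -> half_space_bd x -> u ord_max s x = 0.
  by move=> sT bx; case: sol => _ _ _ h _; case: (h s x _ bx); rewrite ?in_itv.
have sX i : sob 4 (u i t) X.
  exact: (sob_mono (energy_Vel i tT) (in_H_sob (in_H4 (reg (Vel i)) tT))).
have H f : energy_regular eps T w f -> transported T u f -> HN 4 (f t) <= X ->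
    rate T (fun s => HN 4 (f s)) t ((size (index_enum {ffun 'I_3 -> 'I_5}))%:R * (3 * ctri * (Num.sqrt X * X))).
  move=> rf tf fX; exact: (HN_rate T0 cu su bu (cont4 rf) tf tT (fun s sT => in_H4 rf sT) sX
    (sob_mono fX (in_H_sob (in_H4 rf tT)))).
have h := rateD (H _ (reg Ent) trS (energy_Ent tT)) (H _ regm trm (energy_m tT)).
have E (c k x : R) : c * (k * x) + c * (k * x) = 2 * (c * k) * x by ring.
rewrite E in h; apply: rate_eq tT h => s sT.
by rewrite (entropy_energyE sT).
Qed.

End final.

Theorem corollary3p3 (R : realType) (rho : R * R -> R) (rho0 : R)
    (Hrho : equation_of_state rho rho0) :
  exists P : {poly R},
    (forall i : nat, 0 <= P`_i) /\
    forall (eps T M : R) (w0 : unknown -> R3 R -> R)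
           (w : unknown -> R -> R3 R -> R),
      0 < eps -> 0 < T -> 0 < M ->
      admissible_data rho eps w0 ->
      mhd_solution rho eps T w w0 ->
      (energy rho eps T w 0 <= M%:E)%E ->
      forall t : R, t \in `[0, T] ->
        time_derivable T (fun s => fine (entropy_energy rho eps T w s)) t /\
        time_deriv T (fun s => fine (entropy_energy rho eps T w s)) t
          <= P.[fine (energy rho eps T w t)].
Proof.
have c0 : 0 <= cent :> R.
  rewrite /cent; apply: mulr_ge0; first exact: ler0n.
  apply: mulr_ge0; first exact: ler0n.
  by apply: mulr_ge0; [exact: ler0n|exact: (ltW ctri_gt0)].
(* The square root of X is at most 1 + X. *)
exists (cent%:P * ('X + 'X^2)); split.
  by move=> i; rewrite coefCM coefD coefX coefXn mulr_ge0// addr_ge0// ler0n.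
move=> eps T M w0 w eps0 T0 _ _ sol _ t; rewrite in_itv/= => tT.
have [d B] := rate_time T0 tT (entropy_rate Hrho eps0 T0 sol tT); split; first exact: d.
apply: le_trans (ler_norm _) _; apply: le_trans B _.
have := energy_fine_ge0 eps0 T0 sol tT; move: (fine _) => X X0.
have -> : (cent%:P * ('X + 'X^2)).[X] = cent * ((1 + X) * X) by rewrite hornerM hornerC hornerD hornerX hornerXn; move: cent => k; ring.
apply: ler_wpM2l; first exact: c0.
apply: ler_wpM2r; first exact: X0.
have X1 : 0 <= 1 + X by rewrite addr_ge0.
rewrite -(ler_pXn2r (n := 2)) ?nnegrE ?sqrtr_ge0// sqr_sqrtr// sqrrD expr1n mul1r mulr2n.
have := sqr_ge0 X; move: (X ^+ 2) => Y Y0; lra.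
Qed.
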